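(* A holomorphic function $\varphi$ on $\mathbb{C}\setminus\mathbb{R}$ admits a representing measure if and only if the following two conditions are satisfied. (i) $\varphi$ behaves simply on $\overline{\mathbb{R}}$. (ii) There is an open subset $S$ of $\mathbb{R}$ such that $\mathbb{R}\setminus S$ is a finite set and $\varphi$ admits a boundary measure on $S$, i.e., there is a complex Radon measure $\lambda_S$ on $S$ satisfying $$\lim_{y\to+0}\int_{-\infty}^{\infty} f(x)\,\frac{\varphi(x+iy)-\varphi(x-iy)}{2\pi i(1+x^2)}\,dx=\int_S f(x)\,\lambda_S(dx)$$ for every $f\in C_c^\infty(S)$. Moreover, suppose this is the case and define a holomorphic function $\varphi_S$ on $\mathbb{C}\setminus\mathbb{R}$ by $$\varphi_S(z)=\int_S\frac{1+sz}{s-z}\,\lambda_S(ds).$$ Put $\Sigma=(\mathbb{R}\setminus S)\sqcup\{\infty\}$. Then $\varphi-\varphi_S$ extends holomorphically to $(\mathbb{C}\setminus\mathbb{R})\sqcup S$, each point of $\Sigma$ is at most a simple pole of $\varphi-\varphi_S$, the representing measure $\lambda$ of $\varphi$ coincides with $\lambda_S$ on $S$, and the atomic mass $\lambda[\sigma]=\lambda(\{\sigma\})$ at $\sigma\in\Sigma$ is given by $$\lambda[\sigma]=\begin{cases}-\rho(\sigma)/(1+\sigma^2)&(\sigma\in\mathbb{R})\\ \rho(\sigma)&(\sigma=\infty),\end{cases}$$ where $\rho(\sigma)$ is the residue of $\varphi-\varphi_S$ at $\sigma\in\Sigma$ in the following sense: $\varphi(z)-\varphi_S(z)-\frac{\rho(\sigma)}{z-\sigma}$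 is holomorphic near $z=\sigma$ if $\sigma\in\mathbb{R}\setminus S$, whereas $\varphi(1/z)-\varphi_S(1/z)-\frac{\rho(\infty)}{z}$ is holomorphic near $z=0$ if $\sigma=\infty$.
   Context: $\overline{\mathbb{C}}=\mathbb{C}\sqcup\{\infty\}$ is the Riemann sphere and $\overline{\mathbb{R}}=\mathbb{R}\sqcup\{\infty\}\subset\overline{\mathbb{C}}$ is the extended real line (a circle). A complex Radon measure is a regular complex Borel measure, in particular of finite total variation. Representing measure: a complex Radon measure $\lambda$ on $\overline{\mathbb{R}}$ is the representing measure of a holomorphic function $\varphi$ on $\mathbb{C}\setminus\mathbb{R}$ if $$\varphi(w)=\frac{\varphi(i)+\varphi(-i)}{2}+\int_{\overline{\mathbb{R}}}\frac{1+sw}{s-w}\,\lambda(ds)\qquad(w\in\mathbb{C}\setminus\mathbb{R}),$$ where the integrand takes the value $w$ at $s=\infty$; it is unique if it exists. Simple behavior: a holomorphic function $\varphi$ on $\mathbb{C}\setminus\mathbb{R}$ behaves simply at $s\in\mathbb{R}$ if there is a neighborhood $U'$ of $s$ in $\mathbb{C}$ such that $(\operatorname{Im}z)\varphi(z)$ is bounded on $U'\setminus\mathbb{R}$. It behaves simply at $\infty$ if $z\mapsto\varphi(-1/z)$ behaves simply at $0$, i.e., if $\varphi(z)\operatorname{Im}z/|z|^2$ is bounded for all sufficiently large $z\in\mathbb{C}\setminus\mathbb{R}$. It behaves simply on $\overline{\mathbb{R}}$ if it behaves simply at every point of $\overline{\mathbb{R}}$ (equivalently, $\frac{\operatorname{Im}z}{1+|z|^2}\varphi(z)$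 is bounded on $U'\setminus\overline{\mathbb{R}}$ for some open neighborhood $U'$ of $\overline{\mathbb{R}}$ in $\overline{\mathbb{C}}$). *)

(* Defs.v *)
From HB Require Import structures.
From mathcomp Require Import all_boot all_order all_algebra.
From mathcomp Require Import all_classical all_reals all_analysis.
From mathcomp Require Export complex.

Set Implicit Arguments.
Unset Strict Implicit.
Unset Printing Implicit Defensive.

Import Order.TTheory GRing.Theory Num.Theory.
Import numFieldNormedType.Exports.

Local Open Scope classical_set_scope.
Local Open Scope complex_scope.
Local Open Scope ring_scope.

(* R[i] as a one-dimensional normed module over itself (with the topology of
   its modulus), so that [derivable f z 1] is complex differentiability. *)
HB.instance Definition _ (R : rcfType) := PseudoPointedMetric.copy R[i] R[i]^o.
HB.instance Definition _ (R : rcfType) := GRing.ComAlgebra.copy R[i] R[i]^o.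
HB.instance Definition _ (R : rcfType) := Vector.copy R[i] R[i]^o.
HB.instance Definition _ (R : rcfType) := NormedModule.copy R[i] R[i]^o.

Definition borel (T : ptopologicalType) := g_sigma_algebraType (@open T).

(* The circle: [Some s] is the point s of the line, [None] is infinity. *)
Notation xreal R := (one_point_compactification R).

Section complex_measure.
Context d (T : measurableType d) (R : realType).

(* Charges are finite on measurable sets, so a pair of them (real and imaginary
   parts) is a countably additive complex set function. *)
Record complex_measure := ComplexMeasure {
  cmRe : {charge set T -> \bar R} ;
  cmIm : {charge set T -> \bar R} }.

Definition cmval (lam : complex_measure) (A : set T) : R[i] :=
  fine (cmRe lam A) +i* fine (cmIm lam A).

Definition cmvariation (lam : complex_measure) (A : set T) : \bar R :=
  ereal_sup [set (\sum_(n <oo) (Normc.normc (cmval lam (F n)))%:E)%E |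
    F in [set F : nat -> set T |
      [/\ forall n, measurable (F n), trivIset setT F & \bigcup_n F n = A]]].

Definition cmconcentrated (lam : complex_measure) (S : set T) : Prop :=
  forall A : set T, measurable A -> A `&` S = set0 -> cmval lam A = 0.

Definition cRintegral (mu : {measure set T -> \bar R}) (D : set T)
    (f : T -> R[i]) : R[i] :=
  (\int[mu]_(x in D) complex.Re (f x)) +i* (\int[mu]_(x in D) complex.Im (f x)).

(* The value does not depend on the Hahn decomposition that is chosen. *)
Definition charge_integral (nu : {charge set T -> \bar R}) (D : set T)
    (f : T -> R[i]) : R[i] :=
  let HP := cid (Hahn_decomposition nu) in
  let HN := cid (projT2 HP) in
  cRintegral (jordan_pos (projT2 HN)) D f -
  cRintegral (jordan_neg (projT2 HN)) D f.

Definition cmintegral (lam : complex_measure) (D : set T)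
    (f : T -> R[i]) : R[i] :=
  charge_integral (cmRe lam) D f + 'i%C * charge_integral (cmIm lam) D f.

End complex_measure.

Coercion cmval : complex_measure >-> Funclass.

Definition radon (T : ptopologicalType) (R : realType)
    (lam : complex_measure (borel T) R) : Prop :=
  forall A : set (borel T), measurable A ->
    cmvariation lam A =
      ereal_inf [set cmvariation lam U | U in [set U : set T | open U /\ A `<=` U]] /\
    cmvariation lam A =
      ereal_sup [set cmvariation lam K | K in [set K : set T | compact K /\ K `<=` A]].

Section holomorphy.
Context (R : realType).
Implicit Types (f g phi : R[i] -> R[i]) (U : set R[i]) (c rho z : R[i]).

Definition nonreal : set R[i] := [set z | complex.Im z != 0].

(* [U] is meant to be open. *)
Definition holomorphic_on U f : Prop := forall z, U z -> derivable f z 1.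

Definition at_most_simple_pole f c : Prop :=
  exists h : R[i] -> R[i],
    (\forall z \near c, derivable h z 1) /\
    (\forall z \near c^', (z - c) * f z = h z).

Definition simple_residue f c rho : Prop :=
  exists h : R[i] -> R[i],
    (\forall z \near c, derivable h z 1) /\
    (\forall z \near c^', f z - rho / (z - c) = h z).

(* [local_fun f sigma] at [local_pt sigma] is [f] at [sigma], read in the
   coordinate 1/z when sigma is infinity. *)
Definition local_fun f (sigma : xreal R) : R[i] -> R[i] :=
  if sigma is Some _ then f else fun z => f z^-1.

Definition local_pt (sigma : xreal R) : R[i] :=
  if sigma is Some s then s%:C else 0.

Definition behaves_simply_at_real phi (s : R) : Prop :=
  exists2 U, nbhs s%:C U &
    [bounded (complex.Im z)%:C * phi z | z in U `&` nonreal].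

Definition behaves_simply phi : Prop :=
  forall s : xreal R,
    if s is Some x then behaves_simply_at_real phi x
    else behaves_simply_at_real (fun z => phi (- z^-1)) 0.

Definition kernel (w : R[i]) (s : R) : R[i] := (1 + s%:C * w) / (s%:C - w).

Definition xkernel (w : R[i]) (s : xreal R) : R[i] :=
  if s is Some x then kernel w x else w.

Definition representing_measure phi
    (lam : complex_measure (borel (xreal R)) R) : Prop :=
  radon lam /\
  forall w, nonreal w ->
    phi w = (phi 'i%C + phi (- 'i%C)) / 2 + cmintegral lam setT (xkernel w).

Definition smooth (f : R -> R) : Prop :=
  forall n x, derivable (derive1n n f) x 1.

Definition Cc_infty (S : set R) (f : R -> R[i]) : Prop :=
  [/\ smooth (fun x => complex.Re (f x)), smooth (fun x => complex.Im (f x)),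
      compact (closure [set x | f x != 0]) &
      closure [set x | f x != 0] `<=` S].

(* A complex Radon measure on the open set [S] is encoded by its extension by
   zero to the line. *)
Definition boundary_measure phi (S : set R)
    (lam : complex_measure (borel R) R) : Prop :=
  [/\ radon lam, cmconcentrated lam S &
    forall f : R -> R[i], Cc_infty S f ->
      cRintegral lebesgue_measure setT
        (fun x => f x * ((phi (x +i* y) - phi (x -i* y)) /
                         (2 * (pi%:C) * 'i%C * (1 + x ^+ 2)%:C)))
        @[y --> (0 : R)^'+]
      --> cmintegral lam S f].

Definition cauchy_integral (S : set R) (lam : complex_measure (borel R) R)
    (z : R[i]) : R[i] :=
  cmintegral lam S (kernel z).

End holomorphy.

Arguments nonreal : clear implicits.

(* Main.v *)
(** The analytic core is a reflection principle. Suppose psi is holomorphic off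
    the real line, |Im z| |psi z| is bounded near an interval, and the jump of
    psi across the interval vanishes when tested against smooth functions. For
    every test function f, the horizontal convolution of f with psi satisfies the
    same growth bound, and so do its z-derivatives, which are convolutions with
    the derivatives of f; integrating vertically twice (1/y, then log y, then a
    constant) shows that it is bounded, hence, applied to f', Lipschitz on each
    side. Its boundary jump is zero pointwise, so it is Lipschitz across the real
    line and extends holomorphically. The growth bound then gives interior
    estimates that do not depend on f, and letting f run through mollifiers
    extends psi itself.

    The jump kernel of (1 + sz)/(s - z) is a weighted Poisson kernel, so the
    Cauchy transform of a measure has that measure as its boundary measure
    (Fubini and dominated convergence). Hence phi - phi_S has zero jump on S; it
    extends across S, has at most simple poles at the finitely many remaining
    real points, and grows at most linearly, so by Liouville it equals
    c0 + c1 z + sum_s a_s / (z - s). These terms are the transforms of atoms at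
    infinity and at the points s, which yields the representing measure; since a
    measure on S is determined by its integrals against test functions, the
    representing measure of phi is lambda_S plus exactly these atoms. *)

Require Import Defs.
From HB Require Import structures.
From mathcomp Require Import all_boot all_order all_algebra.
From mathcomp Require Import all_classical all_reals all_analysis.
From mathcomp Require Import measurable_realfun ring lra.

Set Implicit Arguments.
Unset Strict Implicit.
Unset Printing Implicit Defensive.

Import Order.TTheory GRing.Theory Num.Theory.
Import numFieldNormedType.Exports.

Local Open Scope classical_set_scope.
Local Open Scope complex_scope.
Local Open Scope ring_scope.

Arguments Normc.normc : simpl never.
Local Notation normc := Normc.normc.
Local Notation Re := (@complex.Re _).
Local Notation Im := (@complex.Im _).
Local Notation kernel := Defs.kernel.

(** * Complex numbers and integrals along segments *)

Section complex_basics.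
Context (R : realType).
Implicit Types (z w : R[i]) (x y : R).

(** The jump vanishes only weakly and [psi] may grow like 1/|Im z|, so neither continuity up to the
    line nor Morera's theorem applies to [psi] itself. Convolving with test functions works because
    they are closed under differentiation: a bound proved for all of them at once also bounds
    z-derivatives. The Lipschitz constant so obtained depends on the test function; it only carries
    the convolution across the line, and a uniform bound must then be found afresh. It comes from
    the factor (u - s)^2 - r^2, which vanishes where the vertical sides of a square meet the real
    line and absorbs the singularity 1/|Im u| there. The same estimate, on squares shrinking to an
    exceptional point or growing to infinity, yields pole order one and linear growth.

    Contour integrals run over squares. The integral of 1/(u - w) is only bounded away from 0, never
    evaluated: a quotient of two contour integrals replaces division by 2 pi i. Constants such as 36
    or 72 result from this; only their independence of the function matters. *)

Lemma normr_normc z : `|z| = (normc z)%:C.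
Proof. by case: z. Qed.

Lemma normc_ge0 z : 0 <= normc z.
Proof. by case: z => a b; rewrite sqrtr_ge0. Qed.

Lemma normc_real x : normc x%:C = `|x|.
Proof. by rewrite /Normc.normc /= expr0n addr0 sqrtr_sqr. Qed.

Lemma normci : normc ('i%C : R[i]) = 1.
Proof. by rewrite /Normc.normc /= expr0n add0r expr1n sqrtr1. Qed.

Lemma normc_0 : normc (0 : R[i]) = 0.
Proof. by rewrite -[0]/(0%:C) normc_real normr0. Qed.

Lemma normc_eq0 z : (normc z == 0) = (z == 0).
Proof.
by apply/eqP/eqP => [/Normc.eq0_normc|->] //; exact: normc_0.
Qed.

Lemma normc_gt0 z : (0 < normc z) = (z != 0).
Proof. by rewrite lt_neqAle normc_ge0 andbT eq_sym normc_eq0. Qed.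

Lemma normcB z w : normc (z - w) = normc (w - z).
Proof. by rewrite -normcN opprB. Qed.

Lemma normcX z n : normc (z ^+ n) = normc z ^+ n.
Proof.
elim: n => [|n IH]; first by rewrite !expr0 Normc.normc1.
by rewrite !exprS Normc.normcM IH.
Qed.

Lemma Re_normc z : `|Re z| <= normc z.
Proof.
case: z => a b; rewrite /Normc.normc /= -sqrtr_sqr ler_sqrt ?lerDl ?sqr_ge0//.
by rewrite addr_ge0 ?sqr_ge0.
Qed.

Lemma Im_normc z : `|Im z| <= normc z.
Proof.
case: z => a b; rewrite /Normc.normc /= -sqrtr_sqr ler_sqrt ?lerDr ?sqr_ge0//.
by rewrite addr_ge0 ?sqr_ge0.
Qed.

Lemma normc_le_ReIm z : normc z <= `|Re z| + `|Im z|.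
Proof.
rewrite {1}(complexE z); apply: le_trans (le_normcD _ _) _.
by rewrite Normc.normcM normci mul1r !normc_real.
Qed.

Lemma le_normcDl z w : normc z - normc w <= normc (z + w).
Proof.
rewrite lerBlDr; have := le_normcD (z + w) (- w).
by rewrite addrK normcN.
Qed.

Lemma le_normcB z w : normc (z - w) <= normc z + normc w.
Proof. by apply: le_trans (le_normcD _ _) _; rewrite normcN. Qed.

Lemma nbhs_normcP z (U : set R[i]) :
  nbhs z U <-> exists2 e : R, 0 < e & forall w, normc (w - z) < e -> U w.
Proof.
split.
  move=> /nbhs_ballP [e /= e0 he]; exists (Re e).
    by move: e0; rewrite ltcE /= => /andP[].
  move=> w hw; apply: he; rewrite /ball /= normr_normc normcB.
  move: e0; rewrite !ltcE /= => /andP[/eqP -> _]; by rewrite eqxx.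
move=> [e e0 he]; apply/nbhs_ballP; exists e%:C => /=.
  by rewrite ltcR.
move=> w; rewrite /ball /= normr_normc ltcR normcB; exact: he.
Qed.

Lemma cvg_normcP (T : Type) (F : set_system T) (f : T -> R[i]) (l : R[i]) :
  Filter F ->
  (f @ F --> l <-> forall e : R, 0 < e -> \forall x \near F, normc (f x - l) < e).
Proof.
move=> FF; split.
  move=> /cvgrPdist_lt h e e0.
  have := h e%:C; rewrite ltcR => /(_ e0); apply: filterS => x.
  by rewrite normr_normc ltcR normcB.
move=> h; apply/cvgrPdist_lt => e e0.
have e1 : 0 < Re e by move: e0; rewrite ltcE /= => /andP[].
have e2 : e = (Re e)%:C.
  by case: e e0 {e1} => a b; rewrite ltcE /= => /andP[/eqP -> _].
have := h _ e1; apply: filterS => x hx.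
by rewrite e2 normr_normc ltcR normcB.
Qed.

Lemma cvg_ReIm (T : Type) (F : set_system T) (f : T -> R[i]) (l : R[i]) :
  Filter F ->
  (f @ F --> l <->
   (Re \o f) @ F --> Re l /\ (Im \o f) @ F --> Im l).
Proof.
move=> FF; split.
  move=> /cvg_normcP h; split; apply/cvgrPdist_lt => e /h; apply: filterS => x;
    apply: le_lt_trans; rewrite distrC.
    by rewrite -raddfB; exact: Re_normc.
  by rewrite -raddfB; exact: Im_normc.
move=> [/cvgrPdist_lt h1 /cvgrPdist_lt h2]; apply/cvg_normcP => e e0.
have e2 : 0 < e / 2 by lra.
near=> x.
apply: le_lt_trans (normc_le_ReIm _) _.
rewrite !raddfB /= [`|Re _ - _|]distrC [`|Im _ - _|]distrC.
have -> : e = e / 2 + e / 2 by lra.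
by apply: ltrD; near: x; [exact: h1 | exact: h2].
Unshelve. all: by end_near. Qed.

Lemma derivable_continuous (f : R[i] -> R[i]) z :
  derivable f z 1 -> {for z, continuous f}.
Proof. by move=> /derivable1_diffP; exact: differentiable_continuous. Qed.

(** Division-free, with real norms and with h = 0 allowed, so that remainders can be estimated
    without treating the base point apart. *)
Lemma is_cderiveP (f : R[i] -> R[i]) z (l : R[i]) :
  is_derive z (1 : R[i]) f l <-> forall e : R, 0 < e ->
    exists2 d : R, 0 < d & forall h : R[i], normc h < d ->
      normc (f (z + h) - f z - h * l) <= e * normc h.
Proof.
have key : (h^-1 *: (f (h *: 1 + z) - f z)) @[h --> 0^'] --> l <->
  forall e : R, 0 < e ->
    exists2 d : R, 0 < d & forall h : R[i], normc h < d ->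
      normc (f (z + h) - f z - h * l) <= e * normc h.
  split.
    move=> /cvg_normcP H e e0.
    have /nbhs_normcP[d d0 hd] := H _ e0.
    exists d => // h hh.
    have [->|h0] := eqVneq h 0.
      by rewrite addr0 subrr sub0r mul0r oppr0 normc_0 mulr0.
    have := hd h; rewrite subr0 => /(_ hh h0) /ltW.
    rewrite -(ler_pM2r (x := normc h)) ?normc_gt0// => hle.
    apply: le_trans hle; rewrite -Normc.normcM.
    rewrite [h^-1 *: _]mulrC [h *: 1]mulr1 mulrBl divfK// [h + z]addrC.
    by rewrite [l * h]mulrC lexx.
  move=> H; apply/cvg_normcP => e e0.
  have e2 : 0 < e / 2 by lra.
  have [d d0 hd] := H _ e2.
  apply/nbhs_normcP; exists d => // h; rewrite subr0 => hh h0.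
  rewrite -(ltr_pM2r (x := normc h)) ?normc_gt0// -Normc.normcM.
  rewrite [h^-1 *: _]mulrC [h *: 1]mulr1 mulrBl divfK// [h + z]addrC.
  rewrite [l * h]mulrC.
  apply: le_lt_trans (hd _ hh) _.
  by rewrite ltr_pM2r ?normc_gt0//; lra.
rewrite -key; split.
  by move=> [/cvg_ex [m hm] <-]; rewrite /derive (cvg_lim _ hm).
move=> hl; apply: DeriveDef; first by apply/cvg_ex; exists l.
by rewrite /derive (cvg_lim _ hl).
Qed.

(** Derivatives of integrals that depend on a complex parameter are all obtained through this
    criterion: a quadratic remainder that is uniform in the integration variable survives
    integration. *)
Lemma is_cderive_quad (f : R[i] -> R[i]) z (l : R[i]) (K d : R) : 0 < d ->
  (forall h, normc h < d -> normc (f (z + h) - f z - h * l) <= K * normc h ^+ 2) ->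
  is_derive z (1 : R[i]) f l.
Proof.
move=> d0 H; apply/is_cderiveP => e e0.
have K1 : 0 < `|K| + 1 by rewrite ltr_wpDl.
exists (Num.min d (e / (`|K| + 1))).
  by rewrite lt_min d0 divr_gt0.
move=> h; rewrite lt_min => /andP[h1 h2].
apply: le_trans (H _ h1) _; rewrite expr2 mulrA.
apply: ler_wpM2r; first exact: normc_ge0.
move: h2; rewrite ltr_pdivlMr// => h2; apply: le_trans (ltW h2).
rewrite mulrC ler_wpM2l ?normc_ge0//; have := ler_norm K; lra.
Qed.

Lemma cderD (f g : R[i] -> R[i]) z : derivable f z 1 -> derivable g z 1 ->
  derivable (fun u => f u + g u) z 1.
Proof. by move=> df dg; exact: (derivableD df dg). Qed.

Lemma cderB (f g : R[i] -> R[i]) z : derivable f z 1 -> derivable g z 1 ->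
  derivable (fun u => f u - g u) z 1.
Proof. by move=> df dg; exact: (derivableB df dg). Qed.

Lemma cderM (f g : R[i] -> R[i]) z : derivable f z 1 -> derivable g z 1 ->
  derivable (fun u => f u * g u) z 1.
Proof. by move=> df dg; exact: (derivableM df dg). Qed.

Lemma cderV (f : R[i] -> R[i]) z : f z != 0 -> derivable f z 1 ->
  derivable (fun u => (f u)^-1) z 1.
Proof. by move=> f0 df; exact: (derivableV f0 df). Qed.

Lemma cder_cst (k z : R[i]) : derivable (fun=> k) z 1.
Proof. exact: derivable_cst. Qed.

Lemma cder_id (z : R[i]) : derivable (fun u : R[i] => u) z 1.
Proof. exact: derivable_id. Qed.

Lemma ccontinuousP (f : R[i] -> R[i]) z : {for z, continuous f} <->
  forall e : R, 0 < e -> exists2 d : R, 0 < d &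
    forall w, normc (w - z) < d -> normc (f w - f z) < e.
Proof.
split; first by move=> /cvg_normcP H e /H /nbhs_normcP.
by move=> H; apply/(cvg_normcP f (f z) (nbhs_filter z)) => e /H; move/nbhs_normcP.
Qed.

Lemma ccontinuous_near (f g : R[i] -> R[i]) z :
  (\forall w \near z, f w = g w) -> {for z, continuous f} -> {for z, continuous g}.
Proof.
move=> /nbhs_normcP[d d0 fg] /ccontinuousP H; apply/ccontinuousP => e /H[d' d'0 Hd].
exists (Num.min d d'); first by rewrite lt_min d0.
move=> w; rewrite lt_min => /andP[w1 w2].
by rewrite -!fg ?Hd// subrr -[normc 0]/(normc (0%:C)) normc_real normr0.
Qed.

Lemma derivable_near (f g : R[i] -> R[i]) z :
  (\forall w \near z, f w = g w) -> derivable f z 1 -> derivable g z 1.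
Proof. exact: near_eq_derivable. Qed.

Definition crect (a b c d : R) : set R[i] :=
  [set z | a <= Re z <= b /\ c <= Im z <= d].

Lemma crect_compact a b c d : compact (crect a b c d).
Proof.
have -> : crect a b c d = (fun p : R * R => p.1 +i* p.2) @` (`[a, b] `*` `[c, d]).
  apply/seteqP; split => [[x y] /= [h1 h2]|_ [[x y]] /= [h1 h2] <-].
    by exists (x, y); rewrite //= !in_itv.
  by move: h1 h2; rewrite !in_itv.
apply: continuous_compact; last by apply: compact_setX; exact: segment_compact.
apply: continuous_subspaceT => -[x y]; apply/cvg_ReIm; split => /=.
  exact: cvg_fst.
exact: cvg_snd.
Qed.

(** Continuity is assumed in the whole plane at the points of the rectangle, not relative to it, so
    [w] may lie outside. Compactness enters as near-covering, with the uniform radius as the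
    parameter. *)
Lemma crect_unif_continuous (f : R[i] -> R[i]) a b c d :
  (forall z, crect a b c d z -> {for z, continuous f}) ->
  forall e : R, 0 < e -> exists2 del : R, 0 < del &
    forall z w, crect a b c d z -> normc (w - z) < del -> normc (f w - f z) < e.
Proof.
move=> cf e e0.
have /compact_near_coveringP ncov := @crect_compact a b c d.
have := ncov R (at_right 0)
  (fun t z => forall w, normc (w - z) < t -> normc (f w - f z) < e) _.
case.
  move=> z /cf /cvg_normcP cfz.
  have /cfz /nbhs_normcP[t t0 ht] : 0 < e / 2 by lra.
  exists ([set w | normc (w - z) < t / 2], [set s | s < t / 2]).
    split => /=.
      by apply/nbhs_normcP; exists (t / 2) => //; lra.
    by apply: nbhs_right_lt; lra.
  move=> [w s] /= [hw hs] v hv.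
  have -> : f v - f w = (f v - f z) - (f w - f z) by ring.
  apply: le_lt_trans (le_normcB _ _) _.
  have -> : e = e / 2 + e / 2 by lra.
  apply: ltrD; apply: ht; last by lra.
  have -> : v - z = (v - w) + (w - z) by ring.
  apply: le_lt_trans (le_normcD _ _) _; lra.
move=> t /=  t0 H; exists (t / 2).
  by have : 0 < t by []; lra.
move=> z w hz hw; apply: (H (t / 2)) => //=; last first.
all: rewrite /ball_ /= ?sub0r ?normrN ?gtr0_norm //; have : 0 < t by []; lra.
Qed.

Lemma crect_bounded (f : R[i] -> R[i]) a b c d :
  (forall z, crect a b c d z -> {for z, continuous f}) ->
  exists M : R, forall z, crect a b c d z -> normc (f z) <= M.
Proof.
move=> cf.
have /compact_near_coveringP ncov := @crect_compact a b c d.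
have := ncov R +oo (fun t z => normc (f z) <= t) _.
case.
  move=> z /cf /cvg_normcP cfz.
  have /cfz hz := @ltr01 R.
  exists ([set w | normc (f w - f z) < 1], [set t | normc (f z) + 1 <= t]).
    by split => //=; apply: nbhs_pinfty_ge; exact: num_real.
  move=> [w s] /= [hw hs].
  have -> : f w = (f w - f z) + f z by ring.
  apply: le_trans (le_normcD _ _) _; lra.
move=> M [Mr HM]; exists (M + 1); apply: HM; lra.
Qed.

End complex_basics.

(** * Complex-valued integrals against a positive measure *)

Section complex_integral.
Context (R : realType) d (T : measurableType d).
Variables (mu : {measure set T -> \bar R}) (D : set T) (mD : measurable D).
Implicit Types (f g : T -> R[i]).

Definition cintegrable f :=
  mu.-integrable D (EFin \o (fun x => Re (f x))) /\
  mu.-integrable D (EFin \o (fun x => Im (f x))).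

Lemma cintegrableD f g : cintegrable f -> cintegrable g ->
  cintegrable (fun x => f x + g x).
Proof.
move=> [f1 f2] [g1 g2]; split.
  apply: eq_integrable (integrableD mD f1 g1) => //= x _.
  by rewrite raddfD.
apply: eq_integrable (integrableD mD f2 g2) => //= x _.
by rewrite raddfD.
Qed.

Lemma cRintegralD f g : cintegrable f -> cintegrable g ->
  cRintegral mu D (fun x => f x + g x) = cRintegral mu D f + cRintegral mu D g.
Proof.
move=> [f1 f2] [g1 g2]; rewrite /cRintegral.
under eq_Rintegral do rewrite raddfD.
rewrite RintegralD//.
by under [in X in _ +i* X]eq_Rintegral do rewrite raddfD; rewrite RintegralD.
Qed.

Lemma cReM (z w : R[i]) : Re (z * w) = Re z * Re w - Im z * Im w.
Proof. by case: z w => [a b] [x y]. Qed.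

Lemma cImM (z w : R[i]) : Im (z * w) = Re z * Im w + Im z * Re w.
Proof. by case: z w => [a b] [x y]. Qed.

Lemma cintegrableZ (c : R[i]) f : cintegrable f -> cintegrable (fun x => c * f x).
Proof.
move=> [f1 f2]; split.
  apply: eq_integrable (integrableB mD (integrableZl mD (Re c) f1)
     (integrableZl mD (Im c) f2)) => //= x _.
  by rewrite cReM.
apply: eq_integrable (integrableD mD (integrableZl mD (Re c) f2)
   (integrableZl mD (Im c) f1)) => //= x _.
by rewrite cImM.
Qed.

Lemma cRintegralZ (c : R[i]) f : cintegrable f ->
  cRintegral mu D (fun x => c * f x) = c * cRintegral mu D f.
Proof.
move=> [f1 f2].
have H (a : R) (g : T -> R) : mu.-integrable D (EFin \o g) ->
    mu.-integrable D (EFin \o (fun x => a * g x)) by exact: integrableZl.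
apply/eqP; rewrite eq_complex cReM cImM /cRintegral /=.
under eq_Rintegral do rewrite cReM.
rewrite RintegralB//; [|exact: H|exact: H].
rewrite !RintegralZl// eqxx /=.
under eq_Rintegral do rewrite cImM.
rewrite RintegralD//; [|exact: H|exact: H].
by rewrite !RintegralZl// eqxx.
Qed.

Lemma cintegrableB f g : cintegrable f -> cintegrable g ->
  cintegrable (fun x => f x - g x).
Proof.
move=> hf hg; have := cintegrableD hf (cintegrableZ (-1) hg).
by under [X in cintegrable X]eq_fun do rewrite mulN1r.
Qed.

Lemma cRintegralB f g : cintegrable f -> cintegrable g ->
  cRintegral mu D (fun x => f x - g x) = cRintegral mu D f - cRintegral mu D g.
Proof.
move=> hf hg; have := cRintegralD hf (cintegrableZ (-1) hg).
rewrite cRintegralZ// mulN1r => <-.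
by under [in RHS]eq_fun do rewrite mulN1r.
Qed.

Lemma eq_cRintegral f g : {in D, f =1 g} -> cRintegral mu D f = cRintegral mu D g.
Proof.
move=> fg; rewrite /cRintegral; congr (_ +i* _);
  by apply: eq_Rintegral => x xD; rewrite fg.
Qed.

(** The factor 2 comes from bounding the real and imaginary parts separately; it propagates into all
    later constants. *)
Lemma cRintegral_le f (g : T -> R) : cintegrable f ->
  mu.-integrable D (EFin \o g) -> (forall x, D x -> normc (f x) <= g x) ->
  normc (cRintegral mu D f) <= 2 * \int[mu]_(x in D) g x.
Proof.
move=> [f1 f2] ig fg; apply: le_trans (normc_le_ReIm _) _.
rewrite /= mulr_natl mulr2n; apply: lerD.
  apply: le_trans (le_normr_Rintegral mD f1) _.
  apply: le_Rintegral => //; first exact: integrable_norm.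
  by move=> x Dx; apply: le_trans (fg _ Dx); exact: Re_normc.
apply: le_trans (le_normr_Rintegral mD f2) _.
apply: le_Rintegral => //; first exact: integrable_norm.
by move=> x Dx; apply: le_trans (fg _ Dx); exact: Im_normc.
Qed.

Definition cmeasurable f :=
  measurable_fun D (fun x => Re (f x)) /\ measurable_fun D (fun x => Im (f x)).

Lemma cintegrable_bounded f (M : R) : (mu D < +oo)%E -> cmeasurable f ->
  (forall x, D x -> normc (f x) <= M) -> cintegrable f.
Proof.
move=> muD [f1 f2] fM; split; apply: measurable_bounded_integrable => //.
  exists M; split; first exact: num_real.
  move=> N MN x Dx; apply: le_trans (ltW MN); apply: le_trans (fM _ Dx).
  exact: Re_normc.
exists M; split; first exact: num_real.
move=> N MN x Dx; apply: le_trans (ltW MN); apply: le_trans (fM _ Dx).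
exact: Im_normc.
Qed.

Lemma cRintegral_bound f (M : R) : (mu D < +oo)%E -> cmeasurable f ->
  (forall x, D x -> normc (f x) <= M) ->
  normc (cRintegral mu D f) <= 2 * M * fine (mu D).
Proof.
move=> muD mf fM.
apply: le_trans (cRintegral_le (g := cst M) (cintegrable_bounded muD mf fM) _ fM) _.
  apply: measurable_bounded_integrable => //.
  by exists `|M|; split => // N MN x Dx; exact: ltW.
by rewrite Rintegral_cst// mulrA.
Qed.

End complex_integral.

(** * Integrals over segments, derivatives along lines, fundamental theorem of calculus *)

Section segment.
Context (R : realType).
Implicit Types (f g G : R -> R[i]) (a b c t : R).

(** An integral over a set, hence unsigned: for [b < a] the interval is empty and the value is 0.
    Orientation is put in by hand in [rectint]. *)
Definition segint a b f : R[i] := cRintegral (@lebesgue_measure R) `[a, b] f.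

Definition rderive f t (l : R[i]) :=
  is_derive t (1 : R) (fun x => Re (f x)) (Re l) /\
  is_derive t (1 : R) (fun x => Im (f x)) (Im l).

Lemma continuous_Re f t : {for t, continuous f} -> {for t, continuous (fun x => Re (f x))}.
Proof. by move=> /cvg_ReIm[]. Qed.

Lemma continuous_Im f t : {for t, continuous f} -> {for t, continuous (fun x => Im (f x))}.
Proof. by move=> /cvg_ReIm[]. Qed.

Lemma continuous_scale f (k : R[i]) t : {for t, continuous f} ->
  {for t, continuous (fun s => k * f s)}.
Proof.
move=> cf; have ck : (fun=> k) @ t --> k by exact: cvg_cst.
exact: (cvgM ck cf).
Qed.

Lemma segint_integrable a b f :
  (forall t, a <= t <= b -> {for t, continuous f}) ->
  cintegrable (@lebesgue_measure R) `[a, b] f.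
Proof.
move=> cf; split; apply: continuous_compact_integrable (@segment_compact R a b) _;
  apply: continuous_in_subspaceT => x; rewrite inE /= in_itv /= => /cf.
  exact: continuous_Re.
exact: continuous_Im.
Qed.

Lemma lebesgue_segment a b : a <= b -> fine (@lebesgue_measure R `[a, b]) = b - a.
Proof.
rewrite lebesgue_measure_itv /= lte_fin.
by rewrite le_eqVlt => /predU1P[->|->//]; rewrite ltxx subrr.
Qed.

Lemma Rintegral_cst_itv a b (m : R) : a <= b ->
  \int[@lebesgue_measure R]_(x in `[a, b]) m = m * (b - a).
Proof. by move=> ab; rewrite Rintegral_cst// -lebesgue_segment. Qed.

Lemma segint_bound a b f (M : R) : a <= b ->
  (forall t, a <= t <= b -> {for t, continuous f}) ->
  (forall t, a <= t <= b -> normc (f t) <= M) ->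
  normc (segint a b f) <= 2 * M * (b - a).
Proof.
move=> ab cf fM.
have E2 : (@lebesgue_measure R `[a, b] < +oo)%E.
  by rewrite lebesgue_measure_itv /=; case: ifP => _; rewrite ?ltry// -EFinB ltry.
rewrite -(lebesgue_segment ab); apply: cRintegral_bound => //.
- have [f1 f2] := segint_integrable cf; split.
    by apply/measurable_EFinP; exact: measurable_int f1.
  by apply/measurable_EFinP; exact: measurable_int f2.
Qed.

Lemma segint_split a c b f : a <= c -> c <= b ->
  (forall t, a <= t <= b -> {for t, continuous f}) ->
  segint a b f = segint a c f + segint c b f.
Proof.
move=> ac cb /segint_integrable[f1 f2].
have H (g : R -> R) : (@lebesgue_measure R).-integrable `[a, b] (EFin \o g) ->
  \int[lebesgue_measure]_(x in `[a, b]) g x =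
  \int[lebesgue_measure]_(x in `[a, c]) g x + \int[lebesgue_measure]_(x in `[c, b]) g x.
  move=> ig; have := Rintegral_itvB (x := c) ig.
  rewrite !bnd_simp ac cb => /(_ isT isT) /eqP.
  rewrite subr_eq => /eqP ->; rewrite addrC; congr (_ + _).
  rewrite Rintegral_itv_obnd_cbnd//; apply: integrableS ig => //.
  by apply: subset_itv; rewrite bnd_simp.
by rewrite /segint /cRintegral !H.
Qed.

Lemma segint_FTC a b g G : a <= b ->
  (forall t, a <= t <= b -> rderive G t (g t)) ->
  (forall t, a <= t <= b -> {for t, continuous g}) ->
  segint a b g = G b - G a.
Proof.
rewrite le_eqVlt => /predU1P[<- _ _|ab dG cg].
  by rewrite subrr /segint /cRintegral set_itv1 !Rintegral_set1.
have H (f F : R -> R) : (forall t, a <= t <= b -> is_derive t 1 F (f t)) ->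
    (forall t, a <= t <= b -> {for t, continuous f}) ->
    \int[lebesgue_measure]_(x in `[a, b]) f x = F b - F a.
  move=> dF cf; have cF t : a <= t <= b -> {for t, continuous F}.
    by move=> /dF [/derivable1_diffP h _]; exact: differentiable_continuous.
  rewrite /Rintegral (@continuous_FTC2 _ _ F)//.
  - by apply: continuous_in_subspaceT => x; rewrite inE /= in_itv /= => /cf.
  - split.
    + move=> x; rewrite in_itv /= => /andP[h1 h2].
      by have [] := dF x _; rewrite ?ltW.
    + by apply: cvg_at_right_filter; apply: cF; rewrite lexx ltW.
    + by apply: cvg_at_left_filter; apply: cF; rewrite lexx ltW.
  - move=> x; rewrite in_itv /= => /andP[h1 h2].
    have hd : is_derive x 1 F (f x) by apply: dF; rewrite !ltW.
    by rewrite derive1E derive_val.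
apply/eqP; rewrite eq_complex /= !raddfB /=; apply/andP; split; apply/eqP.
  apply: (H _ (fun x => Re (G x))) => t ht; first by case: (dG _ ht).
  exact/continuous_Re/cg.
apply: (H _ (fun x => Im (G x))) => t ht; first by case: (dG _ ht).
exact/continuous_Im/cg.
Qed.

Lemma rderive_lineP f t (l : R[i]) : rderive f t l <->
  forall e : R, 0 < e -> exists2 d : R, 0 < d & forall h : R, `|h| < d ->
      normc (f (t + h) - f t - h%:C * l) <= e * `|h|.
Proof.
have key (F : R -> R) (m : R) : is_derive t (1 : R) F m <->
  forall e : R, 0 < e -> exists2 d : R, 0 < d & forall h : R, `|h| < d ->
      `|F (t + h) - F t - h * m| <= e * `|h|.
  have k2 : (h^-1 *: (F (h *: 1 + t) - F t)) @[h --> 0^'] --> m <->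
    forall e : R, 0 < e -> exists2 d : R, 0 < d & forall h : R, `|h| < d ->
      `|F (t + h) - F t - h * m| <= e * `|h|.
    split.
      move=> /cvgrPdist_lt H e e0.
      have /nbhs_ballP[d /= d0 hd] := H _ e0.
      exists d => // h hh.
      have [->|h0] := eqVneq h 0.
        by rewrite addr0 subrr sub0r mul0r oppr0 !normr0 mulr0.
      have := hd h; rewrite /ball /= sub0r normrN => /(_ hh h0) /ltW.
      rewrite distrC -(ler_pM2r (x := `|h|)) ?normr_gt0// => hle.
      apply: le_trans hle; rewrite -normrM.
      rewrite [h^-1 *: _]mulrC [h *: 1]mulr1 mulrBl divfK// [h + t]addrC.
      by rewrite [m * h]mulrC lexx.
    move=> H; apply/cvgrPdist_lt => e e0.
    have e2 : 0 < e / 2 by lra.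
    have [d d0 hd] := H _ e2.
    apply/nbhs_ballP; exists d => // h; rewrite /ball /= sub0r normrN => hh h0.
    rewrite distrC -(ltr_pM2r (x := `|h|)) ?normr_gt0// -normrM.
    rewrite [h^-1 *: _]mulrC [h *: 1]mulr1 mulrBl divfK// [h + t]addrC.
    rewrite [m * h]mulrC.
    apply: le_lt_trans (hd _ hh) _.
    by rewrite ltr_pM2r ?normr_gt0//; lra.
  rewrite -k2; split.
    by move=> [/cvg_ex [n hn] <-]; rewrite /derive (cvg_lim _ hn).
  move=> hl; apply: DeriveDef; first by apply/cvg_ex; exists m.
  by rewrite /derive (cvg_lim _ hl).
rewrite /rderive !key.
have ReE h : Re (f (t + h) - f t - h%:C * l) = Re (f (t + h)) - Re (f t) - h * Re l.
  by rewrite !raddfB /= cReM /= mul0r subr0.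
have ImE h : Im (f (t + h) - f t - h%:C * l) = Im (f (t + h)) - Im (f t) - h * Im l.
  by rewrite !raddfB /= cImM /= mul0r addr0.
split.
  move=> [h1 h2] e e0.
  have e2 : 0 < e / 2 by lra.
  have [d1 d10 hd1] := h1 _ e2.
  have [d2 d20 hd2] := h2 _ e2.
  exists (Num.min d1 d2); first by rewrite lt_min d10.
  move=> h; rewrite lt_min => /andP[/hd1 + /hd2].
  rewrite -ReE -ImE => k1 k3; apply: le_trans (normc_le_ReIm _) _; lra.
move=> H; split=> e /H [d d0 hd]; exists d => // h /hd hh.
  by rewrite -ReE; apply: le_trans (Re_normc _) hh.
by rewrite -ImE; apply: le_trans (Im_normc _) hh.
Qed.

Lemma rderive_comp_line (F : R[i] -> R[i]) (z v l : R[i]) t :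
  is_derive (z + t%:C * v) (1 : R[i]) F l ->
  rderive (fun s : R => F (z + s%:C * v)) t (v * l).
Proof.
move=> /is_cderiveP H; apply/rderive_lineP => e e0.
(* [normc v + 1] instead of [normc v], so that a zero direction needs no separate case. *)
have V : 0 < normc v + 1 by rewrite ltr_wpDl ?normc_ge0.
have [d d0 hd] := H (e / (normc v + 1)) (divr_gt0 e0 V).
exists (d / (normc v + 1)); first exact: divr_gt0.
move=> h; rewrite ltr_pdivlMr// => hh.
have hle : normc (h%:C * v) <= `|h| * (normc v + 1).
  by rewrite Normc.normcM normc_real ler_wpM2l// lerDl.
have := hd (h%:C * v) (le_lt_trans hle hh).
rewrite rmorphD mulrDl addrA mulrA => hm; apply: le_trans hm _.
have : e / (normc v + 1) * normc (h%:C * v) <= e / (normc v + 1) * (`|h| * (normc v + 1)).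
  by rewrite ler_wpM2l// ltW// divr_gt0.
move=> hm; apply: le_trans hm _.
by rewrite mulrCA divfK ?gt_eqF// mulrC.
Qed.

Lemma continuous_line (F : R[i] -> R[i]) (z v : R[i]) t :
  {for z + t%:C * v, continuous F} ->
  {for t, continuous (fun s : R => F (z + s%:C * v))}.
Proof.
move=> /cvg_normcP H; apply/cvg_normcP => e /H /nbhs_normcP[d d0 hd].
have V : 0 < normc v + 1 by rewrite ltr_wpDl ?normc_ge0.
apply/nbhs_ballP; exists (d / (normc v + 1)); first exact: divr_gt0.
move=> s; rewrite /ball /= ltr_pdivlMr// => hs; apply: hd.
have -> : z + s%:C * v - (z + t%:C * v) = (s - t)%:C * v by rewrite rmorphB; ring.
rewrite Normc.normcM normc_real distrC; apply: le_lt_trans hs.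
by rewrite ler_wpM2l// lerDl.
Qed.

End segment.

(** * Goursat's theorem and Cauchy's formula on squares *)

Section rectangle.
Context (R : realType).
Implicit Types (F G : R[i] -> R[i]) (a b c d : R) (z w : R[i]).

(** The counterclockwise contour integral of [F] dz: bottom minus top, then ['i%C] times right minus
    left, each side being parametrised in the increasing direction. *)
Definition rectint a b c d F : R[i] :=
  segint a b (fun x => F (x +i* c)) - segint a b (fun x => F (x +i* d)) +
  'i%C * (segint c d (fun y => F (b +i* y)) - segint c d (fun y => F (a +i* y))).

Arguments rectint : simpl never.

Definition continuous_on (A : set R[i]) F := forall z, A z -> {for z, continuous F}.

Lemma horE (x y : R) : x +i* y = 0 +i* y + x%:C * 1.
Proof. by rewrite mulr1; apply/eqP; rewrite eq_complex /= add0r addr0 !eqxx. Qed.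

Lemma verE (x y : R) : x +i* y = x%:C + y%:C * 'i%C.
Proof.
by apply/eqP; rewrite eq_complex /= !mulr0 !mulr1 subr0 !addr0 add0r !eqxx.
Qed.

Lemma continuous_hor F (x y : R) : {for x +i* y, continuous F} ->
  {for x, continuous (fun t : R => F (t +i* y))}.
Proof.
move=> cF; have -> : (fun t : R => F (t +i* y)) = (fun s => F (0 +i* y + s%:C * 1)).
  by apply/funext => t; rewrite -horE.
by apply: continuous_line; rewrite -horE.
Qed.

Lemma continuous_ver F (x y : R) : {for x +i* y, continuous F} ->
  {for y, continuous (fun t : R => F (x +i* t))}.
Proof.
move=> cF; have -> : (fun t : R => F (x +i* t)) = (fun s => F (x%:C + s%:C * 'i%C)).
  by apply/funext => t; rewrite -verE.
by apply: continuous_line; rewrite -verE.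
Qed.

Lemma rderive_hor F (x y : R) l : is_derive (x +i* y) (1 : R[i]) F l ->
  rderive (fun t : R => F (t +i* y)) x l.
Proof.
move=> dF; have -> : (fun t : R => F (t +i* y)) = (fun s => F (0 +i* y + s%:C * 1)).
  by apply/funext => t; rewrite -horE.
by rewrite -[l]mul1r; apply: rderive_comp_line; rewrite -horE.
Qed.

Lemma rderive_ver F (x y : R) l : is_derive (x +i* y) (1 : R[i]) F l ->
  rderive (fun t : R => F (x +i* t)) y ('i%C * l).
Proof.
move=> dF; have -> : (fun t : R => F (x +i* t)) = (fun s => F (x%:C + s%:C * 'i%C)).
  by apply/funext => t; rewrite -verE.
by apply: rderive_comp_line; rewrite -verE.
Qed.

Definition bdrect a b c d : set R[i] := [set z | crect a b c d z /\
  (Re z = a \/ Re z = b \/ Im z = c \/ Im z = d)].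

Lemma bdrectS a b c d : bdrect a b c d `<=` crect a b c d.
Proof. by move=> z []. Qed.

Lemma continuous_onS (A B : set R[i]) F : A `<=` B -> continuous_on B F ->
  continuous_on A F.
Proof. by move=> AB cF z /AB; exact: cF. Qed.

Lemma crect_hor a b c d F y : continuous_on (crect a b c d) F -> c <= y <= d ->
  forall t, a <= t <= b -> {for t, continuous (fun x => F (x +i* y))}.
Proof. by move=> cF hy t ht; apply: continuous_hor; apply: cF. Qed.

Lemma crect_ver a b c d F x : continuous_on (crect a b c d) F -> a <= x <= b ->
  forall t, c <= t <= d -> {for t, continuous (fun y => F (x +i* y))}.
Proof. by move=> cF hx t ht; apply: continuous_ver; apply: cF. Qed.

Lemma bdrect_bot a b c d t : c <= d -> a <= t <= b -> bdrect a b c d (t +i* c).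
Proof. by move=> cd ht; split; [rewrite /crect /= lexx cd|right; right; left]. Qed.

Lemma bdrect_top a b c d t : c <= d -> a <= t <= b -> bdrect a b c d (t +i* d).
Proof. by move=> cd ht; split; [rewrite /crect /= lexx cd|right; right; right]. Qed.

Lemma bdrect_left a b c d t : a <= b -> c <= t <= d -> bdrect a b c d (a +i* t).
Proof. by move=> ab ht; split; [rewrite /crect /= lexx ab|left]. Qed.

Lemma bdrect_right a b c d t : a <= b -> c <= t <= d -> bdrect a b c d (b +i* t).
Proof. by move=> ab ht; split; [rewrite /crect /= lexx ab|right; left]. Qed.

Lemma bdrect_sides a b c d F : a <= b -> c <= d ->
  continuous_on (bdrect a b c d) F ->
  [/\ forall t, a <= t <= b -> {for t, continuous (fun x => F (x +i* c))},
      forall t, a <= t <= b -> {for t, continuous (fun x => F (x +i* d))},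
      forall t, c <= t <= d -> {for t, continuous (fun y => F (a +i* y))} &
      forall t, c <= t <= d -> {for t, continuous (fun y => F (b +i* y))}].
Proof.
move=> ab cd cF; split=> t ht.
- by apply: continuous_hor; apply: cF; exact: bdrect_bot.
- by apply: continuous_hor; apply: cF; exact: bdrect_top.
- by apply: continuous_ver; apply: cF; exact: bdrect_left.
- by apply: continuous_ver; apply: cF; exact: bdrect_right.
Qed.

Lemma rectint_bound a b c d F (M : R) : a <= b -> c <= d ->
  continuous_on (bdrect a b c d) F ->
  (forall z, bdrect a b c d z -> normc (F z) <= M) ->
  normc (rectint a b c d F) <= 4 * M * ((b - a) + (d - c)).
Proof.
move=> ab cd cF FM.
have [c1 c2 c3 c4] := bdrect_sides ab cd cF.
have h1 := segint_bound ab c1 (fun t ht => FM _ (bdrect_bot cd ht)).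
have h2 := segint_bound ab c2 (fun t ht => FM _ (bdrect_top cd ht)).
have h3 := segint_bound cd c3 (fun t ht => FM _ (bdrect_left ab ht)).
have h4 := segint_bound cd c4 (fun t ht => FM _ (bdrect_right ab ht)).
apply: le_trans (le_normcD _ _) _; rewrite Normc.normcM normci mul1r.
have := le_normcB (segint a b (fun x => F (x +i* c))) (segint a b (fun x => F (x +i* d))).
have := le_normcB (segint c d (fun x => F (b +i* x))) (segint c d (fun x => F (a +i* x))).
by clear -h1 h2 h3 h4; lra.
Qed.

Lemma continuous_cB F G z : {for z, continuous F} -> {for z, continuous G} ->
  {for z, continuous (fun z => F z - G z)}.
Proof. by move=> cF cG; exact: (continuousB cF cG). Qed.

Lemma crectS a b c d a' b' c' d' : a <= a' -> b' <= b -> c <= c' -> d' <= d ->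
  crect a' b' c' d' `<=` crect a b c d.
Proof.
by move=> h1 h2 h3 h4 z [/andP[? ?] /andP[? ?]]; split; apply/andP; split; lra.
Qed.

Lemma rectint_splitv a b c m d F : a <= b -> c <= m -> m <= d ->
  continuous_on (crect a b c d) F ->
  rectint a b c d F = rectint a b c m F + rectint a b m d F.
Proof.
move=> ab cm md cF; rewrite /rectint.
rewrite (segint_split cm md); last by apply: (crect_ver cF); rewrite lexx ab.
rewrite (segint_split cm md (f := fun y => F (a +i* y))); last first.
  by apply: (crect_ver cF); rewrite lexx ab.
by ring.
Qed.

Lemma rectint_splith a b c m d F : c <= d -> a <= m -> m <= b ->
  continuous_on (crect a b c d) F ->
  rectint a b c d F = rectint a m c d F + rectint m b c d F.
Proof.
move=> cd am mb cF; rewrite /rectint.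
rewrite (segint_split am mb); last by apply: (crect_hor cF); rewrite lexx cd.
rewrite (segint_split am mb (f := fun y => F (y +i* d))); last first.
  by apply: (crect_hor cF); rewrite lexx cd.
by ring.
Qed.

Lemma rectintB a b c d F G : a <= b -> c <= d ->
  continuous_on (bdrect a b c d) F -> continuous_on (bdrect a b c d) G ->
  rectint a b c d (fun z => F z - G z) = rectint a b c d F - rectint a b c d G.
Proof.
move=> ab cd cF cG.
have [F1 F2 F3 F4] := bdrect_sides ab cd cF.
have [G1 G2 G3 G4] := bdrect_sides ab cd cG.
rewrite /rectint /segint.
rewrite (cRintegralB _ (segint_integrable F1) (segint_integrable G1))//.
rewrite (cRintegralB _ (segint_integrable F2) (segint_integrable G2))//.
rewrite (cRintegralB _ (segint_integrable F3) (segint_integrable G3))//.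
rewrite (cRintegralB _ (segint_integrable F4) (segint_integrable G4))//.
by ring.
Qed.

Lemma rectintZ a b c d F k : a <= b -> c <= d ->
  continuous_on (bdrect a b c d) F ->
  rectint a b c d (fun z => k * F z) = k * rectint a b c d F.
Proof.
move=> ab cd cF.
have [F1 F2 F3 F4] := bdrect_sides ab cd cF.
rewrite /rectint /segint.
rewrite (cRintegralZ _ k (segint_integrable F1))//.
rewrite (cRintegralZ _ k (segint_integrable F2))//.
rewrite (cRintegralZ _ k (segint_integrable F3))//.
rewrite (cRintegralZ _ k (segint_integrable F4))//.
by ring.
Qed.

Lemma eq_rectint a b c d F G : a <= b -> c <= d ->
  (forall z, bdrect a b c d z -> F z = G z) -> rectint a b c d F = rectint a b c d G.
Proof.
move=> ab cd FG; rewrite /rectint /segint.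
congr (_ - _ + 'i%C * (_ - _)); apply: eq_cRintegral => x; rewrite inE /= in_itv /= => hx.
- exact/FG/bdrect_bot.
- exact/FG/bdrect_top.
- exact/FG/bdrect_right.
- exact/FG/bdrect_left.
Qed.

(** On each side the integral is a difference of values of [G] at two corners, and the eight corner
    values cancel in pairs. *)
Lemma rectint_primitive a b c d F G : a <= b -> c <= d ->
  continuous_on (crect a b c d) F ->
  (forall z, crect a b c d z -> is_derive z (1 : R[i]) G (F z)) ->
  rectint a b c d F = 0.
Proof.
move=> ab cd cF dG; rewrite /rectint mulrBr.
have hh y : c <= y <= d -> segint a b (fun x => F (x +i* y)) = G (b +i* y) - G (a +i* y).
  move=> hy; apply: (segint_FTC (G := fun x => G (x +i* y))) => //.
    by move=> t ht; apply: rderive_hor; exact: dG.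
  exact: crect_hor cF hy.
have hv x : a <= x <= b -> 'i%C * segint c d (fun y => F (x +i* y)) = G (x +i* d) - G (x +i* c).
  move=> hx; rewrite /segint -cRintegralZ//; last first.
    by apply: segint_integrable; exact: crect_ver cF hx.
  apply: (segint_FTC (G := fun y => G (x +i* y))) => //.
    by move=> t ht; apply: rderive_ver; exact: dG.
  move=> t ht; have /cvg_normcP H := crect_ver cF hx ht.
  apply/cvg_normcP => e /H; apply: filterS => y.
  by rewrite -mulrBr Normc.normcM normci mul1r.
by rewrite !hh ?hv ?lexx ?ab ?cd//; ring.
Qed.

Lemma is_derive_affine (A B z0 z : R[i]) :
  is_derive z (1 : R[i]) (fun z => A + (z - z0) * B) B.
Proof.
apply: (@is_cderive_quad _ _ _ _ 0 1) => // h _.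
have -> : A + (z + h - z0) * B - (A + (z - z0) * B) - h * B = 0 by ring.
by rewrite normc_0 mul0r.
Qed.

Lemma continuous_affine (A B z0 z : R[i]) :
  {for z, continuous (fun z => A + (z - z0) * B)}.
Proof. by apply: derivable_continuous; case: (is_derive_affine A B z0 z). Qed.

Lemma rectint_affine a b c d (A B z0 : R[i]) : a <= b -> c <= d ->
  rectint a b c d (fun z => A + (z - z0) * B) = 0.
Proof.
move=> ab cd.
pose G (z : R[i]) : R[i] := A * z + (z - z0) ^+ 2 / 2 * B.
have dG z : crect a b c d z -> is_derive z (1 : R[i]) G (A + (z - z0) * B).
  move=> _; apply: (@is_cderive_quad _ _ _ _ (normc (B / 2)) 1) => // h _.
  rewrite -normcX -Normc.normcM le_eqVlt; apply/orP; left; apply/eqP; congr normc.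
  by rewrite /G; field.
apply: rectint_primitive ab cd _ dG.
by move=> z _; exact: continuous_affine.
Qed.

(** Both end points are monotone, so every left end point lies below every right one, and the
    supremum of the left end points lies in all the intervals. *)
Lemma bisection_limit (x : nat -> R) (l : R) : 0 <= l ->
  (forall n, x n <= x n.+1 /\ x n.+1 + l / 2 ^+ n.+1 <= x n + l / 2 ^+ n) ->
  exists y, forall n, x n <= y <= x n + l / 2 ^+ n.
Proof.
move=> l0 H.
have nd n m : (n <= m)%N -> x n <= x m /\ x m + l / 2 ^+ m <= x n + l / 2 ^+ n.
  elim: m => [|m IH]; first by rewrite leqn0 => /eqP ->.
  rewrite leq_eqVlt => /predU1P[->//|/IH [h1 h2]].
  have [h3 h4] := H m; split; lra.
have bnd n m : x m <= x n + l / 2 ^+ n.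
  have := nd n (maxn n m) (leq_maxl _ _); have := nd m (maxn n m) (leq_maxr _ _).
  have : 0 <= l / 2 ^+ (maxn n m) by rewrite divr_ge0// exprn_ge0.
  lra.
exists (sup (range x)) => n; apply/andP; split.
  apply: ub_le_sup; last by exists n.
  by exists (x n + l / 2 ^+ n) => _ [m _ <-].
by apply: ge_sup; [exists (x n), n|move=> _ [m _ <-]].
Qed.

(** By contradiction: if each quarter carried less than a fourth of the modulus, the triangle
    inequality would make the whole smaller than itself. *)
Lemma rectint_quarter a b c d F : a <= b -> c <= d ->
  continuous_on (crect a b c d) F ->
  let w := (b - a) / 2 in let h := (d - c) / 2 in
  exists x y : R, [/\ normc (rectint a b c d F) <= 4 * normc (rectint x (x + w) y (y + h) F),
    a <= x /\ x + w <= b & c <= y /\ y + h <= d].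
Proof.
move=> ab cd cF w h.
have w0 : 0 <= w by rewrite divr_ge0 ?subr_ge0.
have h0 : 0 <= h by rewrite divr_ge0 ?subr_ge0.
have aw : a + w + w = b by rewrite /w; field.
have ch : c + h + h = d by rewrite /h; field.
clearbody w h.
apply: contrapT => nQ.
have small x y : (x = a \/ x = a + w) -> (y = c \/ y = c + h) ->
    4 * normc (rectint x (x + w) y (y + h) F) < normc (rectint a b c d F).
  move=> hx hy; rewrite ltNge; apply/negP => hle; apply: nQ; exists x, y.
  clear cF; split=> //; first by case: hx => ->; split; lra.
  by case: hy => ->; split; lra.
have E : rectint a b c d F = (rectint a (a + w) c (c + h) F + rectint a (a + w) (c + h) (c + h + h) F)
  + (rectint (a + w) (a + w + w) c (c + h) F + rectint (a + w) (a + w + w) (c + h) (c + h + h) F).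
  rewrite -aw -ch in cF *; clear small nQ ab cd aw ch.
  rewrite (@rectint_splith a _ c (a + w)); [|lra..|exact: cF].
  congr (_ + _); apply: rectint_splitv; try lra.
    by move=> z hz; apply: cF; apply: crectS hz; lra.
  by move=> z hz; apply: cF; apply: crectS hz; lra.
have := small _ _ (or_introl erefl) (or_introl erefl).
have := small _ _ (or_introl erefl) (or_intror erefl).
have := small _ _ (or_intror erefl) (or_introl erefl).
have := small _ _ (or_intror erefl) (or_intror erefl).
rewrite E; clear cF nQ small E.
set r1 := rectint _ _ _ _ _; set r2 := rectint _ _ _ _ _.
set r3 := rectint _ _ _ _ _; set r4 := rectint _ _ _ _ _.
have := le_normcD (r2 + r3) (r4 + r1).
have := le_normcD r2 r3; have := le_normcD r4 r1.
clearbody r1 r2 r3 r4; move: (normc (r2 + r3)) (normc (r4 + r1)) => x y; lra.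
Qed.

Lemma rectint_bisect a b c d F : a <= b -> c <= d ->
  continuous_on (crect a b c d) F ->
  exists x0 y0 : R, crect a b c d (x0 +i* y0) /\ forall n, exists x y : R,
   let w := (b - a) / 2 ^+ n in let h := (d - c) / 2 ^+ n in
   [/\ normc (rectint a b c d F) <= 4 ^+ n * normc (rectint x (x + w) y (y + h) F),
       a <= x /\ x + w <= b, c <= y /\ y + h <= d,
       x <= x0 <= x + w & y <= y0 <= y + h].
Proof.
move=> ab cd cF.
pose w n := (b - a) / 2 ^+ n; pose h n := (d - c) / 2 ^+ n.
have wS n : w n / 2 = w n.+1 by rewrite /w exprS; field; rewrite expf_neq0.
have hS n : h n / 2 = h n.+1 by rewrite /h exprS; field; rewrite expf_neq0.
have w0 n : 0 <= w n by rewrite divr_ge0 ?exprn_ge0 ?subr_ge0.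
have h0 n : 0 <= h n by rewrite divr_ge0 ?exprn_ge0 ?subr_ge0.
pose P n (p : R * R) :=
  [/\ normc (rectint a b c d F) <= 4 ^+ n * normc (rectint p.1 (p.1 + w n) p.2 (p.2 + h n) F),
      a <= p.1 /\ p.1 + w n <= b & c <= p.2 /\ p.2 + h n <= d].
pose Q n (p q : R * R) := [/\ P n.+1 q, p.1 <= q.1 /\ q.1 + w n.+1 <= p.1 + w n
  & p.2 <= q.2 /\ q.2 + h n.+1 <= p.2 + h n].
have step n p : P n p -> exists q, Q n p q.
  case: p => x y [hE [x1 x2] [y1 y2]]; cbn [fst snd] in *.
  have := @rectint_quarter x (x + w n) y (y + h n) F.
  rewrite !lerDl w0 h0 => /(_ isT isT) [|x' [y' ]].
    by move=> z /(crectS x1 x2 y1 y2); exact: cF.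
  have -> : (x + w n - x) / 2 = w n.+1 by rewrite -wS; congr (_ / _); ring.
  have -> : (y + h n - y) / 2 = h n.+1 by rewrite -hS; congr (_ / _); ring.
  move=> [hle [k1 k2] [k3 k4]]; exists (x', y'); split; cbn [fst snd] => //.
  split; cbn [fst snd].
  - apply: le_trans hE _; rewrite exprSr -mulrA ler_pM2l//.
  - by split; [exact: le_trans x1 k1|exact: le_trans k2 x2].
  - by split; [exact: le_trans y1 k3|exact: le_trans k4 y2].
(* [xget p] falls back on [p] when no good quarter exists; [step] and the invariant [P n (s n)] show
   that this never happens along [s]. *)
pose next n p := xget p (Q n p).
pose fix s n := if n is m.+1 then next m (s m) else (a, c).
have Ps n : P n (s n).
  elim: n => [|n IH].
    rewrite /P /w /h !expr0 !divr1 mul1r; cbn [fst snd s].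
    have -> : a + (b - a) = b by rewrite addrC subrK.
    have -> : c + (d - c) = d by rewrite addrC subrK.
    by rewrite !lexx.
  by have [q hq] := step _ _ IH; case: (xgetPex (s n) (ex_intro _ q hq)).
have Qs n : Q n (s n) (s n.+1).
  by have [q hq] := step _ _ (Ps n); exact: (xgetPex (s n) (ex_intro _ q hq)).
have [x0 hx0] : exists y, forall n, (s n).1 <= y <= (s n).1 + w n.
  apply: bisection_limit; first by rewrite subr_ge0.
  by move=> n; case: (Qs n).
have [y0 hy0] : exists y, forall n, (s n).2 <= y <= (s n).2 + h n.
  apply: bisection_limit; first by rewrite subr_ge0.
  by move=> n; case: (Qs n).
exists x0, y0; split.
  have [_ [u1 u2] [u3 u4]] := Ps 0%N.
  have /andP[v1 v2] := hx0 0%N; have /andP[v3 v4] := hy0 0%N.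
  split; apply/andP; split => /=.
  - exact: le_trans u1 v1.
  - exact: le_trans v2 u2.
  - exact: le_trans u3 v3.
  - exact: le_trans v4 u4.
by move=> n; exists (s n).1, (s n).2; have [] := Ps n; split.
Qed.

Lemma dist_in_itv (x w u v : R) :
  x <= u <= x + w -> x <= v <= x + w -> `|u - v| <= w.
Proof. by move=> /andP[? ?] /andP[? ?]; rewrite ler_norml; apply/andP; split; lra. Qed.

(** Near the limit point [z0] of the bisection, [F] differs from its affine approximation by at most
    e |z - z0|, and the affine part integrates to 0. The n-th rectangle therefore contributes at
    most a constant times e / 4^n, against the lower bound E / 4^n kept by the bisection. *)
Lemma goursat a b c d F : a <= b -> c <= d ->
  (forall z, crect a b c d z -> derivable F z 1) ->
  rectint a b c d F = 0.
Proof.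
move=> ab cd dF.
have cF : continuous_on (crect a b c d) F by move=> z /dF /derivable_continuous.
apply/eqP; rewrite -normc_eq0; apply/negPn/negP => E0.
have [x0 [y0 [hz0 bis]]] := rectint_bisect ab cd cF.
set E := normc _ in E0 bis.
have {}E0 : 0 < E by rewrite lt_neqAle normc_ge0 eq_sym E0.
have /derivableP/is_cderiveP H := dF _ hz0.
set l := 'D_1 F _ in H.
pose S := (b - a) + (d - c).
have S0 : 0 <= S by rewrite addr_ge0 ?subr_ge0.
have S1 : 0 < S + 1 by rewrite ltr_wpDl.
(* Chosen so that the final bound 4 e S^2 stays below E; [S + 1] in place of [S] covers the
   rectangle reduced to a point. *)
have e0 : 0 < E / (8 * (S + 1) ^+ 2).
  by rewrite divr_gt0// mulr_gt0// exprn_gt0.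
have [del del0 hdel] := H _ e0.
set e := E / _ in e0 hdel.
have [n hn] : exists n, (S + 1) / 2 ^+ n < del.
  have /cvgrPdist_lt/(_ _ del0) [n _ hn] : (fun n => (S + 1) / (2 : R) ^+ n) @ \oo --> (0 : R).
    have -> : (0 : R) = (S + 1) * 0 by rewrite mulr0.
    under eq_fun do rewrite -exprVn.
    apply: cvgMr; apply: cvg_expr; rewrite ger0_norm ?invr_ge0//.
    by rewrite invf_lt1// ltr1n.
  by exists n; have := hn n (leqnn n); rewrite sub0r normrN; apply: le_lt_trans; exact: ler_norm.
have [x [y]] := bis n.
set w := (b - a) / _; set h := (d - c) / _ => -[hE [x1 x2] [y1 y2] hx0 hy0].
have w0 : 0 <= w by rewrite divr_ge0 ?exprn_ge0 ?subr_ge0.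
have h0 : 0 <= h by rewrite divr_ge0 ?exprn_ge0 ?subr_ge0.
have hwS : w + h = S / 2 ^+ n by rewrite /w /h /S -mulrDl.
have p2 : 0 < (2 : R) ^+ n by rewrite exprn_gt0.
set z0 := x0 +i* y0 in hz0 H hdel.
have close z : crect x (x + w) y (y + h) z -> normc (z - z0) <= S / 2 ^+ n.
  move=> [/andP[u1 u2] /andP[u3 u4]].
  apply: le_trans (normc_le_ReIm _) _; rewrite !raddfB /= -hwS.
  have u12 : x <= Re z <= x + w by rewrite u1.
  have u34 : y <= Im z <= y + h by rewrite u3.
  exact: lerD (dist_in_itv u12 hx0) (dist_in_itv u34 hy0).
have cF' : continuous_on (crect x (x + w) y (y + h)) F.
  by move=> z /(crectS x1 x2 y1 y2); exact: cF.
have cA : continuous_on (crect x (x + w) y (y + h)) (fun z => F z0 + (z - z0) * l).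
  by move=> z _; exact: continuous_affine.
have xw : x <= x + w by rewrite lerDl.
have yh : y <= y + h by rewrite lerDl.
have : normc (rectint x (x + w) y (y + h) F) <= 4 * (e * (S / 2 ^+ n)) * (S / 2 ^+ n).
  have -> : rectint x (x + w) y (y + h) F =
    rectint x (x + w) y (y + h) (fun z => F z - (F z0 + (z - z0) * l)).
    rewrite (rectintB xw yh (continuous_onS (@bdrectS _ _ _ _) cF')
      (continuous_onS (@bdrectS _ _ _ _) cA)).
    by rewrite (rectint_affine _ _ _ xw yh) subr0.
  rewrite -{2}hwS; have -> : w + h = x + w - x + (y + h - y) by ring.
  apply: (rectint_bound xw yh).
    by move=> z /bdrectS hz; apply: continuous_cB; [exact: cF'|exact: continuous_affine].
  move=> z /bdrectS hz.
  have hc := close _ hz.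
  have : normc (z - z0) < del.
    apply: le_lt_trans hc _; apply: le_lt_trans hn.
    by rewrite ler_pM2r ?invr_gt0// lerDl.
  move=> /hdel; rewrite [z0 + _]addrC subrK opprD addrA => hle.
  by apply: le_trans hle _; rewrite ler_wpM2l// ltW.
apply/negP; rewrite -ltNge; have p4 : 0 < (4 : R) ^+ n by rewrite exprn_gt0.
rewrite -(ltr_pM2l p4); apply: lt_le_trans hE.
have -> : (4 : R) ^+ n = 2 ^+ n * 2 ^+ n by rewrite -exprMn -natrM.
have -> : 2 ^+ n * 2 ^+ n * (4 * (e * (S / 2 ^+ n)) * (S / 2 ^+ n)) = 4 * e * S ^+ 2.
  by field; rewrite gt_eqF.
rewrite /e.
have -> : 4 * (E / (8 * (S + 1) ^+ 2)) * S ^+ 2 = E * ((S ^+ 2) / (2 * (S + 1) ^+ 2)).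
  by field; rewrite gt_eqF.
rewrite gtr_pMr// ltr_pdivrMr ?mul1r ?mulr_gt0 ?exprn_gt0//.
clear -S0; nra.
Qed.

End rectangle.

(** * Exceptional lines, Cauchy integrals over squares, the winding integral *)

Section cauchy.
Context (R : realType).
Implicit Types (F G : R[i] -> R[i]) (a b c d r : R) (z w : R[i]).

(** The two horizontal sides nearly cancel by uniform continuity, which costs e / 2, and the two
    vertical sides are short, which costs e / 4 each. *)
Lemma rectint_thin a b c d F : a <= b -> continuous_on (crect a b c d) F ->
  forall e : R, 0 < e -> exists2 del : R, 0 < del & forall c' d' : R,
    c <= c' -> c' <= d' -> d' <= d -> d' - c' < del ->
    normc (rectint a b c' d' F) <= e.
Proof.
move=> ab cF e e0.
have [M0 HM0] := crect_bounded cF.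
pose M := `|M0| + 1; have M1 : 0 < M by rewrite ltr_wpDl.
have HM z : crect a b c d z -> normc (F z) <= M.
  by move=> /HM0 h; apply: le_trans h _; rewrite /M; have := ler_norm M0; lra.
pose B := b - a + 1; have B0 : 0 < B by rewrite ltr_wpDl// subr_ge0.
have eB : 0 < e / (4 * B) by rewrite divr_gt0// mulr_gt0.
have [d1 d10 Hd1] := crect_unif_continuous cF eB.
exists (Num.min d1 (e / (8 * M))).
  by rewrite lt_min d10 divr_gt0// mulr_gt0.
move=> c' d' cc cd dd; rewrite lt_min => /andP[k1 k2].
have cF' : continuous_on (crect a b c' d') F.
  by apply: continuous_onS cF; exact: crectS.
have [s1 s2 s3 s4] := bdrect_sides ab cd (continuous_onS (@bdrectS _ _ _ _ _) cF').
have sub := crectS (lexx a) (lexx b) cc dd.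
rewrite /rectint.
have h1 : normc (segint a b (fun x => F (x +i* c')) - segint a b (fun x => F (x +i* d')))
    <= 2 * (e / (4 * B)) * (b - a).
  rewrite /segint -cRintegralB//; [|exact: segint_integrable s1|exact: segint_integrable s2].
  apply: (segint_bound ab) => t ht.
    exact: (continuousB (s1 _ ht) (s2 _ ht)).
  apply/ltW; rewrite normcB; apply: Hd1.
    by apply/sub/bdrectS/bdrect_bot.
  have -> : t +i* d' - (t +i* c') = 'i%C * (d' - c')%:C.
    by apply/eqP; rewrite eq_complex /=; apply/andP; split; apply/eqP; ring.
  by rewrite Normc.normcM normci mul1r normc_real ger0_norm// subr_ge0.
have h3 := segint_bound cd s3 (fun t ht => HM _ (sub _ (bdrectS (bdrect_left ab ht)))).
have h4 := segint_bound cd s4 (fun t ht => HM _ (sub _ (bdrectS (bdrect_right ab ht)))).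
apply: le_trans (le_normcD _ _) _; rewrite Normc.normcM normci mul1r.
have := le_normcB (segint c' d' (fun x => F (b +i* x))) (segint c' d' (fun x => F (a +i* x))).
have k3 : 2 * (e / (4 * B)) * (b - a) <= e / 2.
  have -> : 2 * (e / (4 * B)) * (b - a) = e / 2 * ((b - a) / B).
    by field; rewrite gt_eqF.
  by rewrite ler_piMr ?divr_ge0 ?(ltW e0)// ler_pdivrMr// mul1r /B lerDl.
have k4 : 2 * M * (d' - c') <= e / 4.
  move: k2; rewrite ltr_pdivlMr ?mulr_gt0// => k2.
  by clear -k2; lra.
clear -h1 h3 h4 k3 k4; lra.
Qed.

Lemma rectint_flat a b c F : rectint a b c c F = 0.
Proof.
rewrite /rectint subrr add0r /segint /cRintegral set_itv1 !Rintegral_set1.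
by rewrite subrr mulr0.
Qed.

(** Induction on the exceptional heights: the rectangle is split along one of them, which then
    becomes an edge of both halves. This is why holomorphy is asked only strictly between the
    horizontal edges; in the base case thin strips along both edges are cut off and Goursat applies
    to the rest. Whole lines are allowed because one statement then covers isolated points and the
    real axis alike. *)
Lemma rectint_off_lines (ys : seq R) a b c d F : a <= b -> c <= d ->
  continuous_on (crect a b c d) F ->
  (forall z, crect a b c d z -> c < Im z < d -> Im z \notin ys -> derivable F z 1) ->
  rectint a b c d F = 0.
Proof.
move=> ab; elim: ys c d => [|y ys IH] c d cd cF dF.
  move: cd; rewrite le_eqVlt => /predU1P[<-|cd]; first exact: rectint_flat.
  apply/eqP; rewrite -normc_eq0; apply/negPn/negP => E0.
  have {}E0 : 0 < normc (rectint a b c d F) by rewrite lt_neqAle normc_ge0 eq_sym E0.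
  have e0 : 0 < normc (rectint a b c d F) / 3 by lra.
  have [del del0 H] := rectint_thin ab cF e0.
  pose m := Num.min (del / 2) ((d - c) / 3).
  have m0 : 0 < m by rewrite lt_min; lra.
  have m1 : m <= del / 2 by rewrite ge_min lexx.
  have m2 : m <= (d - c) / 3 by rewrite ge_min lexx orbT.
  have q1 : c <= c + m by lra.
  have q2 : c + m <= d by lra.
  have q3 : c + m <= d - m by lra.
  have q4 : d - m <= d by lra.
  have q5 : c + m - c < del by lra.
  have q6 : d - (d - m) < del by lra.
  have q7 : c <= d - m by lra.
  have sub : crect a b (c + m) d `<=` crect a b c d by exact: crectS.
  have sub2 : crect a b (c + m) (d - m) `<=` crect a b c d by exact: crectS.
  have := H _ _ (lexx c) q1 q2 q5; have := H _ _ q7 q4 (lexx d) q6.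
  have : normc (rectint a b c d F) <=
      normc (rectint a b c (c + m) F) + normc (rectint a b (d - m) d F).
    rewrite (rectint_splitv ab q1 q2 cF) (rectint_splitv ab q3 q4 (continuous_onS sub cF)).
    rewrite (@goursat _ a b (c + m) (d - m))// ?add0r; first exact: le_normcD.
    move=> z hz; apply: dF => //; first exact: sub2.
    by case: hz => _ /andP[? ?]; apply/andP; split; lra.
  set r1 := rectint a b c (c + m) F; set r2 := rectint a b (d - m) d F.
  set r0 := rectint a b c d F in E0 *; move: E0.
  clearbody r0 r1 r2; move: (normc r0) (normc r1) (normc r2) => u v x; clear; lra.
case: (boolP (c < y < d)) => [/andP[cy yd]|ncyd]; last first.
  apply: IH => // z hz hcd hy; apply: dF => //; rewrite inE negb_or hy andbT.
  by apply: contra ncyd => /eqP <-.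
have cy' := ltW cy; have yd' := ltW yd.
have sub1 : crect a b c y `<=` crect a b c d by exact: crectS.
have sub2 : crect a b y d `<=` crect a b c d by exact: crectS.
rewrite (rectint_splitv ab cy' yd' cF) !IH ?addr0//; try exact: continuous_onS cF.
  move=> z hz /andP[h1 h2] hy; apply: dF; first exact: sub2.
    by rewrite h2 andbT (lt_trans cy).
  by rewrite inE negb_or hy andbT gt_eqF.
move=> z hz /andP[h1 h2] hy; apply: dF; first exact: sub1.
  by rewrite h1 (lt_trans h2).
by rewrite inE negb_or hy andbT lt_eqF.
Qed.

Definition csquare z r := crect (Re z - r) (Re z + r) (Im z - r) (Im z + r).
Definition bdsquare z r := bdrect (Re z - r) (Re z + r) (Im z - r) (Im z + r).
Definition sqint z r F := rectint (Re z - r) (Re z + r) (Im z - r) (Im z + r) F.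

Lemma csquareP z r w : csquare z r w <-> `|Re (w - z)| <= r /\ `|Im (w - z)| <= r.
Proof.
rewrite /csquare /crect /= !raddfB /= !ler_norml.
by split=> -[/andP[h1 h2] /andP[h3 h4]]; split; apply/andP; split; lra.
Qed.

Lemma bdsquareP z r w : bdsquare z r w <-> csquare z r w /\
  (`|Re (w - z)| = r \/ `|Im (w - z)| = r).
Proof.
rewrite /bdsquare /bdrect /= -/(csquare z r w).
split=> -[hw H]; have /csquareP := hw; rewrite !raddfB /= => -[h1 h2]; split => //.
  have r0 : 0 <= r by apply: le_trans h1.
  move: H => [->|[->|[->|->]]]; [left|left|right|right].
  - by rewrite addrAC subrr add0r normrN ger0_norm.
  - by rewrite addrAC subrr add0r ger0_norm.
  - by rewrite addrAC subrr add0r normrN ger0_norm.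
  - by rewrite addrAC subrr add0r ger0_norm.
case: H; rewrite raddfB /=.
  have [h|h] := lerP 0 (Re w - Re z); [rewrite ger0_norm// => H|rewrite ltr0_norm// => H].
    by right; left; lra.
  by left; lra.
have [h|h] := lerP 0 (Im w - Im z); [rewrite ger0_norm// => H|rewrite ltr0_norm// => H].
  by right; right; right; lra.
by right; right; left; lra.
Qed.

Lemma csquare_center z r : 0 <= r -> csquare z r z.
Proof. by move=> r0; apply/csquareP; rewrite subrr /= normr0. Qed.

Lemma csquare_norm z r w : csquare z r w -> normc (w - z) <= 2 * r.
Proof.
by move=> /csquareP[h1 h2]; apply: le_trans (normc_le_ReIm _) _; lra.
Qed.

Lemma normc_csquare z r w : normc (w - z) <= r -> csquare z r w.
Proof.
by move=> h; apply/csquareP; split; apply: le_trans h; [exact: Re_normc|exact: Im_normc].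
Qed.

Lemma bdsquare_far z r w u : bdsquare z r w -> csquare z (r / 2) u ->
  r / 2 <= normc (w - u).
Proof.
move=> /bdsquareP[_ hw] /csquareP[h1 h2].
have E : w - u = (w - z) - (u - z) by ring.
case: hw => hw; [apply: le_trans (Re_normc _)|apply: le_trans (Im_normc _)];
  rewrite E raddfB /=; apply: le_trans (lerB_dist _ _); rewrite hw; lra.
Qed.

Lemma csquare_half z r : 0 <= r -> csquare z (r / 2) `<=` csquare z r.
Proof. by move=> r0 w /csquareP[h1 h2]; apply/csquareP; split; lra. Qed.

Lemma sub_bdsquare z r : bdsquare z r `<=` csquare z r.
Proof. exact: bdrectS. Qed.

Lemma continuous_inv_sub w z : z != w -> {for z, continuous (fun z => (z - w)^-1)}.
Proof.
move=> zw; apply: derivable_continuous; apply: derivableV; first by rewrite subr_eq0.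
exact: derivableB.
Qed.

Lemma bdsquare_neq z r w u : 0 < r -> bdsquare z r w -> csquare z (r / 2) u -> w != u.
Proof.
move=> r0 h1 h2; rewrite -subr_eq0 -normc_gt0; apply: lt_le_trans (bdsquare_far h1 h2).
lra.
Qed.

Lemma sqint_bound z r F M : 0 <= r -> continuous_on (bdsquare z r) F ->
  (forall w, bdsquare z r w -> normc (F w) <= M) ->
  normc (sqint z r F) <= 16 * M * r.
Proof.
move=> r0 cF FM; have -> : 16 * M * r = 4 * M * ((Re z + r - (Re z - r)) + (Im z + r - (Im z - r))).
  by ring.
by apply: rectint_bound => //; lra.
Qed.

Lemma sqintB z r F G : 0 <= r ->
  continuous_on (bdsquare z r) F -> continuous_on (bdsquare z r) G ->
  sqint z r (fun z => F z - G z) = sqint z r F - sqint z r G.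
Proof. by move=> r0; apply: rectintB; lra. Qed.

Lemma sqintZ z r F k : 0 <= r -> continuous_on (bdsquare z r) F ->
  sqint z r (fun z => k * F z) = k * sqint z r F.
Proof. by move=> r0; apply: rectintZ; lra. Qed.

Lemma eq_sqint z r F G : 0 <= r ->
  (forall w, bdsquare z r w -> F w = G w) -> sqint z r F = sqint z r G.
Proof. by move=> r0; apply: eq_rectint; lra. Qed.

(** The remainder of the kernel is exactly h^2 / ((u - w)^2 (u - w - h)). All three factors of the
    denominator are at least r / 2 on the boundary, whence 8 / r^3. Only continuity of the density
    [Phi] on the boundary enters. *)
Lemma is_derive_cauchy z r (Phi : R[i] -> R[i]) w : 0 < r ->
  continuous_on (bdsquare z r) Phi ->
  (exists M : R, forall u, bdsquare z r u -> normc (Phi u) <= M) ->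
  (exists2 e, 0 < e & forall u, normc (u - w) < e -> csquare z (r / 2) u) ->
  derivable (fun w => sqint z r (fun u => Phi u * (u - w)^-1)) w 1.
Proof.
move=> r0 cPhi [M HM] [e e0 He].
have r0' := ltW r0.
have hc v : csquare z (r / 2) v -> continuous_on (bdsquare z r) (fun u => Phi u * (u - v)^-1).
  move=> hv u hu; apply: (continuousM (cPhi _ hu)).
  by apply: continuous_inv_sub; exact: bdsquare_neq hv.
have hw : csquare z (r / 2) w by apply: He; rewrite subrr normc_0.
have hc2 : continuous_on (bdsquare z r) (fun u => Phi u * (u - w)^-1 * (u - w)^-1).
  move=> u hu; apply: (continuousM (hc _ hw _ hu)).
  by apply: continuous_inv_sub; exact: bdsquare_neq hw.
suff [] : is_derive w (1 : R[i]) (fun w => sqint z r (fun u => Phi u * (u - w)^-1))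
  (sqint z r (fun u => Phi u * (u - w)^-1 * (u - w)^-1)) by [].
apply: (@is_cderive_quad _ _ _ _ (16 * (`|M| * (8 / r ^+ 3)) * r) e) => // h he.
have hwh : csquare z (r / 2) (w + h) by apply: He; rewrite addrAC subrr add0r.
rewrite -(sqintB r0' (hc _ hwh) (hc _ hw)).
have hc3 : continuous_on (bdsquare z r) (fun u => h * (Phi u * (u - w)^-1 * (u - w)^-1)).
  by move=> u hu; apply: (continuousM (@cst_continuous _ _ h _) (hc2 _ hu)).
have hc4 : continuous_on (bdsquare z r) (fun u => Phi u * (u - (w + h))^-1 - Phi u * (u - w)^-1).
  by move=> u hu; exact: (continuousB (hc _ hwh _ hu) (hc _ hw _ hu)).
rewrite -(sqintZ h r0' hc2) -(sqintB r0' hc4 hc3).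
have -> : 16 * (`|M| * (8 / r ^+ 3)) * r * normc h ^+ 2 =
    16 * (`|M| * (8 / r ^+ 3) * normc h ^+ 2) * r by ring.
apply: (sqint_bound r0').
  by move=> u hu; exact: (continuous_cB (hc4 _ hu) (hc3 _ hu)).
move=> u hu.
have n1 := bdsquare_neq r0 hu hw; have n2 := bdsquare_neq r0 hu hwh.
have -> : Phi u * (u - (w + h))^-1 - Phi u * (u - w)^-1 - h * (Phi u * (u - w)^-1 * (u - w)^-1)
   = Phi u * h ^+ 2 * ((u - w)^-1 * (u - w)^-1 * (u - (w + h))^-1).
  by field; rewrite !subr_eq0 n1 n2.
rewrite Normc.normcM Normc.normcM normcX 2!Normc.normcM !Normc.normcV.
have f1 := bdsquare_far hu hw; have f2 := bdsquare_far hu hwh.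
have r2 : 0 < r / 2 by lra.
have g1 : (normc (u - w))^-1 <= 2 / r.
  by rewrite -[2 / r]invrK invf_div lef_pV2// posrE (lt_le_trans r2).
have g2 : (normc (u - (w + h)))^-1 <= 2 / r.
  by rewrite -[2 / r]invrK invf_div lef_pV2// posrE (lt_le_trans r2).
have p1 : 0 <= (normc (u - w))^-1 by rewrite invr_ge0 normc_ge0.
have p2 : 0 <= (normc (u - (w + h)))^-1 by rewrite invr_ge0 normc_ge0.
rewrite -mulrA [normc h ^+ 2 * _]mulrC mulrA.
apply: ler_wpM2r; first by rewrite exprn_ge0// normc_ge0.
apply: ler_pM; rewrite ?normc_ge0 ?mulr_ge0//.
  by apply: le_trans (HM _ hu) (ler_norm _).
have -> : 8 / r ^+ 3 = 2 / r * (2 / r) * (2 / r) by field; rewrite gt_eqF.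
by apply: ler_pM; rewrite ?mulr_ge0//; apply: ler_pM.
Qed.

Lemma segint_Im_ge a b (f : R -> R[i]) m : a <= b ->
  (forall t, a <= t <= b -> {for t, continuous f}) ->
  (forall t, a <= t <= b -> m <= Im (f t)) -> m * (b - a) <= Im (segint a b f).
Proof.
move=> ab cf fm; have [_ f2] := segint_integrable cf.
rewrite -(Rintegral_cst_itv m ab) /segint /cRintegral /=; apply: le_Rintegral => //.
  apply: continuous_compact_integrable; first exact: segment_compact.
  by apply: continuous_subspaceT => x; exact: cst_continuous.
Qed.

Lemma segint_Re_ge a b (f : R -> R[i]) m : a <= b ->
  (forall t, a <= t <= b -> {for t, continuous f}) ->
  (forall t, a <= t <= b -> m <= Re (f t)) -> m * (b - a) <= Re (segint a b f).
Proof.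
move=> ab cf fm; have [f2 _] := segint_integrable cf.
rewrite -(Rintegral_cst_itv m ab) /segint /cRintegral /=; apply: le_Rintegral => //.
  apply: continuous_compact_integrable; first exact: segment_compact.
  by apply: continuous_subspaceT => x; exact: cst_continuous.
Qed.

Lemma cReV z : Re z^-1 = Re z / (Re z ^+ 2 + Im z ^+ 2).
Proof. by case: z. Qed.

Lemma cImV z : Im z^-1 = - Im z / (Re z ^+ 2 + Im z ^+ 2).
Proof. by case: z => x y /=; rewrite mulNr. Qed.

(** The numerator is at least r / 2 and the denominator at most 9 r^2 / 2. *)
Lemma winding_aux (x y r : R) : 0 < r -> r / 2 <= y -> y <= 3 * r / 2 ->
  `|x| <= 3 * r / 2 -> (9 * r)^-1 <= y / (x ^+ 2 + y ^+ 2).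
Proof.
move=> r0 h1 h2; rewrite ler_norml => /andP[h3 h4].
have y0 : 0 < y by lra.
rewrite ler_pdivlMr ?ltr_wpDl ?sqr_ge0 ?exprn_gt0//.
rewrite mulrC ler_pdivrMr ?mulr_gt0//; nra.
Qed.

(** The true value is 2 pi i, but nonvanishing is enough. The integrand contributes with a constant
    sign to the imaginary part on every side: by [winding_aux] each side, of length 2 r, gives at
    least 2 r / (9 r) = 2 / 9. *)
Lemma winding_ge z r w : 0 < r -> csquare z (r / 2) w ->
  8 / 9 <= normc (sqint z r (fun u => (u - w)^-1)).
Proof.
move=> r0 hw; apply: le_trans (Im_normc _); apply: le_trans (ler_norm _).
have cF : continuous_on (bdsquare z r) (fun u => (u - w)^-1).
  by move=> u hu; apply: continuous_inv_sub; exact: bdsquare_neq hw.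
have [k12 k34] : (`|Re w - Re z| <= r / 2) /\ (`|Im w - Im z| <= r / 2).
  by move/csquareP : hw; rewrite !raddfB.
move: k12 k34; rewrite !ler_norml => /andP[k1 k2] /andP[k3 k4].
have q1 : Re z - r <= Re z + r by lra.
have q2 : Im z - r <= Im z + r by lra.
have H1 t : Re z - r <= t -> t <= Re z + r -> `|t - Re w| <= 3 * r / 2.
  by clear -k1 k2 => ? ?; rewrite ler_norml; apply/andP; split; lra.
have H2 t : Im z - r <= t -> t <= Im z + r -> `|t - Im w| <= 3 * r / 2.
  by clear -k3 k4 => ? ?; rewrite ler_norml; apply/andP; split; lra.
have b1 : r / 2 <= Im w - (Im z - r) <= 3 * r / 2 by apply/andP; split; lra.
have b2 : r / 2 <= Im z + r - Im w <= 3 * r / 2 by apply/andP; split; lra.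
have b3 : r / 2 <= Re z + r - Re w <= 3 * r / 2 by apply/andP; split; lra.
have b4 : r / 2 <= Re w - (Re z - r) <= 3 * r / 2 by apply/andP; split; lra.
have [s1 s2 s3 s4] := bdrect_sides q1 q2 cF.
have E (A B C D : R[i]) : Im (A - B + 'i%C * (C - D)) = Im A + Im (- B) + (Re C + Re (- D)).
  by case: A B C D => [? ?] [? ?] [? ?] [? ?] /=; ring.
rewrite /sqint /rectint E.
have I1 x y : Im (x +i* y - w)^-1 = (Im w - y) / ((x - Re w) ^+ 2 + (Im w - y) ^+ 2).
  by rewrite cImV !raddfB /=; congr (_ / _); ring.
have I2 x y : - Im (x +i* y - w)^-1 = (y - Im w) / ((x - Re w) ^+ 2 + (y - Im w) ^+ 2).
  by rewrite I1 -mulNr; congr (_ / _); ring.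
have I3 x y : Re (x +i* y - w)^-1 = (x - Re w) / ((y - Im w) ^+ 2 + (x - Re w) ^+ 2).
  by rewrite cReV !raddfB /=; congr (_ / _); ring.
have I4 x y : - Re (x +i* y - w)^-1 = (Re w - x) / ((y - Im w) ^+ 2 + (Re w - x) ^+ 2).
  by rewrite I3 -mulNr; congr (_ / _); ring.
have j1 : (9 * r)^-1 * (Re z + r - (Re z - r)) <= Im (segint (Re z - r) (Re z + r) (fun x => (x +i* (Im z - r) - w)^-1)).
  apply: (segint_Im_ge q1 s1) => t /andP[t1 t2]; rewrite I1.
  by have /andP[? ?] := b1; apply: winding_aux => //; exact: H1.
have j2 : (9 * r)^-1 * (Re z + r - (Re z - r)) <= Im (- segint (Re z - r) (Re z + r) (fun x => (x +i* (Im z + r) - w)^-1)).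
  have -> : - segint (Re z - r) (Re z + r) (fun x => (x +i* (Im z + r) - w)^-1) =
    segint (Re z - r) (Re z + r) (fun x => -1 * (x +i* (Im z + r) - w)^-1).
    by rewrite /segint (cRintegralZ _ _ (segint_integrable s2)) ?mulN1r.
  apply: (segint_Im_ge q1) => t ht.

    by apply: continuous_scale; exact: s2.
  move: ht => /andP[t1 t2]; rewrite mulN1r raddfN [X in _ <= X]I2.
  by have /andP[? ?] := b2; apply: winding_aux => //; exact: H1.
have j3 : (9 * r)^-1 * (Im z + r - (Im z - r)) <= Re (segint (Im z - r) (Im z + r) (fun x => ((Re z + r) +i* x - w)^-1)).
  apply: (segint_Re_ge q2 s4) => t /andP[t1 t2]; rewrite I3.
  by have /andP[? ?] := b3; apply: winding_aux => //; exact: H2.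
have j4 : (9 * r)^-1 * (Im z + r - (Im z - r)) <= Re (- segint (Im z - r) (Im z + r) (fun x => ((Re z - r) +i* x - w)^-1)).
  have -> : - segint (Im z - r) (Im z + r) (fun x => ((Re z - r) +i* x - w)^-1) =
    segint (Im z - r) (Im z + r) (fun x => -1 * ((Re z - r) +i* x - w)^-1).
    by rewrite /segint (cRintegralZ _ _ (segint_integrable s3)) ?mulN1r.
  apply: (segint_Re_ge q2) => t ht.
    by apply: continuous_scale; exact: s3.
  move: ht => /andP[t1 t2]; rewrite mulN1r raddfN [X in _ <= X]I4.
  by have /andP[? ?] := b4; apply: winding_aux => //; exact: H2.
move: j1 j2 j3 j4.
have -> : (9 * r)^-1 * (Re z + r - (Re z - r)) = 2 / 9 by field; rewrite gt_eqF.
have -> : (9 * r)^-1 * (Im z + r - (Im z - r)) = 2 / 9 by field; rewrite gt_eqF.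
lra.
Qed.

End cauchy.

(** * Removable singularities, Taylor estimates, simple poles, Liouville *)

Section cauchy_consequences.
Context (R : realType).
Implicit Types (F G : R[i] -> R[i]) (a b c d r : R) (z w : R[i]).

Lemma derivable_sub z w : derivable (fun u : R[i] => (u - w : R[i])) z 1.
Proof. exact: (cderB (@cder_id R z) (@cder_cst R w z)). Qed.

Lemma derivable_inv_sub z w : z != w -> derivable (fun u : R[i] => (u - w)^-1) z 1.
Proof.
by move=> zw; apply: (cderV _ (@derivable_sub z w)); rewrite subr_eq0.
Qed.

(** Completed by the derivative at [z = w]. Its holomorphy there is a case of removability, and
    iterating it produces Taylor remainders and principal parts without power series. *)
Definition dquot F w z := if z == w then 'D_1 F w else (F z - F w) * (z - w)^-1.

Lemma dquot_neq F w z : z != w -> dquot F w z = (F z - F w) * (z - w)^-1.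
Proof. by rewrite /dquot => /negPf ->. Qed.

Lemma dquotM F w z : F z = F w + (z - w) * dquot F w z.
Proof.
have [->|zw] := eqVneq z w; first by rewrite subrr mul0r addr0.
by rewrite dquot_neq// mulrCA divff ?subr_eq0// mulr1 addrC subrK.
Qed.

Lemma near_neq z w : z != w -> \forall u \near z, u != w.
Proof.
move=> zw; apply/nbhs_normcP; exists (normc (z - w)).
  by rewrite normc_gt0 subr_eq0.
move=> u hu; apply: contraTneq hu => ->; by rewrite normcB ltxx.
Qed.

Lemma dquot_derivable_neq F w z : z != w -> derivable F z 1 ->
  derivable (dquot F w) z 1.
Proof.
move=> zw dF.
have : derivable (fun u => (F u - F w) * (u - w)^-1) z 1.
  apply: (derivableM _ (derivable_inv_sub zw)).
  by apply: (derivableB dF); exact: derivable_cst.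
apply: derivable_near; apply: filterS (near_neq zw) => u uw.
by rewrite dquot_neq.
Qed.

Lemma dquot_continuous F w : derivable F w 1 -> {for w, continuous (dquot F w)}.
Proof.
move=> /derivableP/is_cderiveP H; apply/ccontinuousP => e e0.
have e2 : 0 < e / 2 by lra.
have [d d0 hd] := H _ e2.
exists d => // z hz.
have [->|zw] := eqVneq z w; first by rewrite subrr normc_0.
have zw0 : z - w != 0 by rewrite subr_eq0.
rewrite dquot_neq//; have := hd _ hz; rewrite [w + _]addrC subrK => hle.
have -> : dquot F w w = 'D_1 F w by rewrite /dquot eqxx.
have -> : (F z - F w) * (z - w)^-1 - 'D_1 F w = (F z - F w - (z - w) * 'D_1 F w) * (z - w)^-1.
  by field.
rewrite Normc.normcM Normc.normcV ltr_pdivrMr ?normc_gt0//.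
apply: le_lt_trans hle _; rewrite ltr_pM2r ?normc_gt0//; lra.
Qed.

Lemma cauchy_formula (ys : seq R) z r F w : 0 < r ->
  continuous_on (csquare z r) F ->
  (forall u, csquare z r u -> Im u \notin ys -> derivable F u 1) ->
  csquare z (r / 2) w -> derivable F w 1 ->
  sqint z r (fun u => F u * (u - w)^-1) = F w * sqint z r (fun u => (u - w)^-1).
Proof.
move=> r0 cF dF hw dw; have r0' := ltW r0.
have : sqint z r (dquot F w) = 0.
  apply: (rectint_off_lines (ys := Im w :: ys)); [lra|lra| |].
    move=> u hu; have [->|uw] := eqVneq u w; first exact: dquot_continuous.
    have cq : {for u, continuous (fun u => (F u - F w) * (u - w)^-1)}.
      apply: (continuousM _ (continuous_inv_sub uw)).
      by apply: (continuousB (cF _ hu)); exact: cst_continuous.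
    apply: ccontinuous_near cq; apply: filterS (near_neq uw) => v vw.
    by rewrite dquot_neq.
  move=> u hu _; rewrite inE negb_or => /andP[u1 u2].
  apply: dquot_derivable_neq; last exact: dF.
  by apply: contra u1 => /eqP ->.
have cb : continuous_on (bdsquare z r) (fun u => (u - w)^-1).
  by move=> u hu; apply: continuous_inv_sub; exact: bdsquare_neq hw.
have cFb : continuous_on (bdsquare z r) (fun u => F u * (u - w)^-1).
  by move=> u hu; apply: (continuousM (cF _ (sub_bdsquare hu)) (cb _ hu)).
have cwb : continuous_on (bdsquare z r) (fun u => F w * (u - w)^-1).
  by move=> u hu; apply: (continuousM (@cst_continuous _ _ (F w) _) (cb _ hu)).
rewrite (@eq_sqint _ _ _ _ (fun u => F u * (u - w)^-1 - F w * (u - w)^-1))//; last first.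
  by move=> u hu; rewrite dquot_neq ?mulrBl//; exact: bdsquare_neq hw.
rewrite (sqintB r0' cFb cwb) (sqintZ (F w) r0' cb) => /eqP.
by rewrite subr_eq0 => /eqP.
Qed.

Lemma sqint_inv_neq0 z r w : 0 < r -> csquare z (r / 2) w ->
  sqint z r (fun u => (u - w)^-1) != 0.
Proof.
move=> r0 hw; rewrite -normc_gt0; apply: lt_le_trans (winding_ge r0 hw); lra.
Qed.

Lemma csquare_bounded F z r : continuous_on (csquare z r) F ->
  exists M : R, forall u, csquare z r u -> normc (F u) <= M.
Proof. exact: crect_bounded. Qed.

Lemma near_csquare z r : 0 < r -> exists2 e : R, 0 < e &
  forall w u, normc (w - z) < e -> normc (u - w) < e -> csquare z (r / 2) u.
Proof.
move=> r0; exists (r / 4); first by lra.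
move=> w u h1 h2; apply: normc_csquare.
have -> : u - z = (u - w) + (w - z) by ring.
apply: le_trans (le_normcD _ _) _; lra.
Qed.

(** Cauchy's integral normalised by the winding integral around the same point instead of 2 pi i;
    numerator and denominator are both holomorphic in [w]. *)
Definition cauchy_quot z r F w :=
  sqint z r (fun u => F u * (u - w)^-1) * (sqint z r (fun u => (u - w)^-1))^-1.

Lemma cauchy_quot_derivable z r F w : 0 < r -> continuous_on (bdsquare z r) F ->
  (exists M : R, forall u, bdsquare z r u -> normc (F u) <= M) ->
  (exists2 e, 0 < e & forall u, normc (u - w) < e -> csquare z (r / 2) u) ->
  derivable (cauchy_quot z r F) w 1.
Proof.
move=> r0 cF bF He.
have hw : csquare z (r / 2) w.
  by case: He => e e0; apply; rewrite subrr normc_0.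
apply: cderM; first exact: is_derive_cauchy.
apply: cderV; first exact: sqint_inv_neq0.
have := @is_derive_cauchy _ z r (fun=> 1) w r0 _ _ He.
under [X in derivable X]eq_fun do under eq_fun do rewrite mul1r.
apply; first by move=> u _; exact: cst_continuous.
by exists 1 => u _; rewrite Normc.normc1.
Qed.

(** [F] coincides near [z] with the holomorphic function [cauchy_quot z r F]: at points off the
    lines by Cauchy's formula, at points on them because both sides are continuous and points off
    the lines are dense. *)
Lemma removable_lines (ys : seq R) z r F : 0 < r ->
  continuous_on (csquare z r) F ->
  (forall u, csquare z r u -> Im u \notin ys -> derivable F u 1) ->
  derivable F z 1.
Proof.
move=> r0 cF dF; have r0' := ltW r0.
have [e e0 He] := near_csquare z r0.
have [M HM] := csquare_bounded cF.
have dG w : normc (w - z) < e -> derivable (cauchy_quot z r F) w 1.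
  move=> hw; apply: cauchy_quot_derivable => //.
  - by move=> u /sub_bdsquare; exact: cF.
  - by exists M => u /sub_bdsquare; exact: HM.
  - by exists e => // u; exact: He.
have FG w : normc (w - z) < e -> F w = cauchy_quot z r F w.
  move=> hw; apply/eqP; rewrite -subr_eq0 -normc_eq0; apply/negPn/negP => n0.
  have {}n0 : 0 < normc (F w - cauchy_quot z r F w).
    by rewrite lt_neqAle normc_ge0 andbT eq_sym.
  have hsw : csquare z (r / 2) w by apply: He hw _; rewrite subrr normc_0.
  have := continuousB (cF _ (csquare_half r0' hsw)) (derivable_continuous (dG _ hw)).
  move=> /cvg_normcP /(_ _ n0) /nbhs_normcP[del del0 hdel].
  have ew : 0 < e - normc (w - z) by lra.
  (* Among [size ys + 1] distinct heights Im w + m / (k + 2) at least one avoids [ys]; the shift k +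
     2 keeps the displacement strictly below m. *)
  have [t [t0 t1 t2 t3]] : exists t : R, [/\ 0 < t, t < del, t < e - normc (w - z) &
      Im w + t \notin ys].
    pose m := Num.min del (e - normc (w - z)).
    have m0 : 0 < m by rewrite lt_min del0.
    apply: contrapT => nt.
    have sub : {subset [seq Im w + m / (k.+2)%:R | k <- iota 0 (size ys).+1] <= ys}.
      move=> _ /mapP[k _ ->]; apply/negPn/negP => hk; apply: nt.
      have k0 : 0 < m / k.+2%:R by rewrite divr_gt0.
      have k1 : m / k.+2%:R < m by rewrite ltr_pdivrMr// ltr_pMr// ltr1n.
      by exists (m / k.+2%:R); move: k1; rewrite /m lt_min => /andP[].
    have /uniq_leq_size /(_ sub) : uniq [seq Im w + m / (k.+2)%:R | k <- iota 0 (size ys).+1].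
      rewrite map_inj_uniq ?iota_uniq// => k l /addrI /(mulfI (lt0r_neq0 m0)) /invr_inj /eqP.
      by rewrite eqr_nat => /eqP [].
    by rewrite size_map size_iota ltnn.
  pose v := w + 'i%C * t%:C.
  have hv : normc (v - w) = t by rewrite /v addrAC subrr add0r Normc.normcM normci mul1r normc_real gtr0_norm.
  have hvz : normc (v - z) < e.
    have -> : v - z = (v - w) + (w - z) by ring.
    by apply: le_lt_trans (le_normcD _ _) _; rewrite hv; lra.
  have Imv : Im v \notin ys.
    have -> // : Im v = Im w + t by rewrite /v raddfD /= mul0r mul1r add0r.
  have hsv : csquare z (r / 2) v by apply: He hvz _; rewrite subrr normc_0.
  have dv : derivable F v 1 by apply: dF => //; exact: csquare_half hsv.
  have := cauchy_formula r0 cF dF hsv dv.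
  move=> FE; have Ev : F v - cauchy_quot z r F v = 0.
    by rewrite /cauchy_quot FE mulfK ?subrr//; exact: sqint_inv_neq0.
  have := hdel v; rewrite hv => /(_ t1).
  by rewrite /= [(F - _) v]Ev sub0r normcN ltxx.
have : derivable (cauchy_quot z r F) z 1 by apply: dG; rewrite subrr normc_0.
apply: derivable_near; apply/nbhs_normcP; exists e => // w hw.
by rewrite -FG.
Qed.

(** A weak maximum principle read off Cauchy's formula: the contour integral is at most 32 M, as the
    kernel is at most 2 / r on the boundary, and the winding integral is at least 8 / 9, which gives
    36 M. *)
Lemma maximum_square z r F M w : 0 < r ->
  (forall u, csquare z r u -> derivable F u 1) ->
  (forall u, bdsquare z r u -> normc (F u) <= M) ->
  csquare z (r / 2) w -> normc (F w) <= 36 * M.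
Proof.
move=> r0 dF FM hw; have r0' := ltW r0.
have cF : continuous_on (csquare z r) F by move=> u /dF /derivable_continuous.
have hws := csquare_half r0' hw.
have cFb : continuous_on (bdsquare z r) (fun u => F u * (u - w)^-1).
  move=> u hu; apply: (continuousM (cF _ (sub_bdsquare hu))).
  by apply: continuous_inv_sub; exact: bdsquare_neq hw.
have E := @cauchy_formula [::] _ _ _ _ r0 cF (fun u hu _ => dF u hu) hw (dF _ hws).
have : normc (sqint z r (fun u => F u * (u - w)^-1)) <= 16 * (M * (2 / r)) * r.
  apply: (sqint_bound r0' cFb) => u hu; rewrite Normc.normcM Normc.normcV.
  apply: ler_pM; rewrite ?normc_ge0 ?invr_ge0 ?normc_ge0 ?FM//.
  have r2 : 0 < r / 2 by lra.
  have f := bdsquare_far hu hw.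
  by rewrite -[2 / r]invrK invf_div lef_pV2// posrE (lt_le_trans r2).
have -> : 16 * (M * (2 / r)) * r = 32 * M by field; rewrite gt_eqF.
rewrite E Normc.normcM; have := winding_ge r0 hw; have := normc_ge0 (F w).
set x := normc (F w); set y := normc _; nra.
Qed.

Lemma dquot_derivable z r F : 0 < r ->
  (forall u, csquare z r u -> derivable F u 1) ->
  forall u, csquare z r u -> derivable (dquot F z) u 1.
Proof.
move=> r0 dF u hu; have [->|uz] := eqVneq u z; last first.
  by apply: dquot_derivable_neq => //; exact: dF.
have dz := dF _ (csquare_center z (ltW r0)).
apply: (@removable_lines [:: Im z] z r _ r0).
  move=> v hv; have [->|vz] := eqVneq v z; first exact: dquot_continuous.
  exact: (derivable_continuous (dquot_derivable_neq vz (dF _ hv))).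
move=> v hv; rewrite inE => hI; apply: dquot_derivable_neq; last exact: dF.
by apply: contra hI => /eqP ->.
Qed.

Lemma dquot_bd z r F M u : 0 < r ->
  (forall u, csquare z r u -> normc (F u) <= M) -> bdsquare z r u ->
  normc (dquot F z u) <= 2 * M / r.
Proof.
move=> r0 FM hu; have r0' := ltW r0.
have r2 : csquare z (r / 2) z by apply: csquare_center; lra.
have uz := bdsquare_neq r0 hu r2.
rewrite dquot_neq// Normc.normcM Normc.normcV.
apply: ler_pM; rewrite ?normc_ge0 ?invr_ge0 ?normc_ge0//.
  apply: le_trans (le_normcB _ _) _.
  have := FM _ (sub_bdsquare hu); have := FM _ (csquare_center z r0'); lra.
rewrite lef_pV2 ?posrE ?normc_gt0 ?subr_eq0//.
move: hu => /bdsquareP[_ [<-|<-]]; [exact: Re_normc|exact: Im_normc].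
Qed.

(** The derivative is the value at [z] of the first difference quotient, and the remainder is h^2
    times the second one. Both are bounded through [maximum_square]; 72 = 36 * 2, and 74 = 72 + 2
    adds the bounds of the first quotient at the centre and on the boundary. *)
Lemma taylor_square z r F M : 0 < r ->
  (forall u, csquare z r u -> derivable F u 1) ->
  (forall u, csquare z r u -> normc (F u) <= M) ->
  normc ('D_1 F z) <= 72 * M / r /\
  forall h, normc h <= r / 2 ->
    normc (F (z + h) - F z - h * 'D_1 F z) <= 36 * 74 * M / r ^+ 2 * normc h ^+ 2.
Proof.
move=> r0 dF FM; have r0' := ltW r0.
have h1 w : csquare z (r / 2) w -> normc (dquot F z w) <= 36 * (2 * M / r).
  apply: (maximum_square r0 (dquot_derivable r0 dF)) => u hu.
  exact: dquot_bd FM hu.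
have r2 : csquare z (r / 2) z by apply: csquare_center; lra.
have hD : normc ('D_1 F z) <= 72 * M / r.
  have := h1 _ r2; rewrite /dquot eqxx; lra.
split=> // h hh.
have h2 w : csquare z (r / 2) w -> normc (dquot (dquot F z) z w) <= 36 * (74 * M / r ^+ 2).
  apply: (maximum_square r0 (dquot_derivable r0 (dquot_derivable r0 dF))) => u hu.
  have uz := bdsquare_neq r0 hu r2.
  rewrite dquot_neq// Normc.normcM Normc.normcV.
  have -> : 74 * M / r ^+ 2 = (74 * M / r) / r by field; rewrite gt_eqF.
  apply: ler_pM; rewrite ?normc_ge0 ?invr_ge0 ?normc_ge0//.
    apply: le_trans (le_normcB _ _) _.
    have := dquot_bd r0 FM hu; have : normc (dquot F z z) <= 72 * M / r by rewrite /dquot eqxx.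
    lra.
  rewrite lef_pV2 ?posrE ?normc_gt0 ?subr_eq0//.
  move: hu => /bdsquareP[_ [<-|<-]]; [exact: Re_normc|exact: Im_normc].
have E : F (z + h) - F z - h * 'D_1 F z = dquot (dquot F z) z (z + h) * h ^+ 2.
  rewrite (dquotM F z (z + h)) (dquotM (dquot F z) z (z + h)).
  have -> : dquot F z z = 'D_1 F z by rewrite /dquot eqxx.
  by ring.
rewrite E Normc.normcM normcX ler_wpM2r ?exprn_ge0 ?normc_ge0//.
have -> : 36 * 74 * M / r ^+ 2 = 36 * (74 * M / r ^+ 2) by ring.
by apply: h2; apply: normc_csquare; rewrite addrAC subrr add0r.
Qed.

(** Multiplying by (u - z)^2, and not just by u - z, gives a function that tends to 0 at [z], hence
    is continuous there and therefore holomorphic. As it vanishes at [z], its derivative there is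
    the coefficient [k] and its second difference quotient is [G]. *)
Lemma simple_pole_split z r F (C : R) : 0 < r ->
  (forall u, csquare z r u -> u != z -> derivable F u 1) ->
  (forall u, csquare z r u -> u != z -> normc (F u) <= C / normc (u - z)) ->
  exists (k : R[i]) (G : R[i] -> R[i]),
    (forall u, csquare z r u -> derivable G u 1) /\
    (forall u, u != z -> F u = k / (u - z) + G u).
Proof.
move=> r0 dF FC; have r0' := ltW r0.
pose H u := if u == z then 0 else (u - z) ^+ 2 * F u.
have HE u : u != z -> H u = (u - z) ^+ 2 * F u by rewrite /H => /negPf ->.
have dH' u : csquare z r u -> u != z -> derivable H u 1.
  move=> hu uz.
  have : derivable (fun u => (u - z) * (u - z) * F u) u 1.
    apply: (cderM _ (dF _ hu uz)).
    exact: (cderM (@derivable_sub u z) (@derivable_sub u z)).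
  apply: derivable_near; apply: filterS (near_neq uz) => v vz.
  by rewrite HE// expr2.
have cHz : {for z, continuous H}.
  apply/ccontinuousP => e e0.
  have C1 : 0 < `|C| + 1 by rewrite ltr_wpDl.
  exists (Num.min r (e / (`|C| + 1))).
    by rewrite lt_min r0 divr_gt0.
  move=> u; rewrite lt_min => /andP[u1 u2].
  have [->|uz] := eqVneq u z; first by rewrite subrr normc_0.
  have -> : H z = 0 by rewrite /H eqxx.
  rewrite subr0 HE// Normc.normcM normcX.
  have n0 : 0 < normc (u - z) by rewrite normc_gt0 subr_eq0.
  have hu : csquare z r u by apply: normc_csquare; exact: ltW.
  apply: (@le_lt_trans _ _ (normc (u - z) * C)).
    rewrite expr2 -mulrA ler_wpM2l ?normc_ge0//.
    by have := FC _ hu uz; rewrite ler_pdivlMr// mulrC.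
  move: u2; rewrite ltr_pdivlMr// => u2; apply: le_lt_trans u2.
  by rewrite ler_wpM2l ?normc_ge0//; have := ler_norm C; lra.
have dH u : csquare z r u -> derivable H u 1.
  move=> hu; have [->|uz] := eqVneq u z; last exact: dH'.
  apply: (@removable_lines [:: Im z] z r _ r0).
    move=> v hv; have [->|vz] := eqVneq v z; first exact: cHz.
    by apply: derivable_continuous; exact: dH'.
  move=> v hv; rewrite inE => hI; apply: dH' => //.
  by apply: contra hI => /eqP ->.
exists (dquot H z z), (dquot (dquot H z) z); split.
  exact: (dquot_derivable r0 (dquot_derivable r0 dH)).
move=> u uz; have nz : u - z != 0 by rewrite subr_eq0.
have := dquotM (dquot H z) z u; have := dquotM H z u.
rewrite HE// /H eqxx -/H add0r expr2 -mulrA => /(mulfI nz) E1 E2.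
apply: (mulfI nz); rewrite E1 E2 mulrDr mulrCA divff// mulr1.
by rewrite /H.
Qed.

(** Liouville's argument for the second difference quotient at 0, which is entire and O(1/|z|),
    hence zero. *)
Lemma entire_linear F (C : R) : (forall z, derivable F z 1) ->
  (forall z, normc (F z) <= C * (1 + normc z)) ->
  exists a b : R[i], forall z, F z = a + b * z.
Proof.
move=> dF FC.
have C0 : 0 <= C.
  by have := FC 0; rewrite normc_0 addr0 mulr1; apply: le_trans; exact: normc_ge0.
pose h1 := dquot F 0; pose h2 := dquot h1 0.
have d1 z : derivable h1 z 1.
  have r0 : 0 < normc z + 1 by rewrite ltr_wpDl ?normc_ge0.
  apply: (dquot_derivable r0) => //; apply: normc_csquare; rewrite subr0; lra.
have d2 z : derivable h2 z 1.
  have r0 : 0 < normc z + 1 by rewrite ltr_wpDl ?normc_ge0.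
  apply: (dquot_derivable r0) => //; apply: normc_csquare; rewrite subr0; lra.
(* For |z| >= 1 the increment of [F] from 0 is at most C (2 + |z|) <= 3 C |z|, so [B] bounds z
   [h2 z] there. *)
pose B := 3 * C + normc ('D_1 F 0).
have B0 : 0 <= B by rewrite addr_ge0 ?mulr_ge0 ?normc_ge0.
have big z : 1 <= normc z -> normc (h2 z) <= B / normc z.
  move=> z1; have z0 : 0 < normc z by exact: lt_le_trans z1.
  have zn : z != 0 by rewrite -normc_gt0.
  have E : h2 z = ((F z - F 0) / z - 'D_1 F 0) / z.
    by rewrite /h2 dquot_neq// subr0 /h1 dquot_neq// subr0 /dquot eqxx.
  rewrite E Normc.normcM Normc.normcV ler_pM2r ?invr_gt0//.
  apply: le_trans (le_normcB _ _) _; rewrite /B lerD2r.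
  rewrite Normc.normcM Normc.normcV ler_pdivrMr//.
  apply: le_trans (le_normcB _ _) _.
  have := FC z; have := FC 0; rewrite normc_0; nra.
have h20 z : h2 z = 0.
  apply/eqP; rewrite -normc_eq0; apply/negPn/negP => n0.
  have {}n0 : 0 < normc (h2 z) by rewrite lt_neqAle normc_ge0 andbT eq_sym.
  (* Large enough for [z] to lie in the half square and for the maximum estimate 36 B / r to fall
     below |[h2 z]|. *)
  pose r := 2 * normc z + 1 + 36 * (B + 1) / normc (h2 z).
  have p0 : 0 < 36 * (B + 1) / normc (h2 z) by rewrite divr_gt0// mulr_gt0// ltr_wpDl.
  have nz := normc_ge0 z.
  have r1 : 1 <= r by rewrite /r; lra.
  have r0 : 0 < r by lra.
  have hz : csquare 0 (r / 2) z by apply: normc_csquare; rewrite subr0 /r; lra.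
  have : normc (h2 z) <= 36 * (B / r).
    apply: (maximum_square r0 (fun u _ => d2 u) _ hz) => u /bdsquareP[_ hu].
    have ur : r <= normc u.
      by move: hu; rewrite subr0 => -[<-|<-]; [exact: Re_normc|exact: Im_normc].
    apply: le_trans (big _ (le_trans r1 ur)) _.
    by rewrite ler_wpM2l// lef_pV2 ?posrE//; exact: lt_le_trans ur.
  apply/negP; rewrite -ltNge mulrA ltr_pdivrMr//.
  have E : normc (h2 z) * (36 * (B + 1) / normc (h2 z)) = 36 * (B + 1).
    by field; rewrite gt_eqF.
  have -> : normc (h2 z) * r = normc (h2 z) * (2 * normc z + 1) + 36 * (B + 1).
    by rewrite -E /r; ring.
  have : 0 <= normc (h2 z) * (2 * normc z + 1).
    by rewrite mulr_ge0 ?normc_ge0//; lra.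
  by clear; lra.
exists (F 0), (h1 0) => z.
have := dquotM h1 0 z; rewrite -/h2 h20 mulr0 addr0 => E.
by have := dquotM F 0 z; rewrite -/h1 E subr0 mulrC.
Qed.

(** The hypothesis blows up only where the square meets the real line, and there a polynomial factor
    compensates. The resulting bound at the centre depends on [C] and [r] alone and holds even for
    real [z], where the hypothesis is silent. Centres with |Im z| >= r / 2 need no compensation. *)
Lemma boundary_growth z r F (C : R) : 0 < r ->
  (forall u, csquare z r u -> derivable F u 1) ->
  (forall u, csquare z r u -> Im u != 0 -> `|Im u| * normc (F u) <= C) ->
  normc (F z) <= 36 * 9 * C / r.
Proof.
move=> r0 dF FC; have r0' := ltW r0.
(* Seen from the hypothesis at the point obtained from [z] by moving vertically by r away from the
   real line. *)
have C0 : 0 <= C.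
  have hu : csquare z r (z + 'i%C * (r * (if 0 <= Im z then 1 else -1))%:C).
    apply: normc_csquare; rewrite addrAC subrr add0r Normc.normcM normci mul1r normc_real.
    by case: ifP; rewrite ?mulr1 ?mulrN1 ?normrN ger0_norm.
  apply: le_trans (FC _ hu _); first by rewrite mulr_ge0 ?normc_ge0.
  rewrite raddfD /= mul0r mul1r add0r; case: ifPn => h.
    by rewrite mulr1 gt_eqF// ltr_wpDl.
  by rewrite mulrN1 lt_eqF// subr_lt0; move: h; rewrite -ltNge => h; lra.
have far u : csquare z r u -> r / 2 <= `|Im u| -> normc (F u) <= 2 * C / r.
  move=> hu hI; have I0 : Im u != 0 by rewrite -normr_gt0; lra.
  rewrite ler_pdivlMr//; have := FC _ hu I0; have := normc_ge0 (F u); nra.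
have [hI|hI] := lerP (r / 2) `|Im z|.
  apply: le_trans (far _ (csquare_center z r0') hI) _.
  by rewrite ler_wpM2r ?invr_ge0//; lra.
set s : R[i] := (Re z)%:C.
(* [q] vanishes at s - r and s + r, where the vertical sides cross the real line, and is a multiple
   of Im u along these sides. On the horizontal sides |Im u| >= r / 2. At the centre |q| >= r^2, so
   dividing by [q] costs only this factor. *)
pose q u : R[i] := (u - s) * (u - s) - (r ^+ 2)%:C.
have dq u : derivable q u 1.
  apply: cderB; last exact: cder_cst.
  exact: (cderM (@derivable_sub u s) (@derivable_sub u s)).
have bd u : bdsquare z r u -> normc (q u * F u) <= 9 * r * C.
  move=> /bdsquareP[hu hb]; have /csquareP[] := hu; rewrite !raddfB /= => k1 k2.
  set x := Re u - Re z in k1; set t := Im u.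
  have us : u - s = x +i* t.
    by rewrite /s /x /t; case: (u) => p q' /=; apply/eqP; rewrite eq_complex /= subr0 !eqxx.
  have kt : `|t| <= 3 * r / 2.
    by move: k2 hI; rewrite !ler_norml ltr_norml => /andP[? ?] /andP[? ?]; rewrite /t; apply/andP; split; lra.
  have t0 := normr_ge0 t.
  move: hb; rewrite !raddfB /= -/x -/t => -[hx|hy].
    have x2 : x ^+ 2 = r ^+ 2 by rewrite -hx real_normK ?num_real.
    have qE : q u = t%:C * (- t +i* (2 * x)).
      rewrite /q us; apply/eqP; rewrite eq_complex /= !mul0r subr0 addr0 -!expr2 x2.
      by apply/andP; split; apply/eqP; ring.
    have [t00|tn0] := eqVneq t 0.
      by rewrite qE t00 !mul0r normc_0 !mulr_ge0.
    rewrite qE !Normc.normcM normc_real mulrAC.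
    have h1 : normc (- t +i* (2 * x)) <= 9 * r.
      apply: le_trans (normc_le_ReIm _) _; rewrite /= normrN normrM ger0_norm//.
      by rewrite hx; lra.
    rewrite mulrC; apply: ler_pM; rewrite ?mulr_ge0 ?normc_ge0//; exact: FC.
  have tr : r / 2 <= `|t|.
    move: hy hI; rewrite /t; set p := Im u; set q' := Im z => hy.
    have := ler_distD p 0 q'; have := lerB_dist p q'.
    have : `|p - q'| <= `|p| + `|q'| by exact: ler_normB.
    lra.
  have h1 : normc (q u) <= 9 / 2 * r ^+ 2.
    rewrite /q us; apply: le_trans (le_normcB _ _) _; rewrite normc_real ger0_norm ?sqr_ge0//.
    rewrite Normc.normcM -expr2.
    have -> : normc (x +i* t) ^+ 2 = x ^+ 2 + t ^+ 2.
      by rewrite /Normc.normc sqr_sqrtr// addr_ge0 ?sqr_ge0.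
    move: kt k1; rewrite !ler_norml => /andP[? ?] /andP[? ?]; nra.
  rewrite Normc.normcM.
  have -> : 9 * r * C = 9 / 2 * r ^+ 2 * (2 * C / r) by field; rewrite gt_eqF.
  apply: ler_pM; rewrite ?normc_ge0//; exact: far.
have r2 : csquare z (r / 2) z by apply: csquare_center; lra.
have := maximum_square r0 (fun u hu => cderM (dq u) (dF u hu)) bd r2.
have qz : r ^+ 2 <= normc (q z).
  have -> : q z = - (Im z ^+ 2 + r ^+ 2)%:C.
    by rewrite /q /s; case: (z) => p t /=; apply/eqP; rewrite eq_complex /=; apply/andP; split; apply/eqP; ring.
  rewrite normcN normc_real ger0_norm ?lerDr ?sqr_ge0//.
  by rewrite addr_ge0 ?sqr_ge0.
rewrite [X in normc X]/= Normc.normcM => h.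
have rr : 0 < r ^+ 2 by rewrite exprn_gt0.
rewrite ler_pdivlMr// -(ler_pM2l r0).
have -> : r * (normc (F z) * r) = r ^+ 2 * normc (F z) by ring.
apply: le_trans (_ : normc (q z) * normc (F z) <= _).
  by rewrite ler_wpM2r ?normc_ge0.
by apply: le_trans h _; rewrite le_eqVlt; apply/orP; left; apply/eqP; ring.
Qed.

End cauchy_consequences.

(** * Reflection across the real line *)

Section real_paths.
Context (R : realType).
Implicit Types (f g : R -> R[i]) (a b t : R).

Lemma is_derive_le (p q p' q' : R -> R) a b : a <= b ->
  (forall t, a <= t <= b -> is_derive t 1 p (p' t)) ->
  (forall t, a <= t <= b -> is_derive t 1 q (q' t)) ->
  (forall t, a <= t <= b -> `|p' t| <= q' t) -> `|p b - p a| <= q b - q a.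
Proof.
move=> ab dp dq pq.
have key (e : R) : (e = 1 \/ e = -1) -> 0 <= (q b - e * p b) - (q a - e * p a).
  move=> e1.
  have dk t : a <= t <= b -> is_derive t 1 (fun t => q t - e * p t) (q' t - e * p' t).
    move=> ht; have h1 := dp _ ht; have h2 := dq _ ht.
    exact: (is_deriveB h2 (is_deriveZ e h1)).
  have [||c hc ->] := @MVT_segment R (fun t => q t - e * p t) (fun t => q' t - e * p' t) a b ab.
  - by move=> t; rewrite in_itv /= => /andP[h1 h2]; apply: dk; rewrite !ltW.
  - apply: continuous_in_subspaceT => t; rewrite inE /= in_itv /= => /dk [/derivable1_diffP h _].
    exact: differentiable_continuous.
  rewrite mulr_ge0 ?subr_ge0//; move: hc; rewrite in_itv /= => /pq; rewrite ler_norml => /andP[? ?].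
  by case: e1 => ->; lra.
have := key 1 (or_introl erefl); have := key (-1) (or_intror erefl).
by rewrite ler_norml => ? ?; apply/andP; split; lra.
Qed.

(** Increments are compared with those of a scalar primitive [q], so integrating a bound vertically
    only takes a primitive in closed form. *)
Lemma rderive_le f f' (q q' : R -> R) a b : a <= b ->
  (forall t, a <= t <= b -> rderive f t (f' t)) ->
  (forall t, a <= t <= b -> is_derive t 1 q (q' t)) ->
  (forall t, a <= t <= b -> normc (f' t) <= q' t) ->
  normc (f b - f a) <= 2 * (q b - q a).
Proof.
move=> ab df dq fq.
have h1 : `|Re (f b) - Re (f a)| <= q b - q a.
  apply: (@is_derive_le (fun t => Re (f t)) q (fun t => Re (f' t)) q') => // t ht.
    by case: (df _ ht).
  exact: le_trans (Re_normc _) (fq _ ht).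
have h2 : `|Im (f b) - Im (f a)| <= q b - q a.
  apply: (@is_derive_le (fun t => Im (f t)) q (fun t => Im (f' t)) q') => // t ht.
    by case: (df _ ht).
  exact: le_trans (Im_normc _) (fq _ ht).
apply: le_trans (normc_le_ReIm _) _; rewrite !raddfB /=; lra.
Qed.

Lemma lipschitz_path (F : R[i] -> R[i]) (z w : R[i]) (B : R) :
  (forall t : R, 0 <= t <= 1 -> derivable F (z + t%:C * (w - z)) 1 /\
     normc ('D_1 F (z + t%:C * (w - z))) <= B) ->
  normc (F w - F z) <= 2 * (B * normc (w - z)).
Proof.
move=> H.
have := @rderive_le (fun t => F (z + t%:C * (w - z)))
  (fun t => (w - z) * 'D_1 F (z + t%:C * (w - z)))
  (fun t => B * normc (w - z) * t) (fun _ => B * normc (w - z)) 0 1 ler01.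
have -> : z + 1%:C * (w - z) = w by rewrite (_ : 1%:C = 1)//; ring.
have -> : z + 0%:C * (w - z) = z by rewrite (_ : 0%:C = 0)//; ring.
rewrite mulr0 subr0 mulr1; apply.
- move=> t /H [/derivableP dF _]; exact: rderive_comp_line.
- move=> t _; have := is_deriveZ (B * normc (w - z)) (@is_derive_id R R t 1).
  by rewrite /= [_ *: 1]mulr1.
- by move=> t /H [_ h]; rewrite Normc.normcM mulrC ler_wpM2r// normc_ge0.
Qed.

Lemma rderiveM f g t l m : rderive f t l -> rderive g t m ->
  rderive (fun t => f t * g t) t (l * g t + f t * m).
Proof.
move=> [f1 f2] [g1 g2]; split.
  have := is_deriveB (is_deriveM f1 g1) (is_deriveM f2 g2).
  have -> : (fun x => Re (f x)) * (fun x => Re (g x)) - (fun x => Im (f x)) * (fun x => Im (g x))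
    = (fun x => Re (f x * g x)) by apply/funext => x; rewrite cReM.
  move=> h; apply: is_derive_eq h _.
  rewrite /GRing.scale /=; move: (f t) (g t) => [? ?] [? ?].
  by case: l {f1 f2} => ? ?; case: m {g1 g2} => ? ? /=; ring.
have := is_deriveD (is_deriveM f1 g2) (is_deriveM f2 g1).
have -> : (fun x => Re (f x)) * (fun x => Im (g x)) + (fun x => Im (f x)) * (fun x => Re (g x))
  = (fun x => Im (f x * g x)) by apply/funext => x; rewrite cImM.
move=> h; apply: is_derive_eq h _.
rewrite /GRing.scale /=; move: (f t) (g t) => [? ?] [? ?].
by case: l {f1 f2} => ? ?; case: m {g1 g2} => ? ? /=; ring.
Qed.

Lemma rderive_real (p : R -> R) t (l : R) : is_derive t 1 p l ->
  rderive (fun t => (p t)%:C) t l%:C.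
Proof.
by move=> h; split => //=; exact: is_derive_cst.
Qed.

Lemma continuous_shiftR (F : R[i] -> R[i]) (z : R[i]) t : {for z + t%:C, continuous F} ->
  {for t, continuous (fun t : R => F (z + t%:C))}.
Proof.
move=> h; have := @continuous_line _ F z 1 t; rewrite mulr1 => /(_ h).
by under [X in {for _, continuous X} -> _]eq_fun do rewrite mulr1.
Qed.

Lemma rderive_shiftR (F : R[i] -> R[i]) (z : R[i]) t l : is_derive (z + t%:C) 1 F l ->
  rderive (fun t : R => F (z + t%:C)) t l.
Proof.
move=> h; have := @rderive_comp_line _ F z 1 l t; rewrite mulr1 mul1r => /(_ h).
by under [X in rderive X _ _ -> _]eq_fun do rewrite mulr1.
Qed.

Lemma segint_shift f a b (c : R) : a <= b ->
  (forall t, a + c <= t <= b + c -> {for t, continuous f}) ->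
  segint (a + c) (b + c) f = segint a b (fun t => f (t + c)).
Proof.
move=> ab cf.
have key (p : R -> R) : (forall t, a + c <= t <= b + c -> {for t, continuous p}) ->
  \int[lebesgue_measure]_(x in `[a + c, b + c]) p x =
  \int[lebesgue_measure]_(x in `[a, b]) p (x + c).
  move=> cp; rewrite /Rintegral; congr fine.
  have D : (fun t : R => t + c)^`()%classic = fun=> 1.
    apply/funext => t; rewrite derive1E.
    have := is_deriveD (@is_derive_id R R t 1) (@is_derive_cst R R R c t 1).
    by rewrite addr0 => h; have [_ ] := h.
  rewrite (@integration_by_substitution_increasing R (fun t => t + c) p a b ab).
  - by apply: eq_integral => x _; rewrite D /= [X in X%:E]mulr1.
  - by move=> x y _ _ xy; rewrite ltrD2r.
  - by rewrite D => x _; exact: cst_continuous.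
  - by rewrite D; exact: is_cvg_cst.
  - by rewrite D; exact: is_cvg_cst.
  - have ct x : {for x, continuous (fun t : R => t + c)}.
      by apply: cvgD; [exact: cvg_id|exact: cvg_cst].
    split.
    + by move=> x _; apply: derivableD; [exact: derivable_id|exact: derivable_cst].
    + by apply: cvg_at_right_filter; exact: ct.
    + by apply: cvg_at_left_filter; exact: ct.
  - by apply: continuous_in_subspaceT => x; rewrite inE /= in_itv /= => /cp.
rewrite /segint /cRintegral !key//.
  by move=> t ht; exact/continuous_Im/cf.
by move=> t ht; exact/continuous_Re/cf.
Qed.

Lemma segint0 a b f : (forall t, a < t < b -> f t = 0) -> segint a b f = 0.
Proof.
move=> f0.
have key (p : R -> R) : (forall t, a < t < b -> p t = 0) ->
    \int[@lebesgue_measure R]_(x in `[a, b]) p x = 0.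
  move=> p0; rewrite /Rintegral (@integral_itv_bndoo R a b _ true false).
    by rewrite integral0_eq// => x /=; rewrite in_itv /= => /p0 ->.
  apply: (@eq_measurable_fun _ _ _ _ _ (cst 0%E)); last exact: measurable_cst.
  by move=> x; rewrite inE /= in_itv /= => /p0 ->.
rewrite /segint /cRintegral !key//.
  by move=> t /f0 ->.
by move=> t /f0 ->.
Qed.

End real_paths.

(** * Lipschitz functions extend holomorphically across the real line *)

Section lipschitz_extension.
Context (R : realType).
Implicit Types (F G : R[i] -> R[i]) (A : set R[i]).

(** McShane's formula: a supremum of cones of slope L with apex on the graph. It provides values on
    the real line without taking limits. *)
Lemma mcshane A (p : R[i] -> R) (L : R) : 0 <= L ->
  (forall z w, A z -> A w -> `|p z - p w| <= L * normc (z - w)) ->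
  exists q : R[i] -> R, (forall z, A z -> q z = p z) /\
    forall z w, `|q z - q w| <= L * normc (z - w).
Proof.
move=> L0 Lp.
have [[a Aa]|A0] := pselect (exists a, A a); last first.
  exists (fun=> 0); split; first by move=> z Az; exfalso; apply: A0; exists z.
  by move=> z w; rewrite subrr normr0 mulr_ge0 ?normc_ge0.
pose E z := [set p w - L * normc (z - w) | w in A].
have E0 z : E z !=set0 by exists (p a - L * normc (z - a)), a.
have tri (z w u : R[i]) : normc (z - u) <= normc (z - w) + normc (w - u).
  have -> : z - u = (z - w) + (w - u) by ring.
  exact: le_normcD.
have ubE z : ubound (E z) (p a + L * normc (z - a)).
  move=> _ [w Aw <-]; have := Lp _ _ Aw Aa; rewrite ler_norml => /andP[_ h].
  have := ler_wpM2l L0 (tri w z a); rewrite [normc (w - z)]normcB mulrDr; lra.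
have hE z : has_sup (E z) by split=> //; exists (p a + L * normc (z - a)).
have step z w : sup (E z) <= sup (E w) + L * normc (z - w).
  apply: ge_sup => // _ [u Au <-].
  have : p u - L * normc (w - u) <= sup (E w) by apply: ub_le_sup; [case: (hE w)|exists u].
  have := ler_wpM2l L0 (tri w z u); rewrite [normc (w - z)]normcB mulrDr; lra.
exists (fun z => sup (E z)); split.
  move=> z Az; apply/eqP; rewrite eq_le; apply/andP; split.
    apply: ge_sup => // _ [w Aw <-].
    have := Lp _ _ Aw Az; rewrite normcB ler_norml => /andP[_ h]; lra.
  by apply: ub_le_sup; [case: (hE z)|exists z => //; rewrite subrr normc_0 mulr0 subr0].
move=> z w; rewrite ler_norml; apply/andP.
have := step z w; have := step w z; rewrite [normc (w - z)]normcB => ? ?; split; lra.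
Qed.

(** Extending both parts by [mcshane] gives a function that is continuous on the whole plane and
    holomorphic off the real line, which is then removable. The condition on [z] says that it is an
    interior point of the square. *)
Lemma lipschitz_removable (s : R) r F (L : R) : 0 <= L ->
  (forall z, csquare s%:C r z -> Im z != 0 -> derivable F z 1) ->
  (forall z w, csquare s%:C r z -> csquare s%:C r w -> Im z != 0 -> Im w != 0 ->
     normc (F z - F w) <= L * normc (z - w)) ->
  exists G, (forall z, csquare s%:C r z -> Im z != 0 -> G z = F z) /\
    forall z e, 0 < e -> csquare z e `<=` csquare s%:C r -> derivable G z 1.
Proof.
move=> L0 dF LF.
pose A := [set z | csquare s%:C r z /\ Im z != 0].
have [p [pF Lp]] : exists q : R[i] -> R, (forall z, A z -> q z = Re (F z)) /\
    forall z w, `|q z - q w| <= L * normc (z - w).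
  apply: mcshane => // z w [z1 z2] [w1 w2]; rewrite -raddfB.
  exact: le_trans (Re_normc _) (LF _ _ z1 w1 z2 w2).
have [q [qF Lq]] : exists q : R[i] -> R, (forall z, A z -> q z = Im (F z)) /\
    forall z w, `|q z - q w| <= L * normc (z - w).
  apply: mcshane => // z w [z1 z2] [w1 w2]; rewrite -raddfB.
  exact: le_trans (Im_normc _) (LF _ _ z1 w1 z2 w2).
pose G z := p z +i* q z.
have GF z : csquare s%:C r z -> Im z != 0 -> G z = F z.
  by move=> z1 z2; rewrite /G pF// qF//; case: (F z).
have cG z : {for z, continuous G}.
  apply/ccontinuousP => e e0.
  have L1 : 0 < 2 * L + 1 by rewrite ltr_wpDl ?mulr_ge0.
  exists (e / (2 * L + 1)); first exact: divr_gt0.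
  move=> w; rewrite ltr_pdivlMr// => h; apply: le_lt_trans (normc_le_ReIm _) _.
  have := Lp w z; have := Lq w z; rewrite /G /= => h1 h2.
  apply: le_lt_trans h; have := normc_ge0 (w - z); lra.
exists G; split=> // z e e0 sub.
apply: (@removable_lines _ [:: 0] z (e / 2)); first by lra.
  by move=> w _; exact: cG.
move=> w hw; rewrite inE => hI.
have /csquareP[k1 k2] := hw.
have near_w v : normc (v - w) < e / 2 -> csquare s%:C r v.
  move=> hv; apply: sub; apply/csquareP.
  have -> : Re (v - z) = Re (v - w) + Re (w - z) by rewrite !raddfB /=; ring.
  have -> : Im (v - z) = Im (v - w) + Im (w - z) by rewrite !raddfB /=; ring.
  have := Re_normc (v - w); have := Im_normc (v - w).
  by split; apply: le_trans (ler_normD _ _) _; lra.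
have e2 : 0 < e / 2 by lra.
have hwr : csquare s%:C r w by apply: near_w; rewrite subrr normc_0.
have : derivable F w 1 by apply: dF.
apply: derivable_near; apply/nbhs_normcP.
exists (Num.min (e / 2) `|Im w|); first by rewrite lt_min e2 normr_gt0.
move=> v; rewrite lt_min => /andP[v1 v2]; rewrite GF//; first exact: near_w.
apply: contraTneq v2 => v0; rewrite -leNgt; apply: le_trans (Im_normc _).
by rewrite raddfB /= v0 sub0r normrN.
Qed.

End lipschitz_extension.

Section test_functions.
Context (R : realType).
Implicit Types (f g : R -> R) (r t : R).

(** The gap [d < r] makes [f] vanish at both end points, so integration by parts over [-r, r] has no
    boundary terms, and the derivative has the same property. *)
Definition test_function r f :=
  smooth f /\ exists2 d : R, d < r & forall t, d < `|t| -> f t = 0.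

Lemma smooth_is_derive f t : smooth f -> is_derive t 1 f (f^`()%classic t).
Proof.
move=> sf; have := sf 0%N t; rewrite derive1n0 => df.
by apply: DeriveDef => //; rewrite derive1E.
Qed.

Lemma smooth_continuous f t : smooth f -> {for t, continuous f}.
Proof.
move=> sf; have [/derivable1_diffP h _] := @smooth_is_derive f t sf.
exact: differentiable_continuous.
Qed.

Lemma smooth_derive1 f : smooth f -> smooth (f^`()%classic).
Proof. by move=> sf n x; rewrite -derive1Sn; exact: sf. Qed.

Lemma test_function_derive1 r f : test_function r f -> test_function r (f^`()%classic).
Proof.
move=> [sf [d dr fd]]; split; first exact: smooth_derive1.
exists d => // t dt; rewrite derive1E.
rewrite (@near_eq_derive _ _ _ f (cst 0)) ?derive_cst//.
have : 0 < `|t| - d by rewrite subr_gt0.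
move=> e0; apply/nbhs_ballP; exists (`|t| - d) => // x; rewrite /ball /= => hx.
apply: fd; have := lerB_dist t x; lra.
Qed.

Lemma test_function_bounded r f : test_function r f ->
  exists2 M : R, 0 <= M & forall t, - r <= t <= r -> `|f t| <= M.
Proof.
move=> [sf _]; have [r0|r0] := leP (- r) r; last first.
  by exists 0 => // t /andP[h1 h2]; have := le_trans h1 h2; rewrite leNgt r0.
have cf : {within `[- r, r], continuous (fun t => `|f t|)}.
  apply: continuous_subspaceT => x; apply: cvg_norm; exact: smooth_continuous.
have [c _ hc] := @EVT_max R (fun t => `|f t|) (- r) r r0 cf.
by exists `|f c| => // t ht; apply: hc; rewrite in_itv.
Qed.

Lemma continuous_real f t : {for t, continuous f} -> {for t, continuous (fun t => (f t)%:C : R[i])}.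
Proof.
move=> cf; apply/cvg_ReIm; split => //=; exact: cvg_cst.
Qed.

End test_functions.

Section derivative_lipschitz.
Context (R : realType).
Implicit Types (F : R[i] -> R[i]) (z w : R[i]) (r : R).

Lemma csquareW z w r e : normc (w - z) <= e -> csquare w (r - e) `<=` csquare z r.
Proof.
move=> h v /csquareP[h1 h2]; apply/csquareP.
have -> : Re (v - z) = Re (v - w) + Re (w - z) by rewrite !raddfB /=; ring.
have -> : Im (v - z) = Im (v - w) + Im (w - z) by rewrite !raddfB /=; ring.
have := Re_normc (w - z); have := Im_normc (w - z).
by split; apply: le_trans (ler_normD _ _) _; lra.
Qed.

(** Taylor expansions at [z] and at [w] with the same two points are added: the values of [F] cancel
    and w - z times the difference of the derivatives remains, bounded by two quadratic
    remainders. *)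
Lemma derivative_continuous F z r : 0 < r ->
  (forall u, csquare z r u -> derivable F u 1) ->
  {for z, continuous (fun u => 'D_1 F u)}.
Proof.
move=> r0 dF.
have cF : continuous_on (csquare z r) F by move=> u /dF /derivable_continuous.
have [M0 HM] := csquare_bounded cF.
have M0p : 0 <= M0 by apply: le_trans (HM z (csquare_center z (ltW r0))); exact: normc_ge0.
have [_ T1] := taylor_square r0 dF HM.
pose K := 36 * 74 * M0 / (r / 2) ^+ 2.
have K0 : 0 <= K.
  by apply: divr_ge0; [apply: mulr_ge0|apply: exprn_ge0; lra].
have r2 : 0 < r / 2 by lra.
have KE : 36 * 74 * M0 / r ^+ 2 <= K.
  rewrite /K ler_wpM2l ?mulr_ge0// lef_pV2 ?posrE ?exprn_gt0//.
  by rewrite lerXn2r ?nnegrE//; lra.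
apply/ccontinuousP => e e0.
exists (Num.min (r / 4) (e / (2 * K + 1))).
  have K1 : 0 < 2 * K + 1 by lra.
  by rewrite lt_min divr_gt0 //= divr_gt0.
move=> w; rewrite lt_min => /andP[h1 h2].
have [->|wz] := eqVneq w z; first by rewrite subrr normc_0.
have n0 : 0 < normc (w - z) by rewrite normc_gt0 subr_eq0.
have sub : csquare w (r / 2) `<=` csquare z r.
  have -> : r / 2 = r - r / 2 by lra.
  by apply: csquareW; lra.
have [_ T2] := taylor_square r2 (fun u hu => dF u (sub u hu)) (fun u hu => HM u (sub u hu)).
have := T1 (w - z); rewrite [z + _]addrC subrK => t1.
have {}t1 : normc (F w - F z - (w - z) * 'D_1 F z) <= 36 * 74 * M0 / r ^+ 2 * normc (w - z) ^+ 2.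
  by apply: t1; lra.
have := T2 (z - w); rewrite [w + _]addrC subrK normcB => t2.
have {}t2 : normc (F z - F w - (z - w) * 'D_1 F w) <= K * normc (w - z) ^+ 2.
  by apply: t2; lra.
have t3 := le_trans t1 (ler_wpM2r (exprn_ge0 2 (normc_ge0 (w - z))) KE).
move: t2 t3 h2 K0; rewrite -/K; clear -n0; move: K => K t2 t3 h2 K0.
have K1 : 0 < 2 * K + 1 by rewrite ltr_wpDl// mulr_ge0.
have h : normc (w - z) * normc ('D_1 F w - 'D_1 F z) <=
    normc (w - z) * (2 * K * normc (w - z)).
  have -> : normc (w - z) * (2 * K * normc (w - z)) =
      K * normc (w - z) ^+ 2 + K * normc (w - z) ^+ 2 by ring.
  rewrite -Normc.normcM.
  have E (a b p q u v : R[i]) : (u - v) * (a - b) =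
    (p - q - (u - v) * b) + (q - p - (v - u) * a) by ring.
  rewrite (E _ _ (F w) (F z)).
  move: t2 t3; clear E.
  move: ('D_1 F w) ('D_1 F z) (F z) (F w) => a b p q t2 t3.
  by apply: le_trans (le_normcD _ _) _; rewrite lerD.
have {}h : normc ('D_1 F w - 'D_1 F z) <= 2 * K * normc (w - z).
  by rewrite -(ler_pM2l n0).
apply: le_lt_trans h _.
move: h2; rewrite ltr_pdivlMr// mulrDr mulr1 mulrC => h2.
by apply: lt_trans h2; rewrite ltrDl.
Qed.

End derivative_lipschitz.

(** * The reflection principle for a weakly vanishing jump *)

Section reflection.
Context (R : realType).
(** Nested squares about [s]: [psi] is controlled on radius 4 r, its convolutions with test
    functions of radius r live on 2 r, their holomorphic extensions are bounded on r, and the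
    conclusion is reached on r / 2. Translated test functions have radius 3 r = 2 r + r, whence the
    jump hypothesis. The bound r <= 1 / 8 makes log(2 r) negative. *)
Variables (s r C : R) (psi : R[i] -> R[i]).
Hypotheses (r0 : 0 < r) (r8 : r <= 1 / 8).
Hypothesis dpsi : forall z, csquare s%:C (4 * r) z -> Im z != 0 -> derivable psi z 1.
Hypothesis bpsi : forall z, csquare s%:C (4 * r) z -> Im z != 0 ->
  `|Im z| * normc (psi z) <= C.
Hypothesis jpsi : forall f : R -> R, smooth f ->
  (forall t, 3 * r <= `|t - s| -> f t = 0) ->
  forall e : R, 0 < e -> exists2 d : R, 0 < d & forall y, 0 < y < d ->
    normc (segint (s - 3 * r) (s + 3 * r)
      (fun x => (f x)%:C * (psi (x +i* y) - psi (x +i* (- y))))) < e.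

(** Convolution in the horizontal direction with the reflected function t -> f(-t); this choice
    keeps signs out of the argument of [F]. *)
Definition tconv (f : R -> R) (F : R[i] -> R[i]) (z : R[i]) : R[i] :=
  segint (- r) r (fun t => (f t)%:C * F (z + t%:C)).

Let box : set R[i] := [set z | csquare s%:C (2 * r) z /\ Im z != 0].

Let rr : - r <= r. Proof. by move: r0; lra. Qed.

Let Im_shift z (t : R) : Im (z + t%:C) = Im z.
Proof. by rewrite raddfD /= addr0. Qed.

Let box_shift z (t : R) : box z -> - r <= t <= r ->
  csquare s%:C (4 * r) (z + t%:C) /\ Im (z + t%:C) != 0.
Proof.
move=> [/csquareP[h1 h2] h3] ht; rewrite Im_shift; split => //.
have -> : z + t%:C = t%:C + z by rewrite addrC.
apply/csquareP; rewrite -addrA !raddfD /= add0r; move: h1 h2; rewrite !raddfB /=.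
by rewrite !ler_norml => /andP[? ?] /andP[? ?]; split; apply/andP; split; move: ht r0 => /andP[? ?]; lra.
Qed.

Let box_csquare z (t : R) : box z -> - r <= t <= r ->
  forall u, csquare (z + t%:C) (`|Im z| / 2) u ->
    csquare s%:C (4 * r) u /\ `|Im z| / 2 <= `|Im u|.
Proof.
move=> [/csquareP[h1 h2] h3] ht u /csquareP[u1 u2]; move: h1 h2 u1 u2.
have -> : Re (u - (z + t%:C)) = Re u - Re z - t by case: (u) (z) => [? ?] [? ?] /=; ring.
have -> : Im (u - (z + t%:C)) = Im u - Im z by case: (u) (z) => [? ?] [? ?] /=; ring.
have -> : Re (z - s%:C) = Re z - s by case: (z).
have -> : Im (z - s%:C) = Im z by case: (z) => [? ?] /=; ring.
move=> h1 h2 u1 u2.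
have k2 : `|Im z| <= `|Im u| + `|Im z| / 2.
  have := ler_distD (Im u) (Im z) 0; rewrite !subr0 distrC; lra.
split; last by lra.
apply/csquareP.
have -> : Re (u - s%:C) = Re u - s by case: (u).
have -> : Im (u - s%:C) = Im u by case: (u) => [? ?] /=; ring.
have hz : `|Im z| / 2 <= r by lra.
split; last first.
  have := ler_distD (Im z) (Im u) 0; rewrite !subr0; lra.
move: h1 u1 ht r0 hz; clear -r; rewrite !ler_norml => /andP[? ?] /andP[? ?] /andP[? ?] ? ?.
by apply/andP; split; lra.
Qed.

Let psi_bound z (t : R) : box z -> - r <= t <= r -> normc (psi (z + t%:C)) <= C / `|Im z|.
Proof.
move=> hz ht; have [h1 h2] := box_shift hz ht.
have [_ hI] := hz; rewrite ler_pdivlMr ?normr_gt0// mulrC -[Im z](Im_shift z t).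
exact: bpsi.
Qed.

Let C0 : 0 <= C.
Proof.
have h : csquare s%:C (4 * r) (s +i* r).
  by apply/csquareP; rewrite /= subrr subr0 normr0 ger0_norm ?(ltW r0)//; move: r0; split; lra.
apply: le_trans (bpsi h _); first by rewrite mulr_ge0 ?normc_ge0.
by rewrite gt_eqF.
Qed.

Let continuous_tconv f z (t : R) : smooth f -> box z -> - r <= t <= r ->
  {for t, continuous (fun t => (f t)%:C * psi (z + t%:C))}.
Proof.
move=> sf hz ht; have cf := @continuous_real R f t (smooth_continuous sf).
have [h1 h2] := box_shift hz ht.
have cp := @continuous_shiftR R psi z t (derivable_continuous (dpsi h1 h2)).
exact: (continuousM cf cp).
Qed.

Let dpsi_continuous z (t : R) : box z -> - r <= t <= r ->
  {for z + t%:C, continuous (fun u => 'D_1 psi u)}.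
Proof.
move=> hz ht; have [_ I0] := hz.
have I1 : 0 < `|Im z| / 2 by rewrite divr_gt0 ?normr_gt0.
apply: (@derivative_continuous R psi (z + t%:C) (`|Im z| / 2) I1) => u hu.
have [u1 u2] := box_csquare hz ht hu.
by apply: dpsi => //; rewrite -normr_gt0; lra.
Qed.

Let continuous_tconv' f z (t : R) : smooth f -> box z -> - r <= t <= r ->
  {for t, continuous (fun t => (f t)%:C * 'D_1 psi (z + t%:C))}.
Proof.
move=> sf hz ht; have cf := @continuous_real R f t (smooth_continuous sf).
have cp := @continuous_shiftR R (fun u => 'D_1 psi u) z t (dpsi_continuous hz ht).
exact: (continuousM cf cp).
Qed.

(** The Taylor remainders of [psi] at the points z + t are uniform in t, because all these points
    have the same distance |Im z| from the real line. *)
Let tconv_derive' f z : test_function r f -> box z ->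
  is_derive z (1 : R[i]) (tconv f psi) (tconv f (fun u => 'D_1 psi u) z).
Proof.
move=> tf hz; have [sf _] := tf; have [Mf Mf0 HMf] := test_function_bounded tf.
have [hzs I0] := hz.
pose rho := `|Im z| / 2.
have rho0 : 0 < rho by rewrite divr_gt0 ?normr_gt0.
pose M := C / rho; pose K := 36 * 74 * M / rho ^+ 2.
have K0 : 0 <= K.
  apply: divr_ge0; last by rewrite exprn_ge0// ltW.
  by apply: mulr_ge0; rewrite // divr_ge0// ltW.
have T t : - r <= t <= r -> forall h, normc h <= rho / 2 ->
    normc (psi (z + t%:C + h) - psi (z + t%:C) - h * 'D_1 psi (z + t%:C)) <= K * normc h ^+ 2.
  move=> ht; apply: (proj2 (@taylor_square R (z + t%:C) rho psi M rho0 _ _)).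
    move=> u /(box_csquare hz ht) [u1 u2].
    by apply: dpsi => //; rewrite -normr_gt0; exact: lt_le_trans u2.
  move=> u /(box_csquare hz ht) [u1 u2]; rewrite ler_pdivlMr// mulrC.
  have I0u : Im u != 0 by rewrite -normr_gt0; exact: lt_le_trans u2.
  by apply: le_trans (bpsi u1 I0u); rewrite ler_wpM2r ?normc_ge0.
have ct h : normc h < rho / 2 -> forall t, - r <= t <= r ->
   {for t, continuous (fun t => (f t)%:C * psi (z + h + t%:C))}.
  move=> hh t ht; have cf := @continuous_real R f t (smooth_continuous sf).
  have hu : csquare (z + t%:C) rho (z + h + t%:C).
    apply: normc_csquare; have -> : z + h + t%:C - (z + t%:C) = h by ring.
    by move: hh rho0; lra.
  have [u1 u2] := box_csquare hz ht hu.
  have I0u : Im (z + h + t%:C) != 0 by rewrite -normr_gt0; exact: lt_le_trans u2.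
  have cp := @continuous_shiftR R psi (z + h) t (derivable_continuous (dpsi u1 I0u)).
  exact: (continuousM cf cp).
have rho2 : 0 < rho / 2 by move: rho0; lra.
apply: (@is_cderive_quad _ _ _ _ (2 * (Mf * K) * (r - - r)) (rho / 2)) => // h hh.
have c1 := ct h hh.
have c2 := fun t ht => @continuous_tconv f z t sf hz ht.
have c3 := fun t ht => @continuous_tconv' f z t sf hz ht.
have c4 : forall t, - r <= t <= r -> {for t, continuous (fun t => h * ((f t)%:C * 'D_1 psi (z + t%:C)))}.
  by move=> t ht; apply: continuous_scale; exact: c3.
have c5 : forall t, - r <= t <= r -> {for t, continuous (fun t => (f t)%:C * psi (z + h + t%:C) - (f t)%:C * psi (z + t%:C))}.
  by move=> t ht; exact: (continuousB (c1 t ht) (c2 t ht)).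
rewrite /tconv /segint.
rewrite -(cRintegralB _ (segint_integrable c1) (segint_integrable c2))//.
rewrite -(cRintegralZ _ h (segint_integrable c3))//.
rewrite -(cRintegralB _ (segint_integrable c5) (segint_integrable c4))//.
have -> : 2 * (Mf * K) * (r - - r) * normc h ^+ 2 = 2 * (Mf * K * normc h ^+ 2) * (r - - r) by ring.
apply: (segint_bound rr) => t ht.
  exact: (continuousB (c5 t ht) (c4 t ht)).
have -> : (f t)%:C * psi (z + h + t%:C) - (f t)%:C * psi (z + t%:C) - h * ((f t)%:C * 'D_1 psi (z + t%:C))
   = (f t)%:C * (psi (z + t%:C + h) - psi (z + t%:C) - h * 'D_1 psi (z + t%:C)).
  have -> : z + h + t%:C = z + t%:C + h by ring.
  by ring.
rewrite Normc.normcM normc_real -mulrA; apply: ler_pM; rewrite ?normc_ge0//.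
  exact: HMf.
by apply: T => //; exact: ltW.
Qed.

(** Differentiating psi(z + t) in z or in t is the same, so integration by parts moves the
    derivative onto [f], at the price of a sign. *)
Let tconv_parts f z : test_function r f -> box z ->
  tconv f (fun u => 'D_1 psi u) z = - tconv (f^`()%classic) psi z.
Proof.
move=> tf hz; have [sf [d dr fd]] := tf; have sf' := smooth_derive1 sf.
have c1 := fun t ht => @continuous_tconv (f^`()%classic) z t sf' hz ht.
have c2 := fun t ht => @continuous_tconv' f z t sf hz ht.
have E : segint (- r) r (fun t => (f^`()%classic t)%:C * psi (z + t%:C) + (f t)%:C * 'D_1 psi (z + t%:C)) = 0.
  rewrite (@segint_FTC _ _ _ _ (fun t => (f t)%:C * psi (z + t%:C)) rr).
  - have f0 t : `|t| = r -> f t = 0 by move=> tr; apply: fd; rewrite tr.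
    rewrite !f0 ?mul0r ?subrr ?normrN ?ger0_norm//; exact: ltW.
  - move=> t ht; apply: rderiveM.
      by apply: rderive_real; exact: smooth_is_derive.
    have [h1 h2] := box_shift hz ht.
    by apply: rderive_shiftR; apply/derivableP; exact: dpsi.
  - by move=> t ht; exact: (continuousD (c1 t ht) (c2 t ht)).
move: E; rewrite /segint (cRintegralD _ (segint_integrable c1) (segint_integrable c2))//.
by move=> /eqP; rewrite addrC addr_eq0 => /eqP.
Qed.

Let tconv_derive f z : test_function r f -> box z ->
  is_derive z (1 : R[i]) (tconv f psi) (- tconv (f^`()%classic) psi z).
Proof. by move=> tf hz; rewrite -tconv_parts//; exact: tconv_derive'. Qed.

(** The constant [A] may depend on [f]; only the profile [q] in |Im z| is common to all test
    functions. *)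
Let controlled (q : R -> R) := forall f, test_function r f ->
  exists2 A : R, 0 <= A & forall z, box z -> normc (tconv f psi z) <= A * q `|Im z|.

Let controlled_inv : controlled (fun y => y^-1).
Proof.
move=> f tf; have [sf _] := tf; have [Mf Mf0 HMf] := test_function_bounded tf.
exists (2 * (Mf * C) * (r - - r)).
  by rewrite !mulr_ge0// ?C0//; move: r0; lra.
move=> z hz.
have -> : 2 * (Mf * C) * (r - - r) * `|Im z|^-1 = 2 * (Mf * (C / `|Im z|)) * (r - - r).
  by ring.
apply: (segint_bound rr) => t ht; first exact: continuous_tconv.
rewrite Normc.normcM normc_real; apply: ler_pM; rewrite ?normc_ge0//.
  exact: HMf.
exact: psi_bound.
Qed.

(* Vertical integration from Im z = 2 r improves a bound q, valid for all test
   functions, to its primitive, because the derivative of a convolution is again a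
   convolution. *)
Let controlled_primitive (q k k' : R -> R) (B : R) : controlled q ->
  (forall y, 0 < y <= 2 * r -> is_derive y 1 k (q y)) ->
  0 < q (2 * r) ->
  (forall y, 0 < y <= 2 * r -> 1 <= k' y /\ k (2 * r) - k y <= B * k' y) -> 0 <= B ->
  controlled k'.
Proof.
move=> cq dk q0 hk' B0 f tf.
have [A A0 HA] := cq _ tf.
have [A' A'0 HA'] := cq _ (test_function_derive1 tf).
exists (A * q (2 * r) + 2 * (A' * B)).
  by rewrite addr_ge0 ?mulr_ge0// ltW.
move=> z hz; have [/csquareP[h1 h2] I0] := hz.
move: h1 h2; rewrite !raddfB /= subr0 => h1 h2.
(* [e] is the sign of Im z, and [p] below is the vertical path that starts at [z], leads away from
   the real line and is parametrised by its height, up to 2 r. *)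
pose e : R := if 0 < Im z then 1 else -1.
have eI : Im z = e * `|Im z|.
  rewrite /e; case: ltP => h; first by rewrite gtr0_norm ?mul1r.
  by rewrite ler0_norm// mulN1r opprK.
have ne : `|e| = 1 by rewrite /e; case: ifP; rewrite ?normrN normr1.
have ene : e != 0 by rewrite -normr_gt0 ne.
have e2 : e * e = 1 by rewrite /e; case: ifP; rewrite ?mulrNN mulr1.
pose p (t : R) := (Re z)%:C + t%:C * ('i%C * e%:C).
have Imp t : Im (p t) = t * e by rewrite /p /=; ring.
have Rep t : Re (p t) = Re z by rewrite /p /=; ring.
have nI : 0 < `|Im z| by rewrite normr_gt0.
have bp t : `|Im z| <= t <= 2 * r -> box (p t).
  move=> /andP[t1 t2]; have t0 : 0 < t by exact: lt_le_trans t1.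
  split; last by rewrite Imp; apply: mulf_neq0 => //; rewrite gt_eqF.
  have Rs : Re (p t - s%:C) = Re z - s by rewrite -[in RHS](Rep t) raddfB.
  have Is : Im (p t - s%:C) = t * e by rewrite -(Imp t) raddfB /= subr0.
  by apply/csquareP; rewrite Rs Is normrM ne mulr1 gtr0_norm.
have pz : p `|Im z| = z.
  by apply/eqP; rewrite eq_complex Imp Rep eqxx /= mulrC -eI.
have y2 : `|Im z| <= 2 * r by [].
have := @rderive_le R (fun t => tconv f psi (p t))
  (fun t => ('i%C * e%:C) * - tconv (f^`()%classic) psi (p t))
  (fun t => A' * k t) (fun t => A' * q t) `|Im z| (2 * r) y2.
have dom t : `|Im z| <= t <= 2 * r -> 0 < t <= 2 * r.
  by move=> /andP[t1 ->]; rewrite andbT; exact: lt_le_trans t1.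
move=> /(_ _ _ _); rewrite pz => H.
have : normc (tconv f psi (p (2 * r)) - tconv f psi z) <= 2 * (A' * k (2 * r) - A' * k `|Im z|).
  apply: H.
  - by move=> t ht; apply: rderive_comp_line; exact: tconv_derive (bp t ht).
  - by move=> t /dom ht; have := is_deriveZ A' (dk _ ht).
  - move=> t ht; rewrite !Normc.normcM normci mul1r normc_real ne mul1r normcN.
    have := HA' _ (bp t ht); rewrite Imp normrM ne mulr1 gtr0_norm//.
    by case/andP: (dom _ ht).
have top : normc (tconv f psi (p (2 * r))) <= A * q (2 * r).
  have h : `|Im z| <= 2 * r <= 2 * r by rewrite y2 lexx.
  have := HA _ (bp _ h); rewrite Imp normrM ne mulr1 gtr0_norm//.
  by move: r0; lra.
have [k1 k2] : 1 <= k' `|Im z| /\ k (2 * r) - k `|Im z| <= B * k' `|Im z|.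
  by apply: hk'; rewrite nI.
have := le_normcB (tconv f psi (p (2 * r))) (tconv f psi (p (2 * r)) - tconv f psi z).
have -> : tconv f psi (p (2 * r)) - (tconv f psi (p (2 * r)) - tconv f psi z) = tconv f psi z.
  by ring.
have := ler_wpM2l A'0 k2; have := ler_wpM2l (mulr_ge0 A0 (ltW q0)) k1.
lra.
Qed.

(** First vertical integration, of 1/y. The summand 1 makes the profile at least 1 and leaves room
    for the constant of integration, since log(2 r) <= 0. *)
Let controlled_ln : controlled (fun y => 1 - ln y).
Proof.
apply: (@controlled_primitive (fun y => y^-1) (@ln R) _ 1 controlled_inv) => //.
- by move=> y /andP[y0 _]; exact: is_derive1_ln.
- by rewrite invr_gt0; move: r0; lra.
- move=> y /andP[y0 y1]; rewrite mul1r.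
  have := r8; have := r0 => r0' r8'.
  have h1 : ln y <= 0 by rewrite ln_le0//; lra.
  have h2 : ln (2 * r) <= 0 by rewrite ln_le0//; lra.
  by split; lra.
Qed.

(** Second vertical integration: the logarithm is integrable at 0, with 2 y - y log y as primitive
    of 1 - log y. This primitive is nonnegative on (0, 2 r], so its increment is at most its value
    at 2 r, the constant given to [controlled_primitive]. *)
Let controlled_one : controlled (fun=> 1).
Proof.
have := r8; have := r0 => r0' r8'.
have h2 : ln (2 * r) <= 0 by rewrite ln_le0//; lra.
apply: (@controlled_primitive (fun y => 1 - ln y) (fun y => 2 * y - y * ln y) _
   (4 * r - 2 * r * ln (2 * r)) controlled_ln).
- move=> y /andP[y0 _]; have dl := is_derive1_ln y0.
  have d1 := is_deriveZ (2 : R) (@is_derive_id R R y 1).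
  have d2 := is_deriveM (@is_derive_id R R y 1) dl.
  apply: is_derive_eq (is_deriveB d1 d2) _.
  rewrite /GRing.scale /=; field; rewrite gt_eqF//.
- by lra.
- move=> y /andP[y0 y1]; rewrite mulr1; split => //.
  have h1 : ln y <= 0 by rewrite ln_le0//; lra.
  have : y * ln y <= 0 by rewrite mulr_ge0_le0// ltW.
  lra.
- by rewrite subr_ge0; apply: (@le_trans _ _ 0); [rewrite mulr_ge0_le0//; lra|lra].
Qed.

(** [controlled_one], applied to the derivative of [f], bounds the z-derivative of the convolution,
    and each half of the box is convex. The sign [e] selects the half. *)
Let tconv_lipschitz_side f (e : R) : test_function r f -> (e = 1 \/ e = -1) ->
  exists2 L : R, 0 <= L & forall z w, box z -> box w -> 0 < e * Im z -> 0 < e * Im w ->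
    normc (tconv f psi z - tconv f psi w) <= L * normc (z - w).
Proof.
move=> tf e1; have [A A0 HA] := controlled_one (test_function_derive1 tf).
exists (2 * A); first by rewrite mulr_ge0.
move=> z w hz hw ez ew.
rewrite -mulrA normcB [normc (z - w)]normcB; apply: lipschitz_path => t /andP[t0 t1].
have hb : box (z + t%:C * (w - z)).
  move: hz hw => [/csquareP[z1 z2] _] [/csquareP[w1 w2] _].
  have RE : Re (z + t%:C * (w - z) - s%:C) = (1 - t) * Re (z - s%:C) + t * Re (w - s%:C).
    by case: (z) (w) => [? ?] [? ?] /=; ring.
  have IE : Im (z + t%:C * (w - z) - s%:C) = (1 - t) * Im (z - s%:C) + t * Im (w - s%:C).
    by case: (z) (w) => [? ?] [? ?] /=; ring.
  have cvx (x y : R) : `|x| <= 2 * r -> `|y| <= 2 * r -> `|(1 - t) * x + t * y| <= 2 * r.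
    move=> hx hy; apply: le_trans (ler_normD _ _) _; rewrite !normrM [`|1 - t|]ger0_norm ?subr_ge0// [`|t|]ger0_norm//.
    have : (1 - t) * `|x| <= (1 - t) * (2 * r) by rewrite ler_wpM2l// subr_ge0.
    have := ler_wpM2l t0 hy; lra.
  split; first by apply/csquareP; rewrite RE IE; split; exact: cvx.
  have E : e * Im (z + t%:C * (w - z)) = (1 - t) * (e * Im z) + t * (e * Im w).
    by case: (z) (w) => [? ?] [? ?] /=; ring.
  have : 0 < e * Im (z + t%:C * (w - z)).
    rewrite E; have [->|tn] := eqVneq t 1; first by rewrite subrr mul0r add0r mul1r.
    apply: ltr_pwDl; last by apply: mulr_ge0 => //; exact: ltW.
    by apply: mulr_gt0 => //; rewrite subr_gt0 lt_neqAle tn.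
  by move=> h; apply/eqP => h0; move: h; rewrite h0 mulr0 ltxx.
have [d1 d2] := tconv_derive tf hb.
by split=> //; rewrite d2 normcN -[A]mulr1; exact: HA.
Qed.

(** The jump of the convolution above the point [x] is the jump of [psi] tested against the
    translate of [f] by [x], which still vanishes at distance 3 r from [s]. The weak hypothesis thus
    becomes pointwise. *)
Let tconv_jump f (x : R) : test_function r f -> `|x - s| <= 2 * r ->
  forall e : R, 0 < e -> exists2 d : R, 0 < d & forall y, 0 < y < d ->
    normc (tconv f psi (x +i* y) - tconv f psi (x +i* (- y))) < e.
Proof.
move=> tf hx e e0; have [sf [d dr fd]] := tf.
have hxs : - (2 * r) <= x - s <= 2 * r by rewrite -ler_norml.
pose g (t : R) := f (t - x).
have gE n : (derive1n n g) = (fun t => derive1n n f (t - x)).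
  elim: n => [|n IH]; first by rewrite !derive1n0.
  apply/funext => t; rewrite !derive1nS IH derive1E.
  have h1 : is_derive (t - x) 1 (derive1n n f) ((derive1n n f)^`()%classic (t - x)).
    by apply: DeriveDef; [exact: sf|rewrite derive1E].
  have h2 : is_derive t 1 (fun t => t - x) 1.
    by have := is_deriveB (@is_derive_id R R t 1) (@is_derive_cst R R R x t 1); rewrite subr0.
  have [_ E] := @is_derive1_comp R (derive1n n f) (fun t => t - x) t _ _ h1 h2.
  by rewrite [LHS]E mulr1.
have sg : smooth g.
  move=> n t; rewrite gE.
  have h1 : is_derive (t - x) 1 (derive1n n f) ((derive1n n f)^`()%classic (t - x)).
    by apply: DeriveDef; [exact: sf|rewrite derive1E].
  have h2 : is_derive t 1 (fun t => t - x) 1.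
    by have := is_deriveB (@is_derive_id R R t 1) (@is_derive_cst R R R x t 1); rewrite subr0.
  by have [] := @is_derive1_comp R (derive1n n f) (fun t => t - x) t _ _ h1 h2.
have g0 t : 3 * r <= `|t - s| -> g t = 0.
  move=> h; apply: fd.
  have := ler_distD x t s; lra.
have [del del0 H] := jpsi sg g0 e0.
exists (Num.min del (2 * r)); first by rewrite lt_min del0; move: r0; lra.
move=> y; rewrite lt_min => /andP[y0 /andP[y1 y2]].
have by' (e' : R) : (e' = 1 \/ e' = -1) -> box (x +i* (e' * y)).
  move=> e1; split; last first.
    by apply: mulf_neq0; [case: e1 => ->; rewrite ?oppr_eq0 oner_eq0|rewrite gt_eqF].
  apply/csquareP; rewrite /= subr0 normrM [`|y|]gtr0_norm//.
  by split=> //; case: e1 => ->; rewrite ?normrN normr1 mul1r ltW.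
have b1 := by' 1 (or_introl erefl); have b2 := by' (-1) (or_intror erefl).
rewrite mul1r in b1; rewrite mulN1r in b2.
pose h := (fun t => (g t)%:C * (psi (t +i* y) - psi (t +i* (- y)))).
have sq (t y' : R) : `|t - s| <= 3 * r -> `|y'| <= 2 * r -> csquare s%:C (4 * r) (t +i* y').
  by move=> k1 k2; apply/csquareP; rewrite /= subr0; move: r0; split; lra.
have ny : `|y| <= 2 * r by rewrite gtr0_norm// ltW.
have iv t : s - 3 * r <= t <= s + 3 * r -> `|t - s| <= 3 * r.
  by move=> /andP[? ?]; rewrite ler_norml; apply/andP; split; lra.
have ch t : s - 3 * r <= t <= s + 3 * r -> {for t, continuous h}.
  move=> /iv ht; have cg := @continuous_real R g t (smooth_continuous sg).
  have c1 : {for t, continuous (fun t => psi (t +i* y))}.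
    apply: continuous_hor; apply: derivable_continuous; apply: dpsi; first exact: sq.
    by rewrite /= gt_eqF.
  have c2 : {for t, continuous (fun t => psi (t +i* (- y)))}.
    apply: continuous_hor; apply: derivable_continuous; apply: dpsi.
      by apply: sq; rewrite ?normrN.
    by rewrite /= oppr_eq0 gt_eqF.
  have c3 : {for t, continuous (fun t => psi (t +i* y) - psi (t +i* (- y)))}.
    exact: (continuousB c1 c2).
  exact: (continuousM cg c3).
have k1 : s - 3 * r <= - r + x by move: hxs => /andP[? ?]; lra.
have k2 : - r + x <= r + x by rewrite lerD2r.
have k3 : r + x <= s + 3 * r by move: hxs => /andP[? ?]; lra.
have ch2 t : - r + x <= t <= s + 3 * r -> {for t, continuous h}.
  by move=> /andP[u1 u2]; apply: ch; rewrite u2 (le_trans k1).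
have ch3 t : - r + x <= t <= r + x -> {for t, continuous h}.
  by move=> /andP[u1 u2]; apply: ch2; rewrite u1 (le_trans u2).
have E : segint (s - 3 * r) (s + 3 * r) h =
    tconv f psi (x +i* y) - tconv f psi (x +i* (- y)).
  rewrite (segint_split k1 (le_trans k2 k3) ch) (segint_split k2 k3 ch2).
  rewrite [X in X + _]segint0; last first.
    move=> t /andP[u1 u2]; rewrite /h /g fd ?mul0r//.
    by have := ler_norm (x - t); rewrite distrC; lra.
  rewrite [X in _ + (_ + X)]segint0; last first.
    move=> t /andP[u1 u2]; rewrite /h /g fd ?mul0r//.
    by have := ler_norm (t - x); lra.
  rewrite add0r addr0 (segint_shift rr ch3) /tconv /segint.
  have c1 := fun t ht => @continuous_tconv f _ t sf b1 ht.
  have c2 := fun t ht => @continuous_tconv f _ t sf b2 ht.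
  rewrite -(cRintegralB _ (segint_integrable c1) (segint_integrable c2))//.
  congr (cRintegral _ _ _); apply/funext => t; rewrite /h /g addrK mulrBr.
  have D (y' : R) : (t + x) +i* y' = x +i* y' + t%:C.
    by apply/eqP; rewrite eq_complex /= addr0 addrC !eqxx.
  by rewrite !D.
by rewrite -E; apply: H; rewrite y0.
Qed.

(** For points on opposite sides: from [z] vertically to height y, across the real line to height
    -y, then to [w]. The crossing costs arbitrarily little by [tconv_jump], and the remaining
    lengths are controlled by |Im z| + |Im w| <= |z - w|. *)
Let tconv_lipschitz f : test_function r f ->
  exists2 L : R, 0 <= L & forall z w, box z -> box w ->
    normc (tconv f psi z - tconv f psi w) <= L * normc (z - w).
Proof.
move=> tf; have [L1 L10 H1] := tconv_lipschitz_side tf (or_introl erefl).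
have [L2 L20 H2] := tconv_lipschitz_side tf (or_intror erefl).
pose L := L1 + L2; have L0 : 0 <= L by rewrite addr_ge0.
have HL (e : R) z w : (e = 1 \/ e = -1) -> box z -> box w -> 0 < e * Im z -> 0 < e * Im w ->
    normc (tconv f psi z - tconv f psi w) <= L * normc (z - w).
  by move=> [->|->] bz bw ez ew; [apply: le_trans (H1 _ _ bz bw ez ew) _|
    apply: le_trans (H2 _ _ bz bw ez ew) _]; rewrite ler_wpM2r ?normc_ge0// ?lerDl ?lerDr.
exists (3 * L); first by rewrite mulr_ge0.
have key (e : R) z w : (e = 1 \/ e = -1) -> box z -> box w -> 0 < e * Im z -> e * Im w < 0 ->
    normc (tconv f psi z - tconv f psi w) <= 3 * L * normc (z - w).
  move=> e1 bz bw ez ew; apply/ler_addgt0Pr => eta eta0.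
  have hx : `|Re z - s| <= 2 * r by case: bz => /csquareP[]; rewrite raddfB.
  have eta2 : 0 < eta / 2 by lra.
  have [d d0 Hd] := tconv_jump tf hx eta2.
  have L1' : 0 < 4 * L + 1 by rewrite ltr_wpDl ?mulr_ge0.
  (* Small enough for the jump to stay below eta / 2, for the path to stay in the box, and for the
     two detours of length y to cost at most eta / 2. *)
  pose y := Num.min (d / 2) (Num.min r (eta / (4 * L + 1))).
  have [y0 yd yr ye] : [/\ 0 < y, y < d, y <= r & y * (4 * L + 1) <= eta].
    split; rewrite /y.
    - by rewrite !lt_min r0 !divr_gt0.
    - by rewrite gt_min; apply/orP; left; lra.
    - by rewrite !ge_min lexx orbT.
    - by rewrite -ler_pdivlMr// !ge_min lexx !orbT.
  have ne : `|e| = 1 by case: e1 => ->; rewrite ?normrN normr1.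
  have ee : e * e = 1 by case: e1 => ->; rewrite ?mulrNN mulr1.
  pose p (e' : R) := Re z +i* (e' * y).
  have bp e' : `|e'| = 1 -> box (p e').
    move=> ne'; split; last first.
      by rewrite /=; apply: mulf_neq0; [rewrite -normr_gt0 ne'|rewrite gt_eqF].
    apply/csquareP; rewrite /= subr0; split => //.
    by rewrite normrM ne' mul1r gtr0_norm//; move: r0; lra.
  have b1 := bp e ne; have b2 : box (p (- e)) by apply: bp; rewrite normrN.
  have h1 := HL e z (p e) e1 bz b1 ez _.
  have {}h1 : normc (tconv f psi z - tconv f psi (p e)) <= L * normc (z - p e).
    by apply: h1; rewrite /= mulrA ee mul1r.
  have h2 : normc (tconv f psi (p (- e)) - tconv f psi w) <= L * normc (p (- e) - w).
    apply: (HL (- e)) => //; last by rewrite mulNr oppr_gt0.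
      by case: e1 => ->; [right|left]; rewrite ?opprK.
    by rewrite /= mulrA mulrNN ee mul1r.
  have h3 : normc (tconv f psi (p e) - tconv f psi (p (- e))) < eta / 2.
    have hy : 0 < y < d by rewrite y0.
    case: e1 => ->; rewrite /p ?opprK ?mul1r ?mulN1r; first exact: Hd.
    by rewrite normcB; exact: Hd.
  have hz : `|Im z| + `|Im w| <= normc (z - w).
    apply: le_trans (Im_normc _); rewrite raddfB /=.
    have k : `|Im z - Im w| = e * Im z - e * Im w.
      rewrite -[LHS]mul1r -ne -normrM mulrBr ger0_norm// subr_ge0.
      by apply/ltW; apply: lt_trans ew ez.
    rewrite k -[`|Im z|]mul1r -[`|Im w|]mul1r -ne -!normrM gtr0_norm// ltr0_norm//.
  have g1 : normc (z - p e) <= `|Im z| + y.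
    apply: le_trans (normc_le_ReIm _) _; rewrite !raddfB /= subrr normr0 add0r.
    by apply: le_trans (ler_normB _ _) _; rewrite normrM ne mul1r [`|y|]gtr0_norm.
  have g2 : normc (p (- e) - w) <= normc (z - w) + (`|Im w| + y).
    apply: le_trans (normc_le_ReIm _) _; rewrite !raddfB /=; apply: lerD.
      by have := Re_normc (z - w); rewrite raddfB.
    apply: le_trans (ler_normB _ _) _.
    by rewrite normrM normrN ne mul1r [`|y|]gtr0_norm// addrC.
  have -> : tconv f psi z - tconv f psi w = (tconv f psi z - tconv f psi (p e)) +
     ((tconv f psi (p e) - tconv f psi (p (- e))) + (tconv f psi (p (- e)) - tconv f psi w)).
    by ring.
  apply: le_trans (le_normcD _ _) _; have := le_normcD (tconv f psi (p e) - tconv f psi (p (- e))) (tconv f psi (p (- e)) - tconv f psi w).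
  have := ler_wpM2l L0 g1; have := ler_wpM2l L0 g2.
  have := ler_wpM2l L0 hz; move: h1 h2 h3 ye y0; have := mulr_ge0 L0 (normc_ge0 (z - w)).
  have := mulr_ge0 L0 (normr_ge0 (Im z)); have := mulr_ge0 L0 (normr_ge0 (Im w)).
  move: (normc _) (normc _) (normc _) (normc _) (normc _) (normc _) => *; lra.
move=> z w bz bw.
have [_ z0] := bz; have [_ w0] := bw.
have le3 : L * normc (z - w) <= 3 * L * normc (z - w).
  rewrite ler_wpM2r ?normc_ge0//; lra.
case: (ltrgt0P (Im z)) => [zp|zn|zz]; last by rewrite zz eqxx in z0.
  case: (ltrgt0P (Im w)) => [wp|wn|wz]; last by rewrite wz eqxx in w0.
    by apply: le_trans le3; apply: (HL 1); rewrite ?mul1r//; left.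
  by apply: (key 1); rewrite ?mul1r//; left.
case: (ltrgt0P (Im w)) => [wp|wn|wz]; last by rewrite wz eqxx in w0.
  by apply: (key (-1)); rewrite ?mulN1r ?oppr_gt0 ?oppr_lt0//; right.
by apply: le_trans le3; apply: (HL (-1)); rewrite ?mulN1r ?oppr_gt0//; right.
Qed.

(** The density has mass 1, so only the factor 2 of [cRintegral_le] is lost. The bound is asked only
    where [f] is nonzero, which lets it express continuity on a small support. *)
Let tconv_average f (F : R -> R[i]) (c : R) : smooth f -> (forall t, 0 <= f t) ->
  segint (- r) r (fun t => (f t)%:C) = 1 ->
  (forall t, - r <= t <= r -> {for t, continuous F}) ->
  (forall t, - r <= t <= r -> f t != 0 -> normc (F t) <= c) ->
  normc (segint (- r) r (fun t => (f t)%:C * F t)) <= 2 * c.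
Proof.
move=> sf f0 f1 cF Fc.
have cr := fun t (_ : - r <= t <= r) => @continuous_real R f t (smooth_continuous sf).
have cfF t : - r <= t <= r -> {for t, continuous (fun t => (f t)%:C * F t)}.
  by move=> ht; exact: (continuousM (cr t ht) (cF t ht)).
have [i1 _] := segint_integrable cr.
have E : \int[@lebesgue_measure R]_(t in `[- r, r]) (c * f t) = c.
  by rewrite RintegralZl//; move: f1 => [-> _]; rewrite mulr1.
rewrite -[X in _ * X]E; apply: cRintegral_le => //.
- exact: segint_integrable cfF.
- have mD : measurable (`[- r, r] : set R) by [].
  have := @integrableZl _ _ R lebesgue_measure _ mD c _ i1.
  by apply: eq_integrable => // t _ /=; rewrite EFinM.
- move=> t /=; rewrite in_itv /= => ht; rewrite Normc.normcM normc_real ger0_norm//.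
  have [->|fn] := eqVneq (f t) 0; first by rewrite mul0r mulr0.
  by rewrite mulrC ler_wpM2r// Fc.
Qed.

Hypothesis mollifiers : forall eta : R, 0 < eta -> exists f : R -> R,
  [/\ test_function r f, forall t, 0 <= f t, forall t, f t != 0 -> `|t| < eta &
      segint (- r) r (fun t => (f t)%:C) = 1].

Lemma csquare_trans (z w : R[i]) (a b : R) : csquare z a w -> csquare w b `<=` csquare z (a + b).
Proof.
move=> /csquareP[h1 h2] v /csquareP[h3 h4]; apply/csquareP.
have -> : Re (v - z) = Re (v - w) + Re (w - z) by rewrite !raddfB /=; ring.
have -> : Im (v - z) = Im (v - w) + Im (w - z) by rewrite !raddfB /=; ring.
by split; apply: le_trans (ler_normD _ _) _; lra.
Qed.

Lemma sub_csquare_le (z : R[i]) (a b : R) : a <= b -> csquare z a `<=` csquare z b.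
Proof.
by move=> ab w /csquareP[h1 h2]; apply/csquareP; split; apply: le_trans ab.
Qed.

(** Once a convolution extends holomorphically across the real line, the growth bound 2 C / |Im|,
    common to all mollifiers, can be turned into interior bounds by [boundary_growth] and then
    [taylor_square]. The Lipschitz constant on the small square no longer depends on the mollifier
    and passes to [psi]. *)
Let psi_lipschitz : exists2 L : R, 0 <= L & forall z w,
  csquare s%:C (r / 2) z -> csquare s%:C (r / 2) w -> Im z != 0 -> Im w != 0 ->
  normc (psi z - psi w) <= L * normc (z - w).
Proof.
have r0' := r0.
(* [K] bounds the extension on radius r, by [boundary_growth] on squares of radius r / 2; [B] bounds
   its derivative on radius r / 2, by [taylor_square] on squares of the same size. *)
pose K := 36 * 9 * (2 * C) / (r / 2); pose B := 72 * K / (r / 2).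
have r2 : 0 < r / 2 by lra.
have q1 : 3 * r / 2 <= 2 * r by lra.
have q2 : r / 2 <= 3 * r / 2 by lra.
have q3 : r <= 3 * r / 2 by lra.
have K0 : 0 <= K by apply: divr_ge0; [rewrite !mulr_ge0// C0|exact: ltW].
have B0 : 0 <= B by apply: divr_ge0; [rewrite mulr_ge0|exact: ltW].
exists (2 * B); first by rewrite mulr_ge0.
move=> z w hz hw z0 w0.
have sub2 : csquare s%:C (r / 2) `<=` csquare s%:C (2 * r).
  by move=> v /csquareP[? ?]; apply/csquareP; split; lra.
have bz : box z by split => //; exact: sub2.
have bw : box w by split => //; exact: sub2.
apply/ler_addgt0Pr => e e0.
(* Only approximation at the two given points is needed, so continuity of [psi] there suffices and
   the radius may depend on the point. *)
have app v : box v -> exists2 eta : R, 0 < eta & forall f, test_function r f ->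
    (forall t, 0 <= f t) -> (forall t, f t != 0 -> `|t| < eta) ->
    segint (- r) r (fun t => (f t)%:C) = 1 -> normc (tconv f psi v - psi v) <= e / 2.
  move=> bv; have e4 : 0 < e / 4 by lra.
  have h0 : - r <= 0 <= r by rewrite oppr_le0 (ltW r0).
  have [v1 v2] := box_shift bv h0; rewrite addr0 in v1 v2.
  have /ccontinuousP/(_ _ e4)[eta eta0 Heta] := derivable_continuous (dpsi v1 v2).
  exists eta => // f tf f0 feta f1; have [sf _] := tf.
  have c1 := fun t ht => @continuous_tconv f _ t sf bv ht.
  have cr := fun t (_ : - r <= t <= r) => @continuous_real R f t (smooth_continuous sf).
  have c2 : forall t, - r <= t <= r -> {for t, continuous (fun t => psi v * (f t)%:C)}.
    by move=> t ht; apply: continuous_scale; exact: cr.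
  have -> : tconv f psi v - psi v = segint (- r) r (fun t => (f t)%:C * (psi (v + t%:C) - psi v)).
    rewrite -[X in _ - X]mulr1 -f1 /tconv /segint -(cRintegralZ _ _ (segint_integrable cr))//.
    rewrite -(cRintegralB _ (segint_integrable c1) (segint_integrable c2))//.
    by congr (cRintegral _ _ _); apply/funext => t; rewrite mulrBr [psi v * _]mulrC.
  have -> : e / 2 = 2 * (e / 4) by lra.
  apply: (@tconv_average f (fun t => psi (v + t%:C) - psi v) (e / 4) sf f0 f1).
    move=> t ht; have [u1 u2] := box_shift bv ht.
    have c3 := @continuous_shiftR R psi v t (derivable_continuous (dpsi u1 u2)).
    have c4 : {for t, continuous (fun=> psi v : R[i])} by exact: cst_continuous.
    exact: (continuousB c3 c4).
  move=> t _ /feta ht; apply/ltW/Heta.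
  have -> : v + t%:C - v = t%:C by ring.
  by rewrite normc_real.
have [ez ez0 Hz] := app _ bz; have [ew ew0 Hw] := app _ bw.
have m0 : 0 < Num.min ez ew by rewrite lt_min ez0.
have [f [tf f0 fm f1]] := mollifiers m0.
have fz t : f t != 0 -> `|t| < ez by move=> /fm; rewrite lt_min => /andP[].
have fw t : f t != 0 -> `|t| < ew by move=> /fm; rewrite lt_min => /andP[].
have {}Hz := Hz _ tf f0 fz f1; have {}Hw := Hw _ tf f0 fw f1.
(* This [L] depends on the mollifier and serves only to produce the extension [G]; it does not enter
   the final constant 2 B. *)
have [L L0 HL] := tconv_lipschitz tf.
have [G [GE dG]] : exists G, (forall z, csquare s%:C (2 * r) z -> Im z != 0 -> G z = tconv f psi z) /\
    forall z e, 0 < e -> csquare z e `<=` csquare s%:C (2 * r) -> derivable G z 1.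
  apply: (lipschitz_removable L0).
    by move=> v v1 v2; case: (tconv_derive tf (conj v1 v2)).
  by move=> v u v1 u1 v2 u2; exact: HL (conj v1 v2) (conj u1 u2).
have dGr v : csquare s%:C (3 * r / 2) v -> derivable G v 1.
  move=> hv; apply: (dG _ (r / 2)) => //.
  have -> : 2 * r = 3 * r / 2 + r / 2 by field.
  exact: csquare_trans.
have GC v : csquare s%:C (2 * r) v -> Im v != 0 -> `|Im v| * normc (G v) <= 2 * C.
  move=> v1 v2; rewrite GE// mulrC -ler_pdivlMr ?normr_gt0//.
  rewrite -mulrA; apply: (@tconv_average f (fun t => psi (v + t%:C)) _ (proj1 tf) f0 f1).
  - move=> t ht; have [u1 u2] := box_shift (conj v1 v2) ht.
    exact: continuous_shiftR (derivable_continuous (dpsi u1 u2)).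
  - by move=> t ht _; exact: psi_bound.
have GK v : csquare s%:C r v -> normc (G v) <= K.
  move=> hv; have sub u : csquare v (r / 2) u -> csquare s%:C (3 * r / 2) u.
    have -> : 3 * r / 2 = r + r / 2 by field.
    exact: csquare_trans.
  apply: (boundary_growth r2) => u /sub hu; first exact: dGr.
  move=> u0; apply: GC => //; exact: sub_csquare_le q1 _ hu.
have GB v : csquare s%:C (r / 2) v -> normc ('D_1 G v) <= B.
  move=> hv; have sub u : csquare v (r / 2) u -> csquare s%:C r u.
    by move=> h; have := csquare_trans hv h; rewrite -splitr.
  apply: (proj1 (@taylor_square R v (r / 2) G K r2 _ _)) => u /sub hu; last exact: GK.
  apply: dGr; exact: sub_csquare_le q3 _ hu.
have GL : normc (G z - G w) <= 2 * (B * normc (z - w)).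
  apply: lipschitz_path => t /andP[t0 t1].
  have hb : csquare s%:C (r / 2) (w + t%:C * (z - w)).
    have RE : Re (w + t%:C * (z - w) - s%:C) = (1 - t) * Re (w - s%:C) + t * Re (z - s%:C).
      by case: (z) (w) => [? ?] [? ?] /=; ring.
    have IE : Im (w + t%:C * (z - w) - s%:C) = (1 - t) * Im (w - s%:C) + t * Im (z - s%:C).
      by case: (z) (w) => [? ?] [? ?] /=; ring.
    have cvx (x y : R) : `|x| <= r / 2 -> `|y| <= r / 2 -> `|(1 - t) * x + t * y| <= r / 2.
      move=> hx hy; apply: le_trans (ler_normD _ _) _; rewrite !normrM [`|1 - t|]ger0_norm ?subr_ge0// [`|t|]ger0_norm//.
      have : (1 - t) * `|x| <= (1 - t) * (r / 2) by rewrite ler_wpM2l// subr_ge0.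
      have := ler_wpM2l t0 hy; lra.
    move: hz hw => /csquareP[? ?] /csquareP[? ?].
    by apply/csquareP; rewrite RE IE; split; exact: cvx.
  split; last exact: GB.
  by apply: dGr; exact: sub_csquare_le q2 _ hb.
move: GL; rewrite !GE//; [|exact: sub2|exact: sub2] => GL.
have -> : psi z - psi w = (psi z - tconv f psi z) + ((tconv f psi z - tconv f psi w) + (tconv f psi w - psi w)).
  by ring.
apply: le_trans (le_normcD _ _) _; rewrite normcB.
have := le_normcD (tconv f psi z - tconv f psi w) (tconv f psi w - psi w).
lra.
Qed.

(** Being Lipschitz on both sides with one constant, [psi] falls itself under
    [lipschitz_removable]. *)
Lemma reflection : exists G, (forall z, csquare s%:C (r / 2) z -> Im z != 0 -> G z = psi z) /\
    forall z e, 0 < e -> csquare z e `<=` csquare s%:C (r / 2) -> derivable G z 1.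
Proof.
have [L L0 HL] := psi_lipschitz.
apply: (lipschitz_removable L0) => // z hz; apply: dpsi.
by move: hz r0 => /csquareP[? ?] ?; apply/csquareP; split; lra.
Qed.

End reflection.

(** * Bump functions and mollifiers *)

Section smooth_functions.
Context (R : realType).
Implicit Types (f g : R -> R).

Lemma is_derive_derive1 f (f' : R -> R) : (forall x : R, is_derive x 1 f (f' x)) ->
  f^`()%classic = f'.
Proof. by move=> df; apply/funext => x; rewrite derive1E derive_val. Qed.

(** A coinduction principle: it is enough to exhibit a class of functions stable under
    differentiation. Formulas for iterated derivatives are thereby avoided. *)
Lemma smooth_class (P : set (R -> R)) :
  (forall f, P f -> exists2 f', P f' & forall x : R, is_derive x 1 f (f' x)) -> P `<=` @smooth R.
Proof.
move=> cP f Pf n; elim: n f Pf => [|n IH] f Pf x; have [f' Pf' df] := cP _ Pf.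
  by rewrite derive1n0; have [] := df x.
by rewrite derive1Sn (is_derive_derive1 df); exact: IH.
Qed.

(** Products alone are not stable under differentiation, but by the Leibniz rule the algebra
    generated by the smooth functions is, so [smooth_class] applies to it. *)
Inductive smooth_algebra : (R -> R) -> Prop :=
| smooth_base f of smooth f : smooth_algebra f
| smooth_add f g of smooth_algebra f & smooth_algebra g : smooth_algebra (fun x => f x + g x)
| smooth_mul f g of smooth_algebra f & smooth_algebra g : smooth_algebra (fun x => f x * g x).

Lemma smooth_algebra_smooth f : smooth_algebra f -> smooth f.
Proof.
apply: smooth_class => {}f; elim => {f} [f sf|f g af [f' af' df] ag [g' ag' dg]|
    f g af [f' af' df] ag [g' ag' dg]].
- exists (f^`()%classic); first by apply: smooth_base; exact: smooth_derive1.
  by move=> x; exact: smooth_is_derive.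
- exists (fun x => f' x + g' x); first exact: smooth_add.
  by move=> x; apply: is_deriveD.
- exists (fun x => f x * g' x + g x * f' x); first by apply: smooth_add; exact: smooth_mul.
  by move=> x; apply: is_deriveM.
Qed.

Lemma smoothD f g : smooth f -> smooth g -> smooth (fun x => f x + g x).
Proof.
by move=> sf sg; apply: smooth_algebra_smooth; apply: smooth_add; exact: smooth_base.
Qed.

Lemma smoothM f g : smooth f -> smooth g -> smooth (fun x => f x * g x).
Proof.
by move=> sf sg; apply: smooth_algebra_smooth; apply: smooth_mul; exact: smooth_base.
Qed.

Lemma smooth_cst (c : R) : smooth (fun=> c : R).
Proof.
apply: (@smooth_class [set f | exists c : R, f = fun=> c]); last by exists c.
by move=> f [k ->]; exists (fun=> 0); [exists 0|move=> x; exact: is_derive_cst].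
Qed.

Lemma smooth_affine f (a b : R) : smooth f -> smooth (fun x => f (a * x + b)).
Proof.
move=> sf; apply: (@smooth_class [set g | exists f c, smooth f /\ g = fun x => c * f (a * x + b)]).
  move=> g [k [c [sk ->]]]; exists (fun x => (c * a) * k^`()%classic (a * x + b)).
    by exists (k^`()%classic), (c * a); split; [exact: smooth_derive1|].
  move=> x; have d1 : is_derive x 1 (fun x => a * x + b) a.
    have := is_derive_poly (a%:P * 'X + b%:P) x.
    rewrite derivD derivM !derivC derivX mul0r add0r mulr1 addr0 hornerC.
    by congr (is_derive _ _ _ _); apply/funext => y; rewrite !hornerE.
  have d3 := @is_derive1_comp R k (fun x => a * x + b) x _ _ (smooth_is_derive (a * x + b) sk) d1.
  have d4 := is_deriveZ c d3.
  by apply: (is_derive_eq d4); rewrite /GRing.scale /=; ring.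
by exists f, 1; split => //; apply/funext => x; rewrite mul1r.
Qed.

Lemma smooth_id : smooth (fun x : R => x).
Proof.
apply: (@smooth_class [set f | (f = fun x => x) \/ exists c : R, f = fun=> c]); last by left.
move=> f [->|[c ->]].
  by exists (fun=> 1); [by right; exists 1|move=> x; exact: is_derive_id].
by exists (fun=> 0); [by right; exists 0|move=> x; exact: is_derive_cst].
Qed.

(** Serves at the flat point 0 of exp(-1/x), where differentiation rules say nothing. *)
Lemma is_derive_quad f (x K : R) : (forall h, `|f (x + h) - f x| <= K * h ^+ 2) ->
  is_derive x 1 f 0.
Proof.
move=> H.
have K0 : 0 <= K by have := H 1; rewrite expr1n mulr1; exact: le_trans.
have L : h^-1 *: ((f \o shift x) (h *: 1) - f x) @[h --> 0^'] --> (0 : R).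
  apply/cvgr0Pnorm_lt => e e0; have K1 : 0 < K + 1 by lra.
  near=> h.
  have h0 : h != 0 by near: h; exact: nbhs_dnbhs_neq.
  have : `|h| < e / (K + 1).
    by near: h; apply: dnbhs0_lt; rewrite divr_gt0.
  rewrite ltr_pdivlMr// => hK.
  rewrite normrM normfV ltr_pdivrMl ?normr_gt0// /= [h *: 1]mulr1 [h + x]addrC.
  apply: le_lt_trans (H h) _.
  have -> : h ^+ 2 = `|h| * `|h| by rewrite -expr2 real_normK ?num_real.
  rewrite mulrCA ltr_pM2l ?normr_gt0//; apply: le_lt_trans hK.
  by rewrite mulrC ler_wpM2l// lerDl.
split; first by apply/cvg_ex; exists 0.
exact: cvg_lim L.
Unshelve. all: by end_near. Qed.

End smooth_functions.

Section bump_functions.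
Context (R : realType).
Implicit Types (p : {poly R}) (t x : R).

(** Write exp(t) as the (k+1)-st power of exp(t/(k+1)), which is at least t/(k+1); this produces the
    constant (k+1)^k. *)
Lemma expR_dominates_pow (k : nat) : exists2 C : R, 0 <= C & forall t, 0 <= t -> t ^+ k * expR (- t) <= C.
Proof.
exists (k.+1%:R ^+ k) => [|t t0]; first by rewrite exprn_ge0.
rewrite expRN ler_pdivrMr ?expR_gt0//.
have k0 : (0 : R) < k.+1%:R by rewrite ltr0n.
have -> : expR t = expR (t / k.+1%:R) ^+ k.+1.
  by rewrite -expRM_natl mulrC divfK// gt_eqF.
have h : 1 + t / k.+1%:R <= expR (t / k.+1%:R) by exact: expR_ge1Dx.
have d0 : 0 <= t / k.+1%:R by rewrite divr_ge0// ltW.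
have e1 : 1 <= expR (t / k.+1%:R) by apply: le_trans h; rewrite lerDl.
apply: (@le_trans _ _ (k.+1%:R ^+ k * expR (t / k.+1%:R) ^+ k)).
  rewrite -exprMn lerXn2r ?nnegrE ?mulr_ge0 ?expR_ge0 ?(ltW k0)//.
  by rewrite mulrC -ler_pdivrMr//; apply: le_trans h; rewrite lerDr.
by rewrite ler_wpM2l ?exprn_ge0 ?(ltW k0)// exprS ler_peMl// exprn_ge0// expR_ge0.
Qed.

Lemma expR_dominates_poly p (k : nat) : exists2 C : R, 0 <= C &
  forall t, 0 <= t -> `|p.[t]| * t ^+ k * expR (- t) <= C.
Proof.
elim/poly_ind: p k => [|p c IH] k.
  by exists 0 => // t t0; rewrite horner0 normr0 !mul0r.
have [C C0 HC] := IH k.+1; have [D D0 HD] := expR_dominates_pow k.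
exists (C + `|c| * D) => [|t t0]; first by rewrite addr_ge0 ?mulr_ge0.
rewrite hornerD hornerM hornerX hornerC.
apply: (@le_trans _ _ (`|p.[t]| * t ^+ k.+1 * expR (- t) + `|c| * (t ^+ k * expR (- t)))).
  rewrite mulrA -mulrDl ler_wpM2r ?expR_ge0// exprS mulrA -mulrDl ler_wpM2r ?exprn_ge0//.
  by apply: le_trans (ler_normD _ _) _; rewrite normrM [`|t|]ger0_norm.
by apply: lerD; [exact: HC|rewrite ler_wpM2l// HD].
Qed.

(** The factor p(1/x) is there to obtain a class containing exp(-1/x) and stable under
    differentiation; [p = 1] is the function of interest. *)
Definition poly_expinv p x : R := if 0 < x then p.[x^-1] * expR (- x^-1) else 0.

(** For x > 0, the substitution t = 1/x contributes -t^2 and differentiating p(t) exp(-t) gives (p'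
    - p) exp(-t). At 0, the bound of |p(t)| t^2 exp(-t) read at t = 1/h is a quadratic estimate, so
    the derivative is 0. *)
Lemma poly_expinv_derive p x :
  is_derive x 1 (poly_expinv p) (poly_expinv ((p - p^`()) * 'X^2) x).
Proof.
have [x0|x0|x0] := ltrgt0P x.
- have E : \near x, (fun y => p.[y^-1] * expR (- y^-1)) x = poly_expinv p x.
    by near=> y; rewrite /poly_expinv ifT//; near: y; exact: lt_nbhsr.
  apply: near_eq_is_derive E _; rewrite /poly_expinv x0.
  have d1 : is_derive x 1 (fun y : R => y^-1) (- x ^- 2).
    have := @is_deriveV R (fun y => y) x 1 1 _ (is_derive_id _ _).
    by rewrite gt_eqF// => /(_ isT); rewrite /GRing.scale /= mulr1.
  have d2 := is_derive1_comp (is_derive_poly p x^-1) d1.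
  have d3 : is_derive x 1 (fun y : R => - y^-1) (x ^- 2).
    by have := is_deriveN d1; rewrite opprK.
  have d4 := @is_derive1_comp R expR (fun y => - y^-1) x _ _ (is_derive_expR (- x^-1)) d3.
  have d5 := is_deriveM d2 d4.
  apply: (is_derive_eq d5); rewrite hornerM hornerXn hornerD hornerN /= /GRing.scale /= exprVn; ring.
- have E : \near x, (fun=> 0) x = poly_expinv p x.
    near=> y; rewrite /poly_expinv ifF//; apply/negbTE; rewrite -leNgt ltW//.
    by near: y; exact: lt_nbhsl.
  apply: near_eq_is_derive E _; rewrite /poly_expinv ltNge ltW//=.
  exact: is_derive_cst.
- have [C C0 HC] := expR_dominates_poly p 2.
  have -> : poly_expinv ((p - p^`()) * 'X^2) x = 0 by rewrite /poly_expinv x0 ltxx.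
  rewrite x0; apply: (@is_derive_quad _ _ _ C) => h.
  rewrite /poly_expinv add0r ltxx subr0; case: ltP => h0; last by rewrite normr0 mulr_ge0// sqr_ge0.
  have hV : 0 <= h^-1 by rewrite invr_ge0 ltW.
  rewrite normrM [`|expR _|]ger0_norm ?expR_ge0// -ler_pdivrMr ?exprn_gt0//.
  by have := HC _ hV; rewrite exprVn mulrAC.
Unshelve. all: by end_near. Qed.

Lemma poly_expinv_smooth p : smooth (poly_expinv p).
Proof.
apply: (@smooth_class R [set f | exists p, f = poly_expinv p]); last by exists p.
move=> f [q ->]; exists (poly_expinv ((q - q^`()) * 'X^2)); first by eexists.
exact: poly_expinv_derive.
Qed.

(** The product of exp(-1/(t - a)) and exp(-1/(b - t)), each cut off to 0 outside its half-line. *)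
Lemma bump_exists (a b : R) : exists g : R -> R,
  [/\ smooth g, forall t, 0 <= g t < 1 & forall t, (0 < g t) = (a < t < b)].
Proof.
pose E := poly_expinv 1.
have E0 x : 0 <= E x by rewrite /E /poly_expinv; case: ifP; rewrite // hornerC mul1r expR_ge0.
have E1 x : E x < 1.
  rewrite /E /poly_expinv; case: ifP => // x0; rewrite hornerC mul1r expR_lt1 oppr_lt0.
  by rewrite invr_gt0.
have Ep x : (0 < E x) = (0 < x).
  rewrite /E /poly_expinv; case: (0 < x); last by rewrite ltxx.
  by rewrite hornerC mul1r expR_gt0.
exists (fun t => E (1 * t + - a) * E (- 1 * t + b)); split.
- by apply: smoothM; apply: smooth_affine; exact: poly_expinv_smooth.
- move=> t; rewrite mulr_ge0//=; have := E1 (1 * t - a); have := E1 (- 1 * t + b).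
  have := E0 (- 1 * t + b); have := E0 (1 * t - a).
  move: (E (1 * t - a)) (E (- 1 * t + b)) => u v u0 v0 v1 u1.
  by apply: le_lt_trans v1; rewrite ler_piMl// ltW.
- move=> t; have -> : 1 * t + - a = t - a by rewrite mul1r.
  have -> : - 1 * t + b = b - t by ring.
  have := Ep (t - a); have := Ep (b - t); rewrite !subr_gt0 => <- <-.
  have := E0 (t - a); have := E0 (b - t).
  move: (E (t - a)) (E (b - t)) => u v; rewrite !le_eqVlt.
  case/orP => [/eqP <-|h1]; first by rewrite mulr0 ltxx andbF.
  case/orP => [/eqP <-|h2]; first by rewrite mul0r ltxx.
  by rewrite h1 h2 mulr_gt0.
Qed.

Lemma mollifier_exists (r eta : R) : 0 < r -> 0 < eta -> exists f : R -> R,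
  [/\ test_function r f, forall t, 0 <= f t, forall t, f t != 0 -> `|t| < eta &
      segint (- r) r (fun t => (f t)%:C) = 1].
Proof.
(* Half of the minimum, so that the support lies strictly inside both ranges, as [test_function]
   requires. *)
move=> r0 eta0; pose e := Num.min eta r / 2.
have m0 : 0 < Num.min eta r by rewrite lt_min eta0.
have e0 : 0 < e by rewrite /e; lra.
have [me mr] : e < eta /\ e < r.
  have h1 : Num.min eta r <= eta by rewrite ge_min lexx.
  have h2 : Num.min eta r <= r by rewrite ge_min lexx orbT.
  by rewrite /e; split; lra.
have [g [sg g01 gp]] := bump_exists (- e) e.
have g0 t : 0 <= g t by have /andP[] := g01 t.
have gs t : g t != 0 -> `|t| < e by rewrite ltr_norml -gp lt_neqAle eq_sym g0 andbT.
have cg (t : R) : - r <= t <= r -> {for t, continuous (fun t => (g t)%:C : R[i])}.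
  by move=> _; apply: continuous_real; exact: smooth_continuous.
have [ig _] := segint_integrable cg.
pose I : R := \int[@lebesgue_measure R]_(t in `[- r, r]) g t.
have I0 : 0 < I.
  have c0 : {for 0, continuous g} by exact: smooth_continuous.
  have gz : 0 < g 0 by rewrite gp oppr_lt0 e0.
  have gz2 : 0 < g 0 / 2 by lra.
  have /cvgrPdist_lt/(_ _ gz2) := c0; move=> /nbhs_ballP[d /= d0 Hd].
  pose d' := Num.min (d / 2) r.
  have d'0 : 0 < d' by rewrite lt_min r0 andbT divr_gt0.
  have d'r : d' <= r by rewrite ge_min lexx orbT.
  have d'd : d' < d by rewrite gt_min ltr_pdivrMr// ltr_pMr// ltr1n.
  have gl t : - d' <= t <= d' -> g 0 / 2 <= g t.
    rewrite -ler_norml => ht; have : `|g 0 - g t| < g 0 / 2.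
      by apply: Hd; rewrite /ball /= sub0r normrN; exact: le_lt_trans d'd.
    by rewrite ltr_norml => /andP[]; lra.
  have dd : - d' <= d' by lra.
  have cg' (t : R) : - d' <= t <= d' -> {for t, continuous (fun t => (g t)%:C : R[i])}.
    by move=> _; apply: continuous_real; exact: smooth_continuous.
  have [ig' _] := segint_integrable cg'.
  have : (\int[@lebesgue_measure R]_(t in `[- d', d']) (g 0 / 2)) <= \int[@lebesgue_measure R]_(t in `[- d', d']) g t.
    apply: le_Rintegral => //.
      have ck (t : R) : - d' <= t <= d' -> {for t, continuous (fun=> (g 0 / 2)%:C : R[i])}.
        by move=> _; apply: continuous_real; apply: smooth_continuous; exact: smooth_cst.
      by case: (segint_integrable ck).
  rewrite Rintegral_cst_itv// => h.
  have h2 : \int[@lebesgue_measure R]_(t in `[- d', d']) g t <= I.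
    rewrite /I /Rintegral fine_le ?integrable_fin_num//.
    apply: ge0_subset_integral => //.
    - by case/integrableP: ig.
    - by move=> t _; rewrite lee_fin.
    - by move=> t /=; rewrite !in_itv /=; lra.
  apply: lt_le_trans (le_trans h h2); rewrite mulr_gt0//; lra.
exists (fun t => I^-1 * g t); split.
- split; first by apply: smoothM => //; exact: smooth_cst.
  exists e => // t et; apply/eqP; rewrite mulf_eq0; apply/orP; right.
  by apply/negP => /negP /gs; rewrite ltNge ltW.
- by move=> t; rewrite mulr_ge0// invr_ge0 ltW.
- by move=> t; rewrite mulf_eq0 negb_or => /andP[_ /gs h]; exact: lt_trans me.
- rewrite /segint /cRintegral /=; congr (_ +i* _); last by rewrite Rintegral_cst// mul0r.
  by rewrite RintegralZl// -/I mulVf// gt_eqF.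
Qed.

End bump_functions.

(** * Integration against charges and complex measures *)

Section charge_integral.
Context d (T : measurableType d) (R : realType).
Implicit Types (nu : {charge set T -> \bar R}) (m : {measure set T -> \bar R})
  (A D : set T) (f g : T -> R[i]) (lam : complex_measure T R).

(** All that is used later about the chosen Hahn decomposition. The second clause carries vanishing
    of the charge on all measurable subsets over to both positive measures, which is how
    concentration on a set is exploited. *)
Lemma charge_integral_jordan nu : exists P N : {finite_measure set T -> \bar R},
  [/\ forall A, measurable A -> nu A = (P A - N A)%E,
      forall A, measurable A ->
        (forall B, measurable B -> B `<=` A -> nu B = 0%E) -> P A = 0%E /\ N A = 0%E &
      forall D f, charge_integral nu D f = cRintegral P D f - cRintegral N D f].
Proof.
pose HP := cid (Hahn_decomposition nu); pose HN := cid (projT2 HP).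
exists (jordan_pos (projT2 HN)), (jordan_neg (projT2 HN)); split => // A mA.
  by rewrite (jordan_decomp (projT2 HN) mA) /cadd /= cscaleN1.
move=> nu0; have [[mP _] [mN _] _ _] := projT2 HN.
split; [apply: etrans (jordan_posE _ _) _|apply: etrans (jordan_negE _ _) _].
  by rewrite cjordan_posE /crestr0 mem_set// /crestr nu0//; exact: measurableI.
by rewrite cjordan_negE /crestr0 mem_set// /crestr nu0 ?oppe0//; exact: measurableI.
Qed.

Lemma cRintegral_measure_add (m1 m2 : {measure set T -> \bar R}) D f : measurable D ->
  cintegrable m1 D f -> cintegrable m2 D f ->
  cRintegral (measure_add m1 m2) D f = cRintegral m1 D f + cRintegral m2 D f.
Proof.
move=> mD [r1 i1] [r2 i2]; rewrite /cRintegral /Rintegral.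
apply/eqP; rewrite eq_complex /=; apply/andP; split; apply/eqP.
- rewrite (integral_measure_add mD r1 r2) fineD//.
  + exact: integrable_fin_num.
  + exact: integrable_fin_num.
- rewrite (integral_measure_add mD i1 i2) fineD//.
  + exact: integrable_fin_num.
  + exact: integrable_fin_num.
Qed.

Lemma eq_measure_cRintegral (m1 m2 : {measure set T -> \bar R}) D f : measurable D ->
  (forall A, measurable A -> A `<=` D -> m1 A = m2 A) ->
  cRintegral m1 D f = cRintegral m2 D f.
Proof.
by move=> mD m12; rewrite /cRintegral /Rintegral; congr (_ +i* _); congr fine;
  apply: eq_measure_integral => A mA AD; rewrite m12.
Qed.

(** Bounded measurable functions are integrable against every finite measure and form an algebra, so
    integrals against complex measures carry no integrability side conditions. *)
Definition bmeasurable f :=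
  cmeasurable setT f /\ exists M : R, forall x, normc (f x) <= M.

Lemma bmeasurable_cintegrable m D f : (m setT < +oo)%E -> measurable D -> bmeasurable f ->
  cintegrable m D f.
Proof.
move=> mfin mD [[mf1 mf2] [M fM]]; apply: (@cintegrable_bounded _ _ _ _ _ mD _ M) => //.
- by apply: le_lt_trans mfin; apply: le_measure; rewrite ?inE.
- by split; apply: measurable_funTS.
Qed.

Lemma finite_measure_lty (m : {finite_measure set T -> \bar R}) : (m setT < +oo)%E.
Proof. by rewrite ltey_eq fin_num_measure. Qed.

(** From P - N = m1 - m2 on sets, P + m2 and m1 + N are the same positive measure. Any decomposition
    into finite measures may therefore replace the Jordan one, whether or not its two parts are
    mutually singular. *)
Lemma charge_integral_unique nu m1 m2 f :
  (m1 setT < +oo)%E -> (m2 setT < +oo)%E ->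
  (forall A, measurable A -> nu A = (m1 A - m2 A)%E) -> bmeasurable f ->
  charge_integral nu setT f = cRintegral m1 setT f - cRintegral m2 setT f.
Proof.
move=> f1 f2 num bf; have [P [N [nuPN _ ->]]] := charge_integral_jordan nu.
have iP := bmeasurable_cintegrable (finite_measure_lty P) measurableT bf.
have iN := bmeasurable_cintegrable (finite_measure_lty N) measurableT bf.
have i1 := bmeasurable_cintegrable f1 measurableT bf.
have i2 := bmeasurable_cintegrable f2 measurableT bf.
apply/eqP; rewrite subr_eq addrAC eq_sym subr_eq; apply/eqP.
rewrite -!cRintegral_measure_add//; apply: eq_measure_cRintegral => // A mA _.
rewrite /measure_add /= /msum !big_ord_recl !big_ord0 /= !adde0.
have fin (m : {measure set T -> \bar R}) : (m setT < +oo)%E -> m A \is a fin_num.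
  move=> mfin; rewrite ge0_fin_numE//; apply: le_lt_trans mfin.
  by apply: le_measure; rewrite ?inE.
have := nuPN A mA; rewrite num//.
move: (fin _ f1) (fin _ f2) (fin _ (finite_measure_lty P)) (fin _ (finite_measure_lty N)).
move: (m1 A) (m2 A) (P A) (N A) => [a| |] [b| |] [p| |] [n| |] // _ _ _ _.
by move=> [] h; rewrite -!EFinD; congr EFin; lra.
Qed.

Lemma bmeasurableD f g : bmeasurable f -> bmeasurable g -> bmeasurable (fun x => f x + g x).
Proof.
move=> [[f1 f2] [M fM]] [[g1 g2] [N gN]]; split; last first.
  by exists (M + N) => x; apply: le_trans (le_normcD _ _) _; exact: lerD.
split.
  have -> : (fun x => Re (f x + g x)) = (fun x => Re (f x)) \+ (fun x => Re (g x)).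
    by apply/funext => x; rewrite raddfD.
  exact: measurable_funD.
have -> : (fun x => Im (f x + g x)) = (fun x => Im (f x)) \+ (fun x => Im (g x)).
  by apply/funext => x; rewrite raddfD.
exact: measurable_funD.
Qed.

Lemma bmeasurableM f g : bmeasurable f -> bmeasurable g -> bmeasurable (fun x => f x * g x).
Proof.
move=> [[f1 f2] [M fM]] [[g1 g2] [N gN]]; split; last first.
  exists (M * N) => x; rewrite Normc.normcM.
  by apply: ler_pM => //; exact: normc_ge0.
split.
  have -> : (fun x => Re (f x * g x)) = ((fun x => Re (f x)) \* (fun x => Re (g x))) \-
     ((fun x => Im (f x)) \* (fun x => Im (g x))).
    by apply/funext => x; rewrite cReM.
  by apply: measurable_funB; exact: measurable_funM.
have -> : (fun x => Im (f x * g x)) = ((fun x => Re (f x)) \* (fun x => Im (g x))) \+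
     ((fun x => Im (f x)) \* (fun x => Re (g x))).
  by apply/funext => x; rewrite cImM.
by apply: measurable_funD; exact: measurable_funM.
Qed.

Lemma bmeasurable_cst (k : R[i]) : bmeasurable (fun=> k).
Proof. by split; [split; exact: measurable_cst|exists (normc k)]. Qed.

Lemma bmeasurableB f g : bmeasurable f -> bmeasurable g -> bmeasurable (fun x => f x - g x).
Proof.
move=> bf bg; have -> : (fun x => f x - g x) = (fun x => f x + (-1) * g x).
  by apply/funext => x; rewrite mulN1r.
by apply: bmeasurableD => //; apply: bmeasurableM => //; exact: bmeasurable_cst.
Qed.

(** Some constant M with |integral of f| <= M sup |f|, picked by choice; it is not claimed to be the
    total variation. The default 0 never occurs unless it is itself such a constant, by
    [cmtotalP]. *)
Definition cmtotal lam : R :=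
  xget 0 [set M | 0 <= M /\ forall f (B : R), bmeasurable f -> (forall x, normc (f x) <= B) ->
     normc (cmintegral lam setT f) <= M * B].

Lemma cmintegral_parts lam : exists m1 m2 m3 m4 : {finite_measure set T -> \bar R},
  [/\ forall A, measurable A -> cmRe lam A = (m1 A - m2 A)%E,
      forall A, measurable A -> cmIm lam A = (m3 A - m4 A)%E,
      forall A, measurable A ->
        (forall B, measurable B -> B `<=` A -> lam B = 0) ->
        [/\ m1 A = 0%E, m2 A = 0%E, m3 A = 0%E & m4 A = 0%E] &
      forall D f, cmintegral lam D f = cRintegral m1 D f - cRintegral m2 D f +
        'i%C * (cRintegral m3 D f - cRintegral m4 D f)].
Proof.
have [m1 [m2 [e12 z12 i12]]] := charge_integral_jordan (cmRe lam).
have [m3 [m4 [e34 z34 i34]]] := charge_integral_jordan (cmIm lam).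
exists m1, m2, m3, m4; split => // [A mA lam0|D f]; last first.
  by rewrite /cmintegral i12 i34.
have fin (nu : {charge set T -> \bar R}) B : measurable B -> fine (nu B) = 0 -> nu B = 0%E.
  by move=> mB; rewrite -(fineK (fin_num_measure nu _ mB)) /= => ->.
have [z1 z2] : m1 A = 0%E /\ m2 A = 0%E.
  by apply: z12 => // B mB BA; apply: fin => //; have [] := lam0 _ mB BA.
have [z3 z4] : m3 A = 0%E /\ m4 A = 0%E.
  by apply: z34 => // B mB BA; apply: fin => //; have [] := lam0 _ mB BA.
by [].
Qed.

Lemma cmintegralZ lam f (k : R[i]) : bmeasurable f ->
  cmintegral lam setT (fun x => k * f x) = k * cmintegral lam setT f.
Proof.
move=> bf; have [m1 [m2 [m3 [m4 [_ _ _ E]]]]] := cmintegral_parts lam.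
have i (m : {finite_measure set T -> \bar R}) h : bmeasurable h -> cintegrable m setT h.
  by move=> bh; apply: bmeasurable_cintegrable => //; exact: finite_measure_lty.
rewrite !E !(cRintegralZ measurableT k (i _ _ bf)); ring.
Qed.

Lemma cmintegralB lam f g : bmeasurable f -> bmeasurable g ->
  cmintegral lam setT (fun x => f x - g x) = cmintegral lam setT f - cmintegral lam setT g.
Proof.
move=> bf bg; have [m1 [m2 [m3 [m4 [_ _ _ E]]]]] := cmintegral_parts lam.
have i (m : {finite_measure set T -> \bar R}) h : bmeasurable h -> cintegrable m setT h.
  by move=> bh; apply: bmeasurable_cintegrable => //; exact: finite_measure_lty.
rewrite !E !(cRintegralB measurableT (i _ _ bf) (i _ _ bg)); ring.
Qed.

Lemma cmtotalP lam : 0 <= cmtotal lam /\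
  forall f (B : R), bmeasurable f -> (forall x, normc (f x) <= B) ->
     normc (cmintegral lam setT f) <= cmtotal lam * B.
Proof.
rewrite /cmtotal; case: xgetP => // /(_ _) H; exfalso.
have [m1 [m2 [m3 [m4 [_ _ _ E]]]]] := cmintegral_parts lam.
pose tot (m : {finite_measure set T -> \bar R}) : R := 2 * fine (m setT).
have tot0 (m : {finite_measure set T -> \bar R}) : 0 <= tot m by rewrite mulr_ge0// fine_ge0.
apply: (H (tot m1 + tot m2 + (tot m3 + tot m4))); split; first by rewrite !addr_ge0.
move=> f B bf fB.
have b (m : {finite_measure set T -> \bar R}) : normc (cRintegral m setT f) <= tot m * B.
  have := @cRintegral_bound _ _ _ m setT measurableT f B (finite_measure_lty m) (proj1 bf) (fun x _ => fB x).
  by rewrite /tot mulrAC.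
rewrite E; apply: le_trans (le_normcD _ _) _; rewrite Normc.normcM normci mul1r mulrDl.
by apply: lerD; apply: le_trans (le_normcB _ _) _; rewrite mulrDl; exact: lerD.
Qed.

Lemma cmintegral_unique lam (m1 m2 m3 m4 : {measure set T -> \bar R}) f :
  (m1 setT < +oo)%E -> (m2 setT < +oo)%E -> (m3 setT < +oo)%E -> (m4 setT < +oo)%E ->
  (forall A, measurable A -> cmRe lam A = (m1 A - m2 A)%E) ->
  (forall A, measurable A -> cmIm lam A = (m3 A - m4 A)%E) -> bmeasurable f ->
  cmintegral lam setT f = cRintegral m1 setT f - cRintegral m2 setT f +
        'i%C * (cRintegral m3 setT f - cRintegral m4 setT f).
Proof.
by move=> f1 f2 f3 f4 e12 e34 bf; rewrite /cmintegral (charge_integral_unique f1 f2 e12 bf)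
  (charge_integral_unique f3 f4 e34 bf).
Qed.

(** The complement of [D] is null for all four positive measures behind [lam]. Integrals over [S]
    thus become integrals over the whole line, where linearity is available. *)
Lemma cmintegral_concentrated lam D f : measurable D -> cmconcentrated lam D ->
  bmeasurable f -> cmintegral lam D f = cmintegral lam setT f.
Proof.
move=> mD lamD bf; have [m1 [m2 [m3 [m4 [_ _ z E]]]]] := cmintegral_parts lam.
have [] := z (~` D) (measurableC mD).
  by move=> B mB BD; apply: lamD => //; apply/seteqP; split => x // [] /BD.
have e (m : {finite_measure set T -> \bar R}) : m (~` D) = 0%E ->
    cRintegral m D f = cRintegral m setT f.
  move=> m0.
  have [i1 i2] := bmeasurable_cintegrable (finite_measure_lty m) measurableT bf.
  have mC := measurableC mD.
  rewrite /cRintegral /Rintegral; congr (_ +i* _); congr fine.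
    by rewrite [RHS](negligible_integral mC measurableT i1 m0) setTD setCK.
  by rewrite [RHS](negligible_integral mC measurableT i2 m0) setTD setCK.
by move=> z1 z2 z3 z4; rewrite !E !e.
Qed.

End charge_integral.

Section borel_sets.
Context (R : realType) (T : ptopologicalType).

Lemma borel_open (U : set T) : open U -> measurable (U : set (borel T)).
Proof. by move=> oU; apply: sub_sigma_algebra. Qed.

Lemma borel_continuous_measurable (f : T -> R) : continuous f ->
  measurable_fun setT (f : borel T -> R).
Proof.
move=> cf; apply: (measurability _ (RGenOpens.measurableE R)) => _ [_ [x [y ->]] <-].
rewrite setTI; apply: borel_open; apply: open_comp; last exact: interval_open.
by move=> u _; exact: cf.
Qed.

Lemma borel_continuous_cmeasurable (f : T -> R[i]) : (forall t, {for t, continuous f}) ->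
  cmeasurable (setT : set (borel T)) f.
Proof.
move=> cf; split; apply: borel_continuous_measurable => t; have /cvg_ReIm[] := cf t => //.
Qed.

End borel_sets.

Lemma cRintegral_point d (T : measurableType d) (R : realType)
    (m : {measure set T -> \bar R}) (p : T) (f : T -> R[i]) :
  measurable [set p] -> (m setT < +oo)%E -> m (~` [set p]) = 0%E -> bmeasurable f ->
  cRintegral m setT f = (fine (m [set p]))%:C * f p.
Proof.
move=> mp mfin m0 bf; have mC := measurableC mp.
have [i1 i2] := bmeasurable_cintegrable mfin measurableT bf.
have E (g : T -> R) : m.-integrable setT (EFin \o g) ->
    \int[m]_x g x = fine (m [set p]) * g p.
  move=> ig; rewrite /Rintegral (negligible_integral mC measurableT ig m0) setTD setCK.
  rewrite (eq_integral (cst (g p)%:E)); last by move=> x; rewrite inE => ->.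
  by rewrite [LHS]Rintegral_cst// mulrC.
rewrite /cRintegral (E _ i1) (E _ i2).
by apply/eqP; rewrite eq_complex cReM cImM /= !mul0r subr0 addr0 !eqxx.
Qed.

(** * Transfer of measures between the line and the circle *)

Section borel_circle.
Context (R : realType).
Local Notation BX := (borel (xreal R)).

Lemma measurable_range_Some : measurable (range Some : set BX).
Proof.
by apply: borel_open; apply: one_point_compactification_open_some; exact: openT.
Qed.

Lemma measurable_None : measurable ([set None] : set BX).
Proof.
have -> : [set None] = ~` range Some :> set BX.
  by apply/seteqP; split => [_ -> []|[x|]//=]//; case; exists x.
exact: measurableC measurable_range_Some.
Qed.

(** The sets with measurable image form a sigma-algebra containing the open sets; complements are
    taken inside the image of the line, which is open in the circle. *)
Lemma measurable_image_Some (A : set (borel R)) : measurable A -> measurable (Some @` A : set BX).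
Proof.
pose G := [set A : set R | measurable (Some @` A : set BX)].
have sG : sigma_algebra setT G.
  split.
  - by rewrite /G /= image_set0.
  - move=> B GB; rewrite /G /= setTD.
    have -> : Some @` (~` B) = range Some `\` Some @` B :> set BX.
      apply/seteqP; split => [_ [x Bx <-]|_ [[x _ <-] Bx]].
        by split; [exists x|case=> y By [yx]; apply: Bx; rewrite -yx].
      by exists x => // Bx'; apply: Bx; exists x.
    by apply: measurableD => //; exact: measurable_range_Some.
  - move=> F GF; rewrite /G /= image_bigcup.
    by apply: bigcup_measurable => n _; exact: GF.
suff : <<s @open R >> `<=` G by apply.
apply: smallest_sub => // U oU; apply: borel_open.
exact: one_point_compactification_open_some.
Qed.

Lemma measurable_Some : measurable_fun setT (Some : borel R -> BX).
Proof.
apply: (@measurability _ _ (borel R) BX setT Some (@open (xreal R)) erefl) => _ [U oU <-].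
rewrite setTI; apply: borel_open; apply: open_comp => // x _.
exact: one_point_compactification_some_continuous.
Qed.

Lemma measurable_preimage_Some (A : set BX) : measurable A ->
  measurable (Some @^-1` A : set (borel R)).
Proof. by move=> mA; rewrite -[X in measurable X]setTI; exact: measurable_Some. Qed.

Lemma circle_measurable_fun (f : BX -> R) : measurable_fun setT (f \o Some : borel R -> R) ->
  measurable_fun setT f.
Proof.
move=> mf _ B mB; rewrite setTI.
have -> : f @^-1` B = Some @` ((f \o Some) @^-1` B) `|` (f @^-1` B `&` [set None]).
  apply/seteqP; split => [[x|] Bx|z [[x Bx <-]|[Bx _]]]//.
    by left; exists x.
  by right.
apply: measurableU.
  by apply: measurable_image_Some; rewrite -[X in measurable X]setTI; exact: mf.
have [BN|BN] := pselect (B (f None)).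
  have -> : f @^-1` B `&` [set None] = [set None] by apply/seteqP; split => [x []|x ->].
  exact: measurable_None.
have -> : f @^-1` B `&` [set None] = set0 by apply/seteqP; split => x // [Bx xN]; apply: BN; rewrite -xN.
exact: measurable0.
Qed.

Lemma circle_bmeasurable (f : BX -> R[i]) : bmeasurable (fun x : borel R => f (Some x)) ->
  bmeasurable f.
Proof.
move=> [[f1 f2] [M fM]]; split; first by split; exact: circle_measurable_fun.
exists (Num.max M (normc (f None))) => -[x|]; last by rewrite le_max lexx orbT.
by rewrite le_max fM.
Qed.

Lemma bmeasurable_Some (f : BX -> R[i]) : bmeasurable f ->
  bmeasurable (fun x : borel R => f (Some x)).
Proof.
move=> [[f1 f2] [M fM]]; split; last by exists M.
split.
  exact: (measurableT_comp (f := fun x : BX => Re (f x)) f1 measurable_Some).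
exact: (measurableT_comp (f := fun x : BX => Im (f x)) f2 measurable_Some).
Qed.

Section pull.
Variable nu : {charge set BX -> \bar R}.
(** The restriction of the charge to the line; the mass at infinity is forgotten. *)
Definition cpull (A : set (borel R)) : \bar R := nu (Some @` A).

Let pull0 : cpull set0 = 0%E. Proof. by rewrite /cpull image_set0 charge0. Qed.

Let pullfin A : measurable A -> cpull A \is a fin_num.
Proof. by move=> mA; apply: fin_num_measure; exact: measurable_image_Some. Qed.

Let pull_sigma : semi_sigma_additive cpull.
Proof.
move=> F mF tF mUF; rewrite /cpull image_bigcup; apply: charge_semi_sigma_additive.
- by move=> n; exact: measurable_image_Some.
- apply/trivIsetP => i j _ _ ij; apply/seteqP; split => // _ [[x Fx <-] [y Fy [yx]]].
  have /trivIsetP/(_ i j I I ij)/seteqP[/(_ x) h _] := tF.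
  by apply: h; split => //; rewrite -yx.
- by apply: bigcup_measurable => n _; exact: measurable_image_Some.
Qed.

HB.instance Definition _ := isCharge.Build _ _ _ cpull pull0 pullfin pull_sigma.
End pull.

Section mpull.
Variable m : {measure set BX -> \bar R}.
Definition mpull (A : set (borel R)) : \bar R := m (Some @` A).

Let pull0 : mpull set0 = 0%E. Proof. by rewrite /mpull image_set0 measure0. Qed.

Let pull_ge0 A : (0 <= mpull A)%E. Proof. exact: measure_ge0. Qed.

Let pull_sigma : semi_sigma_additive mpull.
Proof.
move=> F mF tF mUF; rewrite /mpull image_bigcup; apply: measure_semi_sigma_additive.
- by move=> n; exact: measurable_image_Some.
- apply/trivIsetP => i j _ _ ij; apply/seteqP; split => // _ [[x Fx <-] [y Fy [yx]]].
  have /trivIsetP/(_ i j I I ij)/seteqP[/(_ x) h _] := tF.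
  by apply: h; split => //; rewrite -yx.
- by apply: bigcup_measurable => n _; exact: measurable_image_Some.
Qed.

HB.instance Definition _ := isMeasure.Build _ _ _ mpull pull0 pull_ge0 pull_sigma.
End mpull.

Section push.
Variable nu : {charge set (borel R) -> \bar R}.
(** The extension of the charge to the circle, with no mass at infinity. *)
Definition cpush (A : set BX) : \bar R := nu (Some @^-1` A).

Let push0 : cpush set0 = 0%E. Proof. by rewrite /cpush preimage_set0 charge0. Qed.

Let pushfin A : measurable A -> cpush A \is a fin_num.
Proof. by move=> mA; apply: fin_num_measure; exact: measurable_preimage_Some. Qed.

Let push_sigma : semi_sigma_additive cpush.
Proof.
move=> F mF tF mUF; rewrite /cpush preimage_bigcup; apply: charge_semi_sigma_additive.
- by move=> n; exact: measurable_preimage_Some.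
- apply/trivIsetP => i j _ _ ij; rewrite -preimage_setI.
  by have /trivIsetP/(_ i j I I ij) := tF; move=> ->; rewrite preimage_set0.
- by apply: bigcup_measurable => n _; exact: measurable_preimage_Some.
Qed.

HB.instance Definition _ := isCharge.Build _ _ _ cpush push0 pushfin push_sigma.
End push.

Section mpush.
Variable m : {measure set (borel R) -> \bar R}.
Definition mpush (A : set BX) : \bar R := m (Some @^-1` A).

Let push0 : mpush set0 = 0%E. Proof. by rewrite /mpush preimage_set0 measure0. Qed.

Let push_ge0 A : (0 <= mpush A)%E. Proof. exact: measure_ge0. Qed.

Let push_sigma : semi_sigma_additive mpush.
Proof.
move=> F mF tF mUF; rewrite /mpush preimage_bigcup; apply: measure_semi_sigma_additive.
- by move=> n; exact: measurable_preimage_Some.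
- apply/trivIsetP => i j _ _ ij; rewrite -preimage_setI.
  by have /trivIsetP/(_ i j I I ij) := tF; move=> ->; rewrite preimage_set0.
- by apply: bigcup_measurable => n _; exact: measurable_preimage_Some.
Qed.

HB.instance Definition _ := isMeasure.Build _ _ _ mpush push0 push_ge0 push_sigma.
End mpush.

Lemma cRintegral_pushforward (m : {measure set (borel R) -> \bar R}) (f : BX -> R[i]) :
  (m setT < +oo)%E -> bmeasurable f ->
  cRintegral (mpush m) setT f = cRintegral m setT (fun x => f (Some x)).
Proof.
move=> mfin bf; have bf' := bmeasurable_Some bf.
have [i1 i2] := bmeasurable_cintegrable mfin measurableT bf'.
have [[f1 f2] _] := bf.
rewrite /cRintegral /Rintegral; congr (_ +i* _); congr fine.
  have mf : measurable_fun setT (fun x : BX => (Re (f x))%:E) by exact/measurable_EFinP.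
  rewrite -[RHS](integral_pushforward measurable_Some mf i1 measurableT).
  exact: erefl.
have mf : measurable_fun setT (fun x : BX => (Im (f x))%:E) by exact/measurable_EFinP.
rewrite -[RHS](integral_pushforward measurable_Some mf i2 measurableT).
exact: erefl.
Qed.

(** [m] is the push of its pull plus an atom at infinity; the proof checks this on sets and
    integrates each summand. *)
Lemma cRintegral_circle (m : {measure set BX -> \bar R}) (f : BX -> R[i]) :
  (m setT < +oo)%E -> bmeasurable f ->
  cRintegral m setT f = cRintegral (mpull m) setT (fun x => f (Some x)) +
    (fine (m [set None]))%:C * f None.
Proof.
move=> mfin bf.
have mpfin : (mpull m setT < +oo)%E.
  apply: le_lt_trans mfin; apply: le_measure; rewrite ?inE//; exact: measurable_range_Some.
have mN0 : m [set None] \is a fin_num.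
  rewrite ge0_fin_numE//; apply: le_lt_trans mfin; apply: le_measure; rewrite ?inE//.
  exact: measurable_None.
have c0 : 0 <= fine (m [set None]) by exact: fine_ge0.
pose k := NngNum c0.
pose m' := measure_add (mpush (mpull m)) (mscale k (dirac (None : BX))).
have -> : cRintegral m setT f = cRintegral m' setT f.
  apply: eq_measure_cRintegral => // A mA _.
  rewrite /m' /measure_add /= /msum !big_ord_recl !big_ord0 /= adde0 /mscale /= fineK//.
  rewrite /mpush /= /mpull /=.
  have -> : m A = (m (A `&` range Some) + m (A `&` [set None]))%E.
    rewrite -measureU; [|by apply: measurableI => //; exact: measurable_range_Some|
      by apply: measurableI => //; exact: measurable_None|].
      congr (m _); rewrite -setIUr; apply/esym/setIidPl => -[x|] _; [by left; exists x|by right].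
    by apply/seteqP; split => // x [[_ [y _ <-]] [_]].
  congr (_ + _)%E.
    congr (m _); apply/seteqP; split => [y [Ay [x _ xE]]|y [x Ax <-]].
      by exists x => //; rewrite /= xE.
    by split => //; exists x.
  rewrite /dirac indicE; have [AN|AN] := pselect (A None).
    by rewrite mem_set// mule1; congr (m _); apply/seteqP; split => [x []|x ->].
  rewrite memNset// mule0.
  have -> : A `&` [set None] = set0 by apply/seteqP; split => x // [Ax xN]; apply: AN; rewrite -xN.
  exact: measure0.
have f2 : (mscale k (dirac (None : BX)) setT < +oo)%E.
  by rewrite /mscale /= diracT mule1 ltry.
rewrite cRintegral_measure_add//; [|exact: bmeasurable_cintegrable|exact: bmeasurable_cintegrable].
rewrite cRintegral_pushforward//; congr (_ + _).
have mE A : mscale k (dirac (None : BX)) A = (k%:num%:E * (\1_A (None : BX))%:E)%E by [].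
rewrite (cRintegral_point measurable_None)//; last first.
  by apply: etrans (mE _) _; rewrite indicE memNset ?mule0// => /(_ erefl).
congr (_%:C * _); apply: etrans (congr1 fine (mE _)) _.
by rewrite indicE mem_set// mule1.
Qed.

End borel_circle.

Lemma complexE_ReIm (R : realType) (z : R[i]) : z = (Re z)%:C + 'i%C * (Im z)%:C.
Proof.
by case: z => x y; apply/eqP; rewrite eq_complex /=; apply/andP; split; apply/eqP; ring.
Qed.

(** * Atoms and dominated convergence for complex measures *)

Section charge_operations.
Context d (T : measurableType d) (R : realType).
Implicit Types (nu : {charge set T -> \bar R}) (f : T -> R[i]).

Definition atom_charge nu (p : T) (c : R) : {charge set T -> \bar R} :=
  cadd nu (cscale c (charge_of_finite_measure (dirac p))).

Lemma atom_chargeE nu p c A : atom_charge nu p c A = (nu A + c%:E * (\1_A p)%:E)%E.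
Proof. by []. Qed.

(** The positive part of [c] is added to P and its negative part to N. The pair need not be a Jordan
    decomposition any more, but [charge_integral_unique] accepts it. *)
Lemma charge_integral_atom nu p c f : measurable [set p] -> bmeasurable f ->
  charge_integral (atom_charge nu p c) setT f = charge_integral nu setT f + c%:C * f p.
Proof.
move=> mp bf; have [P [N [nuPN _ ->]]] := charge_integral_jordan nu.
have c1 : 0 <= Num.max c 0 by rewrite le_max lexx orbT.
have c2 : 0 <= Num.max (- c) 0 by rewrite le_max lexx orbT.
have cE : c = Num.max c 0 - Num.max (- c) 0.
  by case: (lerP 0 c) => h; rewrite ?(max_l h) ?(max_r (ltW h)) ?sub0r;
    [rewrite max_r ?subr0// oppr_le0|rewrite max_l ?opprK// oppr_ge0 ltW].
pose m1 := measure_add P (mscale (NngNum c1) (dirac p)).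
pose m2 := measure_add N (mscale (NngNum c2) (dirac p)).
have mE (k : {nonneg R}) A : mscale k (dirac p) A = (k%:num%:E * (\1_A p)%:E)%E by [].
have fin (k : {nonneg R}) : (mscale k (dirac p) setT < +oo)%E by apply: (le_lt_trans (y := (k%:num%:E * (\1_setT p)%:E)%E)) => //; rewrite indicE in_setT mule1 ltry.
have maddE (m : {finite_measure set T -> \bar R}) k A :
    measure_add m (mscale k (dirac p)) A = (m A + k%:num%:E * (\1_A p)%:E)%E.
  by rewrite /measure_add /= /msum !big_ord_recl !big_ord0 /= adde0.
have fadd (m : {finite_measure set T -> \bar R}) (k : {nonneg R}) :
    (measure_add m (mscale k (dirac p)) setT < +oo)%E.
  apply: (le_lt_trans (y := (m setT + k%:num%:E * (\1_setT p)%:E)%E)); first by rewrite -maddE.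
  by apply: lte_add_pinfty; [exact: finite_measure_lty|exact: fin].
rewrite (@charge_integral_unique _ _ _ _ m1 m2 f (fadd _ _) (fadd _ _))//.
  have I (m : {finite_measure set T -> \bar R}) k : cRintegral (measure_add m (mscale k (dirac p))) setT f =
      cRintegral m setT f + k%:num%:C * f p.
    rewrite cRintegral_measure_add//; last 2 first.
    - by apply: bmeasurable_cintegrable => //; exact: finite_measure_lty.
    - by apply: bmeasurable_cintegrable => //; exact: fin.
    congr (_ + _); rewrite (cRintegral_point mp (fin k) _ bf).
      congr (_%:C * _); apply: etrans (congr1 fine (mE _ _)) _.
      by rewrite indicE mem_set// mule1.
    by apply: etrans (mE _ _) _; rewrite indicE memNset ?mule0// => /(_ erefl).
  by rewrite !I /= [in RHS]cE rmorphB /=; ring.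
move=> A mA; rewrite atom_chargeE nuPN//.
apply: etrans (_ : _ = (P A + (Num.max c 0)%:E * (\1_A p)%:E -
   (N A + (Num.max (- c) 0)%:E * (\1_A p)%:E))%E) _; last first.
  by congr (_ - _)%E; apply/esym; [exact: (maddE P (NngNum c1) A)|exact: (maddE N (NngNum c2) A)].
have := fin_num_measure P _ mA; have := fin_num_measure N _ mA.
move: (P A) (N A) => [a| |] [b| |] //= _ _.
by rewrite -!EFinM -!EFinD; congr EFin; rewrite [in LHS]cE; ring.
Qed.

Lemma Rintegral_dominated (m : {measure set T -> \bar R}) (D : set T) (F : nat -> T -> R)
    (G : T -> R) (M : R) : measurable D -> (m D < +oo)%E ->
  (forall n, measurable_fun D (F n)) ->
  (forall n x, D x -> `|F n x| <= M) -> (forall x, D x -> F n x @[n --> \oo] --> G x) ->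
  \int[m]_(x in D) F n x @[n --> \oo] --> \int[m]_(x in D) G x.
Proof.
move=> mD mfin mF FM FG.
have mF' n : measurable_fun D (fun x => (F n x)%:E) by exact/measurable_EFinP.
have FG' x : D x -> (F n x)%:E @[n --> \oo] --> (G x)%:E.
  by move=> Dx; apply: cvg_EFin; [exact: nearW|exact: FG].
have mG : measurable_fun D (fun x => (G x)%:E).
  by apply/measurable_EFinP; exact: (measurable_fun_cvg mF FG).
have iM : m.-integrable D (fun=> M%:E).
  apply: (measurable_bounded_integrable (f := fun=> M)) => //.
  by exists `|M|; split; [exact: num_real|move=> N MN x _; exact: ltW].
have [iG _ cv] := @dominated_convergence _ _ _ m D mD (fun n x => (F n x)%:E) (fun x => (G x)%:E)
  (fun=> M%:E) mF' mG (aeW _ FG') iM (aeW _ (fun x n Dx => FM n x Dx)).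
by move: cv; rewrite -(fineK (integrable_fin_num mD iG)) => /fine_cvg.
Qed.

Lemma cRintegral_dominated (m : {measure set T -> \bar R}) (D : set T) (F : nat -> T -> R[i])
    (G : T -> R[i]) (M : R) : measurable D -> (m D < +oo)%E ->
  (forall n, cmeasurable D (F n)) ->
  (forall n x, D x -> normc (F n x) <= M) -> (forall x, D x -> F n x @[n --> \oo] --> G x) ->
  cRintegral m D (F n) @[n --> \oo] --> cRintegral m D G.
Proof.
move=> mD mfin mF FM FG; apply/cvg_ReIm; split; apply: (Rintegral_dominated (M := M)) => //.
- by move=> n; case: (mF n).
- by move=> n x Dx; apply: le_trans (FM n x Dx); exact: Re_normc.
- by move=> x /FG /cvg_ReIm[].
- by move=> n; case: (mF n).
- by move=> n x Dx; apply: le_trans (FM n x Dx); exact: Im_normc.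
- by move=> x /FG /cvg_ReIm[].
Qed.

Lemma cmintegral_dominated (lam : complex_measure T R) (F : nat -> T -> R[i])
    (G : T -> R[i]) (M : R) :
  (forall n, cmeasurable setT (F n)) ->
  (forall n x, normc (F n x) <= M) -> (forall x, F n x @[n --> \oo] --> G x) ->
  cmintegral lam setT (F n) @[n --> \oo] --> cmintegral lam setT G.
Proof.
move=> mF FM FG; have [m1 [m2 [m3 [m4 [_ _ _ E]]]]] := cmintegral_parts lam.
have c (m : {finite_measure set T -> \bar R}) :
    cRintegral m setT (F n) @[n --> \oo] --> cRintegral m setT G.
  by apply: (cRintegral_dominated (M := M)) => //; exact: finite_measure_lty.
rewrite E; under eq_cvg do rewrite E.
have ci : (fun=> 'i%C : R[i]) @ \oo --> ('i%C : R[i]) by exact: cvg_cst.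
exact: (cvgD (cvgB (c m1) (c m2)) (cvgM ci (cvgB (c m3) (c m4)))).
Qed.

Lemma cmintegral_dominated_at_right (lam : complex_measure T R) (F : R -> T -> R[i])
    (G : T -> R[i]) (M : R) :
  (forall y, 0 < y < 1 -> cmeasurable setT (F y)) ->
  (forall y x, 0 < y < 1 -> normc (F y x) <= M) ->
  (forall x, F y x @[y --> 0^'+] --> G x) ->
  cmintegral lam setT (F y) @[y --> 0^'+] --> cmintegral lam setT G.
Proof.
move=> mF FM FG.
have key (u : nat -> R) : (forall n, 0 < u n) -> u n @[n --> \oo] --> 0 ->
    cmintegral lam setT (F (u n)) @[n --> \oo] --> cmintegral lam setT G.
  (* The hypotheses hold only for 0 < y < 1, and a sequence tending to 0 is below 1 only eventually;
     the finitely many other terms are replaced by 1 / 2. *)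
  move=> u0 cu; pose v n : R := if u n < 1 then u n else 1 / 2.
  have v01 n : 0 < v n < 1.
    by rewrite /v; case: ifPn => [->|_]; rewrite ?u0//; apply/andP; split; lra.
  have ev : \forall n \near \oo, u n = v n.
    have /cvgrPdist_lt/(_ 1 ltr01) := cu; apply: filterS => n.
    by rewrite sub0r normrN gtr0_norm// /v => ->.
  have cv : v n @[n --> \oo] --> 0 by apply: cvg_trans cu; exact: near_eq_cvg.
  have c1 : cmintegral lam setT (F (v n)) @[n --> \oo] --> cmintegral lam setT G.
    apply: (cmintegral_dominated (M := M)) => [n|n x|x].
    - exact: mF.
    - exact: FM.
    - have /cvg_ReIm[c1 c2] := FG x; apply/cvg_ReIm; split.
        by move/cvg_at_rightP : c1; apply; split => // n; case/andP: (v01 n).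
      by move/cvg_at_rightP : c2; apply; split => // n; case/andP: (v01 n).
  apply: cvg_trans c1; apply: near_eq_cvg; apply: filterS ev => n -> //.
by apply/cvg_ReIm; split; apply/cvg_at_rightP => u [u0 cu]; have /cvg_ReIm[] := key u u0 cu.
Qed.

Definition atom_measure (lam : complex_measure T R) p (a : R[i]) :=
  ComplexMeasure (atom_charge (cmRe lam) p (Re a)) (atom_charge (cmIm lam) p (Im a)).

Lemma cmintegral_atom (lam : complex_measure T R) p a f : measurable [set p] ->
  bmeasurable f -> cmintegral (atom_measure lam p a) setT f = cmintegral lam setT f + a * f p.
Proof.
move=> mp bf; rewrite /cmintegral /= !charge_integral_atom//.
rewrite [in RHS](complexE_ReIm a); ring.
Qed.

Lemma atom_measureE (lam : complex_measure T R) p a A : measurable A ->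
  atom_measure lam p a A = lam A + a * ((\1_A p)%:C : R[i]).
Proof.
move=> mA; rewrite /cmval /= !atom_chargeE.
rewrite !fineD ?fin_num_measure//=.
apply/eqP; rewrite eq_complex; case: a => a b /=; apply/andP; split; apply/eqP; ring.
Qed.

End charge_operations.

Section circle_measures.
Context (R : realType).
Local Notation BX := (borel (xreal R)).

Lemma charge_integral_push (nu : {charge set (borel R) -> \bar R}) (f : BX -> R[i]) :
  bmeasurable f ->
  charge_integral (cpush nu) setT f = charge_integral nu setT (fun x => f (Some x)).
Proof.
move=> bf; have [P [N [nuPN _ ->]]] := charge_integral_jordan nu.
rewrite (@charge_integral_unique _ _ _ _ (mpush P) (mpush N))//.
- by rewrite !cRintegral_pushforward//; exact: finite_measure_lty.
- exact: finite_measure_lty.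
- exact: finite_measure_lty.
- by move=> A mA; rewrite [LHS]nuPN//; exact: measurable_preimage_Some.
Qed.

Lemma charge_integral_pull (nu : {charge set BX -> \bar R}) (f : BX -> R[i]) :
  bmeasurable f ->
  charge_integral nu setT f = charge_integral (cpull nu) setT (fun x => f (Some x)) +
    (fine (nu [set None]))%:C * f None.
Proof.
move=> bf; have [P [N [nuPN _ ->]]] := charge_integral_jordan nu.
have fin (m : {finite_measure set BX -> \bar R}) : (mpull m setT < +oo)%E.
  rewrite ltey_eq; apply/orP; left; apply: fin_num_measure; exact: measurable_range_Some.
rewrite (@charge_integral_unique _ _ _ _ (mpull P) (mpull N) _ (fin P) (fin N)); last 2 first.
- by move=> A mA; rewrite [LHS]nuPN//; exact: measurable_image_Some.
- exact: bmeasurable_Some.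
rewrite nuPN; last exact: measurable_None.
have := fin_num_measure P _ (@measurable_None R).
have := fin_num_measure N _ (@measurable_None R).
rewrite !(cRintegral_circle _ bf); [|exact: finite_measure_lty|exact: finite_measure_lty].
by move=> fN fP; rewrite fineB// rmorphB /=; ring.
Qed.

Definition push_measure (lam : complex_measure (borel R) R) : complex_measure BX R :=
  ComplexMeasure (cpush (cmRe lam)) (cpush (cmIm lam)).

Definition pull_measure (lam : complex_measure BX R) : complex_measure (borel R) R :=
  ComplexMeasure (cpull (cmRe lam)) (cpull (cmIm lam)).

Lemma cmintegral_push lam (f : BX -> R[i]) : bmeasurable f ->
  cmintegral (push_measure lam) setT f = cmintegral lam setT (fun x => f (Some x)).
Proof. by move=> bf; rewrite /cmintegral /= !charge_integral_push. Qed.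

Lemma cmintegral_pull lam (f : BX -> R[i]) : bmeasurable f ->
  cmintegral lam setT f = cmintegral (pull_measure lam) setT (fun x => f (Some x)) +
    lam [set None] * f None.
Proof.
move=> bf; rewrite /cmintegral /= !charge_integral_pull//.
rewrite (complexE_ReIm (lam [set None])) /=.
by move: (charge_integral _ _ _) (charge_integral _ _ _) ((fine _)%:C) ((fine _)%:C) (f None) => J K x y w; ring.
Qed.

End circle_measures.

(** * Fubini for a complex measure in the second variable *)

Section fubini.
Context d1 d2 (T1 : measurableType d1) (T2 : measurableType d2) (R : realType).
Variables (m1 : {sigma_finite_measure set T1 -> \bar R}).

(** A majorant depending on the first variable alone suffices because [m2] is finite: it makes [F]
    integrable for the product measure. *)
Lemma Rfubini (m2 : {finite_measure set T2 -> \bar R}) (F : T1 * T2 -> R) (h : T1 -> R) :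
  measurable_fun setT F -> m1.-integrable setT (EFin \o h) ->
  (forall x s, `|F (x, s)| <= h x) ->
  [/\ m1.-integrable setT (EFin \o (fun x => \int[m2]_s F (x, s))),
      measurable_fun setT (fun s => \int[m1]_x F (x, s)) &
      \int[m1]_x \int[m2]_s F (x, s) = \int[m2]_s \int[m1]_x F (x, s)].
Proof.
move=> mF ih Fh.
have mF' : measurable_fun setT (EFin \o F) by exact/measurable_EFinP.
have m2fin := finite_measure_lty m2.
have i2 x : m2.-integrable setT (fun s => (F (x, s))%:E).
  apply: (measurable_bounded_integrable (f := fun s => F (x, s))) => //.
    by apply: measurableT_comp mF _; exact: pair1_measurable.
  by exists (h x); split; [exact: num_real|move=> N hN s _; apply: le_trans (ltW hN)].
have i1 s : m1.-integrable setT (fun x => (F (x, s))%:E).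
  apply: le_integrable ih => //.
    by apply/measurable_EFinP; apply: measurableT_comp mF _; exact: pair2_measurable.
  move=> x _ /=; rewrite lee_fin; apply: le_trans (Fh x s) _; exact: ler_norm.
have h0 x : 0 <= h x by apply: le_trans (Fh x point).
have iF : (m1 \x m2)%E.-integrable setT (EFin \o F).
  apply/integrable12ltyP => //.
  have ih2 : m1.-integrable setT (fun x => (h x)%:E * (m2 setT))%E.
    rewrite -(fineK (fin_num_measure m2 _ measurableT)).
    apply: eq_integrable (integrableZr measurableT (fine (m2 setT)) ih) => // x _.
  have [mh2 fin2] := integrableP _ _ _ ih2.
  apply: le_lt_trans fin2; apply: ge0_le_integral => //.
  - by move=> x _; exact: integral_ge0.
  - apply: (measurable_fun_fubini_tonelli_F (fun p => `|(F p)%:E|%E)) => //.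
    exact: measurableT_comp.
  - exact: measurableT_comp.
  - move=> x _; apply: (@le_trans _ _ (\int[m2]_(s in setT) (h x)%:E)%E).
      apply: ge0_le_integral => //.
      + by apply: measurableT_comp => //; case/integrableP: (i2 x).
      + by move=> s _; rewrite lee_fin.
    by rewrite integral_cst//; exact: lee_abs.
have E2 x : (\int[m2]_s (F (x, s))%:E = (\int[m2]_s F (x, s))%:E)%E.
  by rewrite fineK//; exact: integrable_fin_num.
have E1 s : (\int[m1]_x (F (x, s))%:E = (\int[m1]_x F (x, s))%:E)%E.
  by rewrite fineK//; exact: integrable_fin_num.
split.
- by apply: eq_integrable (integrable_fubini_F iF) => // x _ /=; rewrite -E2.
- apply/measurable_EFinP; have := measurable_fubini_G iF.
  by congr measurable_fun; apply/funext => s /=; rewrite -E1.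
- rewrite {1}/Rintegral [in RHS]/Rintegral; congr fine.
  under eq_integral do rewrite -E2; rewrite (Fubini iF).
  by apply: eq_integral => s _; rewrite /= E1.
Qed.

Lemma cmfubini (lam : complex_measure T2 R) (F : T1 * T2 -> R[i]) (h : T1 -> R) :
  cmeasurable setT F -> m1.-integrable setT (EFin \o h) ->
  (forall x s, normc (F (x, s)) <= h x) ->
  cmeasurable setT (fun s => cRintegral m1 setT (fun x => F (x, s))) /\
  cRintegral m1 setT (fun x => cmintegral lam setT (fun s => F (x, s))) =
  cmintegral lam setT (fun s => cRintegral m1 setT (fun x => F (x, s))).
Proof.
move=> [mF1 mF2] ih Fh.
have Fh1 x s : `|Re (F (x, s))| <= h x by apply: le_trans (Re_normc _) _.
have Fh2 x s : `|Im (F (x, s))| <= h x by apply: le_trans (Im_normc _) _.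
have H1 (m : {finite_measure set T2 -> \bar R}) := Rfubini m mF1 ih Fh1.
have H2 (m : {finite_measure set T2 -> \bar R}) := Rfubini m mF2 ih Fh2.
have [m_1 [m_2 [m_3 [m_4 [_ _ _ E]]]]] := cmintegral_parts lam.
split; first by split; [case: (H1 m_1)|case: (H2 m_1)].
have I (m : {finite_measure set T2 -> \bar R}) :
    cintegrable m1 setT (fun x => cRintegral m setT (fun s => F (x, s))).
  by split; [case: (H1 m)|case: (H2 m)].
have J (m : {finite_measure set T2 -> \bar R}) :
    cRintegral m1 setT (fun x => cRintegral m setT (fun s => F (x, s))) =
    cRintegral m setT (fun s => cRintegral m1 setT (fun x => F (x, s))).
  by rewrite {1 3}/cRintegral /=; congr (_ +i* _); [case: (H1 m)|case: (H2 m)].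
rewrite E; under [X in cRintegral m1 setT X]funext do rewrite E.
have B1 := cintegrableB measurableT (I m_1) (I m_2).
have B2 := cintegrableB measurableT (I m_3) (I m_4).
rewrite (cRintegralD measurableT B1 (cintegrableZ measurableT 'i%C B2)).
rewrite (cRintegralZ measurableT 'i%C B2).
by rewrite (cRintegralB measurableT (I m_1) (I m_2)) (cRintegralB measurableT (I m_3) (I m_4)) !J.
Qed.

End fubini.

(** * The Poisson kernel and boundary values of Cauchy transforms *)

Section poisson_kernel.
Context (R : realType).
Local Notation leb := (@lebesgue_measure R).
Implicit Types (x s y A B : R) (f : R -> R).

Definition poisson y s x : R := y / (pi * ((x - s) ^+ 2 + y ^+ 2)).

Let pi1 : 1 <= pi :> R. Proof. by apply: le_trans (pi_ge2 R); rewrite ler1n. Qed.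

Let den0 y s x : 0 < y -> 0 < (x - s) ^+ 2 + y ^+ 2.
Proof. by move=> y0; rewrite ltr_wpDl ?sqr_ge0// exprn_gt0. Qed.

Lemma poisson_ge0 y s x : 0 < y -> 0 <= poisson y s x.
Proof. by move=> y0; rewrite divr_ge0 ?mulr_ge0 ?pi_ge0 ?(ltW (den0 _ _ y0))// ltW. Qed.

(** Both follow from pi >= 1, the first also from |x - s| y <= (x - s)^2 + y^2. The first bound
    dominates Lipschitz differences; the second gives decay away from [s] as y tends to 0 and
    controls the weight 1 + s^2. *)
Lemma poisson_bounds y s x : 0 < y ->
  `|x - s| * poisson y s x <= 1 /\ (x - s) ^+ 2 * poisson y s x <= y.
Proof.
move=> y0; have d0 := den0 s x y0; have dp : 0 < pi * ((x - s) ^+ 2 + y ^+ 2) by rewrite mulr_gt0 ?pi_gt0.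
have d1 : (x - s) ^+ 2 + y ^+ 2 <= pi * ((x - s) ^+ 2 + y ^+ 2) by rewrite ler_peMl// ltW.
rewrite /poisson !mulrA !ler_pdivrMr//; split.
  rewrite mul1r; apply: le_trans d1.
  have -> : (x - s) ^+ 2 = `|x - s| ^+ 2 by rewrite real_normK ?num_real.
  have := sqr_ge0 (`|x - s| - y); have := sqr_ge0 (`|x - s|); have := sqr_ge0 y.
  by rewrite sqrrB; move: `|x - s| => u; rewrite -mulr_natl; lra.
rewrite mulrC ler_wpM2l ?(ltW y0)//; apply: le_trans d1.
by rewrite lerDl sqr_ge0.
Qed.

Lemma poisson_bound_off y s x : 0 < y -> x != s -> `|x - s| * poisson y s x <= y / `|x - s|.
Proof.
move=> y0 xs; have u0 : 0 < `|x - s| by rewrite normr_gt0 subr_eq0.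
have [_ h] := poisson_bounds s x y0.
by rewrite ler_pdivlMr// mulrAC -expr2 real_normK ?num_real.
Qed.

Lemma poisson_derive y s x : 0 < y ->
  is_derive x 1 (fun x => atan ((x - s) / y) / pi) (poisson y s x).
Proof.
move=> y0.
have d1 : is_derive x 1 (fun x => (x - s) / y) y^-1.
  have := is_derive_poly ((y^-1)%:P * 'X + (- s / y)%:P) x.
  rewrite derivD derivM !derivC derivX mul0r add0r mulr1 addr0 hornerC.
  congr (is_derive _ _ _ _); apply/funext => t; rewrite !hornerE.
  by rewrite mulrBl mulrC mulNr.
have d2 := @is_derive1_comp R atan (fun x => (x - s) / y) x _ _ (is_derive1_atan _) d1.
have d3 := is_deriveZ pi^-1 d2.
have -> : (fun x => atan ((x - s) / y) / pi) = pi^-1 *: (atan \o (fun x => (x - s) / y)).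
  by apply/funext => t; rewrite /= mulrC.
apply: (is_derive_eq d3); rewrite /poisson /GRing.scale /=.
have p0 : pi != 0 :> R by rewrite gt_eqF ?pi_gt0.
have y00 : y != 0 by rewrite gt_eqF.
have -> : 1 + ((x - s) / y) ^+ 2 = ((x - s) ^+ 2 + y ^+ 2) / y ^+ 2.
  by rewrite expr_div_n mulrDl divff ?expf_neq0// addrC.
have dn : (x - s) ^+ 2 + y ^+ 2 != 0 by rewrite gt_eqF// den0.
rewrite invf_div invfM; move: p0 dn; move: (pi : R) (_ + _) => p D p0 dn.
by rewrite expr2 -!mulrA [D^-1 / y]mulrC mulVKf// mulrCA.
Qed.

Lemma poisson_continuous y s x : 0 < y -> {for x, continuous (poisson y s)}.
Proof.
move=> y0; apply: cvgM; first exact: cvg_cst.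
apply: cvgV; first by rewrite gt_eqF// mulr_gt0 ?pi_gt0// den0.
apply: cvgM; first exact: cvg_cst.
apply: cvgD; last exact: cvg_cst.
have h : (fun x => x - s) @ x --> x - s by apply: cvgB; [exact: cvg_id|exact: cvg_cst].
by rewrite /= expr2; under eq_cvg do rewrite expr2; exact: cvgM.
Qed.

Lemma segment_integrable (g : R -> R) a b : (forall t, a <= t <= b -> {for t, continuous g}) ->
  leb.-integrable `[a, b] (EFin \o g).
Proof.
move=> cg; have cg' t : a <= t <= b -> {for t, continuous (fun t => (g t)%:C : R[i])}.
  by move=> ht; apply: continuous_real; exact: cg.
by case: (segint_integrable cg').
Qed.

Lemma poisson_mass y s B : 0 < y -> - B <= B -> \int[leb]_(x in `[- B, B]) poisson y s x =
  atan ((B - s) / y) / pi - atan ((- B - s) / y) / pi.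
Proof.
move=> y0 BB.
have cg' t : - B <= t <= B -> {for t, continuous (fun t => (poisson y s t)%:C : R[i])}.
  by move=> ht; apply: continuous_real; exact: poisson_continuous.
have := segint_FTC (G := fun x => (atan ((x - s) / y) / pi)%:C) BB _ cg'.
move=> /(_ (fun t _ => rderive_real (poisson_derive s t y0))).
by move=> /(congr1 (@complex.Re R)) h; apply: etrans h _; rewrite raddfB.
Qed.

Lemma poisson_mass_le1 y s B : 0 < y -> - B <= B -> \int[leb]_(x in `[- B, B]) poisson y s x <= 1.
Proof.
move=> y0 BB; rewrite poisson_mass// -mulrBl ler_pdivrMr ?pi_gt0// mul1r.
have := atan_ltpi2 ((B - s) / y); have := atan_gtNpi2 ((- B - s) / y); lra.
Qed.

Lemma atan_cvg (c : R) (u : nat -> R) : 0 < c -> (forall n, 0 < u n) -> u n @[n --> \oo] --> 0 ->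
  atan (c / u n) @[n --> \oo] --> pi / 2.
Proof.
move=> c0 u0 cu; apply/cvgrPdist_lt => e e0.
have /cvgrPdist_lt/(_ e e0) := @cvgy_atan R; move=> [N [_ HN]].
have m0 : 0 < c / (`|N| + 1) by rewrite divr_gt0// ltr_wpDl.
have /cvgrPdist_lt/(_ _ m0) := cu; apply: filterS => n.
rewrite sub0r normrN gtr0_norm// => hn; apply: HN.
apply: (@lt_le_trans _ _ (`|N| + 1)); first by have := ler_norm N; lra.
by rewrite ler_pdivlMr// mulrC -ler_pdivlMr ?ltr_wpDl// ltW.
Qed.

Lemma poisson_mass_cvg s B (u : nat -> R) : `|s| < B -> (forall n, 0 < u n) ->
  u n @[n --> \oo] --> 0 -> \int[leb]_(x in `[- B, B]) poisson (u n) s x @[n --> \oo] --> (1 : R).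
Proof.
move=> sB u0 cu; have B0 : 0 < B by exact: le_lt_trans sB.
have [h1 h2] : 0 < B - s /\ 0 < B + s.
  by move: sB; rewrite ltr_norml => /andP[]; split; lra.
have -> : (fun n => \int[leb]_(x in `[- B, B]) poisson (u n) s x) =
    (fun n => pi^-1 * (atan ((B - s) / u n) + atan ((B + s) / u n))).
  apply/funext => n; rewrite poisson_mass//; last by lra.
  have -> : (- B - s) / u n = - ((B + s) / u n) by rewrite -mulNr opprD.
  by rewrite atanN mulNr opprK -mulrDl mulrC.
have c := cvgD (atan_cvg h1 u0 cu) (atan_cvg h2 u0 cu).
have -> : (1 : R) = pi^-1 * (pi / 2 + pi / 2).
  by rewrite -splitr mulVf// gt_eqF ?pi_gt0.
by apply: cvgM; [exact: cvg_cst|exact: c].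
Qed.

Lemma smooth_lipschitz f B : smooth f -> exists2 L : R, 0 <= L & forall x s,
  - B <= x <= B -> - B <= s <= B -> `|f x - f s| <= L * `|x - s|.
Proof.
move=> sf; have [BB|BB] := leP (- B) B; last first.
  by exists 0 => // x s /andP[h1 h2]; have := le_trans h1 h2; rewrite leNgt BB.
have cf : {within `[- B, B], continuous (fun t => `|f^`()%classic t|)}.
  by apply: continuous_subspaceT => x; apply: cvg_norm; apply: smooth_continuous; exact: smooth_derive1.
have [c _ hc] := @EVT_max R (fun t => `|f^`()%classic t|) (- B) B BB cf.
exists `|f^`()%classic c| => // x s.
have key (a b : R) : - B <= a <= B -> - B <= b <= B -> a <= b -> `|f b - f a| <= `|f^`()%classic c| * `|b - a|.
  move=> /andP[a1 a2] /andP[b1 b2] ab.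
  have [k hk ->] := @MVT_segment R f (f^`()%classic) a b ab (fun t _ => smooth_is_derive t sf)
    (continuous_subspaceT (fun t => smooth_continuous sf)).
  rewrite normrM ler_wpM2r//; apply: hc; move: hk; rewrite !in_itv /= => /andP[k1 k2].
  by rewrite (le_trans a1 k1) (le_trans k2 b2).
move=> hx hs; have [xs|/ltW sx] := leP x s; last exact: key.
by rewrite distrC [`|x - s|]distrC; exact: key.
Qed.

(** The jump of [kernel] across the line with the normalisation of boundary measures, see
    [kernel_jump]: 1 + s^2 comes from the numerator of the kernel, 1 + x^2 from the
    normalisation. *)
Definition poisson_weight y x s : R := (1 + s ^+ 2) / (1 + x ^+ 2) * poisson y s x.

Let w0 x : 0 < 1 + x ^+ 2. Proof. by rewrite ltr_wpDr ?sqr_ge0. Qed.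

Lemma poisson_weight_ge0 y x s : 0 < y -> 0 <= poisson_weight y x s.
Proof. by move=> y0; rewrite mulr_ge0 ?poisson_ge0// divr_ge0// ltW. Qed.

(** The factor 1 + s^2 is unbounded; it is at most 2 (1 + x^2) + 2 (x - s)^2, with difference 1 + (s
    - 2 x)^2, and the second term is absorbed by (x - s)^2 P <= y < 1. *)
Lemma poisson_weight_le y x s : 0 < y -> y < 1 -> poisson_weight y x s <= 2 * poisson y s x + 2.
Proof.
move=> y0 y1; have [_ h] := poisson_bounds s x y0; have p0 := poisson_ge0 s x y0.
rewrite /poisson_weight mulrAC ler_pdivrMr//.
have h1 : 1 + s ^+ 2 <= 2 * (1 + x ^+ 2) + 2 * (x - s) ^+ 2.
  rewrite -subr_ge0.
  have -> : 2 * (1 + x ^+ 2) + 2 * (x - s) ^+ 2 - (1 + s ^+ 2) = 1 + (s - 2 * x) ^+ 2 by ring.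
  by rewrite addr_ge0// sqr_ge0.
apply: le_trans (ler_wpM2r p0 h1) _.
have h2 : 1 <= 1 + x ^+ 2 by rewrite lerDl sqr_ge0.
move: h p0 h2; move: (poisson y s x) ((x - s) ^+ 2) (1 + x ^+ 2) => p v w h p0 h2.
have -> : (2 * w + 2 * v) * p = 2 * p * w + 2 * (v * p) by ring.
by rewrite [leRHS]mulrDl lerD2l ler_pM2l// (le_trans h)// (le_trans (ltW y1)).
Qed.

Lemma Rintegral_support (g : R -> R) B : (forall x, B < `|x| -> g x = 0) ->
  \int[leb]_x g x = \int[leb]_(x in `[- B, B]) g x.
Proof.
move=> g0; rewrite [RHS]Rintegral_mkcond; congr (Rintegral _ _ _); apply/funext => x.
rewrite patchE; case: ifPn => // /negP xB; apply: g0; rewrite ltNge; apply/negP => h.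
by apply: xB; rewrite inE /= in_itv /= -ler_norml.
Qed.

(** The Poisson kernel has mass at most 1, so the majorant 2 M P + 2 M has integral at most 2 M + 4
    A M over [-A, A]. Uniformity in [s] provides the dominating constant for integration against the
    measure. *)
Lemma poisson_weight_bounded f A M : 0 <= A -> (forall x, {for x, continuous f}) ->
  (forall x, A < `|x| -> f x = 0) -> (forall x, `|f x| <= M) ->
  forall y s, 0 < y < 1 -> `|\int[leb]_x (f x * poisson_weight y x s)| <= M * (2 + 4 * A).
Proof.
move=> A0 cf f0 fM y s /andP[y0 y1].
have M0 : 0 <= M by exact: le_trans (fM 0).
rewrite (@Rintegral_support _ A); last by move=> x /f0 ->; rewrite mul0r.
have AA : - A <= A by lra.
have cw (t : R) : {for t, continuous (poisson_weight y ^~ s)}.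
  apply: cvgM; last exact: poisson_continuous.
  apply: cvgM; first exact: cvg_cst.
  apply: cvgV; first by rewrite gt_eqF.
  apply: cvgD; first exact: cvg_cst.
  by rewrite /= expr2; under eq_cvg do rewrite expr2; apply: cvgM; exact: cvg_id.
have i1 : leb.-integrable `[- A, A] (EFin \o (fun x => f x * poisson_weight y x s)).
  by apply: segment_integrable => t _; apply: cvgM; [exact: cf|exact: cw].
have i2 : leb.-integrable `[- A, A] (EFin \o (poisson y s)).
  by apply: segment_integrable => t _; exact: poisson_continuous.
have i4 : leb.-integrable `[- A, A] (EFin \o (cst (2 * M))).
  by apply: segment_integrable => t _; exact: cst_continuous.
have i3 : leb.-integrable `[- A, A] (EFin \o (fun x => (2 * M) * poisson y s x)).
  by apply: segment_integrable => t _; apply: cvgM; [exact: cvg_cst|exact: poisson_continuous].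
apply: le_trans (le_normr_Rintegral _ i1) _ => //.
apply: (@le_trans _ _ (\int[leb]_(x in `[- A, A]) ((2 * M) * poisson y s x + cst (2 * M) x))).
  apply: le_Rintegral => //.
  - exact: integrable_norm.
  - by apply: eq_integrable (integrableD _ i3 i4).
  - move=> x _; rewrite normrM [`|poisson_weight _ _ _|]ger0_norm ?poisson_weight_ge0//.
    have := ler_pM (normr_ge0 (f x)) (poisson_weight_ge0 x s y0) (fM x) (poisson_weight_le x s y0 y1).
    by rewrite /=; lra.
rewrite RintegralD// RintegralZl// Rintegral_cst_itv//.
have := poisson_mass_le1 s y0 AA; move: (\int[leb]_(x in _) _) => I hI.
have := ler_wpM2l M0 hI; lra.
Qed.

(** After splitting off f(s) times the Poisson mass, which tends to 1, the factor [q] vanishes at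
    [s] with a linear bound. As |x - s| P <= 1, the remaining integrand is bounded by K, and it
    tends to 0 pointwise: dominated convergence replaces the usual splitting into near and far
    parts. *)
Lemma poisson_weight_cvg f A s (u : nat -> R) : 0 <= A -> smooth f ->
  (forall x, A < `|x| -> f x = 0) -> (forall n, 0 < u n) -> u n @[n --> \oo] --> 0 ->
  \int[leb]_x (f x * poisson_weight (u n) x s) @[n --> \oo] --> f s.
Proof.
(* The interval must contain the support of [f] and have [s] in its interior, for otherwise the
   Poisson mass would not tend to 1. *)
move=> A0 sf f0 u0 cu; pose B := A + `|s| + 1.
have sB : `|s| < B by rewrite /B; lra.
have B0 : 0 < B by exact: le_lt_trans sB.
have BB : - B <= B by lra.
have f0' x : B < `|x| -> f x = 0 by move=> h; apply: f0; move: h (normr_ge0 s); rewrite /B; lra.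
have [L L0 HL] := smooth_lipschitz B sf.
pose q x := f x * ((1 + s ^+ 2) / (1 + x ^+ 2)) - f s.
pose K := L * (1 + s ^+ 2) + `|f s| * (2 * B).
have K0 : 0 <= K.
  by rewrite addr_ge0// mulr_ge0//; [exact: ltW (w0 s)|rewrite mulr_ge0// ltW].
have qK x : - B <= x <= B -> `|q x| <= K * `|x - s|.
  move=> hx; have hs : - B <= s <= B by rewrite -ler_norml ltW.
  have w1 : 1 <= 1 + x ^+ 2 by rewrite lerDl sqr_ge0.
  have -> : q x = (f x - f s) * (1 + s ^+ 2) / (1 + x ^+ 2) + f s * ((s + x) * (s - x)) / (1 + x ^+ 2).
    by rewrite /q; field; rewrite gt_eqF.
  have dv (a : R) : `|a / (1 + x ^+ 2)| <= `|a|.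
    rewrite normrM normfV [`|1 + _|]gtr0_norm// ler_pdivrMr// ler_peMr//.
  apply: le_trans (ler_normD _ _) _; rewrite /K [leRHS]mulrDl; apply: lerD; apply: le_trans (dv _) _.
    by rewrite normrM [`|1 + _|]gtr0_norm// mulrAC ler_wpM2r ?(ltW (w0 s))// HL.
  rewrite !normrM -mulrA ler_wpM2l// [`|s - x|]distrC ler_wpM2r//.
  apply: le_trans (ler_normD _ _) _; have : `|x| <= B by rewrite ler_norml.
  by move: sB; lra.
have cq (t : R) : {for t, continuous q}.
  apply: cvgB; last exact: cvg_cst.
  apply: cvgM; first exact: smooth_continuous.
  apply: cvgM; first exact: cvg_cst.
  apply: cvgV; first by rewrite gt_eqF.
  apply: cvgD; first exact: cvg_cst.
  by rewrite /= expr2; under eq_cvg do rewrite expr2; apply: cvgM; exact: cvg_id.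
have i1 n : leb.-integrable `[- B, B] (EFin \o (fun x => q x * poisson (u n) s x)).
  by apply: segment_integrable => t _; apply: cvgM; [exact: cq|exact: poisson_continuous].
have i2 n : leb.-integrable `[- B, B] (EFin \o (poisson (u n) s)).
  by apply: segment_integrable => t _; exact: poisson_continuous.
have i3 n : leb.-integrable `[- B, B] (EFin \o (fun x => f s * poisson (u n) s x)).
  by apply: segment_integrable => t _; apply: cvgM; [exact: cvg_cst|exact: poisson_continuous].
have -> : (fun n => \int[leb]_x (f x * poisson_weight (u n) x s)) =
    (fun n => \int[leb]_(x in `[- B, B]) (q x * poisson (u n) s x) +
      f s * \int[leb]_(x in `[- B, B]) poisson (u n) s x).
  apply/funext => n; rewrite (@Rintegral_support _ B); last by move=> x /f0' ->; rewrite mul0r.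
  rewrite -RintegralZl// -RintegralD//; apply: eq_Rintegral => x _.
  by rewrite /poisson_weight /q; ring.
suff c : \int[leb]_(x in `[- B, B]) (q x * poisson (u n) s x) @[n --> \oo] --> (0 : R).
  have ck : (fun=> f s) @ \oo --> f s by exact: cvg_cst.
  by have := cvgD c (cvgM ck (poisson_mass_cvg sB u0 cu)); rewrite add0r mulr1; apply.
have -> : (0 : R) = \int[leb]_(x in `[- B, B]) cst 0 x by rewrite Rintegral_cst_itv// mul0r.
apply: (Rintegral_dominated (M := K)) => //.
- by apply: compact_finite_measure; exact: segment_compact.
- by move=> n; apply/measurable_EFinP; case/integrableP: (i1 n).
- move=> n x; rewrite /= in_itv /= => hx; rewrite normrM [`|poisson _ _ _|]ger0_norm ?poisson_ge0//.
  have [h _] := poisson_bounds s x (u0 n).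
  apply: le_trans (ler_wpM2r (poisson_ge0 s x (u0 n)) (qK x hx)) _.
  by rewrite -mulrA ler_piMr.
- move=> x; rewrite /= in_itv /= => hx; have [->|xs] := eqVneq x s.
    have -> : (fun n => q s * poisson (u n) s s) = cst 0; last exact: cvg_cst.
    by apply/funext => n; rewrite /q divff ?gt_eqF// mulr1 subrr mul0r.
  apply/cvgr0Pnorm_le => e e0.
  have c0 : 0 < e * `|x - s| / (K + 1).
    by rewrite divr_gt0 ?ltr_wpDl// mulr_gt0// normr_gt0 subr_eq0.
  have /cvgrPdist_lt/(_ _ c0) := cu; apply: filterS => n; rewrite sub0r normrN gtr0_norm// => hn.
  rewrite normrM [`|poisson _ _ _|]ger0_norm ?poisson_ge0//.
  apply: le_trans (ler_wpM2r (poisson_ge0 s x (u0 n)) (qK x hx)) _.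
  have u00 : 0 < `|x - s| by rewrite normr_gt0 subr_eq0.
  rewrite -mulrA; apply: le_trans (ler_wpM2l K0 (poisson_bound_off (u0 n) xs)) _.
  rewrite mulrA ler_pdivrMr//; move: hn; rewrite ltr_pdivlMr ?ltr_wpDl// => hn.
  by apply: le_trans (ltW hn); rewrite mulrC ler_wpM2l ?(ltW (u0 n))// lerDl.
Qed.

End poisson_kernel.

(** * The kernel (1 + sz)/(s - z) and the Cauchy transform *)

Section cauchy_kernel.
Context (R : realType).
Implicit Types (x s y : R) (z w : R[i]) (lam : complex_measure (borel R) R).

Lemma nonreal_dist s z : `|Im z| <= normc (s%:C - z).
Proof. by apply: le_trans (Im_normc _); rewrite raddfB /= sub0r normrN. Qed.

Lemma nonreal_neq s z : Im z != 0 -> s%:C - z != 0.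
Proof.
by move=> z0; rewrite -normc_gt0; apply: lt_le_trans (nonreal_dist s z); rewrite normr_gt0.
Qed.

(** In this form [s] occurs only in the denominator, so boundedness in [s] is visible. *)
Lemma kernelE z s : Im z != 0 -> kernel z s = z + (1 + z ^+ 2) / (s%:C - z).
Proof.
by move=> z0; rewrite /kernel; field; exact: nonreal_neq.
Qed.

Lemma kernel_bound z s : Im z != 0 ->
  normc (kernel z s) <= 2 * (1 + normc z ^+ 2) / `|Im z|.
Proof.
move=> z0; have y0 : 0 < `|Im z| by rewrite normr_gt0.
have n0 := lt_le_trans y0 (nonreal_dist s z).
rewrite kernelE//; apply: le_trans (le_normcD _ _) _.
rewrite Normc.normcM Normc.normcV ler_pdivlMr// mulrDl.
have h1 : normc z * `|Im z| <= normc z ^+ 2 by rewrite expr2 ler_wpM2l ?normc_ge0// Im_normc.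
have h2 : normc (1 + z ^+ 2) <= 1 + normc z ^+ 2.
  by apply: le_trans (le_normcD _ _) _; rewrite normcX Normc.normc1.
have h3 : normc (1 + z ^+ 2) * (normc (s%:C - z))^-1 * `|Im z| <= 1 + normc z ^+ 2.
  apply: le_trans h2; rewrite -mulrA ler_piMr ?normc_ge0// mulrC ler_pdivrMr// mul1r.
  exact: nonreal_dist.
by have := sqr_ge0 (normc z); lra.
Qed.

Lemma continuous_realC s : {for s, continuous (fun t : R => t%:C : R[i])}.
Proof. by apply: continuous_real; exact: cvg_id. Qed.

Lemma kernel_continuous z s : Im z != 0 -> {for s, continuous (kernel z)}.
Proof.
move=> z0; have cs := @continuous_realC s.
have cz : (fun=> z : R[i]) @ s --> z by exact: cvg_cst.
have c1 : (fun=> 1 : R[i]) @ s --> (1 : R[i]) by exact: cvg_cst.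
have d : (fun t : R => (t%:C - z)^-1) @ s --> (s%:C - z)^-1.
  by apply: cvgV; [exact: nonreal_neq|exact: (cvgB cs cz)].
exact: (cvgM (cvgD c1 (cvgM cs cz)) d).
Qed.

Lemma continuous_bmeasurable (f : R -> R[i]) M : (forall t, {for t, continuous f}) ->
  (forall t, normc (f t) <= M) -> bmeasurable (f : borel R -> R[i]).
Proof. by move=> cf fM; split; [exact: borel_continuous_cmeasurable|exists M]. Qed.

Lemma kernel_bmeasurable z : Im z != 0 -> bmeasurable (kernel z : borel R -> R[i]).
Proof.
move=> z0; apply: (@continuous_bmeasurable _ (2 * (1 + normc z ^+ 2) / `|Im z|)) => t.
  exact: kernel_continuous.
exact: kernel_bound.
Qed.

Lemma xkernel_bmeasurable z : Im z != 0 -> bmeasurable (xkernel z : borel (xreal R) -> R[i]).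
Proof. by move=> z0; apply: circle_bmeasurable; exact: kernel_bmeasurable. Qed.

(** Integration over the whole line; for measures concentrated on [S] it agrees off the real line
    with [cauchy_integral]. *)
Definition cauchy_transform lam z : R[i] := cmintegral lam setT (kernel z).

Lemma cauchy_transform_bound lam z : Im z != 0 ->
  normc (cauchy_transform lam z) <= cmtotal lam * (2 * (1 + normc z ^+ 2) / `|Im z|).
Proof.
move=> z0; have [_ h] := cmtotalP lam; apply: h; first exact: kernel_bmeasurable.
by move=> s; exact: kernel_bound.
Qed.

(** The function estimated is the z-derivative of [kernel]; |s| <= |s - z| + |z| makes it bounded in
    [s], hence integrable against any complex measure. *)
Lemma dkernel_bound z s : Im z != 0 ->
  normc ((1 + (s ^+ 2)%:C) / (s%:C - z) ^+ 2) <= 2 + (1 + 2 * normc z ^+ 2) / `|Im z| ^+ 2.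
Proof.
move=> z0; have y0 : 0 < `|Im z| by rewrite normr_gt0.
have n0 := lt_le_trans y0 (nonreal_dist s z).
rewrite Normc.normcM Normc.normcV normcX ler_pdivrMr ?exprn_gt0//.
have hs : `|s| <= normc (s%:C - z) + normc z.
  by have := le_normcD (s%:C - z) z; rewrite subrK normc_real.
have h1 : s ^+ 2 <= 2 * normc (s%:C - z) ^+ 2 + 2 * normc z ^+ 2.
  have -> : s ^+ 2 = `|s| ^+ 2 by rewrite real_normK ?num_real.
  have := sqr_ge0 (normc (s%:C - z) - normc z).
  have : `|s| ^+ 2 <= (normc (s%:C - z) + normc z) ^+ 2.
    by rewrite lerXn2r// ?nnegrE// addr_ge0// normc_ge0.
  rewrite sqrrB sqrrD -mulr_natl; lra.
have -> : normc (1 + (s ^+ 2)%:C) = 1 + s ^+ 2.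
  have -> : 1 + (s ^+ 2)%:C = (1 + s ^+ 2)%:C by rewrite rmorphD.
  by rewrite normc_real ger0_norm// addr_ge0// sqr_ge0.
rewrite mulrDl mulrAC -mulrA.
have h2 : 1 <= normc (s%:C - z) ^+ 2 / `|Im z| ^+ 2.
  by rewrite ler_pdivlMr ?exprn_gt0// mul1r lerXn2r ?nnegrE ?normc_ge0// nonreal_dist.
have k0 : 0 <= 1 + 2 * normc z ^+ 2 by rewrite addr_ge0// mulr_ge0// sqr_ge0.
have := ler_wpM2l k0 h2; lra.
Qed.

Lemma kernel_quad z h s : Im z != 0 -> normc h < `|Im z| / 2 ->
  kernel (z + h) s - kernel z s - h * ((1 + (s ^+ 2)%:C) / (s%:C - z) ^+ 2) =
  h ^+ 2 * ((1 + (s ^+ 2)%:C) / (s%:C - z) ^+ 2) / (s%:C - z - h) /\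
  `|Im z| / 2 <= normc (s%:C - z - h) .
Proof.
move=> z0 hh; have y0 : 0 < `|Im z| by rewrite normr_gt0.
have d2 : `|Im z| / 2 <= normc (s%:C - z - h).
  have := le_normcDl (s%:C - z) (- h); have := nonreal_dist s z.
  by rewrite normcN; lra.
have n1 := nonreal_neq s z0.
have n2 : s%:C - z - h != 0 by rewrite -normc_gt0; apply: lt_le_trans d2; rewrite divr_gt0.
split => //; rewrite /kernel.
have -> : (s ^+ 2)%:C = s%:C ^+ 2 by rewrite rmorphXn.
have -> : s%:C - (z + h) = s%:C - z - h by ring.
by field; rewrite n1 n2.
Qed.

Lemma cauchy_transform_derivable lam z : Im z != 0 -> derivable (cauchy_transform lam) z 1.
Proof.
move=> z0; have y0 : 0 < `|Im z| by rewrite normr_gt0.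
pose dk s : R[i] := (1 + (s ^+ 2)%:C) / (s%:C - z) ^+ 2.
pose K := 2 + (1 + 2 * normc z ^+ 2) / `|Im z| ^+ 2.
have bdk : bmeasurable (dk : borel R -> R[i]).
  apply: (@continuous_bmeasurable _ K) => t; last exact: dkernel_bound.
  have cz : (fun=> z : R[i]) @ t --> z by exact: cvg_cst.
  have c1 : (fun=> 1 : R[i]) @ t --> (1 : R[i]) by exact: cvg_cst.
  have cs := @continuous_realC t.
  have cd : (fun t : R => ((t%:C - z) ^+ 2)^-1) @ t --> ((t%:C - z) ^+ 2)^-1.
    apply: cvgV; first by rewrite expf_neq0// nonreal_neq.
    by rewrite expr2; under eq_cvg do rewrite expr2; exact: (cvgM (cvgB cs cz) (cvgB cs cz)).
  have cn : (fun t : R => 1 + (t ^+ 2)%:C : R[i]) @ t --> (1 + (t ^+ 2)%:C : R[i]).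
    apply: cvgD; first exact: cvg_cst.
    rewrite rmorphXn expr2; under eq_cvg do rewrite rmorphXn expr2.
    exact: (cvgM cs cs).
  exact: (cvgM cn cd).
have y2 : 0 < `|Im z| / 2 by rewrite divr_gt0.
suff : is_derive z (1 : R[i]) (cauchy_transform lam) (cmintegral lam setT dk) by case.
have [t0 Ht] := cmtotalP lam.
apply: (@is_cderive_quad _ _ _ _ (cmtotal lam * (K / (`|Im z| / 2))) (`|Im z| / 2)) => // h hh.
have zh0 : Im (z + h) != 0.
  have := Im_normc h; rewrite raddfD /= -normr_gt0 => hi.
  by have := lerB_normD (Im z) (Im h); lra.
have bz := kernel_bmeasurable z0; have bzh := kernel_bmeasurable zh0.
rewrite /cauchy_transform -cmintegralB// -cmintegralZ// -cmintegralB//; last first.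
- by apply: bmeasurableM => //; exact: bmeasurable_cst.
- exact: bmeasurableB.
rewrite -mulrA; apply: Ht.
  apply: bmeasurableB; first exact: bmeasurableB.
  by apply: bmeasurableM => //; exact: bmeasurable_cst.
move=> s; have [-> d2] := kernel_quad s z0 hh.
have := @dkernel_bound z s z0; move: ((1 + (s ^+ 2)%:C) / _) => D hD.
rewrite Normc.normcM Normc.normcV Normc.normcM normcX -mulrA mulrC ler_wpM2r ?sqr_ge0//.
apply: ler_pM; rewrite ?normc_ge0 ?invr_ge0 ?normc_ge0//.
by rewrite lef_pV2 ?posrE// (lt_le_trans y2).
Qed.

(** Over the common denominator (x - s)^2 + y^2, which is the product of the two conjugate ones, the
    numerators differ by 2 i y (1 + s^2). *)
Lemma kernel_jump x y s : 0 < y ->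
  (kernel (x +i* y) s - kernel (x -i* y) s) / (2 * pi%:C * 'i%C * (1 + x ^+ 2)%:C) =
  (poisson_weight y x s)%:C.
Proof.
move=> y0; have p0 : pi != 0 :> R by rewrite gt_eqF ?pi_gt0.
have w0 : 1 + x ^+ 2 != 0 by rewrite gt_eqF// ltr_wpDr ?sqr_ge0.
have d0 : (x - s) ^+ 2 + y ^+ 2 != 0 by rewrite gt_eqF// ltr_wpDl ?sqr_ge0// exprn_gt0.
have E1 : s%:C - (x +i* y) = - ((x - s) +i* y).
  by apply/eqP; rewrite eq_complex /= sub0r opprB !eqxx.
have E2 : s%:C - (x -i* y) = - ((x - s) -i* y).
  by apply/eqP; rewrite eq_complex /= sub0r opprB opprK !eqxx.
have n1 : (x - s) +i* y != 0 by rewrite eq_complex /= negb_and (gt_eqF y0) orbT.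
have n2 : (x - s) -i* y != 0 by rewrite eq_complex /= negb_and oppr_eq0 (gt_eqF y0) orbT.
have ND : ((x - s) +i* y) * ((x - s) -i* y) = ((x - s) ^+ 2 + y ^+ 2)%:C.
  by apply/eqP; rewrite eq_complex /=; apply/andP; split; apply/eqP; ring.
have -> : kernel (x +i* y) s - kernel (x -i* y) s =
   (2 * 'i%C * y%:C * (1 + s ^+ 2)%:C) / ((x - s) ^+ 2 + y ^+ 2)%:C.
  rewrite -ND /kernel E1 E2.
  have N : (1 + s%:C * (x -i* y)) * ((x - s) +i* y) - (1 + s%:C * (x +i* y)) * ((x - s) -i* y)
     = 2 * 'i%C * y%:C * (1 + s ^+ 2)%:C.
    by apply/eqP; rewrite eq_complex /=; apply/andP; split; apply/eqP; ring.
  rewrite -N; field; by rewrite n1 n2.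
have n0 : 'i%C != 0 :> R[i] by rewrite -normc_gt0 normci.
rewrite /poisson_weight /poisson !(rmorphM, fmorphV) /=.
have C0 (a : R) : a != 0 -> a%:C != 0 :> R[i] by move=> a0; rewrite eq_complex /= eqxx andbT.
move: (C0 _ p0) (C0 _ w0) (C0 _ d0); move: (pi%:C) ((1 + x ^+ 2)%:C) (((x - s) ^+ 2 + y ^+ 2)%:C) => p w d p1 w1 d1.
by field; rewrite p1 w1 d1 n0.
Qed.

End cauchy_kernel.

(** * Boundary values of Cauchy transforms *)

Section boundary_limit.
Context (R : realType).
Local Notation leb := (@lebesgue_measure R).
Implicit Types (x s y : R) (z w : R[i]) (f : R -> R[i]) (psi : R[i] -> R[i]).

Definition boundary_pairing f psi y : R[i] :=
  cRintegral leb setT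
    (fun x => f x * ((psi (x +i* y) - psi (x -i* y)) /
                     (2 * (pi%:C) * 'i%C * (1 + x ^+ 2)%:C))).

Lemma Cc_infty_support (S : set R) f : Cc_infty S f ->
  exists2 A : R, 0 <= A & forall x, A < `|x| -> f x = 0.
Proof.
move=> [_ _ cf _]; have [M [_ HM]] := compact_bounded cf.
exists (`|M| + 1) => [|x hx]; first by rewrite addr_ge0.
apply/eqP/negP => /negP fx.
have fx' : closure [set x | f x != 0] x by exact: subset_closure.
have := HM (`|M| + 1) _ x fx'; rewrite /= leNgt hx => h.
by apply: notF; apply: h; rewrite (le_lt_trans (ler_norm M))// ltrDl.
Qed.

Lemma Cc_infty_continuous (S : set R) f x : Cc_infty S f -> {for x, continuous f}.
Proof. by move=> [s1 s2 _ _]; apply/cvg_ReIm; split; exact: smooth_continuous. Qed.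

Lemma Cc_infty_bounded (S : set R) f : Cc_infty S f ->
  exists2 M : R, 0 <= M & forall x, normc (f x) <= M.
Proof.
move=> cf; have [A A0 fA] := Cc_infty_support cf; have [s1 s2 _ _] := cf.
have bd (g : R -> R) : smooth g -> exists2 M : R, 0 <= M & forall t, - A <= t <= A -> `|g t| <= M.
  move=> sg; have AA : - A <= A by lra.
  have cg : {within `[- A, A], continuous (fun t => `|g t|)}.
    by apply: continuous_subspaceT => t; apply: cvg_norm; exact: smooth_continuous.
  have [c _ hc] := @EVT_max R (fun t => `|g t|) (- A) A AA cg.
  by exists `|g c| => // t ht; apply: hc; rewrite in_itv.
have [M1 M10 H1] := bd _ s1; have [M2 M20 H2] := bd _ s2.
exists (M1 + M2) => [|x]; first exact: addr_ge0.
have [xA|xA] := leP `|x| A; last by rewrite fA// normc_0 addr_ge0.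
by apply: le_trans (normc_le_ReIm _) _; rewrite ler_norml in xA; apply: lerD; [exact: H1|exact: H2].
Qed.

Lemma Cc_infty_bmeasurable (S : set R) f : Cc_infty S f -> bmeasurable (f : borel R -> R[i]).
Proof.
move=> cf; have [M _ fM] := Cc_infty_bounded cf.
by apply: (continuous_bmeasurable (M := M)) => // t; exact: Cc_infty_continuous cf.
Qed.

Lemma support_integrable (g : R -> R) A : (forall x, {for x, continuous g}) ->
  (forall x, A < `|x| -> g x = 0) -> leb.-integrable setT (EFin \o g).
Proof.
move=> cg gA; have i : leb.-integrable `[- A, A] (EFin \o g).
  by apply: segment_integrable => t _; exact: cg.
have mD : measurable (`[- A, A] : set R) by [].
have := (@integrable_mkcond _ _ R leb `[- A, A] (EFin \o g) mD).1 i.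
apply: eq_integrable => // x _; rewrite patchE; case: ifPn => // /negP h.
rewrite /= gA// ltNge; apply/negP => hx; apply: h; rewrite inE /= in_itv /=.
by rewrite -ler_norml.
Qed.

Lemma support_cintegrable f A : (forall x, {for x, continuous f}) ->
  (forall x, A < `|x| -> f x = 0) -> cintegrable leb setT f.
Proof.
move=> cf fA; split; apply: (@support_integrable _ A) => x.
- exact: continuous_Re.
- by move=> /fA ->.
- exact: continuous_Im.
- by move=> /fA ->.
Qed.

Definition continuous_nonreal psi := forall z, Im z != 0 -> {for z, continuous psi}.

Lemma pairing_continuous f psi y x : (forall x, {for x, continuous f}) ->
  continuous_nonreal psi -> 0 < y ->
  {for x, continuous (fun x => f x * ((psi (x +i* y) - psi (x -i* y)) /
                     (2 * (pi%:C) * 'i%C * (1 + x ^+ 2)%:C)))}.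
Proof.
move=> cf cpsi y0.
have c1 : {for x, continuous (fun t => psi (t +i* y))}.
  by apply: continuous_hor; apply: cpsi; rewrite /= gt_eqF.
have c2 : {for x, continuous (fun t => psi (t +i* (- y)))}.
  by apply: continuous_hor; apply: cpsi; rewrite /= oppr_eq0 gt_eqF.
have c3 : {for x, continuous (fun t : R => (2 * (pi%:C) * 'i%C * (1 + t ^+ 2)%:C)^-1 : R[i])}.
  apply: cvgV.
    rewrite !mulf_neq0//.
    - by rewrite eq_complex /= negb_and gt_eqF// pi_gt0.
    - by rewrite -normc_gt0 normci.
    - by rewrite eq_complex /= negb_and gt_eqF// ltr_wpDr ?sqr_ge0.
  apply: cvgM; first exact: cvg_cst.
  apply: (@continuous_real R (fun t => 1 + t ^+ 2)); apply: cvgD; first exact: cvg_cst.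
  by rewrite expr2; under eq_cvg do rewrite expr2; apply: cvgM; exact: cvg_id.
exact: (cvgM (cf x) (cvgM (cvgB c1 c2) c3)).
Qed.

Lemma pairing_integrable (S : set R) f psi y : Cc_infty S f -> continuous_nonreal psi -> 0 < y ->
  cintegrable leb setT (fun x => f x * ((psi (x +i* y) - psi (x -i* y)) /
                     (2 * (pi%:C) * 'i%C * (1 + x ^+ 2)%:C))).
Proof.
move=> cf cpsi y0; have [A A0 fA] := Cc_infty_support cf.
apply: (@support_cintegrable _ A) => x; last by move=> /fA ->; rewrite mul0r.
by apply: pairing_continuous => // t; exact: Cc_infty_continuous cf.
Qed.

Lemma boundary_pairingD (S : set R) f psi1 psi2 y : Cc_infty S f ->
  continuous_nonreal psi1 -> continuous_nonreal psi2 -> 0 < y ->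
  boundary_pairing f (fun z => psi1 z + psi2 z) y =
  boundary_pairing f psi1 y + boundary_pairing f psi2 y.
Proof.
move=> cf c1 c2 y0; rewrite /boundary_pairing.
rewrite -(cRintegralD measurableT (pairing_integrable cf c1 y0) (pairing_integrable cf c2 y0)).
by congr (cRintegral _ _ _); apply/funext => x; ring.
Qed.

Lemma boundary_pairingZ (S : set R) f psi k y : Cc_infty S f ->
  continuous_nonreal psi -> 0 < y ->
  boundary_pairing f (fun z => k * psi z) y = k * boundary_pairing f psi y.
Proof.
move=> cf c y0; rewrite /boundary_pairing -(cRintegralZ measurableT k (pairing_integrable cf c y0)).
by congr (cRintegral _ _ _); apply/funext => x; ring.
Qed.

Lemma boundary_pairing_cst f k y : boundary_pairing f (fun=> k) y = 0.
Proof.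
rewrite /boundary_pairing.
have -> : (fun x => f x * ((k - k) / (2 * (pi%:C) * 'i%C * (1 + x ^+ 2)%:C))) = fun=> 0.
  by apply/funext => x; rewrite subrr mul0r mulr0.
by rewrite /cRintegral /= !Rintegral_cst// !mul0r.
Qed.

(** The jump of the identity at height y is 2 i y, so the pairing is y times a fixed integral. This
    disposes of the linear term contributed by mass at infinity. *)
Lemma boundary_pairing_id (S : set R) f : Cc_infty S f ->
  boundary_pairing f id y @[y --> 0^'+] --> (0 : R[i]).
Proof.
move=> cf; have [A A0 fA] := Cc_infty_support cf.
pose c x : R[i] := ((pi * (1 + x ^+ 2))^-1)%:C.
have cc x : {for x, continuous c}.
  apply: (@continuous_real R (fun t => (pi * (1 + t ^+ 2))^-1)); apply: cvgV.
    by rewrite mulf_neq0 ?gt_eqF ?pi_gt0// ltr_wpDr ?sqr_ge0.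
  apply: cvgM; first exact: cvg_cst.
  apply: cvgD; first exact: cvg_cst.
  by rewrite expr2; under eq_cvg do rewrite expr2; apply: cvgM; exact: cvg_id.
have ifc : cintegrable leb setT (fun x => f x * c x).
  apply: (@support_cintegrable _ A) => x; last by move=> /fA ->; rewrite mul0r.
  exact: (cvgM (@Cc_infty_continuous _ _ x cf) (cc x)).
pose k := cRintegral leb setT (fun x => f x * c x).
have E y : boundary_pairing f id y = y%:C * k.
  rewrite -(cRintegralZ measurableT y%:C ifc); congr (cRintegral _ _ _); apply/funext => x.
  have -> : (x +i* y) - (x -i* y) = 2 * 'i%C * y%:C.
    by apply/eqP; rewrite eq_complex /=; apply/andP; split; apply/eqP; ring.
  rewrite /c fmorphV rmorphM /=.
  have C0 (a : R) : a != 0 -> a%:C != 0 :> R[i] by move=> a0; rewrite eq_complex /= eqxx andbT.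
  have n0 : 'i%C != 0 :> R[i] by rewrite -normc_gt0 normci.
  have p0 : pi%:C != 0 :> R[i] by apply: C0; rewrite gt_eqF ?pi_gt0.
  have w0 : (1 + x ^+ 2)%:C != 0 :> R[i] by apply: C0; rewrite gt_eqF// ltr_wpDr ?sqr_ge0.
  move: p0 w0; move: (pi%:C) ((1 + x ^+ 2)%:C) => p w p0 w0.
  by field; rewrite p0 w0 n0.
have k0 : 0 < normc k + 1 by rewrite ltr_wpDl ?normc_ge0.
apply/cvg_normcP => e e0; near=> y.
have y0 : 0 < y by near: y; exact: nbhs_right_gt.
rewrite subr0 E Normc.normcM normc_real gtr0_norm//.
have : y < e / (normc k + 1) by near: y; apply: nbhs_right_lt; exact: divr_gt0.
rewrite ltr_pdivlMr// => h; apply: le_lt_trans h.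
by rewrite ler_wpM2l ?(ltW y0)// lerDl.
Unshelve. all: by end_near. Qed.

Lemma continuous_measurable_comp d (T : measurableType d) (g : R -> R) (h : T -> R) :
  (forall x, {for x, continuous g}) -> measurable_fun setT h -> measurable_fun setT (fun t => g (h t)).
Proof. by move=> cg mh; apply: measurableT_comp mh; exact: continuous_measurable_fun. Qed.

Lemma measurable_idR : measurable_fun setT (id : measurableTypeR R -> R).
Proof. by move=> _ A mA; rewrite setTI. Qed.

Lemma poisson_weight_measurable y : 0 < y ->
  measurable_fun setT (fun p : measurableTypeR R * borel R => poisson_weight y p.1 p.2).
Proof.
move=> y0.
have m1 : measurable_fun setT (fun p : measurableTypeR R * borel R => p.1 : R).
  by apply: (measurableT_comp measurable_idR); exact: measurable_fst.
have m2 : measurable_fun setT (fun p : measurableTypeR R * borel R => p.2 : R).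
  have mid : measurable_fun setT (id : borel R -> R).
    by apply: (@borel_continuous_measurable R R id) => x; exact: cvg_id.
  by apply: (measurableT_comp mid); exact: measurable_snd.
have w0 x : 0 < 1 + x ^+ 2 by rewrite ltr_wpDr ?sqr_ge0.
have csq (x : R) : {for x, continuous (fun x : R => x ^+ 2)}.
  exact: exprn_continuous.
have c1 (x : R) : {for x, continuous (fun x : R => 1 + x ^+ 2)}.
  by apply: cvgD; [exact: cvg_cst|exact: csq].
have c2 (x : R) : {for x, continuous (fun x : R => (1 + x ^+ 2)^-1)}.
  by apply: cvgV; [rewrite gt_eqF|exact: c1].
have c3 (x : R) : {for x, continuous (fun x : R => (pi * (x ^+ 2 + y ^+ 2))^-1)}.
  apply: cvgV; first by rewrite mulf_neq0 ?gt_eqF ?pi_gt0// ltr_wpDl ?sqr_ge0// exprn_gt0.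
  apply: cvgM; first exact: cvg_cst.
  by apply: cvgD; [exact: csq|exact: cvg_cst].
have m3 := continuous_measurable_comp c1 m2.
have m4 := continuous_measurable_comp c2 m1.
have m5 := continuous_measurable_comp c3 (measurable_funB m1 m2).
have mc : measurable_fun setT (fun _ : measurableTypeR R * borel R => y) by exact: measurable_cst.
exact: (measurable_funM (measurable_funM m3 m4) (measurable_funM mc m5)).
Qed.

(** A bound for each fixed y, used only to have an integrable majorant in Fubini's theorem; it is
    not uniform as y tends to 0. *)
Lemma poisson_weight_ub y x s : 0 < y < 1 -> poisson_weight y x s <= 2 / y + 2.
Proof.
move=> /andP[y0 y1]; apply: le_trans (poisson_weight_le _ _ y0 y1) _.
rewrite lerD2r ler_wpM2l// /poisson ler_pdivrMr; last first.
  by rewrite mulr_gt0 ?pi_gt0// ltr_wpDl ?sqr_ge0// exprn_gt0.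
rewrite mulrC ler_pdivlMr// -expr2.
apply: (@le_trans _ _ ((x - s) ^+ 2 + y ^+ 2)); first by rewrite lerDr sqr_ge0.
by rewrite ler_peMl ?addr_ge0 ?sqr_ge0//; apply: le_trans (pi_ge2 R); rewrite ler1n.
Qed.

Lemma boundary_pairing_fubini (S : set R) f (lam : complex_measure (borel R) R) y : Cc_infty S f ->
  0 < y < 1 ->
  cmeasurable (setT : set (borel R)) (fun s => cRintegral leb setT (fun x => f x * (poisson_weight y x s)%:C)) /\
  boundary_pairing f (cauchy_transform lam) y =
  cmintegral lam setT (fun s => cRintegral leb setT (fun x => f x * (poisson_weight y x s)%:C)).
Proof.
move=> cf y01; have /andP[y0 y1] := y01; have [A A0 fA] := Cc_infty_support cf.
have [s1 s2 _ _] := cf.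
pose F (p : measurableTypeR R * borel R) : R[i] := f p.1 * (poisson_weight y p.1 p.2)%:C.
pose h x : R := (`|Re (f x)| + `|Im (f x)|) * (2 / y + 2).
have mpw := poisson_weight_measurable y0.
have m1 : measurable_fun setT (fun p : measurableTypeR R * borel R => p.1 : R).
  by apply: (measurableT_comp measurable_idR); exact: measurable_fst.
have mF : cmeasurable setT F.
  split.
    have -> : (fun p => Re (F p)) = (fun p : measurableTypeR R * borel R => Re (f p.1)) \* (fun p => poisson_weight y p.1 p.2).
      by apply/funext => p; rewrite /F cReM /= mulr0 subr0.
    apply: measurable_funM => //; apply: (@continuous_measurable_comp _ _ (fun x => Re (f x))) => // x.
    exact: smooth_continuous.
  have -> : (fun p => Im (F p)) = (fun p : measurableTypeR R * borel R => Im (f p.1)) \* (fun p => poisson_weight y p.1 p.2).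
    by apply/funext => p; rewrite /F cImM /= mulr0 add0r.
  apply: measurable_funM => //; apply: (@continuous_measurable_comp _ _ (fun x => Im (f x))) => // x.
  exact: smooth_continuous.
have ih : leb.-integrable setT (EFin \o h).
  apply: (@support_integrable _ A) => x; last by move=> /fA; rewrite /h => -> /=; rewrite normr0 addr0 mul0r.
  apply: cvgM; last exact: cvg_cst.
  by apply: cvgD; apply: cvg_norm; exact: smooth_continuous.
have Fh x s : normc (F (x, s)) <= h x.
  rewrite /F Normc.normcM normc_real ger0_norm ?poisson_weight_ge0//=.
  apply: ler_pM; rewrite ?normc_ge0 ?poisson_weight_ge0//; last exact: poisson_weight_ub.
  exact: normc_le_ReIm.
have [mG EG] := cmfubini lam mF ih Fh; split; first exact: mG.
rewrite -EG /boundary_pairing; congr (cRintegral _ _ _); apply/funext => x.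
have n1 : Im (x +i* y) != 0 by rewrite /= gt_eqF.
have n2 : Im (x -i* y) != 0 by rewrite /= oppr_eq0 gt_eqF.
have b1 := kernel_bmeasurable n1; have b2 := kernel_bmeasurable n2.
rewrite /cauchy_transform -(cmintegralB lam b1 b2) mulrCA mulrC -(cmintegralZ lam _ (bmeasurableB b1 b2)).
congr (cmintegral _ _ _); apply/funext => s.
by rewrite /F /= -kernel_jump//; ring.
Qed.

(** By Fubini the pairing integrates the function [G y] against [lam]. It tends to [f] pointwise by
    [poisson_weight_cvg] and boundedly by [poisson_weight_bounded]. *)
Lemma boundary_pairing_cauchy (S : set R) f (lam : complex_measure (borel R) R) : Cc_infty S f ->
  boundary_pairing f (cauchy_transform lam) y @[y --> 0^'+] --> cmintegral lam setT f.
Proof.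
move=> cf; have [A A0 fA] := Cc_infty_support cf; have [s1 s2 _ _] := cf.
have [M M0 fM] := Cc_infty_bounded cf.
pose G y (s : borel R) := cRintegral leb setT (fun x => f x * (poisson_weight y x s)%:C).
have GE y s : G y s = (\int[leb]_x (Re (f x) * poisson_weight y x s)) +i*
    (\int[leb]_x (Im (f x) * poisson_weight y x s)).
  rewrite /G /cRintegral; congr (_ +i* _); apply: eq_Rintegral => x _.
    by rewrite cReM /= mulr0 subr0.
  by rewrite cImM /= mulr0 add0r.
have fR x : A < `|x| -> Re (f x) = 0 by move=> /fA ->.
have fI x : A < `|x| -> Im (f x) = 0 by move=> /fA ->.
have c1 : cmintegral lam setT (G y) @[y --> 0^'+] --> cmintegral lam setT f.
  apply: (@cmintegral_dominated_at_right _ _ _ lam G f (2 * (M * (2 + 4 * A)))).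
  - by move=> y y01; have [] := boundary_pairing_fubini lam cf y01.
  - move=> y s y01; rewrite GE; apply: le_trans (normc_le_ReIm _) _ => /=.
    rewrite mulr_natl mulr2n; apply: lerD; apply: poisson_weight_bounded => //.
    + by move=> x; exact: smooth_continuous.
    + by move=> x; apply: le_trans (fM x); exact: Re_normc.
    + by move=> x; exact: smooth_continuous.
    + by move=> x; apply: le_trans (fM x); exact: Im_normc.
  - move=> s; apply/cvg_ReIm; split; apply/cvg_at_rightP => u [u0 cu].
    have -> : (fun n => (Re \o G ^~ s) (u n)) = fun n => \int[leb]_x (Re (f x) * poisson_weight (u n) x s).
      by apply/funext => n; rewrite -[LHS]/(Re (G (u n) s)) GE.
    exact: (@poisson_weight_cvg R (fun x => Re (f x)) A s u A0 s1 fR u0 cu).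
    have -> : (fun n => (Im \o G ^~ s) (u n)) = fun n => \int[leb]_x (Im (f x) * poisson_weight (u n) x s).
      by apply/funext => n; rewrite -[LHS]/(Im (G (u n) s)) GE.
    exact: (@poisson_weight_cvg R (fun x => Im (f x)) A s u A0 s2 fI u0 cu).
apply: cvg_trans c1; apply: near_eq_cvg; near=> y.
have y01 : 0 < y < 1.
  by apply/andP; split; near: y; [exact: nbhs_right_gt|exact: nbhs_right_lt].
by have [_ ->] := boundary_pairing_fubini lam cf y01.
Unshelve. all: by end_near. Qed.

End boundary_limit.

(** * Measures are determined by test functions *)

Section open_approximation.
Context (R : realType).
Implicit Types (U S : set R).

Lemma rational_segment U (x : R) : open U -> U x -> exists p q : rat,
  ratr p < x < (ratr q : R) /\ `[ratr p, ratr q]%classic `<=` U.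
Proof.
move=> oU Ux; have /nbhs_ballP[e /= e0 He] := open_nbhs_nbhs (conj oU Ux).
have h1 : x - e < x by lra.
have h2 : x < x + e by lra.
have [p] := rat_in_itvoo h1; rewrite in_itv /= => /andP[p1 p2].
have [q] := rat_in_itvoo h2; rewrite in_itv /= => /andP[q1 q2].
exists p, q; split; first by rewrite p2 q1.
move=> t /=; rewrite in_itv /= => /andP[t1 t2]; apply: He.
by rewrite /ball /= ltr_norml; apply/andP; split; lra.
Qed.

(** Countably many compact segments that fill [U], indexed by coded pairs of rationals; codes of
    segments not contained in [U] give the empty set. The same family yields smooth approximations
    and sigma-compactness. *)
Definition rational_segments U (k : nat) : set R :=
  if unpickle k is Some pq then
    let I : set R := `[ratr (pq : rat * rat).1, ratr pq.2]%classic in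
    [set t | I t /\ I `<=` U]
  else set0.

Lemma rational_segments_sub U k : rational_segments U k `<=` U.
Proof. by rewrite /rational_segments; case: unpickle => [pq|] // t /= [h]; apply. Qed.

Lemma rational_segments_compact U k : compact (rational_segments U k).
Proof.
rewrite /rational_segments; case: unpickle => [pq|]; last exact: compact0.
have [h|h] := pselect (`[ratr pq.1, ratr pq.2]%classic `<=` U).
  have -> : [set t : R | `[ratr pq.1, ratr pq.2]%classic t /\ `[ratr pq.1, ratr pq.2]%classic `<=` U] =
      `[ratr pq.1, ratr pq.2]%classic by apply/seteqP; split => [t []|t].
  exact: segment_compact.
have -> : [set t : R | `[ratr pq.1, ratr pq.2]%classic t /\ `[ratr pq.1, ratr pq.2]%classic `<=` U] = set0.
  by apply/seteqP; split => [t []|t].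
exact: compact0.
Qed.

Lemma rational_segments_cover U : open U -> \bigcup_k rational_segments U k = U.
Proof.
move=> oU; apply/seteqP; split => [t [k _ /rational_segments_sub]//|t Ut].
have [p [q [/andP[pt tq] pqU]]] := rational_segment oU Ut.
have [k kE] : exists k, unpickle k = Some (p, q) by exists (pickle (p, q)); exact: pickleK.
exists k; first exact: I.
by rewrite /rational_segments kE; split => //; rewrite /= in_itv /= !ltW.
Qed.

Lemma smooth_prod (g : nat -> R -> R) n : (forall k, smooth (g k)) ->
  smooth (fun x => \prod_(k < n) g k x).
Proof.
move=> sg; elim: n => [|n IH].
  have -> : (fun x => \prod_(k < 0) g k x) = fun=> 1 by apply/funext => x; rewrite big_ord0.
  exact: smooth_cst.
have -> : (fun x => \prod_(k < n.+1) g k x) = fun x => \prod_(k < n) g k x * g n x.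
  by apply/funext => x; rewrite big_ord_recr.
exact: smoothM.
Qed.

Lemma smooth_exp (g : R -> R) n : smooth g -> smooth (fun x => g x ^+ n).
Proof.
move=> sg; have -> : (fun x => g x ^+ n) = fun x => \prod_(k < n) g x.
  by apply/funext => x; rewrite prodr_const card_ord.
exact: (@smooth_prod (fun=> g)).
Qed.

(** One bump per rational segment inside [U], positive on its interior, and the zero function for
    the other indices. *)
Lemma bump_family U : open U -> exists g : nat -> R -> R,
  [/\ forall k, smooth (g k), forall k x, 0 <= g k x < 1,
      forall k x, g k x != 0 -> rational_segments U k x &
      forall x, U x -> exists k, 0 < g k x].
Proof.
move=> oU.
have ex k : exists g : R -> R, [/\ smooth g, forall x, 0 <= g x < 1,
    forall x, g x != 0 -> rational_segments U k x &
    forall p q : rat, unpickle k = Some (p, q) -> `[ratr p, ratr q]%classic `<=` U ->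
      forall x, ratr p < x < ratr q -> 0 < g x].
  rewrite /rational_segments; case: unpickle => [[p q]|] /=; last first.
    exists (fun=> 0); split => // [|x|x]; first exact: smooth_cst.
      by rewrite lexx ltr01.
    by rewrite eqxx.
  have [h|h] := pselect (`[ratr p, ratr q]%classic `<=` U).
    have [g [sg g01 gp]] := @bump_exists R (ratr p) (ratr q).
    exists g; split => // [x gx|p' q' [<- <-] _ x hx]; last by rewrite gp.
    split => //; rewrite in_itv /=; have : 0 < g x by rewrite lt_def gx; case/andP: (g01 x).
    by rewrite gp => /andP[? ?]; rewrite !ltW.
  exists (fun=> 0); split => // [|x|x|p' q' [<- <-] //]; first exact: smooth_cst.
    by rewrite lexx ltr01.
  by rewrite eqxx.
have [g Hg] := choice ex; exists g; split.
- by move=> k; case: (Hg k).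
- by move=> k; case: (Hg k).
- by move=> k; case: (Hg k).
- move=> x Ux; have [p [q [h pqU]]] := rational_segment oU Ux.
  have [k kE] : exists k, unpickle k = Some (p, q) by exists (pickle (p, q)); exact: pickleK.
  by exists k; have [_ _ _ Hk] := Hg k; exact: (Hk _ _ kE pqU).
Qed.

(** The functions are 1 - P_n^n with P_n the product of 1 - g_k over k < n. Where some g_k is
    positive, P_n is at most 1 - g_k < 1 from some n on, and the growing exponent forces P_n^n to 0;
    outside [U] every P_n is 1. Only finitely many segments enter at each stage, so supports are
    compact. *)
Lemma open_indicator_limit U : open U -> exists F : nat -> R -> R,
  [/\ forall n, Cc_infty U (fun x => (F n x)%:C), forall n x, 0 <= F n x <= 1 &
      forall x, F n x @[n --> \oo] --> (\1_U x : R)].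
Proof.
move=> oU; have [g [sg g01 gC gp]] := bump_family oU.
pose P n x : R := \prod_(k < n) (1 - g k x).
have fac01 k x : 0 <= 1 - g k x <= 1.
  by have /andP[h1 h2] := g01 k x; apply/andP; split; lra.
have P01 n x : 0 <= P n x <= 1.
  rewrite /P; elim: n => [|n /andP[h1 h2]]; first by rewrite big_ord0 ler01 lexx.
  rewrite big_ord_recr /=; have /andP[h3 h4] := fac01 n x.
  by rewrite mulr_ge0//= mulr_ile1.
have Pk n k x : (k < n)%N -> P n x <= 1 - g k x.
  move=> kn; rewrite /P (bigD1 (Ordinal kn)) //= ler_piMr//; first by case/andP: (fac01 k x).
  by apply: prodr_ile1 => i _; exact: fac01.
have sP n : smooth (P n).
  apply: (@smooth_prod (fun k x => 1 - g k x)) => k.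
  apply: smoothD; first exact: smooth_cst.
  have -> : (fun x => - g k x) = fun x => (-1) * g k x by apply/funext => x; rewrite mulN1r.
  by apply: smoothM; [exact: smooth_cst|exact: sg].
exists (fun n x => 1 - P n x ^+ n); split.
- move=> n; pose D := \bigcup_(k in `I_n) rational_segments U k.
  have cD : compact D.
    rewrite /D bigcup_mkord; elim/big_ind : _ => [|X Y|i _]; first exact: compact0.
      exact: compactU.
    exact: rational_segments_compact.
  have DU : D `<=` U by move=> x [k _ /rational_segments_sub].
  have sD : closure [set x | ((1 - P n x ^+ n)%:C : R[i]) != 0] `<=` D.
    rewrite ((closure_id D).1 (compact_closed (@Rhausdorff R) cD)).
    apply: closure_subset => x /= h; apply: contrapT => nD; move/eqP : h; apply.
    have -> : P n x = 1.
      rewrite /P big1// => i _; have [->|gn] := eqVneq (g i x) 0; first by rewrite subr0.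
      by exfalso; apply: nD; exists i; [exact: ltn_ord|exact: gC].
    by rewrite expr1n subrr.
  have s1 : smooth (fun x => 1 - P n x ^+ n).
    apply: smoothD; first exact: smooth_cst.
    have -> : (fun x => - P n x ^+ n) = fun x => (-1) * P n x ^+ n by apply/funext => x; rewrite mulN1r.
    by apply: smoothM; [exact: smooth_cst|exact: smooth_exp].
  split => //; first exact: smooth_cst.
    by apply: subclosed_compact cD sD; exact: closed_closure.
  exact: subset_trans DU.
- move=> n x; have /andP[h1 h2] := P01 n x.
  have : P n x ^+ n <= 1 by exact: exprn_ile1.
  by have := exprn_ge0 n h1; move=> h3 h4; apply/andP; split; lra.
- move=> x; rewrite indicE; have [Ux|nU] := pselect (U x); last first.
    rewrite memNset//; have -> : (fun n => 1 - P n x ^+ n) = cst 0; last exact: cvg_cst.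
    apply/funext => n; have -> : P n x = 1.
      rewrite /P big1// => i _; have [->|gn] := eqVneq (g i x) 0; first by rewrite subr0.
      by exfalso; apply: nU; apply: rational_segments_sub (gC _ _ gn).
    by rewrite expr1n subrr.
  rewrite mem_set//; have [k gk] := gp x Ux.
  have c01 : `|1 - g k x| < 1.
    by have /andP[? ?] := g01 k x; rewrite ger0_norm; lra.
  have c := cvg_expr c01.
  have PC : (fun n => P n x ^+ n) @ \oo --> (0 : R).
    apply: (squeeze_cvgr _ (cvg_cst 0) c); near=> n.
    have /andP[h1 _] := P01 n x; rewrite exprn_ge0//= lerXn2r ?nnegrE//.
      by case/andP: (fac01 k x).
    by apply: Pk; near: n; exact: nbhs_infty_gt.
  have c1 : (fun=> 1 : R) @ \oo --> (1 : R) by exact: cvg_cst.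
  by have := cvgB c1 PC; rewrite subr0; apply.
Unshelve. all: by end_near. Qed.

Lemma cmintegral_indic d (T : measurableType d) (lam : complex_measure T R) (A : set T) :
  measurable A -> cmintegral lam setT (fun x => (\1_A x)%:C) = lam A.
Proof.
move=> mA; have [m1 [m2 [m3 [m4 [E1 E2 _ ->]]]]] := cmintegral_parts lam.
have I (m : {finite_measure set T -> \bar R}) : cRintegral m setT (fun x => (\1_A x)%:C) = (fine (m A))%:C.
  rewrite /cRintegral /=; congr (_ +i* _); last by rewrite Rintegral_cst// mul0r.
  by rewrite /Rintegral integral_indic// setIT.
rewrite !I /cmval E1// E2// !fineB ?fin_num_measure//.
apply/eqP; rewrite eq_complex /=; apply/andP; split; apply/eqP; ring.
Qed.

(** Dominated convergence along [open_indicator_limit] gives equality on the open subsets of [S];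
    open sets form a pi-system generating the Borel sets. *)
Lemma test_measure_unique (lam1 lam2 : complex_measure (borel R) R) S : open S ->
  (forall f, Cc_infty S f -> cmintegral lam1 setT f = cmintegral lam2 setT f) ->
  forall A : set (borel R), measurable A -> A `<=` S -> lam1 A = lam2 A.
Proof.
move=> oS H.
have HU U : open U -> U `<=` S -> lam1 U = lam2 U.
  move=> oU US; have [F [FC F01 FU]] := open_indicator_limit oU.
  have mU := borel_open oU.
  have cv (lam : complex_measure (borel R) R) :
      cmintegral lam setT (fun x => (F n x)%:C) @[n --> \oo] --> lam U.
    rewrite -(cmintegral_indic lam mU); apply: (cmintegral_dominated (M := 1)).
    - by move=> n; case: (Cc_infty_bmeasurable (FC n)).
    - by move=> n x; rewrite normc_real ger0_norm; case/andP: (F01 n x).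
    - by move=> x; apply/cvg_ReIm; split; [exact: FU|exact: cvg_cst].
  have FS n : Cc_infty S (fun x => (F n x)%:C).
    by have [? ? ? h] := FC n; split => //; exact: subset_trans US.
  have := cv lam1; have := cv lam2.
  under eq_cvg do rewrite -(H _ (FS _)).
  by move=> c2 c1; exact: (cvg_unique _ c1 c2).
have mS := borel_open oS.
have key (P N P' N' : {finite_measure set (borel R) -> \bar R}) :
    (forall U, open U -> U `<=` S -> fine (P U - N U)%E = fine (P' U - N' U)%E) ->
    forall A : set (borel R), measurable A -> A `<=` S -> fine (P A - N A)%E = fine (P' A - N' A)%E.
  move=> HPN.
  (* Negative parts are moved to the other side, so that two positive finite measures, restricted to
     [S], are compared. *)
  pose M1 : {measure set (borel R) -> \bar R} := mrestr (measure_add P N') mS.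
  pose M2 : {measure set (borel R) -> \bar R} := mrestr (measure_add P' N) mS.
  have addE (m m' : {finite_measure set (borel R) -> \bar R}) A : measure_add m m' A = (m A + m' A)%E.
    by rewrite /measure_add /= /msum !big_ord_recl !big_ord0 /= adde0.
  have M1E B : M1 B = (P (B `&` S) + N' (B `&` S))%E by exact: addE.
  have M2E B : M2 B = (P' (B `&` S) + N (B `&` S))%E by exact: addE.
  have finE (m : {finite_measure set (borel R) -> \bar R}) (B : set (borel R)) :
      measurable B -> exists r, m B = r%:E.
    by move=> mB; exists (fine (m B)); rewrite fineK// fin_num_measure.
  have H12 A : measurable A -> M1 A = M2 A.
    apply: (@measure_unique _ R (borel R) (@open R) (fun=> setT) erefl _ _ _ M1 M2).
    - by move=> U V oU oV; exact: openI.
    - by move=> _; exact: openT.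
    - by rewrite bigcup_const//; exists 0%N.
    - move=> U oU; have oUS : open (U `&` S) by exact: openI.
      have := HPN _ oUS (@subIsetr _ _ _).
      have mUS := borel_open oUS.
      rewrite M1E M2E.
      have [a ->] := finE P _ mUS; have [b ->] := finE N _ mUS.
      have [c ->] := finE P' _ mUS; have [e ->] := finE N' _ mUS.
      by rewrite /= => h; rewrite -!EFinD; congr EFin; lra.
    - move=> _; rewrite M1E setTI.
      by apply: lte_add_pinfty; rewrite ltey_eq fin_num_measure.
  move=> A mA AS; have := H12 A mA; rewrite M1E M2E.
  have -> : A `&` S = A by apply/setIidPl.
  have [a ->] := finE P _ mA; have [b ->] := finE N _ mA.
  have [c ->] := finE P' _ mA; have [e ->] := finE N' _ mA.
  by rewrite -!EFinD /= => -[h]; lra.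
move=> A mA AS.
have [p1 [p2 [p3 [p4 [E1 E2 _ _]]]]] := cmintegral_parts lam1.
have [q1 [q2 [q3 [q4 [E3 E4 _ _]]]]] := cmintegral_parts lam2.
rewrite /cmval; congr (_ +i* _).
  rewrite E1// E3//; apply: key => // U oU US; have mU := borel_open oU.
  by rewrite -E1// -E3//; have [] := HU U oU US.
rewrite E2// E4//; apply: key => // U oU US; have mU := borel_open oU.
by rewrite -E2// -E4//; have [] := HU U oU US.
Qed.

End open_approximation.

(** * Regularity of Borel measures *)

Section variation.
Context d (T : measurableType d) (R : realType).
Variable lam : complex_measure T R.
Implicit Types A B : set T.

Lemma cmval_split A B : measurable A -> measurable B ->
  lam B = lam (B `&` A) + lam (B `\` A).
Proof.
move=> mA mB.
have D (nu : {charge set T -> \bar R}) : fine (nu B) = fine (nu (B `&` A)) + fine (nu (B `\` A)).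
  rewrite chargeD// fineB ?fin_num_measure//; last exact: measurableI.
  by rewrite addrC subrK.
by apply/eqP; rewrite eq_complex /= !D !eqxx.
Qed.

Lemma cmval0 : lam set0 = 0.
Proof. by rewrite /cmval !charge0. Qed.

(** The sum of the four positive measures behind [lam]. Regularity only has to be proved for such a
    finite positive measure. *)
Lemma dominating_measure : exists mu : {measure set T -> \bar R},
  (mu setT < +oo)%E /\ forall A, measurable A -> ((normc (lam A))%:E <= mu A)%E.
Proof.
have [m1 [m2 [m3 [m4 [E1 E2 _ _]]]]] := cmintegral_parts lam.
pose mu : {measure set T -> \bar R} := measure_add (measure_add m1 m2) (measure_add m3 m4).
have muE A : mu A = ((m1 A + m2 A) + (m3 A + m4 A))%E.
  by rewrite /mu /measure_add /= /msum !big_ord_recl !big_ord0 /= /msum !big_ord_recl !big_ord0 /= !adde0.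
exists mu; split.
  by rewrite muE; do 2 apply: lte_add_pinfty => //; exact: finite_measure_lty.
move=> A mA; rewrite muE.
have finE (m : {finite_measure set T -> \bar R}) : exists2 r, m A = r%:E & 0 <= r.
  by exists (fine (m A)); rewrite ?fine_ge0// fineK// fin_num_measure.
apply: (@le_trans _ _ (`|fine (cmRe lam A)| + `|fine (cmIm lam A)|)%:E).
  by rewrite lee_fin; exact: normc_le_ReIm.
rewrite E1// E2//; have [a -> a0] := finE m1; have [b -> b0] := finE m2.
have [c -> c0] := finE m3; have [e -> e0] := finE m4.
rewrite -!EFinD lee_fin /=; apply: lerD; apply: le_trans (ler_normB _ _) _; rewrite !ger0_norm//.
Qed.

Lemma le_cmvariation A B : A `<=` B -> measurable B ->
  (cmvariation lam A <= cmvariation lam B)%E.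
Proof.
move=> AB mB; apply: ge_ereal_sup => _ [F [mF tF FA] <-].
have mA : measurable A by rewrite -FA; apply: bigcup_measurable.
(* A partition of [A] becomes one of [B]: the new piece takes index 0 and the others move up by
   one. *)
pose G n := if n is n'.+1 then F n' else B `\` A.
apply: (@le_trans _ _ (\sum_(n <oo) (normc (lam (G n)))%:E)%E); last first.
  apply: ereal_sup_ubound; exists G => //; split.
  - by case=> [|n]; [exact: measurableD|exact: mF].
  - have BF n : (B `\` A) `&` F n = set0.
      by apply/seteqP; split => // x [[_ nA] Fx]; apply: nA; rewrite -FA; exists n.
    apply/trivIsetP => -[|i] [|j] _ _ ij.
    + by rewrite eqxx in ij.
    + exact: BF.
    + by rewrite setIC; exact: BF.
    + by have /trivIsetP/(_ i j I I) := tF; apply.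
  - rewrite -[RHS](setDUK AB) -FA; apply/seteqP; split => [x [[|n] _ Gx]|x [[n _ Fx]|h]].
    + by right; rewrite FA.
    + by left; exists n.
    + by exists n.+1.
    + by exists 0%N => //; move: h; rewrite FA.
rewrite [leRHS]nneseries_recl//; last by move=> k _; rewrite lee_fin normc_ge0.
rewrite -nneseries_addn; last by move=> i; rewrite lee_fin normc_ge0.
under [in X in (_ <= _ + X)%E]eq_eseriesr do rewrite addn1.
by rewrite leeDr// lee_fin normc_ge0.
Qed.

Lemma cmvariation_subadditive A B : measurable A -> measurable B ->
  (cmvariation lam B <= cmvariation lam (B `&` A) + cmvariation lam (B `\` A))%E.
Proof.
move=> mA mB; apply: ge_ereal_sup => _ [F [mF tF FB] <-].
apply: (@le_trans _ _ (\sum_(n <oo) ((normc (lam (F n `&` A)))%:E + (normc (lam (F n `\` A)))%:E))%E).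
  apply: lee_nneseries => n _; first by rewrite lee_fin normc_ge0.
  by rewrite -EFinD lee_fin (cmval_split mA (mF n)) le_normcD.
rewrite nneseriesD; [|by move=> n _ _; rewrite lee_fin normc_ge0..].
apply: leeD; apply: ereal_sup_ubound.
  exists (fun n => F n `&` A) => //; split.
  - by move=> n; exact: measurableI.
  - exact: trivIset_setIr.
  - by rewrite -setI_bigcupl FB.
exists (fun n => F n `\` A) => //; split.
- by move=> n; exact: measurableD.
- exact: trivIset_setIr.
- by rewrite -setI_bigcupl FB.
Qed.

Lemma cmvariation_le (mu : {measure set T -> \bar R}) A :
  (forall B, measurable B -> ((normc (lam B))%:E <= mu B)%E) -> (cmvariation lam A <= mu A)%E.
Proof.
move=> H; apply: ge_ereal_sup => _ [F [mF tF <-] <-].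
rewrite measure_bigcup//.
rewrite [leRHS]eseries_mkcond; apply: lee_nneseries => n _; first by rewrite lee_fin normc_ge0.
by rewrite in_setT; exact: H.
Qed.

End variation.

(** * Regularity of finite Borel measures when open sets are countable unions of closed sets *)

Section regularity.
Context (T : ptopologicalType) (R : realType).
Local Notation BT := (borel T).
Hypothesis open_sigma_closed : forall U : set T, open U ->
  exists C : nat -> set T, (forall n, closed (C n)) /\ \bigcup_n C n = U.

Lemma borel_closed (C : set T) : closed C -> measurable (C : set BT).
Proof.
by move=> cC; rewrite -[C]setCK; apply: measurableC; apply: borel_open; exact: closed_openC.
Qed.

Variable mu : {measure set BT -> \bar R}.
Hypothesis mufin : (mu setT < +oo)%E.

Let fin (A : set BT) : measurable A -> (mu A < +oo)%E.
Proof. by move=> mA; apply: le_lt_trans mufin; apply: le_measure; rewrite ?inE. Qed.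

(** Continuity from above, where finiteness of [mu] enters. It replaces countable unions of closed
    sets, which need not be closed, by finite ones. *)
Lemma bigcup_exhaust (U : set BT) (C : nat -> set BT) (x : \bar R) : measurable U ->
  (forall n, measurable (C n)) -> (mu (U `\` \bigcup_n C n) < x)%E ->
  exists n, (mu (U `\` \bigcup_(k in `I_n) C k) < x)%E.
Proof.
move=> mU mC h; pose D n := U `\` \bigcup_(k in `I_n) C k.
have mD n : measurable (D n) by apply: measurableD => //; apply: bigcup_measurable.
have DE : \bigcap_n D n = U `\` \bigcup_n C n.
  apply/seteqP; split => [t Dt|t [Ut nC] n _].
    by split; [have [] := Dt 0%N I|move=> [n _ Cn]; have [_] := Dt n.+1 I; apply; exists n => /=].
  by split => // -[k _ Ck]; apply: nC; exists k.
have dD : nonincreasing_seq D.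
  move=> m n mn; apply/subsetPset => t [Ut nC]; split => // -[k km Ck].
  by apply: nC; exists k => //=; exact: leq_trans mn.
have mI : measurable (\bigcap_n D n) by apply: bigcapT_measurable.
have cv := nonincreasing_cvg_mu (fin (mD 0%N)) mD mI dD.
rewrite DE in cv.
have : \forall n \near \oo, (mu (D n) < x)%E.
  by apply: (cv [set y | (y < x)%E]); apply: open_nbhs_nbhs; split; [exact: open_ereal_lt_ereal|exact: h].
by move=> [n _ Hn]; exists n; apply: Hn => /=.
Qed.

(** Both approximations are bundled with one gap, which makes the notion symmetric under complement:
    C and U exchange roles and U \ C stays the same. *)
Definition regular_set (A : set BT) := measurable A /\ forall e : R, 0 < e ->
  exists C U : set T, [/\ closed C, open U, C `<=` A, A `<=` U & (mu (U `\` C) < e%:E)%E].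

Lemma finite_bigcup_closed (C : nat -> set T) n : (forall k, closed (C k)) ->
  closed (\bigcup_(k in `I_n) C k).
Proof.
move=> cC; rewrite bigcup_mkord; elim/big_ind : _ => [|X Y|i _]; first exact: closed0.
  exact: closedU.
exact: cC.
Qed.

Lemma open_regular (U : set T) : open U -> regular_set U.
Proof.
move=> oU; split; first exact: borel_open.
move=> e e0; have [C [cC CU]] := open_sigma_closed oU.
have [n hn] : exists n, (mu (U `\` \bigcup_(k in `I_n) C k) < e%:E)%E.
  apply: bigcup_exhaust; [exact: borel_open|by move=> n; exact: borel_closed|].
  by rewrite CU setDv measure0 lte_fin.
exists (\bigcup_(k in `I_n) C k), U; split => //; first exact: finite_bigcup_closed.
by move=> t [k _ Ck]; rewrite -CU; exists k.
Qed.

Lemma sigma_algebra_regular : sigma_algebra setT regular_set.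
Proof.
split.
- exact: open_regular open0.
- move=> A [mA rA]; rewrite setTD; split; first exact: measurableC.
  move=> e e0; have [C [U [cC oU CA AU h]]] := rA e e0.
  exists (~` U), (~` C); split.
  + exact: open_closedC.
  + exact: closed_openC.
  + exact: subsetC.
  + exact: subsetC.
  + have -> : ~` C `\` ~` U = U `\` C; last exact: h.
    by rewrite !setDE setCK setIC.
- move=> A rA; have mA n : measurable (A n) by case: (rA n).
  split; first exact: bigcup_measurable.
  move=> e e0.
  have e2 : 0 < e / 2 by rewrite divr_gt0.
  (* These tolerances sum to e / 2, which is strictly below e; the slack allows the union of the
     closed sets to be cut down to a finite one. *)
  have en n : 0 < (e / 2) / (2 ^ n.+1)%:R :> R by rewrite divr_gt0// ltr0n expn_gt0.
  have ex n : exists CU : set T * set T, [/\ closed CU.1, open CU.2, CU.1 `<=` A n, A n `<=` CU.2 &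
      (mu (CU.2 `\` CU.1) < ((e / 2) / (2 ^ n.+1)%:R)%:E)%E].
    by have [_ /(_ _ (en n))[C [U h]]] := rA n; exists (C, U).
  have [CU H] := choice ex.
  pose U := \bigcup_n (CU n).2.
  have oU : open U by apply: bigcup_open => n _; case: (H n).
  have mU := borel_open oU.
  have mC n : measurable ((CU n).1 : set BT) by apply: borel_closed; case: (H n).
  have mUn n : measurable ((CU n).2 : set BT) by apply: borel_open; case: (H n).
  have h1 : (mu (U `\` \bigcup_n (CU n).1) < e%:E)%E.
    apply: (@le_lt_trans _ _ (e / 2)%:E); last by rewrite lte_fin ltr_pdivrMr// ltr_pMr// ltr1n.
    apply: (@le_trans _ _ (\sum_(n <oo) mu ((CU n).2 `\` (CU n).1))%E).
      apply: measure_sigma_subadditive.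
      - by move=> n; exact: measurableD.
      - by apply: measurableD => //; exact: bigcup_measurable.
      - move=> t [[n _ Un] nC]; exists n => //; split => // Cn; apply: nC; by exists n.
    apply: le_trans (epsilon_trick0 xpredT (ltW e2)).
    apply: lee_nneseries => [*|n _]; first exact: measure_ge0.
    by apply: ltW; case: (H n).
  have [n hn] := bigcup_exhaust mU mC h1.
  exists (\bigcup_(k in `I_n) (CU k).1), U; split => //.
  + by apply: finite_bigcup_closed => k; case: (H k).
  + by move=> t [k _ Ck]; exists k => //; case: (H k) => _ _ + _ _; apply.
  + by move=> t [k _ Ak]; exists k => //; case: (H k) => _ _ _ + _; apply.
Qed.

Lemma borel_regular (A : set BT) : measurable A -> regular_set A.
Proof.
have : <<s @open T >> `<=` regular_set.
  apply: smallest_sub; first exact: sigma_algebra_regular.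
  exact: open_regular.
exact.
Qed.

Hypothesis closed_sigma_compact : forall C : set T, closed C ->
  exists K : nat -> set T, (forall n, closed (K n) /\ compact (K n)) /\ \bigcup_n K n = C.

Lemma borel_regular_compact (A : set BT) (e : R) : measurable A -> 0 < e ->
  exists K : set T, [/\ closed K, compact K, K `<=` A & (mu (A `\` K) < e%:E)%E].
Proof.
move=> mA e0; have [_ /(_ e e0)[C [U [cC oU CA AU h]]]] := borel_regular mA.
have [K [cK KC]] := closed_sigma_compact cC.
have h1 : (mu (A `\` C) < e%:E)%E.
  apply: le_lt_trans h; apply: le_measure; rewrite ?inE.
  - by apply: measurableD => //; exact: borel_closed.
  - by apply: measurableD; [exact: borel_open|exact: borel_closed].
  - by move=> t [At nC]; split => //; exact: AU.
rewrite -KC in h1.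
have mK n : measurable (K n : set BT) by apply: borel_closed; case: (cK n).
have [n hn] := bigcup_exhaust mA mK h1.
exists (\bigcup_(k in `I_n) K k); split => //.
- by apply: finite_bigcup_closed => k; case: (cK k).
- rewrite bigcup_mkord; elim/big_ind : _ => [|X Y|i _]; first exact: compact0.
    exact: compactU.
  by case: (cK i).
- by move=> t [k _ Kk]; apply: CA; rewrite -KC; exists k.
Qed.

End regularity.

(** Monotonicity and subadditivity of the variation reduce both equalities to the gaps U \ A and A \
    K, whose variation is at most their measure under the dominating measure. *)
Lemma sigma_compact_radon (T : ptopologicalType) (R : realType) (lam : complex_measure (borel T) R) :
  (forall U : set T, open U ->
    exists C : nat -> set T, (forall n, closed (C n)) /\ \bigcup_n C n = U) ->
  (forall C : set T, closed C ->
    exists K : nat -> set T, (forall n, closed (K n) /\ compact (K n)) /\ \bigcup_n K n = C) ->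
  radon lam.
Proof.
move=> HU HK A mA; have [mu [mufin muH]] := dominating_measure lam.
have varfin : cmvariation lam A \is a fin_num.
  have v0 : (0 <= cmvariation lam A)%E.
    pose F n := if n is 0%N then A else set0.
    apply: (@le_trans _ _ (\sum_(n <oo) (normc (lam (F n)))%:E)%E).
      by apply: nneseries_ge0 => n _ _; rewrite lee_fin normc_ge0.
    apply: ereal_sup_ubound; exists F => //; split.
    - by case=> [|n]; [exact: mA|exact: measurable0].
    - by apply/trivIsetP => -[|i] [|j] // _ _ _ /=; rewrite ?setI0 ?set0I.
    - by apply/seteqP; split => [t [[|n] _ //]|t At]; exists 0%N.
  rewrite ge0_fin_numE//; apply: le_lt_trans (cmvariation_le A muH) _.
  by apply: le_lt_trans mufin; apply: le_measure; rewrite ?inE.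
split; apply/eqP; rewrite eq_le; apply/andP; split.
- apply: le_ereal_inf_tmp => _ [U [oU AU] <-]; apply: le_cmvariation => //; exact: borel_open.
- apply/lee_addgt0Pr => e e0.
  have [_ /(_ e e0)[C [U [cC oU CA AU h]]]] := borel_regular HU mufin mA.
  apply: (@le_trans _ _ (cmvariation lam U)); first by apply: ereal_inf_lbound; exists U.
  have mU := borel_open oU.
  apply: le_trans (cmvariation_subadditive lam mA mU) _.
  have -> : U `&` A = A by apply/setIidPr.
  apply: leeD => //; apply: le_trans (cmvariation_le _ muH) _; apply: le_trans (ltW h).
  apply: le_measure; rewrite ?inE.
  + exact: measurableD.
  + by apply: measurableD => //; exact: borel_closed.
  + by move=> t [Ut nA]; split => // Ct; apply: nA; exact: CA.
- apply/lee_addgt0Pr => e e0.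
  have [K [cK kK KA h]] := borel_regular_compact HU mufin HK mA e0.
  have mK := borel_closed cK.
  apply: le_trans (cmvariation_subadditive lam mK mA) _.
  have -> : A `&` K = K by apply/setIidPr.
  apply: leeD; first by apply: ereal_sup_ubound; exists K.
  by apply: le_trans (cmvariation_le _ muH) _; exact: ltW.
- apply: ge_ereal_sup => _ [K [kK KA] <-]; exact: le_cmvariation.
Qed.

Section radon_line_circle.
Context (R : realType).

Lemma line_radon (lam : complex_measure (borel R) R) : radon lam.
Proof.
apply: sigma_compact_radon => [U oU|C cC].
  exists (rational_segments U); split; last exact: rational_segments_cover.
  by move=> n; apply: (compact_closed (@Rhausdorff R)); exact: rational_segments_compact.
exists (fun n => C `&` `[- n%:R, n%:R]%classic); split.
  move=> n; have cI : compact (`[- n%:R, n%:R]%classic : set R) by exact: segment_compact.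
  have cl : closed (C `&` `[- n%:R, n%:R]%classic).
    by apply: closedI => //; exact: (compact_closed (@Rhausdorff R)).
  by split => //; apply: subclosed_compact cI _ => // t [].
apply/seteqP; split => [t [n _ []]//|t Ct].
exists (Num.bound `|t|) => //; split => //; rewrite /= in_itv /= -ler_norml.
exact/ltW/archi_boundP.
Qed.

Lemma compact_closed_image_Some (K : set R) : compact K -> closed (Some @` K : set (xreal R)).
Proof.
move=> cK; have clK := compact_closed (@Rhausdorff R) cK.
rewrite -[X in closed X]setCK; apply: open_closedC; rewrite openE => -[x|] nK.
  have nKx : (~` K) x by move=> Kx; apply: nK; exists x.
  have oK := closed_openC clK.
  have : nbhs (Some x : xreal R) (Some @` (~` K)).
    by apply: one_point_compactification_some_nbhs; exact: open_nbhs_nbhs.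
  by apply: filterS => _ [t Kt <-] [t' Kt' [tt]]; apply: Kt; rewrite -tt.
exists K => // _ [[t Kt <-]|->]; last by case.
by case=> t' Kt' [tt]; apply: Kt; rewrite -tt.
Qed.

Lemma circle_radon (lam : complex_measure (borel (xreal R)) R) : radon lam.
Proof.
apply: sigma_compact_radon => [U oU|C cC]; last first.
  exists (fun=> C); split; last by rewrite bigcup_const//; exists 0%N.
  move=> _; split => //; apply: (subclosed_compact cC (@one_point_compactification_compact R)) => //.
pose V : set R := Some @^-1` U.
have oV : open V.
  apply: (@open_comp R (xreal R) Some U) => // x _.
  exact: one_point_compactification_some_continuous.
(* Index 0 is reserved for the point at infinity, when it belongs to [U]; the other indices carry
   the segments filling the real part. *)
exists (fun n => if n is n'.+1 then Some @` rational_segments V n' else U `&` [set None]); split.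
  case=> [|n]; last by apply: compact_closed_image_Some; exact: rational_segments_compact.
  have [UN|UN] := pselect (U None).
    have -> : U `&` [set None] = ~` range Some.
      apply/seteqP; split => [_ [_ ->] []//|[x|] h]; first by exfalso; apply: h; exists x.
      by split.
    apply: open_closedC; apply: one_point_compactification_open_some; exact: openT.
  have -> : U `&` [set None] = set0 by apply/seteqP; split => // x [Ux xN]; apply: UN; rewrite -xN.
  exact: closed0.
apply/seteqP; split => [t [[|n] _]|[x|] Ut].
- by case.
- by case=> x /rational_segments_sub Vx <-.
- have [n _ Cn] : (\bigcup_n rational_segments V n) x by rewrite (rational_segments_cover oV).
  by exists n.+1 => //; exists x.
- by exists 0%N.
Qed.

End radon_line_circle.

(** * Functions with vanishing boundary measure are rational *)

Section global_bound.
Context (R : realType).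
Implicit Types (phi psi g : R[i] -> R[i]) (z w : R[i]).

Lemma behaves_simply_at_realP phi (s : R) : behaves_simply_at_real phi s <->
  exists2 d : R, 0 < d & exists M : R, forall z, normc (z - s%:C) < d -> Im z != 0 ->
    `|Im z| * normc (phi z) <= M.
Proof.
split.
  move=> [U /nbhs_normcP[d d0 Ud] [M [Mr HM]]]; exists d => //; exists (Re (M + 1)) => z zd z0.
  have M1 : M < M + 1 by rewrite ltrDl ltr01.
  have := HM _ M1 z (conj (Ud z zd) z0); rewrite /=.
  rewrite normr_normc Normc.normcM normc_real lecE => /andP[_].
  by [].
move=> [d d0 [M HM]]; exists [set z | normc (z - s%:C) < d]; first by apply/nbhs_normcP; exists d.
exists M%:C; split; first by rewrite realE !lecE /= eqxx /= le_total.
move=> x Mx z [/= zd z0]; apply: le_trans (ltW Mx).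
by rewrite normr_normc Normc.normcM normc_real lecE /= eqxx HM.
Qed.

Lemma Im_inv_opp z : Im (- z^-1) = Im z / normc z ^+ 2.
Proof.
case: z => a b; rewrite /normc /= sqr_sqrtr ?addr_ge0 ?sqr_ge0//.
by rewrite opprK.
Qed.

(** Simple behaviour at infinity gives the bound outside a large disc. On a square covering that
    disc, local bounds (simple behaviour at real points, continuity elsewhere) are made uniform by
    compactness. *)
Lemma behaves_simply_bound phi : holomorphic_on (nonreal R) phi -> behaves_simply phi ->
  exists2 C : R, 0 <= C & forall z, Im z != 0 -> `|Im z| * normc (phi z) <= C * (1 + normc z ^+ 2).
Proof.
move=> hol bs.
have [d d0 [M HM]] : exists2 d : R, 0 < d & exists M : R, forall z, d < normc z -> Im z != 0 ->
    `|Im z| * normc (phi z) <= M * normc z ^+ 2.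
  have /behaves_simply_at_realP[d d0 [M HM]] := bs None.
  exists (d^-1); first by rewrite invr_gt0.
  exists M => z dz z0.
  have n0 : 0 < normc z by apply: le_lt_trans dz; rewrite invr_ge0 ltW.
  have zz : z != 0 by rewrite -normc_gt0.
  have := HM (- z^-1); rewrite subr0 normcN Normc.normcV -[d]invrK ltf_pV2 ?posrE ?invr_gt0// => /(_ dz).
  rewrite Im_inv_opp invrN invrK opprK mulf_eq0 negb_or z0 /= invr_eq0 expf_neq0 ?gt_eqF// => /(_ isT).
  by rewrite normrM normfV [`|normc z ^+ 2|]ger0_norm ?sqr_ge0// mulrAC ler_pdivrMr ?exprn_gt0.
pose N := d + 1.
have [M' HM'] : exists M' : R, forall z, crect (- N) N (- N) N z -> Im z != 0 ->
    `|Im z| * normc (phi z) <= M'.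
  have := @crect_compact R (- N) N (- N) N.
  move=> /compact_near_coveringP /(_ R (+oo)%R (fun M' z => Im z != 0 -> `|Im z| * normc (phi z) <= M') _).
  have loc p : exists2 e : R, 0 < e & exists K : R, forall z, normc (z - p) < e -> Im z != 0 ->
      `|Im z| * normc (phi z) <= K.
    have [p0|p0] := eqVneq (Im p) 0.
      have -> : p = (Re p)%:C by apply/eqP; rewrite eq_complex /= p0 !eqxx.
      by apply/behaves_simply_at_realP; exact: (bs (Some (Re p))).
    have /ccontinuousP/(_ 1 ltr01)[e e0 He] := derivable_continuous (hol p p0).
    exists (Num.min e 1); first by rewrite lt_min e0 ltr01.
    exists ((`|Im p| + 1) * (normc (phi p) + 1)) => z; rewrite lt_min => /andP[h1 h2] _.
    apply: ler_pM; rewrite ?normc_ge0//.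
      have := Im_normc (z - p); rewrite raddfB /= => h3.
      have := ler_distD (Im p) (Im z) 0; rewrite !subr0; lra.
    have := le_normcD (phi z - phi p) (phi p); rewrite subrK.
    by have := He z h1; lra.
  move=> H; have [|K [_ HK]] := H _.
    move=> p _; have [e e0 [K HK]] := loc p.
    exists ([set z | normc (z - p) < e], [set x | K < x]).
      split; first by apply/nbhs_normcP; exists e.
      by exists K; split => //; exact: num_real.
    by move=> [z x] /= [ze Kx] z0; apply: le_trans (ltW Kx); exact: HK.
  exists (K + 1) => z hz z0; apply: (HK (K + 1)) => //; by rewrite ltrDl.
exists (`|M| + `|M'|); first by rewrite addr_ge0.
move=> z z0; have n1 : 1 <= 1 + normc z ^+ 2 by rewrite lerDl sqr_ge0.
have [zN|zN] := leP (normc z) N.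
  apply: (@le_trans _ _ M').
    apply: HM' => //; split; rewrite -ler_norml; apply: le_trans zN.
      exact: Re_normc.
    exact: Im_normc.
  apply: le_trans (ler_norm _) _; rewrite -[leLHS]mulr1; apply: ler_pM => //.
  by rewrite lerDr.
apply: le_trans (HM z _ z0) _; first by move: zN; rewrite /N; lra.
apply: (@le_trans _ _ (`|M| * normc z ^+ 2)); first by rewrite ler_wpM2r ?sqr_ge0// ler_norm.
by apply: ler_pM; rewrite ?sqr_ge0// ?lerDl ?lerDr.
Qed.

(** Converse of [behaves_simply_bound]. At infinity, Im(-1/z) = Im z / |z|^2 trades the quadratic
    weight for a constant. *)
Lemma cauchy_behaves_simply phi (C : R) : (forall z, Im z != 0 ->
  `|Im z| * normc (phi z) <= C * (1 + normc z ^+ 2)) -> behaves_simply phi.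
Proof.
move=> H.
have C0 : 0 <= C.
  have i0 : Im ('i%C : R[i]) != 0 by rewrite /= oner_eq0.
  have := H _ i0; rewrite normci expr1n => h.
  have : 0 <= C * (1 + 1) by apply: le_trans h; rewrite mulr_ge0 ?normc_ge0.
  by rewrite pmulr_lge0.
case=> [s|]; apply/behaves_simply_at_realP; exists 1 => //.
  exists (C * (1 + (1 + `|s|) ^+ 2)) => z zs z0; apply: le_trans (H z z0) _.
  rewrite ler_wpM2l// lerD2l lerXn2r ?nnegrE ?normc_ge0 ?addr_ge0//.
  have := le_normcD (z - s%:C) s%:C; rewrite subrK normc_real; lra.
exists (2 * C) => z; rewrite subr0 => z1 z0.
have zz : z != 0 by apply: contra z0 => /eqP ->.
have n0 : 0 < normc z by rewrite normc_gt0.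
have i0 : Im (- z^-1) != 0 by rewrite Im_inv_opp mulf_neq0// invr_eq0 expf_neq0// gt_eqF.
have := H _ i0; rewrite Im_inv_opp normcN Normc.normcV normrM normfV [`|normc z ^+ 2|]ger0_norm ?sqr_ge0//.
rewrite mulrAC ler_pdivrMr ?exprn_gt0// => h; apply: le_trans h _.
rewrite exprVn -mulrA mulrDl mul1r mulVf ?expf_neq0 ?gt_eqF// [2 * C]mulrC ler_wpM2l//.
by rewrite -[leRHS]/(1 + 1) lerD2r exprn_ile1// ?normc_ge0// ltW.
Qed.

End global_bound.

(** * Isolated real singularities under the growth bound *)

Section pole_decomposition.
Context (R : realType).
Implicit Types (psi g : R[i] -> R[i]) (z w : R[i]) (l : seq R) (s : R).

Lemma normc_triangle z w : normc w <= normc (w - z) + normc z.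
Proof. by have := le_normcD (w - z) z; rewrite subrK. Qed.

(** The growth bound involves |Im u|, whereas a simple pole needs |u - s|. On a square about [u]
    with radius comparable to |u - s|, [boundary_growth] converts one into the other, and
    [simple_pole_split] finishes. *)
Lemma real_nbhs_pole g s (r : R) C : 0 < r ->
  (forall u, csquare s%:C r u -> u != s%:C -> derivable g u 1) ->
  (forall u, csquare s%:C r u -> Im u != 0 -> `|Im u| * normc (g u) <= C) ->
  exists (k : R[i]) (G : R[i] -> R[i]),
    (forall u, csquare s%:C (r / 2) u -> derivable G u 1) /\
    (forall u, u != s%:C -> g u = k / (u - s%:C) + G u).
Proof.
move=> r0 dg gC; have r2 : 0 < r / 2 by lra.
apply: (@simple_pole_split _ _ _ _ (4 * (36 * 9 * C))) => // u hu us.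
  apply: dg => //; move: hu => /csquareP[h1 h2]; apply/csquareP; split; lra.
have n0 : 0 < normc (u - s%:C) by rewrite normc_gt0 subr_eq0.
have [h1 h2] := (csquareP _ _ _).1 hu.
(* Points of the square of radius q are within 2 q = |u - s| / 2 of [u], so the square avoids
   [s]. *)
pose q := normc (u - s%:C) / 4.
have q0 : 0 < q by rewrite /q; lra.
have qr : q <= r / 2.
  have := normc_le_ReIm (u - s%:C); rewrite /q; lra.
have sub v : csquare u q v -> csquare s%:C r v.
  by move=> hv; have := csquare_trans hu hv; move=> /csquareP[? ?]; apply/csquareP; split; lra.
have := @boundary_growth _ u q g C q0 _ _.
have -> : 36 * 9 * C / q = 4 * (36 * 9 * C) / normc (u - s%:C).
  by rewrite /q; field; rewrite gt_eqF.
apply.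
  move=> v hv; apply: dg; first exact: sub.
  apply/eqP => vs; have := csquare_norm hv; rewrite vs normcB /q; lra.
by move=> v /sub hv; exact: gC.
Qed.

(** Induction on the exceptional points. Subtracting k/(z - s) keeps the growth bound, with C + |k|,
    because |Im z| <= |z - s|. When no point is left, [boundary_growth] on the square of radius 1 +
    |z| gives linear growth. *)
Lemma decompose_poles l g (C : R) : uniq l ->
  (forall z, (forall s, s \in l -> z != s%:C) -> derivable g z 1) ->
  (forall z, Im z != 0 -> `|Im z| * normc (g z) <= C * (1 + normc z ^+ 2)) ->
  exists (c0 c1 : R[i]) (a : R -> R[i]), forall z, (forall s, s \in l -> z != s%:C) ->
    g z = c0 + c1 * z + \sum_(s <- l) a s / (z - s%:C).
Proof.
have C0 (g' : R[i] -> R[i]) (C' : R) : (forall z, Im z != 0 -> `|Im z| * normc (g' z) <= C' * (1 + normc z ^+ 2)) -> 0 <= C'.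
  move=> H; have i0 : Im ('i%C : R[i]) != 0 by rewrite /= oner_eq0.
  have := H _ i0; rewrite normci expr1n => h.
  have : 0 <= C' * (1 + 1) by apply: le_trans h; rewrite mulr_ge0 ?normc_ge0.
  by rewrite pmulr_lge0.
elim: l g C => [|s l IH] g C.
  move=> _ dg gC; have Cp := C0 _ _ gC.
  have [a [b H]] : exists a b : R[i], forall z, g z = a + b * z.
    apply: (@entire_linear _ g (36 * 9 * (10 * C))) => [z|z]; first exact: dg.
    have n0 := normc_ge0 z; have r0 : 0 < 1 + normc z by lra.
    (* The constant 10: points [u] of this square satisfy |u| <= 3 (1 + |z|), hence 1 + |u|^2 <= 10
       (1 + |z|)^2. *)
    have := @boundary_growth _ z (1 + normc z) g (10 * C * (1 + normc z) ^+ 2) r0 _ _.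
    have -> : 36 * 9 * (10 * C * (1 + normc z) ^+ 2) / (1 + normc z) = 36 * 9 * (10 * C) * (1 + normc z).
      by field; rewrite gt_eqF.
    apply; first by move=> u _; exact: dg.
    move=> u hu u0; apply: le_trans (gC u u0) _.
    rewrite [10 * C]mulrC -mulrA ler_wpM2l//.
    have h1 := csquare_norm hu; have h2 := normc_triangle z u.
    have h3 : normc u <= 3 * (1 + normc z) by lra.
    have h4 : normc u ^+ 2 <= (3 * (1 + normc z)) ^+ 2.
      by rewrite lerXn2r ?nnegrE ?normc_ge0//; lra.
    have h5 : 1 <= (1 + normc z) ^+ 2 by rewrite exprn_ege1//; lra.
    by move: h4; rewrite exprMn -[3 ^+ 2]/(3 * 3); lra.
  by exists a, b, (fun=> 0) => z _; rewrite big_nil addr0.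
move=> /andP[sl ul] dg gC; have Cp := C0 _ _ gC.
have [r r0 Hr] : exists2 r : R, 0 < r & forall u, csquare s%:C r u -> forall t, t \in l -> u != t%:C.
  elim: l sl {ul IH dg} => [|t l IHl] /=; first by exists 1.
  rewrite inE negb_or => /andP[st /IHl[r r0 Hr]].
  exists (Num.min r (`|s - t| / 2)).
    by rewrite lt_min r0 divr_gt0// normr_gt0 subr_eq0.
  move=> u /csquareP[h1 h2] t'; rewrite inE => /orP[/eqP ->|t'l]; last first.
    by apply: Hr t'l; apply/csquareP; move: h1 h2; rewrite !le_min => /andP[? _] /andP[? _].
  apply/eqP => ut; move: h1; rewrite ut raddfB /= le_min => /andP[_].
  have : 0 < `|s - t| by rewrite normr_gt0 subr_eq0.
  by rewrite distrC; lra.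
have hd u : csquare s%:C r u -> u != s%:C -> derivable g u 1.
  move=> hu us; apply: dg => t; rewrite inE => /orP[/eqP->//|]; exact: Hr.
have hC u : csquare s%:C r u -> Im u != 0 -> `|Im u| * normc (g u) <= C * (1 + (2 * r + `|s|) ^+ 2).
  move=> hu u0; apply: le_trans (gC u u0) _; rewrite ler_wpM2l// lerD2l.
  rewrite lerXn2r ?nnegrE ?normc_ge0 ?addr_ge0 ?mulr_ge0 ?(ltW r0)//.
  have := csquare_norm hu; have := normc_triangle s%:C u; rewrite normc_real; lra.
have [k [G [dG gG]]] := real_nbhs_pole r0 hd hC.
have GE z : z != s%:C -> G z = g z - k / (z - s%:C) by move=> /gG ->; ring.
have dG' z : (forall t, t \in l -> z != t%:C) -> derivable G z 1.
  move=> zl; have [->|zs] := eqVneq z s%:C.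
    by apply: dG; apply: csquare_center; lra.
  have zs0 : z - s%:C != 0 by rewrite subr_eq0.
  apply: (@derivable_near _ (fun w => g w - k * (w - s%:C)^-1)).
    apply/nbhs_normcP; exists (normc (z - s%:C)); first by rewrite normc_gt0.
    by move=> w hw; rewrite GE//; apply/eqP => ws; move: hw; rewrite ws normcB ltxx.
  have d1 : derivable g z 1 by apply: dg => t; rewrite inE => /orP[/eqP->//|]; exact: zl.
  have d2 : derivable (fun w : R[i] => w - s%:C) z 1 by exact: (cderB (@cder_id R z) (@cder_cst R s%:C z)).
  have d3 := @cderV R (fun w => w - s%:C) z zs0 d2.
  exact: (cderB d1 (cderM (@cder_cst R k z) d3)).
have [|c0 [c1 [a H]]] := IH G (C + normc k) ul dG'.
  move=> z z0; have zs : z != s%:C by apply: contra z0 => /eqP ->.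
  have n0 : 0 < normc (z - s%:C) by rewrite normc_gt0 subr_eq0.
  rewrite GE//; apply: le_trans (ler_wpM2l (normr_ge0 _) (le_normcB _ _)) _.
  rewrite mulrDr mulrDl; apply: lerD; first exact: gC.
  rewrite Normc.normcM Normc.normcV.
  apply: (@le_trans _ _ (normc k)); last by rewrite ler_peMr ?normc_ge0// lerDl sqr_ge0.
  rewrite mulrCA ler_piMr ?normc_ge0// ler_pdivrMr// mul1r.
  by have := Im_normc (z - s%:C); rewrite raddfB /= subr0.
exists c0, c1, (fun t => if t == s then k else a t) => z zl.
have zs : z != s%:C by apply: zl; rewrite mem_head.
rewrite (gG z zs) H; last by move=> t tl; apply: zl; rewrite inE tl orbT.
rewrite big_cons eqxx addrCA; congr (_ + (_ + _)).
apply: eq_big_seq => t tl; case: eqP => // ts.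
by move: sl; rewrite -ts tl.
Qed.

Lemma derivable_add_i (psi : R[i] -> R[i]) z : {for z, continuous psi} ->
  psi (z + 'i%C * y%:C) @[y --> (0 : R)^'+] --> psi z.
Proof.
move=> /ccontinuousP cp; apply/cvg_normcP => e e0; have [d d0 Hd] := cp e e0.
near=> y; apply: Hd; rewrite addrC addKr Normc.normcM normci mul1r normc_real.
have y0 : 0 < y by near: y; exact: nbhs_right_gt.
rewrite gtr0_norm//; near: y; exact: nbhs_right_lt.
Unshelve. all: by end_near. Qed.

(** Values on the line are vertical limits from above, so the local extensions given by reflection
    glue by construction. At exceptional points the limit may fail to exist, and nothing is claimed
    there. *)
Definition boundary_extension psi z : R[i] :=
  if Im z != 0 then psi z else lim (psi (z + 'i%C * y%:C) @[y --> (0 : R)^'+]).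

Lemma boundary_extension_real psi G (s r : R) : 0 < r ->
  (forall z, csquare s%:C r z -> Im z != 0 -> G z = psi z) ->
  (forall z e, 0 < e -> csquare z e `<=` csquare s%:C r -> derivable G z 1) ->
  forall z, csquare s%:C (r / 2) z -> derivable (boundary_extension psi) z 1.
Proof.
move=> r0 GE dG.
have sub z : csquare s%:C (r / 2) z -> csquare z (r / 4) `<=` csquare s%:C r.
  move=> hz u hu; have := csquare_trans hz hu.
  by move=> /csquareP[? ?]; apply/csquareP; split; lra.
have r4 : 0 < r / 4 by lra.
have E z : csquare s%:C (3 * r / 4) z -> boundary_extension psi z = G z.
  move=> hz; have hz' : csquare z (r / 4) `<=` csquare s%:C r.
    move=> u hu; have := csquare_trans hz hu.
    by move=> /csquareP[? ?]; apply/csquareP; split; lra.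
  rewrite /boundary_extension; case: ifPn => [z0|]; first by rewrite GE//; apply: hz'; apply: csquare_center; exact: ltW.
  rewrite negbK => /eqP z0.
  have c := derivable_add_i (derivable_continuous (dG z _ r4 hz')).
  apply: cvg_lim; first exact: norm_hausdorff.
  apply: cvg_trans c; apply: near_eq_cvg; near=> y.
  have y0 : 0 < y by near: y; exact: nbhs_right_gt.
  rewrite GE//.
    apply: hz'; apply: normc_csquare; rewrite addrC addKr Normc.normcM normci mul1r normc_real gtr0_norm//.
    by near: y; exact: nbhs_right_le.
  by rewrite raddfD /= z0 mul0r mul1r !add0r gt_eqF.
move=> z hz; apply: (@derivable_near _ G); last exact: dG (sub z hz).
apply/nbhs_normcP; exists (r / 4) => // w hw; rewrite E//.
have hw' := normc_csquare (ltW hw); have := csquare_trans hz hw'.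
by move=> /csquareP[? ?]; apply/csquareP; split; lra.
Unshelve. all: by end_near. Qed.

End pole_decomposition.

(** * Extension across the set with vanishing boundary measure *)

Section extension_over_boundary.
Context (R : realType).
Local Notation leb := (@lebesgue_measure R).
Implicit Types (phi psi g : R[i] -> R[i]) (z w : R[i]) (S : set R).

Lemma cRintegral_support (D : set R) (h : R -> R[i]) : (forall x, ~ D x -> h x = 0) ->
  cRintegral leb setT h = cRintegral leb D h.
Proof.
move=> h0; rewrite /cRintegral; congr (_ +i* _).
  rewrite [RHS]Rintegral_mkcond; congr (Rintegral _ _ _); apply/funext => x.
  by rewrite patchE; case: ifPn => // /negP xD; rewrite h0// => Dx; apply: xD; rewrite inE.
rewrite [RHS]Rintegral_mkcond; congr (Rintegral _ _ _); apply/funext => x.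
by rewrite patchE; case: ifPn => // /negP xD; rewrite h0// => Dx; apply: xD; rewrite inE.
Qed.

Definition boundary_weight (x : R) : R[i] := 2 * pi%:C * 'i%C * (1 + x ^+ 2)%:C.

Lemma boundary_weight_neq0 x : boundary_weight x != 0.
Proof.
rewrite /boundary_weight !mulf_neq0//.
- by rewrite eq_complex /= negb_and gt_eqF// pi_gt0.
- by rewrite -normc_gt0 normci.
- by rewrite eq_complex /= negb_and gt_eqF// ltr_wpDr ?sqr_ge0.
Qed.

(** Boundary measures are defined with division by this weight; absorbing it into the test function
    leaves the plain jump required by [reflection]. The weight is purely imaginary, hence the zero
    real part. *)
Lemma weighted_test (f : R -> R) S (D : set R) : smooth f -> compact D -> D `<=` S ->
  (forall x, ~ D x -> f x = 0) -> Cc_infty S (fun x => (f x)%:C * boundary_weight x).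
Proof.
move=> sf cD DS f0.
have supp : closure [set x | (f x)%:C * boundary_weight x != 0] `<=` D.
  rewrite ((closure_id D).1 (compact_closed (@Rhausdorff R) cD)).
  apply: closure_subset => x /= h; apply: contrapT => nD; move/eqP : h; apply.
  by rewrite f0// mul0r.
split.
- have -> : (fun x => Re ((f x)%:C * boundary_weight x)) = fun=> 0.
    by apply/funext => x; rewrite /boundary_weight /=; ring.
  exact: smooth_cst.
- have -> : (fun x => Im ((f x)%:C * boundary_weight x)) = fun x => f x * (2 * pi * (1 + x * x)).
    by apply/funext => x; rewrite /boundary_weight /=; ring.
  apply: smoothM => //; apply: smoothM; first exact: smooth_cst.
  by apply: smoothD; [exact: smooth_cst|apply: smoothM; exact: smooth_id].
- by apply: subclosed_compact cD supp; exact: closed_closure.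
- exact: subset_trans DS.
Qed.

Lemma extension_over_boundary psi S (C : R) : (forall z, Im z != 0 -> derivable psi z 1) ->
  (forall z, Im z != 0 -> `|Im z| * normc (psi z) <= C * (1 + normc z ^+ 2)) -> open S ->
  (forall f, Cc_infty S f -> boundary_pairing f psi y @[y --> 0^'+] --> (0 : R[i])) ->
  forall s, S s -> exists2 r : R, 0 < r &
    forall z, csquare s%:C r z -> derivable (boundary_extension psi) z 1.
Proof.
move=> dpsi bpsi oS jpsi s Ss.
have /nbhs_ballP[e /= e0 He] := open_nbhs_nbhs (conj oS Ss).
(* 1 / 8 is the bound asked by [reflection]; e / 4 keeps the interval of radius 3 r, which carries
   the test functions, inside [S]. *)
pose r := Num.min (1 / 8) (e / 4).
have r0 : 0 < r by rewrite lt_min !divr_gt0.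
have r8 : r <= 1 / 8 by rewrite ge_min lexx.
have re : r <= e / 4 by rewrite ge_min lexx orbT.
have C0 : 0 <= C.
  have i0 : Im ('i%C : R[i]) != 0 by rewrite /= oner_eq0.
  have := bpsi _ i0; rewrite normci expr1n => h.
  have : 0 <= C * (1 + 1) by apply: le_trans h; rewrite mulr_ge0 ?normc_ge0.
  by rewrite pmulr_lge0.
pose C' := C * (1 + (1 + `|s|) ^+ 2).
have b' z : csquare s%:C (4 * r) z -> Im z != 0 -> `|Im z| * normc (psi z) <= C'.
  move=> hz z0; apply: le_trans (bpsi z z0) _; rewrite ler_wpM2l// lerD2l.
  rewrite lerXn2r ?nnegrE ?normc_ge0 ?addr_ge0//.
  have := csquare_norm hz; have := normc_triangle s%:C z; rewrite normc_real; lra.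
have j' (f : R -> R) : smooth f -> (forall t, 3 * r <= `|t - s| -> f t = 0) ->
    forall eta : R, 0 < eta -> exists2 d : R, 0 < d & forall y, 0 < y < d ->
    normc (segint (s - 3 * r) (s + 3 * r)
      (fun x => (f x)%:C * (psi (x +i* y) - psi (x +i* (- y))))) < eta.
  move=> sf f0 eta eta0.
  have cD : compact (`[s - 3 * r, s + 3 * r]%classic : set R) by exact: segment_compact.
  have DS : `[s - 3 * r, s + 3 * r]%classic `<=` S.
    move=> t /=; rewrite in_itv /= => /andP[t1 t2]; apply: He.
    by rewrite /ball /= ltr_norml; apply/andP; split; lra.
  have fD x : ~ `[s - 3 * r, s + 3 * r]%classic x -> f x = 0.
    move=> xD; apply: f0; rewrite leNgt; apply/negP => h; apply: xD.
    by rewrite /= in_itv /=; move: h; rewrite ltr_norml => /andP[? ?]; apply/andP; split; lra.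
  have cc := weighted_test sf cD DS fD.
  have /cvg_normcP/(_ _ eta0) := jpsi _ cc.
  move=> /nbhs_ballP[d /= d0 Hd]; exists d => // y /andP[y0 yd].
  have := Hd y; rewrite /ball /= sub0r normrN gtr0_norm// => /(_ yd y0).
  rewrite subr0; congr (normc _ < _).
  rewrite /boundary_pairing /segint.
  rewrite -(@cRintegral_support `[s - 3 * r, s + 3 * r]%classic (fun x => (f x)%:C * (psi (x +i* y) - psi (x -i* y)))); last first.
    by move=> x xD; rewrite (fD x xD) mul0r.
  congr (cRintegral _ _ _); apply/funext => x; rewrite -/(boundary_weight x).
  by rewrite -mulrA; congr (_ * _); rewrite mulrC divfK// boundary_weight_neq0.
have d' z : csquare s%:C (4 * r) z -> Im z != 0 -> derivable psi z 1 by move=> _; exact: dpsi.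
have [G [GE dG]] := reflection r0 r8 d' b' j' (fun eta => @mollifier_exists R r eta r0).
have r2 : 0 < r / 2 by lra.
exists (r / 2 / 2); first by lra.
exact: boundary_extension_real GE dG.
Qed.

Lemma boundary_extension_nonreal psi z : Im z != 0 -> derivable psi z 1 ->
  derivable (boundary_extension psi) z 1.
Proof.
move=> z0 dz; apply: (@derivable_near _ psi); last exact: dz.
apply/nbhs_normcP; exists `|Im z|; first by rewrite normr_gt0.
move=> w hw; rewrite /boundary_extension ifT//.
have := Im_normc (w - z); rewrite raddfB /= => h; apply/eqP => w0.
by move: h; rewrite w0 sub0r normrN leNgt hw.
Qed.

Lemma rational_decomposition psi S (l : seq R) (C : R) :
  (forall z, Im z != 0 -> derivable psi z 1) ->
  (forall z, Im z != 0 -> `|Im z| * normc (psi z) <= C * (1 + normc z ^+ 2)) -> open S ->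
  (forall f, Cc_infty S f -> boundary_pairing f psi y @[y --> 0^'+] --> (0 : R[i])) ->
  uniq l -> (forall s, s \notin l -> S s) ->
  exists (c0 c1 : R[i]) (a : R -> R[i]), forall z, Im z != 0 ->
    psi z = c0 + c1 * z + \sum_(s <- l) a s / (z - s%:C).
Proof.
move=> dpsi bpsi oS jpsi ul lS.
have [z zl||c0 [c1 [a H]]] := @decompose_poles R l (boundary_extension psi) C ul.
- have [z0|z0] := eqVneq (Im z) 0; last by apply: boundary_extension_nonreal => //; exact: dpsi.
  have zE : z = (Re z)%:C by apply/eqP; rewrite eq_complex /= z0 !eqxx.
  have Sz : S (Re z) by apply: lS; apply/negP => /zl; rewrite -zE eqxx.
  have [r r0 dr] := extension_over_boundary dpsi bpsi oS jpsi Sz.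
  by rewrite zE; apply: dr; apply: csquare_center; exact: ltW.
- by move=> z z0; rewrite /boundary_extension z0; exact: bpsi.
- exists c0, c1, a => z z0; rewrite -H; first by rewrite /boundary_extension z0.
  by move=> s _; apply: contra z0 => /eqP ->.
Qed.

End extension_over_boundary.

(** * Partial fractions and their residues *)

Section rational_functions.
Context (R : realType).
Implicit Types (z w c : R[i]) (l : seq R) (s t : R).

Definition partial_fractions (c0 c1 : R[i]) (a : R -> R[i]) l z : R[i] :=
  c0 + c1 * z + \sum_(s <- l) a s / (z - s%:C).

Lemma derivable_sum_seq (I : eqType) (l : seq I) (F : I -> R[i] -> R[i]) z :
  (forall i, i \in l -> derivable (F i) z 1) -> derivable (fun w => \sum_(i <- l) F i w) z 1.
Proof.
elim: l => [|i l IH] dF.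
  have -> : (fun w => \sum_(i <- [::]) F i w) = fun=> 0 by apply/funext => w; rewrite big_nil.
  exact: (@cder_cst R 0 z).
have -> : (fun w => \sum_(j <- i :: l) F j w) = fun w => F i w + \sum_(j <- l) F j w.
  by apply/funext => w; rewrite big_cons.
have d1 : derivable (F i) z 1 by apply: dF; rewrite mem_head.
have d2 : derivable (fun w => \sum_(j <- l) F j w) z 1.
  by apply: IH => j jl; apply: dF; rewrite inE jl orbT.
exact: (cderD d1 d2).
Qed.

Lemma near_seq (I : eqType) (l : seq I) c (P : I -> R[i] -> Prop) :
  (forall i, i \in l -> \forall z \near c, P i z) ->
  \forall z \near c, forall i, i \in l -> P i z.
Proof.
elim: l => [|i l IH] H; first by apply/nbhs_normcP; exists 1.
have h1 := H i (mem_head _ _).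
have h2 : \forall z \near c, forall j, j \in l -> P j z.
  by apply: IH => j jl; apply: H; rewrite inE jl orbT.
near=> z; move=> j; rewrite inE => /orP[/eqP ->|jl]; first by near: z; exact: h1.
by move: j jl; near: z; exact: h2.
Unshelve. all: by end_near. Qed.

Lemma derivable_simple_fraction (k w z : R[i]) : z != w -> derivable (fun u => k / (u - w)) z 1.
Proof.
move=> zw; have n0 : z - w != 0 by rewrite subr_eq0.
have d2 : derivable (fun u : R[i] => u - w) z 1 by exact: (cderB (@cder_id R z) (@cder_cst R w z)).
have d3 := @cderV R (fun u => u - w) z n0 d2.
exact: (cderM (@cder_cst R k z) d3).
Qed.

Lemma derivable_partial_fractions c0 c1 a l z : (forall s, s \in l -> z != s%:C) ->
  derivable (partial_fractions c0 c1 a l) z 1.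
Proof.
move=> zl.
have d1 : derivable (fun z : R[i] => c0 + c1 * z) z 1.
  exact: (cderD (@cder_cst R c0 z) (cderM (@cder_cst R c1 z) (@cder_id R z))).
have d2 : derivable (fun z : R[i] => \sum_(s <- l) a s / (z - s%:C)) z 1.
  apply: (@derivable_sum_seq _ l (fun s z => a s / (z - s%:C))) => s sl.
  by apply: derivable_simple_fraction; exact: zl.
exact: (cderD d1 d2).
Qed.

Lemma simple_residue_pole f c rho : simple_residue f c rho -> at_most_simple_pole f c.
Proof.
move=> [h [dh hE]]; exists (fun z => rho + (z - c) * h z); split.
  near=> z; have d1 : derivable h z 1 by near: z.
  have d2 : derivable (fun u : R[i] => u - c) z 1 by exact: (cderB (@cder_id R z) (@cder_cst R c z)).
  exact: (cderD (@cder_cst R rho z) (cderM d2 d1)).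
near=> z; have zc : z - c != 0 by rewrite subr_eq0; near: z; exact: nbhs_dnbhs_neq.
rewrite -(_ : f z - rho / (z - c) = h z); last by near: z.
by rewrite mulrBr mulrCA divff// mulr1 addrCA subrr addr0.
Unshelve. all: by end_near. Qed.

Lemma partial_fractionsD1 c0 c1 a l s z : uniq l -> s \in l ->
  partial_fractions c0 c1 a l z = a s / (z - s%:C) + partial_fractions c0 c1 a (rem s l) z.
Proof.
move=> ul sl; rewrite /partial_fractions (perm_big _ (perm_to_rem sl)) big_cons.
by rewrite addrCA.
Qed.

Lemma rem_neq l s t : uniq l -> t \in rem s l -> (s%:C : R[i]) != t%:C.
Proof.
move=> ul; rewrite mem_rem_uniq// inE => /andP[ts _].
by rewrite eq_complex /= eqxx andbT eq_sym.
Qed.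

Lemma residue_partial_fractions c0 c1 a l s : uniq l -> s \in l ->
  simple_residue (partial_fractions c0 c1 a l) s%:C (a s).
Proof.
move=> ul sl; exists (partial_fractions c0 c1 a (rem s l)); split.
  have : \forall z \near s%:C, forall t, t \in rem s l -> z != t%:C.
    by apply: near_seq => t tl; apply: near_neq; exact: rem_neq tl.
  by apply: filterS => z zl; exact: derivable_partial_fractions.
by near=> z; rewrite (partial_fractionsD1 _ _ _ _ ul sl); ring.
Unshelve. all: by end_near. Qed.

(** In the coordinate 1/z the linear term becomes c1/z, while a/(1/z - s) = a z/(1 - s z) is
    holomorphic near 0. *)
Lemma residue_infinity_partial_fractions c0 c1 a l :
  simple_residue (fun z => partial_fractions c0 c1 a l z^-1) 0 c1.
Proof.
pose F s z : R[i] := a s * (z / (1 - s%:C * z)).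
exists (fun z => c0 + \sum_(s <- l) F s z); split.
  have : \forall z \near (0 : R[i]), forall t, t \in l -> 1 - t%:C * z != 0.
    apply: near_seq => t tl; apply/nbhs_normcP; exists ((1 + `|t|)^-1).
      by rewrite invr_gt0 ltr_wpDr.
    move=> w; rewrite subr0 => hw; rewrite -normc_gt0.
    have := le_normcDl (1 : R[i]) (- (t%:C * w)).
    rewrite normcN Normc.normc1 Normc.normcM normc_real.
    have t0 : 0 < 1 + `|t| by rewrite ltr_wpDr.
    have : `|t| * normc w < 1.
      apply: (@le_lt_trans _ _ ((1 + `|t|) * normc w)); first by rewrite ler_wpM2r ?normc_ge0// lerDr.
      by rewrite -ltr_pdivlMl// mulr1.
    lra.
  apply: filterS => z zl.
  have d2 : derivable (fun z => \sum_(s <- l) F s z) z 1.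
    apply: derivable_sum_seq => s sl.
    have e1 : derivable (fun u : R[i] => 1 - s%:C * u) z 1.
      exact: (cderB (@cder_cst R 1 z) (cderM (@cder_cst R s%:C z) (@cder_id R z))).
    have e2 := @cderV R (fun u => 1 - s%:C * u) z (zl s sl) e1.
    exact: (cderM (@cder_cst R (a s) z) (cderM (@cder_id R z) e2)).
  exact: (cderD (@cder_cst R c0 z) d2).
near=> z; have z0 : z != 0 by near: z; exact: nbhs_dnbhs_neq.
rewrite subr0 /partial_fractions.
have -> : \sum_(s <- l) a s / (z^-1 - s%:C) = \sum_(s <- l) F s z.
  apply: eq_bigr => s _; rewrite /F; congr (_ * _).
  have -> : z^-1 - s%:C = (1 - s%:C * z) / z by rewrite mulrBl mul1r mulfK.
  by rewrite invf_div.
ring.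
Unshelve. all: by end_near. Qed.

Lemma continuous_nonreal_limit (F : R[i] -> R[i]) s (k : R[i]) : {for s%:C, continuous F} ->
  (forall z, Im z != 0 -> F z = k) -> F s%:C = k.
Proof.
move=> cF Fk; have c1 := derivable_add_i cF.
have c2 : F (s%:C + 'i%C * y%:C) @[y --> (0 : R)^'+] --> k.
  have ck : (fun=> k) y @[y --> (0 : R)^'+] --> k by exact: cvg_cst.
  apply: cvg_trans ck; apply: near_eq_cvg; near=> y; rewrite Fk//.
  by rewrite raddfD /= mul0r mul1r !add0r gt_eqF//; near: y; exact: nbhs_right_gt.
by apply: (cvg_unique _ c1 c2); exact: norm_hausdorff.
Unshelve. all: by end_near. Qed.

(** Multiplied by z - s, the part without the pole at [s] equals -b(s) off the real line and is
    continuous at [s], where it vanishes. With the poles gone, the values at i and -i determine the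
    linear coefficient. *)
Lemma partial_fractions_eq0 k0 k1 (b : R -> R[i]) l : uniq l ->
  (forall z, Im z != 0 -> partial_fractions k0 k1 b l z = 0) ->
  k1 = 0 /\ forall s, s \in l -> b s = 0.
Proof.
move=> ul H.
have b0 s : s \in l -> b s = 0.
  move=> sl; pose F z := (z - s%:C) * partial_fractions k0 k1 b (rem s l) z.
  have dF : derivable F s%:C 1.
    have d2 : derivable (fun u : R[i] => u - s%:C) s%:C 1.
      exact: (cderB (@cder_id R s%:C) (@cder_cst R s%:C s%:C)).
    have d3 : derivable (partial_fractions k0 k1 b (rem s l)) s%:C 1.
      by apply: derivable_partial_fractions => t tl; exact: rem_neq tl.
    exact: (cderM d2 d3).
  have := @continuous_nonreal_limit F s (- b s) (derivable_continuous dF).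
  rewrite {2}/F subrr mul0r => /(_ _)/esym/eqP; rewrite oppr_eq0 => h.
  apply/eqP; apply: h => z z0; have := H z z0; rewrite (partial_fractionsD1 _ _ _ _ ul sl) => /eqP.
  rewrite addrC addr_eq0 => /eqP; rewrite /F => ->; rewrite mulrN mulrC divfK// subr_eq0.
  by apply: contra z0 => /eqP ->.
split => //.
have E z : Im z != 0 -> k0 + k1 * z = 0.
  move=> z0; have := H z z0; rewrite /partial_fractions big_seq big1 ?addr0//.
  by move=> s sl; rewrite b0// mul0r.
have i1 : Im ('i%C : R[i]) != 0 by rewrite /= oner_eq0.
have i2 : Im (- 'i%C : R[i]) != 0 by rewrite /= oppr_eq0 oner_eq0.
have := E _ i1; have := E _ i2; move=> e2 e1.
have : k1 * (2 * 'i%C) = 0 by rewrite -[RHS](subrr 0) -{1}e1 -e2; ring.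
move/eqP; rewrite !mulf_eq0 => /orP[/eqP //|]; rewrite pnatr_eq0 /= => /eqP h.
by have := normci R; rewrite h normc_0 => /esym/eqP; rewrite oner_eq0.
Qed.

Lemma kernel_fraction z s : Im z != 0 -> kernel z s = (1 + s ^+ 2)%:C / (s%:C - z) - s%:C.
Proof.
move=> z0; have n0 := nonreal_neq s z0.
have -> : (1 + s ^+ 2)%:C = 1 + s%:C ^+ 2 :> R[i] by rewrite rmorphD rmorphXn.
by rewrite /kernel; field.
Qed.

End rational_functions.

(** * Representing measures *)

Section atoms.
Context d (T : measurableType d) (R : realType).
Implicit Types (lam nu : complex_measure T R) (f : T -> R[i]).
Hypothesis measurable_singleton : forall t : T, measurable [set t].

Lemma eq_cmintegral lam nu f : (forall A, measurable A -> lam A = nu A) -> bmeasurable f ->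
  cmintegral lam setT f = cmintegral nu setT f.
Proof.
move=> E bf; have [m1 [m2 [m3 [m4 [E1 E2 _ ->]]]]] := cmintegral_parts nu.
apply: cmintegral_unique => //; try exact: finite_measure_lty.
  move=> A mA; rewrite -E1//.
  rewrite -[LHS](fineK (fin_num_measure (cmRe lam) _ mA)) -[RHS](fineK (fin_num_measure (cmRe nu) _ mA)).
  by congr EFin; have [] := E A mA.
move=> A mA; rewrite -E2//.
rewrite -[LHS](fineK (fin_num_measure (cmIm lam) _ mA)) -[RHS](fineK (fin_num_measure (cmIm nu) _ mA)).
by congr EFin; have [] := E A mA.
Qed.

Definition add_atoms lam (l : seq T) (m : T -> R[i]) : complex_measure T R :=
  foldr (fun t nu => atom_measure nu t (m t)) lam l.

Lemma cmintegral_add_atoms lam l m f : bmeasurable f ->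
  cmintegral (add_atoms lam l m) setT f = cmintegral lam setT f + \sum_(t <- l) m t * f t.
Proof.
move=> bf; elim: l => [|t l IH]; first by rewrite big_nil addr0.
by rewrite big_cons /= cmintegral_atom// IH addrAC addrA.
Qed.

Lemma add_atomsE lam l m A : measurable A ->
  add_atoms lam l m A = lam A + \sum_(t <- l) m t * (\1_A t)%:C.
Proof.
move=> mA; elim: l => [|t l IH]; first by rewrite big_nil addr0.
by rewrite big_cons /= atom_measureE// IH -addrA [X in _ + X]addrC.
Qed.

Lemma cmval_atoms nu (l : seq T) A : uniq l -> measurable A ->
  nu A = nu (A `\` [set` l]) + \sum_(t <- l) nu [set t] * (\1_A t)%:C.
Proof.
move=> ul mA; elim: l ul => [_|t l IH /= /andP[tl ul]].
  by rewrite big_nil addr0; congr (nu _); apply/seteqP; split => [x|x []//] Ax; split.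
have ml : measurable [set` l].
  elim: l {IH tl ul} => [|u l IHl]; first by rewrite set_nil.
  have -> : [set` u :: l] = [set u] `|` [set` l].
    apply/seteqP; split => x /=; rewrite inE; first by move=> /orP[/eqP|]; [left|right].
    by move=> [->|->]; rewrite ?eqxx ?orbT.
  exact: measurableU.
rewrite IH// big_cons (cmval_split nu (measurable_singleton t) (measurableD mA ml)).
have -> : (A `\` [set` l]) `\` [set t] = A `\` [set` t :: l].
  apply/seteqP; split => [x [[Ax nl] nt]|x [Ax nl]].
    by split => //=; rewrite inE => /orP[/eqP|]//; exact: nl.
  by split; [split => // xl; apply: nl; rewrite /= inE [x \in l]xl orbT|move=> xt; apply: nl; rewrite /= xt mem_head].
have -> : nu ((A `\` [set` l]) `&` [set t]) = nu [set t] * (\1_A t)%:C.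
  rewrite indicE; have [At|At] := pselect (A t).
    rewrite mem_set// mulr1; congr (nu _); apply/seteqP; split => [x []//|x ->].
    by split => //; split => //; exact/negP.
  rewrite memNset// mulr0; have -> : (A `\` [set` l]) `&` [set t] = set0.
    by apply/seteqP; split => // x [[Ax _] xt]; apply: At; rewrite -xt.
  exact: cmval0.
by rewrite -addrA addrCA addrA.
Qed.

End atoms.

(** * Existence and identification of the representing measure *)

Section main.
Context (R : realType).
Local Notation BX := (borel (xreal R)).
Implicit Types (phi psi : R[i] -> R[i]) (lam : complex_measure BX R)
  (lamS : complex_measure (borel R) R) (S : set R) (z : R[i]).

Lemma measurable_point (s : R) : measurable ([set s] : set (borel R)).
Proof.
apply: borel_closed; have -> : [set s] = `[s, s]%classic.
  by rewrite set_itv1.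
exact: (compact_closed (@Rhausdorff R) (@segment_compact R s s)).
Qed.

(** The integrand at infinity is z, so mass at infinity shows up as a linear term and the rest is a
    Cauchy transform on the line. *)
Lemma representing_transform phi lam z : representing_measure phi lam -> Im z != 0 ->
  phi z = (phi 'i%C + phi (- 'i%C)) / 2 + cauchy_transform (pull_measure lam) z + lam [set None] * z.
Proof.
move=> [_ H] z0; rewrite H//.
by rewrite -addrA (cmintegral_pull lam (xkernel_bmeasurable z0)).
Qed.

Lemma derivable_nonreal_continuous psi : (forall z, Im z != 0 -> derivable psi z 1) ->
  continuous_nonreal psi.
Proof. by move=> dpsi z /dpsi; exact: derivable_continuous. Qed.

Lemma cauchy_transform_continuous lamS : continuous_nonreal (cauchy_transform lamS).
Proof. by apply: derivable_nonreal_continuous => z z0; exact: cauchy_transform_derivable. Qed.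

Lemma boundary_pairing_ext (f : R -> R[i]) psi1 psi2 y : 0 < y ->
  (forall z, Im z != 0 -> psi1 z = psi2 z) -> boundary_pairing f psi1 y = boundary_pairing f psi2 y.
Proof.
move=> y0 E; rewrite /boundary_pairing; congr (cRintegral _ _ _); apply/funext => x.
by rewrite !E//= ?oppr_eq0 gt_eqF.
Qed.

(** Constants have no jump and the linear term has jump O(y), so only the restriction of [lam] to
    the line survives in the limit. *)
Lemma representing_boundary phi lam S f : representing_measure phi lam -> Cc_infty S f ->
  boundary_pairing f phi y @[y --> 0^'+] --> cmintegral (pull_measure lam) setT f.
Proof.
move=> rep cf; pose k : R[i] := (phi 'i%C + phi (- 'i%C)) / 2.
have c1 := @boundary_pairing_cauchy R S f (pull_measure lam) cf.
have c2 := boundary_pairing_id cf.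
have ck : (fun=> lam [set None]) y @[y --> (0 : R)^'+] --> lam [set None] by exact: cvg_cst.
have c : (boundary_pairing f (cauchy_transform (pull_measure lam)) y + lam [set None] * boundary_pairing f id y)
    @[y --> 0^'+] --> cmintegral (pull_measure lam) setT f.
  rewrite -[X in _ --> X]addr0 -[X in _ --> _ + X](mulr0 (lam [set None])).
  exact: (cvgD c1 (cvgM ck c2)).
apply: cvg_trans c; apply: near_eq_cvg; near=> y.
have y0 : 0 < y by near: y; exact: nbhs_right_gt.
have cid : continuous_nonreal (fun z : R[i] => z) by move=> z _; exact: cvg_id.
have cct := @cauchy_transform_continuous (pull_measure lam).
have cl : continuous_nonreal (fun z => lam [set None] * z).
  by move=> z z0; apply: derivable_continuous; exact: (cderM (@cder_cst R _ z) (@cder_id R z)).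
have ckk : continuous_nonreal (fun _ : R[i] => k) by apply: derivable_nonreal_continuous => z _; exact: (@cder_cst R k z).
have cs : continuous_nonreal (fun z => cauchy_transform (pull_measure lam) z + lam [set None] * z).
  by move=> z z0; exact: (cvgD (cct z z0) (cl z z0)).
rewrite /= (@boundary_pairing_ext f phi (fun z => k + (cauchy_transform (pull_measure lam) z + lam [set None] * z)))//.
  rewrite (boundary_pairingD cf ckk cs y0) boundary_pairing_cst add0r.
  by rewrite (boundary_pairingD cf cct cl y0) (boundary_pairingZ _ cf cid y0).
by move=> z z0; rewrite (representing_transform rep z0) -addrA.
Unshelve. all: by end_near. Qed.

Lemma Im_le_normc2 z : `|Im z| <= 1 + normc z ^+ 2.
Proof.
have := Im_normc z; have := sqr_ge0 (normc z - 1); rewrite sqrrB1 -mulr_natl.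
by have := normc_ge0 z; lra.
Qed.

Lemma representing_behaves_simply phi lam : representing_measure phi lam -> behaves_simply phi.
Proof.
move=> rep; pose k : R[i] := (phi 'i%C + phi (- 'i%C)) / 2.
apply: (@cauchy_behaves_simply _ _ (normc k + cmtotal (pull_measure lam) * 2 + normc (lam [set None]))) => z z0.
rewrite (representing_transform rep z0) -/k.
have y0 : 0 < `|Im z| by rewrite normr_gt0.
have h1 := cauchy_transform_bound (pull_measure lam) z0.
have n0 := normc_ge0 z.
have i1 := Im_le_normc2 z.
apply: (@le_trans _ _ (`|Im z| * (normc k + normc (cauchy_transform (pull_measure lam) z) + normc (lam [set None] * z)))).
  rewrite ler_wpM2l//; apply: le_trans (le_normcD _ _) _; rewrite lerD2r; exact: le_normcD.
move: i1 h1; have := Im_normc z; have : normc z ^+ 2 <= 1 + normc z ^+ 2 by rewrite lerDr.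
move: (1 + normc z ^+ 2) => W nW iz i1 h1.
rewrite [leLHS]mulrDr [`|Im z| * (_ + _)]mulrDr 2!mulrDl; apply: lerD; first apply: lerD.
- by rewrite mulrC ler_wpM2l ?normc_ge0.
- apply: le_trans (ler_wpM2l (ltW y0) h1) _.
  by rewrite mulrCA [`|Im z| * _]mulrC divfK ?gt_eqF// mulrA.
- rewrite Normc.normcM mulrCA ler_wpM2l ?normc_ge0//.
  by apply: le_trans nW; rewrite expr2 ler_wpM2r.
Qed.

Lemma cauchy_integral_transform S lamS z : open S -> cmconcentrated lamS S -> Im z != 0 ->
  cauchy_integral S lamS z = cauchy_transform lamS z.
Proof.
move=> oS cS z0; apply: cmintegral_concentrated => //; first exact: borel_open.
exact: kernel_bmeasurable.
Qed.

(** The difference of [phi] and the transform of [lamS] has a pairing tending to 0 on [S], and both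
    terms obey the same kind of growth bound, so [rational_decomposition] applies with poles in the
    complement of [S]. *)
Lemma boundary_structure phi S lamS : holomorphic_on (nonreal R) phi -> behaves_simply phi ->
  open S -> finite_set (~` S) -> boundary_measure phi S lamS ->
  exists l : seq R, [/\ uniq l, forall s, s \in l <-> ~ S s &
    exists (c0 c1 : R[i]) (a : R -> R[i]), forall z, Im z != 0 ->
      phi z = cauchy_transform lamS z + partial_fractions c0 c1 a l z].
Proof.
move=> hol bs oS /finite_seqP[l0 l0E] [_ concS bm].
have lP s : s \in undup l0 <-> ~ S s.
  rewrite mem_undup; have : [set` l0] s = (~` S) s by rewrite -l0E.
  by move=> /= ->.
exists (undup l0); split => //; first exact: undup_uniq.
have [C C0 HC] := behaves_simply_bound hol bs.
have [t0 _] := cmtotalP lamS.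
pose psi z := phi z + (-1) * cauchy_transform lamS z.
have dct z : Im z != 0 -> derivable (fun z => (-1) * cauchy_transform lamS z) z 1.
  move=> z0; have d1 := @cauchy_transform_derivable R lamS z z0.
  exact: (cderM (@cder_cst R (-1) z) d1).
have dpsi z : Im z != 0 -> derivable psi z 1.
  by move=> z0; exact: (cderD (hol z z0) (dct z z0)).
have bpsi z : Im z != 0 -> `|Im z| * normc (psi z) <= (C + cmtotal lamS * 2) * (1 + normc z ^+ 2).
  move=> z0; apply: le_trans (ler_wpM2l (normr_ge0 _) (le_normcD _ _)) _.
  rewrite mulrDr mulrDl; apply: lerD; first exact: HC.
  rewrite Normc.normcM normcN Normc.normc1 mul1r.
  have y0 : 0 < `|Im z| by rewrite normr_gt0.
  apply: le_trans (ler_wpM2l (ltW y0) (cauchy_transform_bound lamS z0)) _.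
  by rewrite mulrCA [`|Im z| * _]mulrC divfK ?gt_eqF// mulrA.
have jpsi f : Cc_infty S f -> boundary_pairing f psi y @[y --> 0^'+] --> (0 : R[i]).
  move=> cf; have c1 := bm f cf; have c2 := @boundary_pairing_cauchy R S f lamS cf.
  rewrite (cmintegral_concentrated (borel_open oS) concS (Cc_infty_bmeasurable cf)) in c1.
  
  have c : (boundary_pairing f phi y - boundary_pairing f (cauchy_transform lamS) y) @[y --> 0^'+] --> (0 : R[i]).
    by rewrite -(subrr (cmintegral lamS setT f)); exact: (cvgB c1 c2).
  apply: cvg_trans c; apply: near_eq_cvg; near=> y.
  have y0 : 0 < y by near: y; exact: nbhs_right_gt.
  have cphi : continuous_nonreal phi by exact: derivable_nonreal_continuous hol.
  have cct := @cauchy_transform_continuous lamS.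
  have cct' : continuous_nonreal (fun z => (-1) * cauchy_transform lamS z).
    exact: derivable_nonreal_continuous.
  by rewrite /psi (boundary_pairingD cf cphi cct' y0) (boundary_pairingZ _ cf cct y0) mulN1r.
have nS s : s \notin undup l0 -> S s.
  by move=> sl; apply: contrapT => /lP; rewrite (negbTE sl).
have [c0 [c1 [a H]]] := rational_decomposition dpsi bpsi oS jpsi (undup_uniq l0) nS.
exists c0, c1, a => z z0; have := H z z0; rewrite /psi /partial_fractions => <-.
by rewrite mulN1r addrC subrK.
Unshelve. all: by end_near. Qed.

(** 1 + s i = i (s - i), and conjugately at -i: there the kernel is constant in [s]. *)
Lemma xkernel_i (s : xreal R) : xkernel 'i%C s = 'i%C /\ xkernel (- 'i%C) s = - 'i%C.
Proof.
case: s => [s|] //=; have i0 : Im ('i%C : R[i]) != 0 by rewrite /= oner_eq0.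
have i1 : Im (- 'i%C : R[i]) != 0 by rewrite /= oppr_eq0 oner_eq0.
have n1 := nonreal_neq s i0; have n2 := nonreal_neq s i1.
split; rewrite /Defs.kernel; apply: (canLR (mulfK _)) => //.
  by rewrite mulrBr [X in _ - X](_ : _ = -1) ?opprK; [ring|apply/eqP; rewrite eq_complex /=; apply/andP; split; apply/eqP; ring].
rewrite mulrBr [X in _ - X](_ : _ = -1) ?opprK; [ring|apply/eqP; rewrite eq_complex /=; apply/andP; split; apply/eqP; ring].
Qed.

(** The kernels at i and -i are opposite constants, so averaging [phi] over these two points cancels
    the integrals and identifies [c] as the constant prescribed in the definition. *)
Lemma representing_of_form phi lam (c : R[i]) : (forall z, Im z != 0 ->
  phi z = c + cmintegral lam setT (xkernel z)) -> representing_measure phi lam.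
Proof.
move=> H; split; first exact: circle_radon.
have i0 : Im ('i%C : R[i]) != 0 by rewrite /= oner_eq0.
have i1 : Im (- 'i%C : R[i]) != 0 by rewrite /= oppr_eq0 oner_eq0.
have K1 : (xkernel 'i%C : BX -> R[i]) = fun=> 'i%C by apply/funext => s; case: (xkernel_i s).
have K2 : (xkernel (- 'i%C) : BX -> R[i]) = fun=> (-1) * 'i%C.
  by apply/funext => s; rewrite mulN1r; case: (xkernel_i s).
have bi : bmeasurable (fun _ : BX => 'i%C : R[i]) by exact: bmeasurable_cst.
move=> z z0; rewrite (H z z0) (H _ i0) (H _ i1) K1 K2 (cmintegralZ lam _ bi).
move: (cmintegral _ _ _) (cmintegral _ _ _) => J I.
have -> : c + J + (c + -1 * J) = c * 2 by ring.
by rewrite mulfK// pnatr_eq0.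
Qed.

Lemma atom_fraction (a z : R[i]) (s : R) : Im z != 0 ->
  a / (z - s%:C) = (- a / (1 + s ^+ 2)%:C) * kernel z s + (- a / (1 + s ^+ 2)%:C) * s%:C.
Proof.
move=> z0; rewrite (kernel_fraction s z0).
have w0 : (1 + s ^+ 2)%:C != 0 :> R[i].
  by rewrite eq_complex /= negb_and gt_eqF// ltr_wpDr ?sqr_ge0.
have n0 := nonreal_neq s z0; have n1 : z - s%:C != 0 by rewrite -oppr_eq0 opprB.
by move: w0; move: ((1 + s ^+ 2)%:C) => w w0; field; rewrite n0 n1 w0.
Qed.

(** Each fraction is the kernel of an atom up to a constant, by [atom_fraction], and the linear term
    is an atom at infinity. The leftover constants are collected in the [c] of
    [representing_of_form]. *)
Lemma representing_exists phi lamS c0 c1 a l : (forall z, Im z != 0 ->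
    phi z = cauchy_transform lamS z + partial_fractions c0 c1 a l z) ->
  exists lam, representing_measure phi lam.
Proof.
move=> H; pose m s := - a s / (1 + s ^+ 2)%:C.
exists (atom_measure (push_measure (add_atoms lamS l m)) None c1).
apply: (@representing_of_form _ _ (c0 + \sum_(s <- l) m s * s%:C)) => z z0.
rewrite (H z z0) cmintegral_atom//; [|exact: measurable_None|exact: xkernel_bmeasurable].
rewrite (cmintegral_push _ (xkernel_bmeasurable z0)) /=.
rewrite (@cmintegral_add_atoms _ (borel R) R measurable_point lamS l m _ (kernel_bmeasurable z0)) /partial_fractions.
have -> : \sum_(s <- l) a s / (z - s%:C) = \sum_(s <- l) m s * kernel z s + \sum_(s <- l) m s * s%:C.
  by rewrite -big_split /=; apply: eq_bigr => s _; exact: atom_fraction.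
rewrite /cauchy_transform; ring.
Qed.

(** On [S] both measures have the same boundary pairings, so they agree there and [lam] on the line
    is [lamS] plus atoms outside [S]. Comparing the two expressions of [phi] leaves a combination of
    partial fractions that vanishes off the real line, so its coefficients are 0. *)
Lemma representing_atoms phi lam S lamS c0 c1 a l :
  representing_measure phi lam -> open S -> cmconcentrated lamS S ->
  (forall f, Cc_infty S f -> boundary_pairing f phi y @[y --> 0^'+] --> cmintegral lamS S f) ->
  uniq l -> (forall s, s \in l <-> ~ S s) ->
  (forall z, Im z != 0 -> phi z = cauchy_transform lamS z + partial_fractions c0 c1 a l z) ->
  [/\ forall A : set (borel R), measurable A -> A `<=` S -> lam (Some @` A) = lamS A,
      forall s, s \in l -> lam [set Some s] = - a s / (1 + s ^+ 2)%:C &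
      lam [set None] = c1].
Proof.
move=> rep oS concS bm ul lS H.
have onS (A : set (borel R)) : measurable A -> A `<=` S -> lam (Some @` A) = lamS A.
  move=> mA AS; apply: (@test_measure_unique R (pull_measure lam) lamS S oS) => // f cf.
  have c1' := representing_boundary rep cf.
  have := bm f cf; rewrite (cmintegral_concentrated (borel_open oS) concS (Cc_infty_bmeasurable cf)) => c2'.
  by apply: (cvg_unique _ c1' c2'); exact: norm_hausdorff.
pose m s := lam [set Some s].
have E (A : set (borel R)) : measurable A -> pull_measure lam A = add_atoms lamS l m A.
  move=> mA; rewrite add_atomsE// (@cmval_atoms _ (borel R) R measurable_point (pull_measure lam) l A ul mA).
  have lE : [set` l] = ~` S by apply/seteqP; split => s /= /lS.
  rewrite lE; congr (_ + _).
    have mS := borel_open oS.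
    rewrite (cmval_split lamS mS mA) (concS (A `\` S)); last 2 first.
    - exact: measurableD.
    - by rewrite setDE -setIA setICl setI0.
    rewrite addr0 setDE setCK; apply: onS; last exact: subIsetr.
    exact: measurableI.
  by apply: eq_bigr => s _; congr (_ * _); rewrite -[LHS]/(lam (Some @` [set s])) image_set1.
pose k : R[i] := (phi 'i%C + phi (- 'i%C)) / 2.
(* The kernel has the singular part (1 + s^2)/(s - z), that is -(1 + s^2)/(z - s): the factor and
   the sign in the formula for the atoms. *)
pose b s : R[i] := - (1 + s ^+ 2)%:C * m s - a s.
have [] := @partial_fractions_eq0 R (k - \sum_(s <- l) m s * s%:C - c0) (lam [set None] - c1) b l ul.
  move=> z z0; have h1 := representing_transform rep z0; have h2 := H z z0.
  rewrite /cauchy_transform (eq_cmintegral E (kernel_bmeasurable z0)) in h1.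
  rewrite (@cmintegral_add_atoms _ (borel R) R measurable_point lamS l m _ (kernel_bmeasurable z0)) in h1.
  have h3 : \sum_(s <- l) b s / (z - s%:C) = \sum_(s <- l) m s * kernel z s + \sum_(s <- l) m s * s%:C
      - \sum_(s <- l) a s / (z - s%:C).
    rewrite -big_split /= -sumrB; apply: eq_bigr => s _.
    rewrite (kernel_fraction s z0) /b.
    have n0 := nonreal_neq s z0; have n1 : z - s%:C != 0 by rewrite -oppr_eq0 opprB.
    by move: ((1 + s ^+ 2)%:C) => w; field; rewrite n0 n1.
  rewrite /partial_fractions h3; move: h1; rewrite h2 /partial_fractions /cauchy_transform -/k => /eqP.
  rewrite -subr_eq0 => /eqP h4; rewrite -[RHS]oppr0 -[in RHS]h4; ring.
move=> /eqP; rewrite subr_eq0 => /eqP <- hb; split => // s sl.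
have w0 : (1 + s ^+ 2)%:C != 0 :> R[i].
  by rewrite eq_complex /= negb_and gt_eqF// ltr_wpDr ?sqr_ge0.
have /eqP := hb s sl; rewrite /b subr_eq0 => /eqP <-; rewrite /m.
by move: w0; move: ((1 + s ^+ 2)%:C) => w w0; field.
Qed.

End main.

Theorem theorem5p1 (R : realType) (phi : R[i] -> R[i])
    (phi_hol : holomorphic_on (nonreal R) phi) :
  ((exists lam : complex_measure (borel (xreal R)) R,
      representing_measure phi lam)
   <->
   behaves_simply phi /\
   exists S : set R, [/\ open S, finite_set (~` S) &
     exists lamS : complex_measure (borel R) R, boundary_measure phi S lamS])
  /\
  (forall (S : set R) (lamS : complex_measure (borel R) R),
     behaves_simply phi -> open S -> finite_set (~` S) ->
     boundary_measure phi S lamS ->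
     let phiS := cauchy_integral S lamS in
     let Sigma : set (xreal R) := (Some @` (~` S)) `|` [set None] in
     holomorphic_on (nonreal R) phiS /\
     exists g : R[i] -> R[i],
       [/\ holomorphic_on (nonreal R `|` [set x%:C | x in S]) g,
           forall z, nonreal R z -> g z = phi z - phiS z,
           forall sigma, Sigma sigma ->
             at_most_simple_pole (local_fun g sigma) (local_pt sigma) &
           exists rho : xreal R -> R[i],
             (forall sigma, Sigma sigma ->
                simple_residue (local_fun g sigma) (local_pt sigma) (rho sigma))
             /\
             forall lam : complex_measure (borel (xreal R)) R,
               representing_measure phi lam ->
               [/\ forall A : set (borel R), measurable A -> A `<=` S ->
                     lam (Some @` A) = lamS A,
                   forall s : R, (~` S) s ->
                     lam [set Some s] = - rho (Some s) / (1 + s ^+ 2)%:C &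
                   lam [set None] = rho None]]).
Proof.
split.
  split=> [[lam rep]|[bs [S [oS finS [lamS bm]]]]].
    split; first exact: representing_behaves_simply rep.
    (* For a represented function the whole line serves as [S], with the restriction of [lam] to the
       line as boundary measure. *)
    exists setT; split; [exact: openT|by rewrite setCT; exact: finite_set0|].
    exists (pull_measure lam); split; first exact: line_radon.
    - by move=> A _; rewrite setIT => ->; exact: cmval0.
    - by move=> f cf; exact: representing_boundary rep cf.
  have [l [_ _ [c0 [c1 [a H]]]]] := boundary_structure phi_hol bs oS finS bm.
  exact: representing_exists H.
move=> S lamS bs oS finS bm phiS Sigma; have [_ concS bmS] := bm.
have phiSE z : Im z != 0 -> phiS z = cauchy_transform lamS z by exact: cauchy_integral_transform.
have [l [ul lS [c0 [c1 [a H]]]]] := boundary_structure phi_hol bs oS finS bm.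
split.
  move=> z z0; apply: (@derivable_near _ (cauchy_transform lamS)); last exact: cauchy_transform_derivable.
  apply/nbhs_normcP; exists `|Im z|; first by rewrite normr_gt0.
  move=> w hw; rewrite phiSE//; have := Im_normc (w - z); rewrite raddfB /= => h.
  by apply/eqP => w0; move: h; rewrite w0 sub0r normrN leNgt hw.
pose rho (sigma : xreal R) : R[i] := if sigma is Some s then a s else c1.
have res sigma : Sigma sigma ->
    simple_residue (local_fun (partial_fractions c0 c1 a l) sigma) (local_pt sigma) (rho sigma).
  move=> [[s /lS sl <-]|->]; first exact: residue_partial_fractions.
  exact: residue_infinity_partial_fractions.
(* The rational function is itself the extension of [phi - phiS]: its finite poles lie outside [S],
   and its coefficients, fixed before any representing measure is given, are the residues. *)
exists (partial_fractions c0 c1 a l); split.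
- move=> z hz; apply: derivable_partial_fractions => s /lS nSs; apply/eqP => zs.
  rewrite zs in hz; case: hz => [|[t St [ts]]]; first by rewrite /nonreal /= eqxx.
  by apply: nSs; rewrite -ts.
- by move=> z z0; rewrite (H z z0) phiSE// addrC addKr.
- by move=> sigma /res; exact: simple_residue_pole.
- exists rho; split=> // lam rep.
  have [h1 h2 h3] := representing_atoms rep oS concS bmS ul lS H.
  by split=> // s /lS; exact: h2.
Qed.
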